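(* Let $-1<p<1$ and $k_\alpha\ge 0$ for all $\alpha\in R$. Then the operator $\mathcal H_E^*(p)|_{\mathcal P}$ is essentially self-adjoint on $\mathcal P=\mathbb C[P]^W\Delta$, as an operator in the Hilbert space $L^2(T,d\mu)^W$.
   Context: Let $R$ be a reduced crystallographic root system in the Euclidean space $\mathfrak h_{\mathbb R}^*$ dual to $\mathfrak h_{\mathbb R}$, with pairing $\langle\cdot,\cdot\rangle$, Weyl-invariant inner product $(\cdot|\cdot)$, $|\alpha|^2=(\alpha|\alpha)$, positive roots $R_+$, Weyl group $W$, coroot lattice $Q^\vee$, weight lattice $P$. Let $T=\mathfrak h_{\mathbb R}/2\pi Q^\vee$, let $\mu$ be its normalized Haar measure, and let $L^2(T,d\mu)^W$ be the space of $W$-invariant square integrable functions with $(f,g)=\int_T\overline f g\,d\mu$. The coupling constants $k_\alpha$ ($\alpha\in R$) are real and $W$-invariant: $k_{w\alpha}=k_\alpha$. For $\lambda\in P$ let $e^\lambda(h)=e^{\sqrt{-1}\langle\lambda,h\rangle}$, a function on $T$; $\mathbb C[P]$ is the span of these and $\mathbb C[P]^W$ its $W$-invariants. Put $\Delta(h)=\prod_{\alpha\in R_+}|\sin(\langle\alpha,h\rangle/2)|^{k_\alpha}$ and $\mathcal P=\mathbb C[P]^W\Delta=\{f\Delta: f\in\mathbb C[P]^W\}$. With $L$ the Laplacian on $T$, $p=\exp(2\pi\sqrt{-1}\tau)$, and $\wp(x)$ the Weierstrass function with periods $2\pi$ and $2\pi\tau$, the elliptic Hamiltonian is $$\mathcal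 H_E(p)=-L+V_p,\qquad V_p(h)=\sum_{\alpha\in R_+}k_\alpha(k_\alpha-1)|\alpha|^2\wp(\langle\alpha,h\rangle),$$ where equivalently $\wp(x)=\frac1{4\sin^2(x/2)}-\frac1{12}-2\sum_{n\ge1}\frac{np^n}{1-p^n}(\cos nx-1)$; for $p=0$ this is the trigonometric Hamiltonian $\mathcal H_T=\mathcal H_E(0)$. The operator $\mathcal H_E(p)$ is defined on $C^2(T)^W\cap\mathsf D(V_p)$, where $\mathsf D(V_p)$ is the domain of the multiplication operator by $V_p$ in $L^2$; it is symmetric there. $\mathcal H_E^*(p)$ denotes its adjoint in $L^2(T,d\mu)^W$, and $\mathcal H_E^*(p)|_{\mathcal P}$ the restriction of the adjoint to $\mathcal P$.
   Formalization: If some k_α = 1, where the literal claim fails (rank one, k = 1: Δ = |sin t| is not in the domain of the adjoint of -d²/dt²), the domain of H_E(p) is restricted by also requiring ℘(⟨α,h⟩)f in L² for those α; nothing changes when no k_α equals 1. *)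

(* Defs.v *)
From HB Require Import structures.
From mathcomp Require Export all_boot all_order all_algebra finmap complex.
From mathcomp Require Export all_classical all_reals all_analysis.
Set Implicit Arguments.
Unset Strict Implicit.
Unset Printing Implicit Defensive.
Export Order.TTheory GRing.Theory Num.Theory.
Export numFieldNormedType.Exports.

Local Open Scope classical_set_scope.
Local Open Scope complex_scope.
Local Open Scope ring_scope.

(* Unbounded operators in a complex Hilbert space.  The Hilbert space is given
   by a set H of representatives (here: square integrable functions) together
   with the inner product ip, conjugate-linear in its first argument; vectors at
   distance 0 represent the same element.  An operator is given by its graph. *)
Section Operators.
Context {R : realType} {V : zmodType}.
Variables (H : set V) (ip : V -> V -> R[i]).

Definition sqnorm (u : V) : R := complex.Re (ip u u).

Definition dom (G : set (V * V)) : set V := [set u | exists v, G (u, v)].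

Definition restriction (G : set (V * V)) (D : set V) : set (V * V) :=
  [set uv | G uv /\ D uv.1].

Definition densely_defined (G : set (V * V)) : Prop :=
  forall u, H u -> forall e : R, 0 < e ->
  exists2 f, dom G f & sqnorm (u - f) < e.

Definition adjoint (G : set (V * V)) : set (V * V) :=
  [set uv | [/\ H uv.1, H uv.2 &
    forall f g, G (f, g) -> ip uv.1 g = ip uv.2 f]].

Definition op_closure (G : set (V * V)) : set (V * V) :=
  [set uv | [/\ H uv.1, H uv.2 &
    forall e : R, 0 < e ->
    exists2 fg, G fg & sqnorm (uv.1 - fg.1) < e /\ sqnorm (uv.2 - fg.2) < e]].

Definition self_adjoint (G : set (V * V)) : Prop :=
  densely_defined G /\ adjoint G = G.

(* For a densely defined G whose closure is self-adjoint, G is closable and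
   symmetric, since a self-adjoint graph is that of a (single-valued) operator
   and contains G. *)
Definition essentially_self_adjoint (G : set (V * V)) : Prop :=
  densely_defined G /\ self_adjoint (op_closure G).

End Operators.

(* The Euclidean space dual to h_R is R^n with its standard inner product, and
   h_R is identified with R^n through the dual basis: the pairing <a, h> and the
   inner product (a|b) are then both given by [dot]. *)
Section RootSystems.
Context {R : realType} {n : nat}.
Implicit Types (a b l h x y : 'rV[R]_n) (Phi Phip : {fset 'rV[R]_n}).

Definition dot x y : R := \sum_i x 0 i * y 0 i.

Definition coroot a : 'rV[R]_n := (2 / dot a a) *: a.

Definition reflection a x : 'rV[R]_n := x - dot x (coroot a) *: a.

(* Orthogonal matrices act in the same way on h_R and on its dual. *)
Definition reflection_mx a : 'M[R]_n := 1%:M - (coroot a)^T *m a.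

Lemma mul_reflection_mx a x : x *m reflection_mx a = reflection a x.
Proof.
rewrite /reflection_mx mulmxBr mulmx1 mulmxA /reflection.
congr (_ - _); rewrite [x *m _]mx11_scalar mul_scalar_mx; congr (_ *: _).
by rewrite mxE; apply: eq_bigr => i _; rewrite mxE.
Qed.

Definition root_system Phi : Prop :=
  [/\ [/\ 0 \notin Phi & <<Phi>>%VS = fullv],
      {in Phi &, forall a b, reflection a b \in Phi},
      {in Phi &, forall a b, dot b (coroot a) \is a Num.int} &
      {in Phi, forall a (c : R), c *: a \in Phi -> c = 1 \/ c = -1}].

Definition positive_roots Phi Phip : Prop :=
  exists2 v, {in Phi, forall a, dot a v != 0} &
    forall a, (a \in Phip) = (a \in Phi) && (0 < dot a v).

Inductive weyl Phi : 'M[R]_n -> Prop :=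
| weyl_one : weyl Phi 1%:M
| weyl_refl w a : weyl Phi w -> a \in Phi -> weyl Phi (w *m reflection_mx a).

Definition coroot_lattice Phi : set 'rV[R]_n :=
  [set x | exists c : 'rV[R]_n -> int, x = \sum_(a <- Phi) coroot a *~ c a].

Definition weight_lattice Phi : set 'rV[R]_n :=
  [set l | {in Phi, forall a, dot l (coroot a) \is a Num.int}].

Definition torus_rel Phi : rel 'rV[R]_n :=
  fun x y => `[< exists2 q, coroot_lattice Phi q & x - y = (2 * pi) *: q >].

Lemma torus_rel_refl Phi : reflexive (torus_rel Phi).
Proof.
move=> x; apply/asboolP; exists 0; last by rewrite subrr scaler0.
by exists (fun=> 0); rewrite big1.
Qed.

Lemma torus_rel_sym Phi : symmetric (torus_rel Phi).
Proof.
suff H x y : torus_rel Phi x y -> torus_rel Phi y x.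
  by move=> x y; apply/idP/idP; exact: H.
move=> /asboolP[_ [c ->] e]; apply/asboolP.
exists (\sum_(a <- Phi) coroot a *~ (- c a)); first by exists (\- c).
rewrite -opprB e -scalerN -sumrN; congr (_ *: _).
by apply: eq_bigr => a _; rewrite mulrNz.
Qed.

Lemma torus_rel_trans Phi : transitive (torus_rel Phi).
Proof.
move=> y x z /asboolP[_ [c ->] xy] /asboolP[_ [d ->] yz]; apply/asboolP.
exists (\sum_(a <- Phi) coroot a *~ (c a + d a)).
  by exists (fun a => c a + d a).
rewrite -(subrK y x) -addrA xy yz -scalerDr -big_split; congr (_ *: _).
by apply: eq_bigr => a _; rewrite mulrzDr.
Qed.

Definition torus_equiv Phi : equiv_rel 'rV[R]_n :=
  EquivRel (torus_rel Phi) (@torus_rel_refl Phi) (@torus_rel_sym Phi)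
    (@torus_rel_trans Phi).

(* The torus h_R / 2 pi Q^vee, with its quotient topology and Borel sets. *)
Definition torus Phi : Type := {eq_quot torus_equiv Phi}%qT.

End RootSystems.

HB.instance Definition _ (R : realType) n (Phi : {fset 'rV[R]_n}) :=
  Quotient.copy (torus Phi) {eq_quot torus_equiv Phi}%qT.
HB.instance Definition _ (R : realType) n (Phi : {fset 'rV[R]_n}) :=
  PointedTopological.copy (torus Phi)
    (quotient_topology {eq_quot torus_equiv Phi}%qT).
HB.instance Definition _ (R : realType) n (Phi : {fset 'rV[R]_n}) :=
  Measurable.copy (torus Phi) (g_sigma_algebraType (@open (torus Phi))).

Section Torus.
Context {R : realType} {n : nat} (Phi : {fset 'rV[R]_n}).
Local Notation T := (torus Phi).
Implicit Types (h : 'rV[R]_n) (t : T) (f g : T -> R[i]).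

Definition torus_pi h : T := (\pi_T h)%qT.

Definition translate h t : T := torus_pi (h + repr t).

Definition weyl_act (w : 'M[R]_n) t : T := torus_pi (repr t *m w).

Definition weyl_invariant f : Prop :=
  forall w, weyl Phi w -> forall t, f (weyl_act w t) = f t.

Definition normalized_haar (mu : probability T R) : Prop :=
  forall h (A : set T), measurable A -> mu (translate h @^-1` A) = mu A.

Definition expi (x : R) : R[i] := cos x +i* sin x.

(* e^l is a well-defined function on T only for l in the weight lattice, where
   it does not depend on the choice of representative. *)
Definition torus_exp (l : 'rV[R]_n) t : R[i] := expi (dot l (repr t)).

Definition trig_poly : set (T -> R[i]) :=
  [set f | exists s : seq 'rV[R]_n, exists2 c : 'rV[R]_n -> R[i],
    {in s, forall l, weight_lattice Phi l} &
    forall t, f t = \sum_(l <- s) c l * torus_exp l t].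

Definition part (i : 'I_n) (u : 'rV[R]_n -> R) : 'rV[R]_n -> R :=
  'D_(delta_mx 0 i) u.

Definition C1 (u : 'rV[R]_n -> R) : Prop := forall i,
  (forall x, derivable u x (delta_mx 0 i)) /\ continuous (part i u).

Definition C2 (u : 'rV[R]_n -> R) : Prop := C1 u /\ forall i, C1 (part i u).

Definition Re_lift f : 'rV[R]_n -> R := fun h => complex.Re (f (torus_pi h)).
Definition Im_lift f : 'rV[R]_n -> R := fun h => complex.Im (f (torus_pi h)).

Definition torus_C2 : set (T -> R[i]) :=
  [set f | C2 (Re_lift f) /\ C2 (Im_lift f)].

Definition laplacian (u : 'rV[R]_n -> R) (x : 'rV[R]_n) : R :=
  \sum_i part i (part i u) x.

Definition torus_laplacian f : T -> R[i] := fun t =>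
  laplacian (Re_lift f) (repr t) +i* laplacian (Im_lift f) (repr t).

Variable mu : probability T R.

Definition L2 : set (T -> R[i]) :=
  [set f | (fun t => complex.Re (f t)) \in Lfun mu 2%:E /\
           (fun t => complex.Im (f t)) \in Lfun mu 2%:E].

Definition L2W : set (T -> R[i]) :=
  [set f | L2 f /\
    forall w, weyl Phi w -> {ae mu, forall t, f (weyl_act w t) = f t}].

Definition cintegral f : R[i] :=
  (\int[mu]_(t in setT) complex.Re (f t))%R +i*
  (\int[mu]_(t in setT) complex.Im (f t))%R.

Definition inner f g : R[i] := cintegral (fun t => (f t)^* * g t).

(* With p = exp(2 pi i tau), the Weierstrass function with periods 2 pi and
   2 pi tau, given by its expansion in p (which also covers p = 0).  The value
   at the poles is irrelevant, since these form a null set. *)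
Definition wp (p x : R) : R :=
  (4 * sin (x / 2) ^+ 2)^-1 - 12^-1
  - 2 * limn (fun N => \sum_(1 <= m < N)
                 m%:R * p ^+ m / (1 - p ^+ m) * (cos (m%:R * x) - 1)).

Variables (Phip : {fset 'rV[R]_n}) (k : 'rV[R]_n -> R).

Definition potential (p : R) t : R :=
  \sum_(a <- Phip) k a * (k a - 1) * dot a a * wp p (dot a (repr t)).

(* The term of a root with k a = 1 is 0 times the operator of multiplication by
   wp p (dot a h).  As usual for unbounded operators, it is defined only on the
   domain of the latter; the last clause expresses this.  It cannot be omitted:
   if k a = 1 for all roots, one would have H_E = -L on all of C^2(T)^W, and
   Delta would not be in the domain of the adjoint, as the distribution L Delta
   has a singular part carried by the walls.  When k a <> 1 for all roots, the
   domain is just that of multiplication by the potential. *)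
Definition potential_dom (p : R) : set (T -> R[i]) :=
  [set f | [/\ L2W f, L2 (fun t => (potential p t)%:C * f t) &
    {in Phip, forall a, k a = 1 ->
      L2 (fun t => (wp p (dot a (repr t)))%:C * f t)}]].

Definition hamiltonian (p : R) : set ((T -> R[i]) * (T -> R[i])) :=
  [set fg | [/\ torus_C2 fg.1, weyl_invariant fg.1, potential_dom p fg.1 &
    forall t, fg.2 t = - torus_laplacian fg.1 t + (potential p t)%:C * fg.1 t]].

Definition hamiltonian_adj (p : R) : set ((T -> R[i]) * (T -> R[i])) :=
  adjoint L2W inner (hamiltonian p).

Definition Delta t : R :=
  \prod_(a <- Phip) `|sin (dot a (repr t) / 2)| `^ k a.

Definition calP : set (T -> R[i]) :=
  [set u | exists2 f, trig_poly f /\ weyl_invariant f &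
    forall t, u t = f t * (Delta t)%:C].

End Torus.

Arguments trig_poly {R n} Phi.
Arguments Delta {R n} Phi Phip k t.
Arguments calP {R n} Phi Phip k.

(* Main.v *)
(* Idea.  Write L for the Laplacian, V_0 for the potential at p = 0.  Away from
   the walls, (-L + V_0)(f Delta) = Delta H f, where
     H f = - L f - sum_{a > 0} k_a cot(a/2) d_a f + const f;
   the constant comes from the identity
     sum_{a <> b > 0} k_a k_b (a|b) cot(a/2) cot(b/2) = const.
   For W-invariant f, each cot(a/2) d_a f is a trigonometric polynomial with
   frequencies in the ball spanned by those of f, so H preserves the
   finite-dimensional spaces of invariant trigonometric polynomials of bounded
   frequency, and it is symmetric for Delta^2 dmu.  The potential V_p differs
   from V_0 by a bounded function B.
   Functions in the domain of H_E vanish to second order on each wall where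
   k_a <> 0: if phi does not vanish at a point of such a wall, V_p phi is not
   square integrable there, and phi is even about the wall.  This makes the
   boundary terms vanish in the pairing of phi with f Delta, whence f Delta lies
   in the domain of the adjoint.
   Let (u, w) belong to the adjoint of the restriction.  Projecting u and w - B u
   on an invariant finite-dimensional space E gives y and H y, and (y, H y + B y)
   converges to (u, w) as E increases, because P is dense.  Hence the adjoint is
   contained in the closure; the converse is symmetry.
   Everything is done for real and imaginary parts separately, on functions on
   h_R which are periodic under 2 pi Q^vee. *)
Require Import Defs.
From mathcomp Require Import ring lra zify measurable_realfun separable.
Set Implicit Arguments.
Unset Strict Implicit.
Unset Printing Implicit Defensive.

Local Open Scope classical_set_scope.
Local Open Scope ring_scope.

(** * Real square integrable functions *)

(** [Delta] is in general not twice differentiable on the walls, so Green's formula cannot be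
    applied to [f Delta] directly. It is applied to the smooth product of the
    [(sin^2(a/2) + eps)^(k_a/2)], and eps tends to 0 by bounded convergence. The second order
    vanishing of phi is what makes the integrand bounded uniformly in eps, because the squared
    gradient and the Laplacian of the logarithm of this product grow like [1 / sin^2(a/2)]. For two
    elements of P these zero order terms cancel against each other instead. The Haar measure is
    known only through its translation invariance. Integration by parts, nullity of the walls, the
    lower bounds for integrals near a wall, the approximate identities and the invariance under W
    are all derived from it. Operators are graphs on representatives, so the adjoint determines its
    value only up to null sets. This is harmless once the domain of [H_E] is known to be dense: it
    contains the invariant trigonometric polynomials times the product of all [sin^2(a/2)], a factor
    that cancels the poles of the potential. *)

Section RealL2.
Context d (T : measurableType d) (R : realType) (mu : probability T R).
Implicit Types f g h : T -> R.
Local Notation Int f := (\int[mu]_(t in setT) f t)%R.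
Local Notation intg f := (mu.-integrable setT (EFin \o f)).
Local Notation sqint f := (f \in Lfun mu 2%:E).

(** The class through which integrability is checked: [mu] has total mass 1, so these functions are
    integrable and square integrable, and they are stable under sums and products. *)
Definition bm f := measurable_fun setT f /\ exists M : R, forall t, `|f t| <= M.

Lemma bmD f g : bm f -> bm g -> bm (f \+ g).
Proof.
move=> [mf [M fM]] [mg [N gN]]; split; first exact: measurable_funD.
by exists (M + N) => t; rewrite (le_trans (ler_normD _ _))// lerD.
Qed.

Lemma bmM f g : bm f -> bm g -> bm (f \* g).
Proof.
move=> [mf [M fM]] [mg [N gN]]; split; first exact: measurable_funM.
by exists (M * N) => t; rewrite normrM ler_pM.
Qed.

Lemma bm_cst c : bm (fun=> c).
Proof. by split; [exact: measurable_cst|exists `|c|]. Qed.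

Lemma bmN f : bm f -> bm (\- f).
Proof.
move=> [mf [M fM]]; split; first exact: measurableT_comp.
by exists M => t; rewrite normrN.
Qed.

Lemma bmZ c f : bm f -> bm (fun t => c * f t).
Proof. by move=> bf; apply: (bmM (bm_cst c) bf). Qed.

Lemma bmB f g : bm f -> bm g -> bm (f \- g).
Proof. by move=> bf bg; exact: (bmD bf (bmN bg)). Qed.

Lemma bm_sum (I : Type) (r : seq I) (P : pred I) (F : I -> T -> R) :
  (forall i, P i -> bm (F i)) -> bm (fun t => \sum_(i <- r | P i) F i t).
Proof.
move=> bF; elim: r => [|i r IH].
  by rewrite (_ : (fun _ => _) = cst 0); [exact: bm_cst|apply/funext => t; rewrite big_nil].
case Pi: (P i); last first.
  by rewrite (_ : (fun _ => _) = (fun t => \sum_(j <- r | P j) F j t))//;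
    apply/funext => t; rewrite big_cons Pi.
rewrite (_ : (fun _ => _) = (F i \+ (fun t => \sum_(j <- r | P j) F j t))).
  by apply: bmD => //; exact: bF.
by apply/funext => t; rewrite big_cons Pi.
Qed.

Lemma bm_prod (I : Type) (r : seq I) (P : pred I) (F : I -> T -> R) :
  (forall i, P i -> bm (F i)) -> bm (fun t => \prod_(i <- r | P i) F i t).
Proof.
move=> bF; elim: r => [|i r IH].
  by rewrite (_ : (fun _ => _) = cst 1); [exact: bm_cst|apply/funext => t; rewrite big_nil].
case Pi: (P i); last first.
  by rewrite (_ : (fun _ => _) = (fun t => \prod_(j <- r | P j) F j t))//;
    apply/funext => t; rewrite big_cons Pi.
rewrite (_ : (fun _ => _) = (F i \* (fun t => \prod_(j <- r | P j) F j t))).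
  by apply: bmM => //; exact: bF.
by apply/funext => t; rewrite big_cons Pi.
Qed.

Lemma intg_dom f g : measurable_fun setT f -> intg g ->
  (forall t, `|f t| <= g t) -> intg f.
Proof.
move=> mf ig fg; apply: (@le_integrable _ _ _ mu _ measurableT _ _ _ _ ig).
  exact/measurable_EFinP.
by move=> t _ /=; rewrite lee_fin (le_trans (fg t))// ler_norm.
Qed.

Lemma intg_cst c : intg (fun=> c).
Proof. exact: finite_measure_integrable_cst. Qed.

Lemma bm_intg f : bm f -> intg f.
Proof. by move=> [mf [M fM]]; apply: (intg_dom mf (intg_cst M)). Qed.

Lemma intgD f g : intg f -> intg g -> intg (f \+ g).
Proof.
move=> If Ig; rewrite (_ : _ \o _ = (EFin \o f) \+ (EFin \o g))%E//.
exact: integrableD.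
Qed.

Lemma intgZ c f : intg f -> intg (fun t => c * f t).
Proof.
move=> If; rewrite (_ : _ \o _ = (fun t => c%:E * (EFin \o f) t))%E//.
exact: integrableZl.
Qed.

Lemma intg_meas f : intg f -> measurable_fun setT f.
Proof. by move=> /measurable_int/measurable_EFinP. Qed.

Lemma IntD f g : intg f -> intg g -> Int (f \+ g) = Int f + Int g.
Proof. by move=> If Ig; rewrite RintegralD. Qed.

Lemma IntB f g : intg f -> intg g -> Int (f \- g) = Int f - Int g.
Proof. by move=> If Ig; rewrite RintegralB. Qed.

Lemma IntZ c f : intg f -> Int (fun t => c * f t) = c * Int f.
Proof. by move=> If; rewrite RintegralZl. Qed.

Lemma Int_cst c : Int (fun=> c) = c.
Proof. by rewrite Rintegral_cst//= probability_setT mulr1. Qed.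

Lemma Int_le f g : intg f -> intg g -> (forall t, f t <= g t) -> Int f <= Int g.
Proof. by move=> If Ig fg; apply: le_Rintegral => // t _. Qed.

Lemma Int_norm f : intg f -> `|Int f| <= Int (fun t => `|f t|).
Proof. by move=> If; apply: le_normr_Rintegral. Qed.

Lemma Int_ge0 f : (forall t, 0 <= f t) -> 0 <= Int f.
Proof. by move=> f0; apply: Rintegral_ge0. Qed.

Lemma intg_norm f : intg f -> intg (fun t => `|f t|).
Proof. by move=> If; have := integrable_abse If. Qed.

Lemma Int_ae f g : measurable_fun setT f -> measurable_fun setT g ->
  (\forall t \ae mu, f t = g t) -> Int f = Int g.
Proof.
move=> mf mg fg; rewrite /Rintegral; congr fine.
apply: ae_eq_integral => //; try exact/measurable_EFinP.
by move: fg; apply: filterS => t /= ->.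
Qed.

Lemma Int_fineK f : intg f -> (\int[mu]_t (f t)%:E)%E = (Int f)%:E.
Proof. by move=> If; rewrite /Rintegral fineK//; apply: integrable_fin_num. Qed.

Lemma Int_dct (f_ : nat -> T -> R) f g : (forall n, measurable_fun setT (f_ n)) ->
  measurable_fun setT f -> intg g -> (forall n t, `|f_ n t| <= g t) ->
  (\forall t \ae mu, f_ n t @[n --> \oo] --> f t) ->
  intg f /\ (Int (f_ n) @[n --> \oo] --> Int f).
Proof.
move=> mf_ mf Ig fg cv.
have [|||||If _ cvI] := @dominated_convergence _ T R mu setT measurableT
  (fun n => EFin \o f_ n) (EFin \o f) (EFin \o g).
- by move=> n; apply/measurable_EFinP.
- exact/measurable_EFinP.
- move: cv; apply: filterS => t ct _ /=; exact: cvg_EFin (nearW _ _) _.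
- by [].
- by apply: nearW => t n _ /=; rewrite lee_fin.
split => //; rewrite Int_fineK// in cvI.
by case/fine_cvgP: cvI.
Qed.

(** The bound holds only almost everywhere, so the sequence is clamped to [[-|M|, |M|]] by [tr];
    this changes it on a null set and makes [Int_dct] applicable. *)
Lemma Int_bct (f_ : nat -> T -> R) f (M : R) : (forall n, measurable_fun setT (f_ n)) ->
  measurable_fun setT f -> (\forall t \ae mu, forall n, `|f_ n t| <= M) ->
  (\forall t \ae mu, f_ n t @[n --> \oo] --> f t) ->
  intg f /\ (Int (f_ n) @[n --> \oo] --> Int f).
Proof.
move=> mf_ mf fM cv.
pose tr (x : R) := Num.max (- `|M|) (Num.min x `|M|).
have trE x : `|x| <= M -> tr x = x.
  move=> xM; have := ler_norm M; move: xM; rewrite ler_norml => /andP[x1 x2] x3.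
  by rewrite /tr min_l ?max_r//; lra.
have trM x : `|tr x| <= `|M|.
  by rewrite /tr ler_norml le_max lexx ge_max ge_min lexx orbT/= andbT; have := normr_ge0 M; lra.
have mtr g : measurable_fun setT g -> measurable_fun setT (tr \o g).
  move=> mg; apply: measurable_maxr => //; exact: measurable_minr.
have [|||I cI] := @Int_dct (fun n => tr \o f_ n) f (fun=> `|M|) _ mf (intg_cst _).
- by move=> n; exact: mtr.
- by move=> n t /=.
- by move: cv fM; apply: filterS2 => t ct bt /=; move: ct; rewrite (_ : f_ ^~ t = fun n => tr (f_ n t))//; apply/funext => n; rewrite trE.
split=> //; move: cI; rewrite (_ : (fun n => Int (tr \o f_ n)) = (fun n => Int (f_ n)))//.
apply/funext => n; apply: Int_ae => //; first exact: mtr.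
by move: fM; apply: filterS => t /= /(_ n)/trE.
Qed.

Lemma sqintP f : sqint f <-> measurable_fun setT f /\ intg (fun t => f t ^+ 2).
Proof.
split=> [f2|[mf f2]].
  split; last exact: Lfun2_integrable_sqr.
  by move: f2; rewrite inE => /andP[]; rewrite inE.
rewrite inE; apply/andP; split; rewrite inE//= /finite_norm unlock /Lnorm.
rewrite poweR_lty//.
rewrite (_ : (\int[mu]_x _)%E = (\int[mu]_x `|(EFin \o (fun t => (f t ^+ 2)%R)) x|)%E).
  by have /integrableP[] := f2.
apply: eq_integral => t _ /=; congr EFin.
by rewrite normrX -powR_mulrn.
Qed.

Lemma sqint_meas f : sqint f -> measurable_fun setT f.
Proof. by case/sqintP. Qed.

Lemma sqint_mul f g : sqint f -> sqint g -> intg (f \* g).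
Proof. by move=> f2 g2; apply/Lfun1_integrable; exact: Lfun2_mul_Lfun1. Qed.

Lemma sqintD f g : sqint f -> sqint g -> sqint (f \+ g).
Proof.
move=> f2 g2; have [mf If] := (sqintP f).1 f2; have [mg Ig] := (sqintP g).1 g2.
apply/sqintP; split; first exact: measurable_funD.
rewrite (_ : (fun _ => _) = (fun t => f t ^+ 2) \+ ((fun t => g t ^+ 2) \+ (fun t => 2 * (f \* g) t))).
  by apply: intgD => //; apply: intgD => //; apply: intgZ; exact: sqint_mul.
by apply/funext => t /=; ring.
Qed.

Lemma sqint_bm f g : bm f -> sqint g -> sqint (f \* g).
Proof.
move=> [mf [M fM]] g2; have [mg Ig] := (sqintP g).1 g2.
apply/sqintP; split; first exact: measurable_funM.
apply: (@intg_dom _ (fun t => M ^+ 2 * g t ^+ 2)).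
- by apply: measurable_funX; exact: measurable_funM.
- exact: intgZ.
move=> t /=; rewrite ger0_norm ?sqr_ge0// exprMn ler_wpM2r ?sqr_ge0//.
by rewrite -real_normK ?num_real// lerXn2r ?nnegrE// (le_trans _ (fM t)).
Qed.

Lemma sqint_cst c : sqint (fun=> c).
Proof. exact: Lfun_cst. Qed.

Lemma bm_sqint f : bm f -> sqint f.
Proof.
move=> bf; have := sqint_bm bf (sqint_cst 1).
by rewrite (_ : _ \* _ = f)//; apply/funext => t /=; rewrite mulr1.
Qed.

Lemma sqintZ c f : sqint f -> sqint (fun t => c * f t).
Proof. by move=> f2; exact: (sqint_bm (bm_cst c) f2). Qed.

Lemma sqintN f : sqint f -> sqint (\- f).
Proof.
move=> /(sqintZ (-1)); rewrite (_ : (fun _ => _) = \- f)//.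
by apply/funext => t /=; rewrite mulN1r.
Qed.

Lemma sqintB f g : sqint f -> sqint g -> sqint (f \- g).
Proof. by move=> f2 g2; exact: (sqintD f2 (sqintN g2)). Qed.

Lemma Int_sqr_eq0 f : measurable_fun setT f -> intg (fun t => f t ^+ 2) ->
  Int (fun t => f t ^+ 2) = 0 -> \forall t \ae mu, f t = 0.
Proof.
move=> mf I2 I0.
have m2 : measurable_fun setT (EFin \o (fun t => f t ^+ 2)).
  by apply/measurable_EFinP; exact: measurable_funX.
have /iffLR H := ae_eq_integral_abs mu measurableT m2.
have : ae_eq mu setT (EFin \o (fun t => f t ^+ 2)) (cst 0%E).
  apply: H; rewrite -[RHS]/(0%:E) -I0 -Int_fineK//; apply: eq_integral => t _ /=.
  by rewrite ger0_norm ?sqr_ge0.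
rewrite /ae_eq; apply: filterS => t /= /(_ I) [] /eqP; rewrite sqrf_eq0 => /eqP //.
Qed.

End RealL2.

Section Continuity.
Context {R : realType} {V : topologicalType}.
Implicit Types f g : V -> R.

Lemma contD f g : continuous f -> continuous g -> continuous (fun x => f x + g x).
Proof. by move=> cf cg x; apply: (@continuousD R R^o V f g); [exact: cf|exact: cg]. Qed.
Lemma contM f g : continuous f -> continuous g -> continuous (fun x => f x * g x).
Proof. by move=> cf cg x; apply: (@continuousM R V f g); [exact: cf|exact: cg]. Qed.
Lemma cont_cst (c : R) : continuous (fun _ : V => c).
Proof. by move=> x; apply: cst_continuous. Qed.
Lemma contZ (c : R) f : continuous f -> continuous (fun x => c * f x).
Proof. by move=> cf; apply: contM cf; exact: cont_cst. Qed.
Lemma contN f : continuous f -> continuous (fun x => - f x).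
Proof. by move=> cf x; apply: (@continuousN R R^o V f); exact: cf. Qed.
Lemma contB f g : continuous f -> continuous g -> continuous (fun x => f x - g x).
Proof. by move=> cf cg; apply: contD cf (contN cg). Qed.
Lemma cont_sum (I : Type) (r : seq I) (P : pred I) (F : I -> V -> R) :
  (forall i, P i -> continuous (F i)) -> continuous (fun x => \sum_(i <- r | P i) F i x).
Proof.
move=> cF; elim: r => [|i r IH].
  by under eq_fun do rewrite big_nil; exact: cont_cst.
under eq_fun do rewrite big_cons.
by case Pi: (P i) => //; apply: contD; [exact: cF|exact: IH].
Qed.
Lemma contX f m : continuous f -> continuous (fun x => f x ^+ m).
Proof.
move=> cf; elim: m => [|m IH]; first by under eq_fun do rewrite expr0; exact: cont_cst.
by under eq_fun do rewrite exprS; exact: contM.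
Qed.
Lemma cont_comp (g : R -> R) f : continuous g -> continuous f -> continuous (fun x => g (f x)).
Proof. by move=> cg cf x; apply: continuous_comp; [exact: cf|exact: cg]. Qed.
Lemma contV f : (forall x, f x != 0) -> continuous f -> continuous (fun x => (f x)^-1).
Proof. by move=> f0 cf x; apply: (@continuousV R V) => //; exact: cf. Qed.
End Continuity.

(** * Lattices and the torus *)

Section Dot.
Context {R : realType} {n : nat}.
Implicit Types (a b l h x y z : 'rV[R]_n).

Lemma dotC x y : dot x y = dot y x.
Proof. by apply: eq_bigr => i _; rewrite mulrC. Qed.
Lemma dotDl x y z : dot (x + y) z = dot x z + dot y z.
Proof. by rewrite -big_split; apply: eq_bigr => i _; rewrite mxE mulrDl. Qed.
Lemma dotDr x y z : dot x (y + z) = dot x y + dot x z.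
Proof. by rewrite dotC dotDl ![dot _ x]dotC. Qed.
Lemma dotZl (c : R) x y : dot (c *: x) y = c * dot x y.
Proof. by rewrite /dot mulr_sumr; apply: eq_bigr => i _; rewrite mxE mulrA. Qed.
Lemma dotZr (c : R) x y : dot x (c *: y) = c * dot x y.
Proof. by rewrite dotC dotZl dotC. Qed.
Lemma dotNl x y : dot (- x) y = - dot x y.
Proof. by rewrite -scaleN1r dotZl mulN1r. Qed.
Lemma dotNr x y : dot x (- y) = - dot x y.
Proof. by rewrite dotC dotNl dotC. Qed.
Lemma dotBl x y z : dot (x - y) z = dot x z - dot y z.
Proof. by rewrite dotDl dotNl. Qed.
Lemma dotBr x y z : dot x (y - z) = dot x y - dot x z.
Proof. by rewrite dotDr dotNr. Qed.
Lemma dot0l x : dot 0 x = 0.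
Proof. by rewrite -(scale0r 0) dotZl mul0r. Qed.
Lemma dot0r x : dot x 0 = 0.
Proof. by rewrite dotC dot0l. Qed.
Lemma dot_sumr (I : Type) (r : seq I) (P : pred I) (F : I -> 'rV[R]_n) x :
  dot x (\sum_(i <- r | P i) F i) = \sum_(i <- r | P i) dot x (F i).
Proof. by elim/big_rec2: _ => [|i y1 y2 _ <-]; rewrite ?dot0r ?dotDr. Qed.
Lemma dot_ge0 x : 0 <= dot x x.
Proof. by apply: sumr_ge0 => i _; rewrite -expr2 sqr_ge0. Qed.
Lemma dot_eq0 x : (dot x x == 0) = (x == 0).
Proof.
apply/eqP/eqP => [/eqP|->]; last exact: dot0l.
rewrite psumr_eq0 => [/allP H|i _]; last by rewrite -expr2 sqr_ge0.
apply/rowP => i; rewrite mxE; have := H i (mem_index_enum _).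
by rewrite -expr2 sqrf_eq0 => /eqP.
Qed.
Lemma dot_gt0 x : x != 0 -> 0 < dot x x.
Proof. by move=> x0; rewrite lt_def dot_eq0 x0 dot_ge0. Qed.
Lemma dot_delta x i : dot x (delta_mx 0 i) = x 0 i.
Proof.
rewrite /dot (bigD1 i)//= mxE !eqxx mulr1 big1 ?addr0// => j ji.
by rewrite mxE (negPf ji) andbF mulr0.
Qed.

Lemma dot_coroot a : a != 0 -> dot a (coroot a) = 2.
Proof. by move=> a0; rewrite dotZr mulfVK// dot_eq0. Qed.

Lemma continuous_coord (i : 'I_n) : continuous (fun x : 'rV[R]_n => x 0 i).
Proof. exact: coord_continuous. Qed.

Lemma continuous_dot a : continuous (dot a : 'rV[R]_n -> R).
Proof.
by apply: cont_sum => i _; apply: contZ; exact: continuous_coord.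
Qed.

End Dot.

Lemma int_intr (R : realType) (x : R) : x \is a Num.int -> exists m : int, x = m%:~R.
Proof. by move=> /intrP. Qed.

Section Lattices.
Context {R : realType} {n : nat} (Phi : {fset 'rV[R]_n}).
Implicit Types (a b l h x y z q : 'rV[R]_n).

Lemma cl0 : coroot_lattice Phi 0.
Proof. by exists (fun=> 0); rewrite big1. Qed.

Lemma clD x y : coroot_lattice Phi x -> coroot_lattice Phi y ->
  coroot_lattice Phi (x + y).
Proof.
move=> [c ->] [e ->]; exists (fun a => c a + e a).
by rewrite -big_split; apply: eq_bigr => a _; rewrite mulrzDr.
Qed.

Lemma clZ x (m : int) : coroot_lattice Phi x -> coroot_lattice Phi (x *~ m).
Proof.
move=> [c ->]; exists (fun a => c a * m).
by rewrite -scaler_int scaler_sumr; apply: eq_bigr => a _; rewrite scaler_int mulrzA.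
Qed.

Lemma clN x : coroot_lattice Phi x -> coroot_lattice Phi (- x).
Proof. by move=> /(clZ (-1)); rewrite mulrNz mulr1z. Qed.

Lemma cl_sum (I : eqType) (r : seq I) (F : I -> 'rV[R]_n) :
  (forall i, i \in r -> coroot_lattice Phi (F i)) ->
  coroot_lattice Phi (\sum_(i <- r) F i).
Proof.
move=> H; rewrite big_seq; elim/big_ind: _ => //; [exact: cl0|exact: clD].
Qed.

Lemma cl_coroot a : a \in Phi -> coroot_lattice Phi (coroot a).
Proof.
move=> aP; exists (fun b => (b == a)%:Z).
rewrite (bigD1_seq a)//= ?fset_uniq// eqxx mulr1z big1 ?addr0// => b /negPf ->.
by rewrite mulr0z.
Qed.

Lemma wl_cl l q : weight_lattice Phi l -> coroot_lattice Phi q ->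
  exists m : int, dot l q = m%:~R.
Proof.
move=> lP [c ->]; rewrite dot_sumr.
apply/intrP; rewrite big_seq; apply: rpred_sum => a aP.
by rewrite -scaler_int dotZr rpredM// ?intr_int// lP.
Qed.

Lemma wl0 : weight_lattice Phi 0.
Proof. by move=> a _; rewrite dot0l. Qed.
Lemma wlD l h : weight_lattice Phi l -> weight_lattice Phi h -> weight_lattice Phi (l + h).
Proof. by move=> lP hP a aP; rewrite dotDl rpredD ?lP ?hP. Qed.
Lemma wlN l : weight_lattice Phi l -> weight_lattice Phi (- l).
Proof. by move=> lP a aP; rewrite dotNl rpredN lP. Qed.
Lemma wlZ l (m : int) : weight_lattice Phi l -> weight_lattice Phi (l *~ m).
Proof. by move=> lP a aP; rewrite -scaler_int dotZl rpredM ?intr_int ?lP. Qed.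

Local Notation T := (torus Phi).

Lemma repr_pi x : exists2 q, coroot_lattice Phi q &
  repr (torus_pi Phi x) = x + (2 * pi) *: q.
Proof.
have : torus_equiv Phi (repr (torus_pi Phi x)) x.
  by apply/eqmodP; rewrite reprK.
by move=> /asboolP[q qP e]; exists q => //; rewrite -e addrC subrK.
Qed.

Lemma pi_repr (t : T) : torus_pi Phi (repr t) = t.
Proof. exact: reprK. Qed.

Lemma piD x q : coroot_lattice Phi q -> torus_pi Phi (x + (2 * pi) *: q) = torus_pi Phi x.
Proof.
move=> qP; apply/eqmodP; apply/asboolP; exists q => //.
by rewrite addrC addKr.
Qed.

Lemma pi_eq x y : torus_pi Phi x = torus_pi Phi y ->
  exists2 q, coroot_lattice Phi q & x = y + (2 * pi) *: q.
Proof.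
move=> /eqmodP/asboolP[q qP e]; exists q => //.
by rewrite -e addrC subrK.
Qed.

Definition cl_periodic {A : Type} (F : 'rV[R]_n -> A) :=
  forall x q, coroot_lattice Phi q -> F (x + (2 * pi) *: q) = F x.

Lemma periodic_repr {A : Type} (F : 'rV[R]_n -> A) x : cl_periodic F ->
  F (repr (torus_pi Phi x)) = F x.
Proof. by move=> pF; have [q qP ->] := repr_pi x; rewrite pF. Qed.

Lemma translate_pi h x : translate h (torus_pi Phi x) = torus_pi Phi (h + x).
Proof.
rewrite /translate; have [q qP ->] := repr_pi x.
by rewrite addrA piD.
Qed.

Lemma periodic_translate {A : Type} (F : 'rV[R]_n -> A) h (t : T) : cl_periodic F ->
  F (repr (translate h t)) = F (h + repr t).
Proof. by move=> pF; rewrite periodic_repr. Qed.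

(** The choice of representatives is not continuous, but composing [F o repr] with the projection
    gives back [F], and the quotient topology tests continuity on that composite. *)
Lemma continuous_repr (Z : topologicalType) (F : 'rV[R]_n -> Z) :
  continuous F -> cl_periodic F -> continuous (fun t : T => F (repr t)).
Proof.
move=> cF pF.
apply/(@quotient_continuous _ {eq_quot torus_equiv Phi}%qT).
rewrite (_ : _ \o _ = F)//; apply/funext => x /=; exact: periodic_repr.
Qed.

Lemma open_measurableT (A : set T) : open A -> measurable A.
Proof. by move=> oA; apply: sub_sigma_algebra. Qed.

Lemma continuous_measurableT (f : T -> R) : continuous f -> measurable_fun setT f.
Proof.
move=> cf; apply: (measurability _ (RGenOpens.measurableE R)).
move=> _ [_ [x [y ->]] <-]; rewrite setTI; apply: open_measurableT.
by move/continuousP: cf; apply; exact: interval_open.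
Qed.

Lemma continuous_measurable_repr (F : 'rV[R]_n -> R) :
  continuous F -> cl_periodic F -> measurable_fun setT (fun t : T => F (repr t)).
Proof. by move=> cF pF; apply: continuous_measurableT; exact: continuous_repr. Qed.

Lemma continuous_measurableTT (f : T -> T) : continuous f -> measurable_fun setT f.
Proof.
move=> cf; apply: (@measurability _ _ _ _ setT f (@open T)) => //.
move=> _ [A oA <-]; rewrite setTI; apply: open_measurableT.
by move/continuousP: cf; apply.
Qed.

Lemma torus_pi_continuous : continuous (torus_pi Phi : _ -> T).
Proof. exact: (@pi_continuous _ {eq_quot torus_equiv Phi}%qT). Qed.

Lemma continuous_piP (Z : topologicalType) (f : T -> Z) :
  continuous (f \o torus_pi Phi) -> continuous f.
Proof. by move=> cf; apply/(@quotient_continuous _ {eq_quot torus_equiv Phi}%qT). Qed.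

Lemma translate_continuous h : continuous (translate h : T -> T).
Proof.
apply: continuous_piP => x.
rewrite (_ : _ \o _ = (torus_pi Phi) \o (fun y => h + y)).
  apply: continuous_comp; last exact: torus_pi_continuous.
  by apply: (@continuousD R 'rV[R]_n 'rV[R]_n (cst h) id) => //; exact: cst_continuous.
by apply/funext => y /=; exact: translate_pi.
Qed.

End Lattices.

(** * Differentiation under the invariant integral *)

Section Lines.
Context {R : realType} {V : normedModType R}.
Implicit Types (x v : V) (F G : V -> R).

(** Both difference quotients are the same function of the increment. This transfers the mean value
    theorem and the chain rule from one variable to directional derivatives. *)
Lemma is_derive_line F x v (s d : R) :
  is_derive (x + s *: v) v F d <-> is_derive s (1 : R) (fun r => F (x + r *: v)) d.
Proof.
have E : (fun h : R => h^-1 *: ((F \o shift (x + s *: v)) (h *: v) - F (x + s *: v))) =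
  (fun h : R => h^-1 *: (((fun r => F (x + r *: v)) \o shift s) (h *: (1:R)) - F (x + s *: v))).
  apply/funext => h /=; congr (_ *: (F _ - _)).
  have -> : h%:A = h by exact: mulr1.
  by rewrite scalerDl addrCA.
split=> -[]; rewrite /derivable /derive => d1 d2.
  by split; rewrite /derivable /derive -E.
by split; rewrite /derivable /derive E.
Qed.

Lemma is_derive_shift F x v c d :
  is_derive (x + c) v F d <-> is_derive x v (fun y => F (y + c)) d.
Proof.
have E : (fun h : R => h^-1 *: ((F \o shift (x + c)) (h *: v) - F (x + c))) =
  (fun h : R => h^-1 *: (((fun y => F (y + c)) \o shift x) (h *: v) - F (x + c))).
  by apply/funext => h /=; rewrite addrA.
split=> -[]; rewrite /derivable /derive => d1 d2.
  by split; rewrite /derivable /derive -E.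
by split; rewrite /derivable /derive E.
Qed.

Lemma MVT_line F G x v (r : R) : 0 < r ->
  (forall y, is_derive y v F (G y)) ->
  exists2 s, 0 < s < r & F (x + r *: v) - F x = r * G (x + s *: v).
Proof.
move=> r0 dF.
have dl (s : R) : is_derive s (1 : R) (fun t => F (x + t *: v)) (G (x + s *: v)).
  exact/is_derive_line.
have [|s] := @MVT R (fun t => F (x + t *: v)) (fun s => G (x + s *: v)) 0 r r0 (fun s _ => dl s).
  apply: continuous_subspaceT => s; apply: differentiable_continuous.
  by apply/derivable1_diffP; case: (dl s).
by rewrite in_itv /= scale0r addr0 subr0 => ? ->; exists s; rewrite // mulrC.
Qed.

Lemma is_derive_chain (g : R -> R) F x v d e :
  is_derive x v F d -> is_derive (F x) (1:R) g e ->
  is_derive x v (fun y => g (F y)) (e * d).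
Proof.
rewrite -{1 2 3}[x]addr0 -(scale0r v) => /is_derive_line dF dg; apply/is_derive_line.
by apply: (@is_derive1_comp R g (fun r => F (x + r *: v))) => //.
Qed.

End Lines.

Section Torus.
Context {R : realType} {n : nat} (Phi : {fset 'rV[R]_n}) (mu : probability (torus Phi) R).
Hypothesis Hroot : root_system Phi.
Hypothesis Hhaar : normalized_haar mu.
Implicit Types (a b l h x y z q : 'rV[R]_n) (F G : 'rV[R]_n -> R).
Local Notation T := (torus Phi).
Local Notation Int f := (\int[mu]_(t in setT) f t)%R.
Local Notation IT F := (\int[mu]_(t in setT) F (repr t))%R.
Local Notation intg f := (mu.-integrable setT (EFin \o f)).

Lemma Int_translate (f : T -> R) h : measurable_fun setT f -> intg f ->
  Int (fun t => f (translate h t)) = Int f.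
Proof.
move=> mf If; rewrite /Rintegral; congr fine.
have mt := continuous_measurableTT (@translate_continuous R n Phi h).
symmetry; rewrite (eq_measure_integral (pushforward mu (translate h : T -> T))) => [|A mA _]; last first.
  by exact: esym (Hhaar h mA).
rewrite integral_pushforward ?preimage_setT//; first exact/measurable_EFinP.
have /integrableP[mEf Ifi] := If.
apply/integrableP; split; first by apply: measurableT_comp.
move: Ifi; rewrite (eq_measure_integral (pushforward mu (translate h : T -> T))) => [|A mA _]; last first.
  by exact: esym (Hhaar h mA).
by rewrite ge0_integral_pushforward ?preimage_setT//; apply: measurableT_comp.
Qed.

Lemma IT_translate F h : cl_periodic Phi F -> intg (fun t => F (repr t)) ->
  IT (fun x => F (h + x)) = IT F.
Proof.
move=> pF If; rewrite -(Int_translate h (intg_meas If) If).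
by congr Rintegral; apply/funext => t; rewrite periodic_translate.
Qed.

Lemma root_span x : exists c : 'rV[R]_n -> R, x = \sum_(a <- Phi) c a *: coroot a.
Proof.
have [[H0 Hspan] _ _ _] := Hroot.
have : x \in <<Phi>>%VS by rewrite Hspan memvf.
move=> /(@coord_span _ _ _ (in_tuple Phi)) xE.
(* Coordinates are indexed by positions in [Phi]; as [Phi] has no repetitions, the sum has one term.
   The factor [dot a a / 2] converts a root into its coroot. *)
exists (fun a => \sum_(i < size Phi | (Phi`_i == a)) coord (in_tuple Phi) i x * (dot a a / 2)).
rewrite {1}xE (big_nth 0) big_mkord; apply: eq_bigr => i _.
rewrite (bigD1 i)//= big1 ?addr0 => [|j].
  rewrite scalerA; congr (_ *: _) => //.
  have : dot Phi`_i Phi`_i != 0.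
    by rewrite dot_eq0; apply: contra H0 => /eqP <-; exact: mem_nth.
  by move=> h; rewrite -mulrA [X in _ * X](_ : _ = 1) ?mulr1//; field.
by rewrite nth_uniq ?fset_uniq// => /andP[/eqP/val_inj ->]; rewrite eqxx.
Qed.

Definition fund_bound : R := \sum_(a <- Phi) 2 * pi * `|coroot a|.

(** The coefficients of [x] along the coroots are reduced modulo [2 * pi]. The coroots only span, so
    this is no true fundamental domain, but boundedness is enough for compactness arguments. *)
Lemma fund_domain x : exists2 y, torus_pi Phi y = torus_pi Phi x & `|y| <= fund_bound.
Proof.
have [c xE] := root_span x.
pose m a := Num.floor (c a / (2 * pi)).
have pi2 : 0 < 2 * pi :> R by rewrite mulr_gt0// pi_gt0.
exists (x + (2 * pi) *: - \sum_(a <- Phi) coroot a *~ m a).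
  by apply: piD; apply: clN; exists m.
rewrite [in X in X + _]xE scalerN scaler_sumr -sumrB (le_trans (ler_norm_sum _ _ _))//.
apply: ler_sum => a _.
rewrite -scaler_int scalerA -scalerBl normrZ ler_wpM2r//.
have /andP[m1 m2] := floor_itv (c a / (2 * pi)).
rewrite ger0_norm; last by rewrite subr_ge0 mulrC -ler_pdivlMr.
by move: m2; rewrite -/(m a) ltr_pdivrMr// intrD => m2; move: m2; rewrite mulrDl mul1r [_ * (2 * pi)]mulrC; lra.
Qed.

Lemma periodic_bounded F : continuous F -> cl_periodic Phi F -> exists M : R, forall x, `|F x| <= M.
Proof.
move=> cF pF.
have cB : compact [set y : 'rV[R]_n | `|y| <= fund_bound].
  apply: bounded_closed_compact.
    by exists fund_bound; split; [exact: num_real|move=> M lM y /= /le_trans; apply; exact: ltW].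
  rewrite (_ : [set _ | _] = (fun y : 'rV[R]_n => `|y|) @^-1` [set r | r <= fund_bound])//.
  apply: closed_comp; last exact: closed_le.
  by move=> y _; exact: norm_continuous.
have /compact_bounded : compact (F @` [set y : 'rV[R]_n | `|y| <= fund_bound]).
  by apply: continuous_compact => //; apply: continuous_subspaceT.
move=> [M [_ HM]]; exists (M + 1) => x.
have [y yx yB] := fund_domain x.
have [q qP ->] := pi_eq (esym yx); rewrite pF//.
by apply: (HM (M + 1)); [rewrite ltrDl|exists y].
Qed.

Lemma periodic_bm F : continuous F -> cl_periodic Phi F -> bm (fun t : T => F (repr t)).
Proof.
move=> cF pF; split; first exact: continuous_measurable_repr.
by have [M HM] := periodic_bounded cF pF; exists M.
Qed.

(** The difference quotients of [F] have integral 0 by translation invariance, are bounded by the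
    supremum of [|G|] by the mean value theorem, and converge to [G]. This is the only integration
    by parts used on the torus. *)
Lemma IT_derive F G v : cl_periodic Phi F -> continuous F -> continuous G ->
  (forall x, is_derive x v F (G x)) -> cl_periodic Phi G /\ IT G = 0.
Proof.
move=> pF cF cG dF.
have pG : cl_periodic Phi G.
  move=> x q qP.
  have d1 : is_derive x v F (G (x + (2 * pi) *: q)).
    have /is_derive_shift := dF (x + (2 * pi) *: q).
    by rewrite (_ : (fun _ => _) = F)//; apply/funext => y; exact: pF.
  by have [_ <-] := d1; have [_ <-] := dF x.
split=> //.
have [M HM] := periodic_bounded cG pG.
pose f_ k (t : T) := k.+1%:R * (F (k.+1%:R^-1 *: v + repr t) - F (repr t)).
have ph h : cl_periodic Phi (fun x => F (h + x)) by move=> x q qP; rewrite addrA pF.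
have ch h : continuous (fun x => F (h + x)).
  move=> x; apply: (@continuous_comp _ _ _ (fun x => h + x) F); last exact: cF.
  by apply: (@continuousD R 'rV[R]_n 'rV[R]_n (cst h) id) => //; exact: cst_continuous.
have bf k : bm (f_ k).
  by apply: bmZ; apply: bmB; [exact: (periodic_bm (ch _) (ph _))|exact: periodic_bm].
have I0 k : Int (f_ k) = 0.
  rewrite /f_ IntZ; last by apply: bm_intg; apply: bmB; [exact: (periodic_bm (ch _) (ph _))|exact: periodic_bm].
  rewrite IntB; try by apply: bm_intg; first [exact: (periodic_bm (ch _) (ph _))|exact: periodic_bm].
  by rewrite (IT_translate (F := F))// ?subrr ?mulr0//; apply: bm_intg; exact: periodic_bm.
have [||||_ +] := @Int_bct _ T R mu f_ (fun t => G (repr t)) M.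
- by move=> k; case: (bf k).
- exact: continuous_measurable_repr.
- apply: nearW => t k; rewrite /f_ [_ + repr t]addrC.
  have [|s _ ->] := @MVT_line R _ F G (repr t) v k.+1%:R^-1 _ dF; first by rewrite invr_gt0.
  by rewrite mulrA divff ?mul1r.
- apply: nearW => t; have [+ dv] := dF (repr t).
  rewrite -dv /derivable/derive => /cvg_ex[l cl]; rewrite (cvg_lim _ cl)//.
  have /cvgr_dnbhsP/(_ (fun k => k.+1%:R^-1)) := cl.
  move=> H; rewrite (_ : f_ ^~ t = fun k => k.+1%:R^-1^-1 *:
      ((F \o shift (repr t)) (k.+1%:R^-1 *: v) - F (repr t))).
    by apply: H; split=> [k|]; [rewrite invr_eq0 pnatr_eq0|exact: cvg_harmonic].
  by apply/funext => k; rewrite invrK.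
under eq_fun do rewrite I0; move=> cv.
by rewrite -(cvg_lim (@Rhausdorff R) cv) lim_cst.
Qed.

Lemma cos_dot_periodic l c : weight_lattice Phi l -> cl_periodic Phi (fun x => cos (dot l x + c)).
Proof.
move=> lP x q qP; have [m dm] := wl_cl lP qP.
rewrite dotDr dotZr dm addrAC.
have cosN (N : nat) (y : R) : cos (y + 2 * pi * N%:R) = cos y :> R.
  by rewrite mulr_natr [2 * pi]mulr_natl; apply: (periodicn (@cosD2pi R)).
case: m {dm} => N; first exact: cosN.
by rewrite NegzE mulrNz mulrN -[LHS](cosN N.+1) subrK.
Qed.

Lemma cont_cos_dot l c : continuous (fun x : 'rV[R]_n => cos (dot l x + c)).
Proof.
apply: cont_comp; first exact: continuous_cos.
by apply: contD; [exact: continuous_dot|exact: cont_cst].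
Qed.

(** A set with infinitely many disjoint translates is null for an invariant probability. *)
Lemma wall_null l : weight_lattice Phi l -> l != 0 ->
  \forall t \ae mu, cos (dot l (repr t)) != 1.
Proof.
move=> lP l0.
pose A : set T := [set t | cos (dot l (repr t)) = 1].
have mc c : measurable_fun setT (fun t : T => cos (dot l (repr t) + c)).
  by apply: (@continuous_measurable_repr R n Phi _ (@cont_cos_dot l c)); exact: cos_dot_periodic.
have mA : measurable A.
  rewrite (_ : A = setT `&` (fun t : T => cos (dot l (repr t) + 0)) @^-1` [set 1]).
    by apply: mc => //; exact: measurable_set1.
  by rewrite setTI; apply/seteqP; split=> t; rewrite /A /= addr0.
(* Translation by [h j] moves [<l, .>] by [1 / (j + 1)]. *)
pose h (j : nat) := (j.+1%:R^-1 / dot l l) *: l.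
have lh j : dot l (h j) = j.+1%:R^-1 by rewrite dotZr mulfVK// dot_eq0.
pose A_ j := translate (h j) @^-1` A.
have mA_ j : measurable (A_ j).
  rewrite -[A_ j]setTI; apply: (continuous_measurableTT (@translate_continuous R n Phi (h j))) => //.
have A_E j t : A_ j t -> cos (dot l (repr t) + j.+1%:R^-1) = 1.
  rewrite /A_ /A /= -[X in cos X]addr0.
  rewrite (periodic_translate (F := fun x => cos (dot l x + 0))); last exact: cos_dot_periodic.
  by rewrite addr0 dotDr lh addrC.
(* A common point would make the cosine of [1/(i+1) - 1/(j+1)] equal to 1, while this difference
   lies strictly between 0 and 1 when [i < j]. *)
have dis : trivIset setT A_.
  apply/trivIsetP => i j _ _ ij; apply/seteqP; split=> // t [/A_E ci /A_E cj].
  wlog ltij : i j ij ci cj / (i < j)%N.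
    move=> H; move: (ij); rewrite neq_ltn => /orP[lt|lt]; first exact: (H i j).
    by apply: (H j i) => //; rewrite eq_sym.
  have s0 (x : R) : cos x = 1 -> sin x = 0.
    by move=> c1; apply/eqP; rewrite -sqrf_eq0 sin2cos2 c1 expr1n subrr.
  have /(congr1 cos) E : (dot l (repr t) + i.+1%:R^-1) - (dot l (repr t) + j.+1%:R^-1) = i.+1%:R^-1 - j.+1%:R^-1 :> R.
    by ring.
  move: E; rewrite cosB ci cj (s0 _ ci) (s0 _ cj) mulr1 mulr0 addr0 => E.
  have lt1 : (j.+1%:R^-1 : R) < i.+1%:R^-1 by rewrite ltf_pV2 ?posrE// ltr_nat.
  have le1 : (i.+1%:R^-1 : R) <= 1 by rewrite invf_le1// ler1n.
  have j0 : 0 < (j.+1%:R^-1 : R) by rewrite invr_gt0.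
  have p2 := pi_ge2 R.
  have := cos_inj _ _ (etrans (@cos0 R) E); rewrite !in_itv/= => /(_ _ _) H.
  suff e : 0 = i.+1%:R^-1 - j.+1%:R^-1 :> R by move: lt1; rewrite -subr_gt0 -e ltxx.
  clear E ci cj; move: H lt1 le1 j0; move: (i.+1%:R^-1) (j.+1%:R^-1) => u w H ? ? ?.
  by apply: H; apply/andP; split; lra.
have muA j : mu (A_ j) = mu A by exact: Hhaar.
have bound N : (N%:R * fine (mu A) <= 1)%R.
  have : (mu (\big[setU/set0]_(i < N) A_ i) <= 1)%E by apply: probability_le1; apply: bigsetU_measurable.
  rewrite measure_bigsetU// (eq_bigr (fun=> (fine (mu A))%:E)) => [|i _]; last first.
    by transitivity (mu A); [exact: muA|rewrite fineK// fin_num_measure].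
  by rewrite sumEFin lee_fin sumr_const card_ord mulr_natl.
have A0 : mu A = 0%E.
  rewrite -[LHS]fineK ?fin_num_measure//; congr EFin; apply/eqP.
  have : 0 <= fine (mu A) by apply: fine_ge0.
  rewrite le_eqVlt => /predU1P[<-//|r0].
  have := bound (Num.bound (fine (mu A))^-1).
  have /archi_boundP : 0 <= (fine (mu A))^-1 by rewrite invr_ge0 ltW.
  rewrite -(ltr_pM2r r0) mulVf ?gt_eqF// => h1 h2.
  by have := lt_le_trans h1 h2; rewrite ltxx.
exists A; split => //.
by move=> t /=; rewrite /A/= => /negP; rewrite negbK => /eqP.
Qed.

End Torus.

Lemma near_seq {T : Type} {F : set_system T} {FF : Filter F} (I : eqType) (s : seq I)
  (P : I -> T -> Prop) : (forall i, i \in s -> \forall t \near F, P i t) ->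
  \forall t \near F, forall i, i \in s -> P i t.
Proof.
elim: s => [_|i s IH H]; first by apply: filterE.
have H1 := H i (mem_head _ _).
have H2 : \forall t \near F, forall i, i \in s -> P i t.
  by apply: IH => j js; apply: H; rewrite in_cons js orbT.
move: H1 H2; apply: filterS2 => t p1 p2 j.
by rewrite in_cons => /predU1P[->//|]; exact: p2.
Qed.

(** * Vectors off finitely many hyperplanes *)

Section Regular.
Context {R : realType} {n : nat}.

(** If the vector [y] found for the tail is orthogonal to [b], a vector [z] not orthogonal to [b] is
    corrected by a multiple [N y], with [N] above every ratio [|<c,z>| / |<c,y>|]. Only natural
    multiples are formed, so that [L] may be a lattice as well as a subspace. *)
Lemma regular_vector (s : seq 'rV[R]_n) (L : set 'rV[R]_n) :
  L 0 -> (forall x y (m : nat), L x -> L y -> L (x + y *+ m)) ->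
  (forall b, b \in s -> exists2 y, L y & dot b y != 0) ->
  exists2 y, L y & {in s, forall b, dot b y != 0}.
Proof.
move=> L0 LD; elim: s => [_|b s IH H]; first by exists 0.
have [|y Ly ys] := IH; first by move=> c cs; apply: H; rewrite in_cons cs orbT.
have [z Lz bz] := H b (mem_head _ _).
have [b0|] := eqVneq (dot b y) 0; last first.
  by move=> by0; exists y => // c; rewrite in_cons => /predU1P[->|/ys].
pose B := \sum_(c <- s) `|dot c z| / `|dot c y|.
pose N := (Num.bound B).+1.
have BN : B < N%:R.
  rewrite (lt_le_trans (archi_boundP _))// ?ler_nat//.
  by apply: sumr_ge0 => c _; rewrite divr_ge0.
exists (z + y *+ N); first exact: LD.
move=> c; rewrite in_cons dotDr -scaler_nat dotZr => /predU1P[->|cs].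
  by rewrite b0 mulr0 addr0.
apply/negP => /eqP E.
have cy := ys c cs.
have : `|dot c z| / `|dot c y| = N%:R.
  rewrite (_ : dot c z = - (N%:R * dot c y)); last by move: E; lra.
  by rewrite normrN normrM mulfK ?normr_eq0// ger0_norm.
move=> E2; have : `|dot c z| / `|dot c y| <= B.
  rewrite /B (big_rem c)//= lerDl; apply: sumr_ge0 => i _; exact: divr_ge0.
by rewrite E2 leNgt BN.
Qed.

End Regular.

(** * The Weyl group *)

Section Weyl.
Context {R : realType} {n : nat} (Phi : {fset 'rV[R]_n}).
Hypothesis Hroot : root_system Phi.
Implicit Types (a b l h x y z q : 'rV[R]_n) (w : 'M[R]_n).
Local Notation T := (torus Phi).

Lemma root_neq0 a : a \in Phi -> a != 0.
Proof. by have [[+ _] _ _ _] := Hroot => H aP; apply: contraNneq H => <-. Qed.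

Lemma reflectionE a x : reflection a x = x - dot x (coroot a) *: a.
Proof. by []. Qed.

Lemma reflection_self a : a != 0 -> reflection a a = - a.
Proof. by move=> a0; rewrite reflectionE dot_coroot// scaler_nat mulr2n opprD addNKr. Qed.

Lemma rootN a : a \in Phi -> - a \in Phi.
Proof.
move=> aP; have [_ H _ _] := Hroot.
by have := H a a aP aP; rewrite reflection_self// root_neq0.
Qed.

Lemma root_wl a : a \in Phi -> weight_lattice Phi a.
Proof. by move=> aP b bP; have [_ _ H _] := Hroot; apply: H. Qed.

Lemma dot_reflection a x y : a != 0 ->
  dot (x *m reflection_mx a) (y *m reflection_mx a) = dot x y.
Proof.
move=> a0; rewrite !mul_reflection_mx !reflectionE /coroot.
have := a0; rewrite -dot_eq0 => aa.
rewrite !(dotBl, dotBr, dotZl, dotZr) [dot a y]dotC.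
by field.
Qed.

Lemma weyl_dot w x y : weyl Phi w -> dot (x *m w) (y *m w) = dot x y.
Proof.
move=> W; elim: W x y => [|w' a _ IH aP] x y; first by rewrite !mulmx1.
by rewrite !mulmxA dot_reflection ?root_neq0// IH.
Qed.

Lemma weyl_refl1 a : a \in Phi -> weyl Phi (reflection_mx a).
Proof. by move=> aP; rewrite -[reflection_mx a]mul1mx; apply: weyl_refl => //; exact: weyl_one. Qed.

Lemma weyl_mul w1 w2 : weyl Phi w1 -> weyl Phi w2 -> weyl Phi (w1 *m w2).
Proof.
move=> W1; elim => [|w a _ IH aP]; first by rewrite mulmx1.
by rewrite mulmxA; exact: weyl_refl.
Qed.

Lemma mx_eq_mul w1 w2 : (forall x : 'rV[R]_n, x *m w1 = x *m w2) -> w1 = w2.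
Proof. by move=> H; apply/row_matrixP => i; rewrite !rowE H. Qed.

Lemma reflection_mx2 a : a != 0 -> reflection_mx a *m reflection_mx a = 1%:M.
Proof.
move=> a0; apply: mx_eq_mul => x; rewrite mulmx1 mulmxA !mul_reflection_mx !reflectionE.
rewrite dotBl dotZl dot_coroot// -addrA -opprD -scalerDl.
have -> : dot x (coroot a) + (dot x (coroot a) - dot x (coroot a) * 2) = 0 by ring.
by rewrite scale0r subr0.
Qed.

Lemma weyl_inv w : weyl Phi w -> exists2 w', weyl Phi w' & w *m w' = 1%:M /\ w' *m w = 1%:M.
Proof.
elim=> [|w1 a _ [w' W' [e1 e2]] aP].
  by exists 1%:M; [exact: weyl_one|rewrite mulmx1].
exists (reflection_mx a *m w'); first by apply: weyl_mul => //; exact: weyl_refl1.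
split; last by rewrite -mulmxA [w' *m _]mulmxA e2 mul1mx reflection_mx2// root_neq0.
by rewrite -mulmxA [reflection_mx a *m (_ *m _)]mulmxA reflection_mx2 ?root_neq0// mul1mx.
Qed.

Lemma weyl_root w a : weyl Phi w -> a \in Phi -> a *m w \in Phi.
Proof.
move=> W; elim: W a => [|w' b _ IH bP] a aP; first by rewrite mulmx1.
by rewrite mulmxA mul_reflection_mx; have [_ H _ _] := Hroot; apply: H => //; exact: IH.
Qed.

Lemma coroot_weyl w a : weyl Phi w -> coroot (a *m w) = coroot a *m w.
Proof. by move=> W; rewrite /coroot weyl_dot// scalemxAl. Qed.

Lemma weyl_cl w q : weyl Phi w -> coroot_lattice Phi q -> coroot_lattice Phi (q *m w).
Proof.
move=> W [c ->]; rewrite mulmx_suml; apply: cl_sum => a aP.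
rewrite -scaler_int -scalemxAl -coroot_weyl// scaler_int; apply: clZ; apply: cl_coroot.
exact: weyl_root.
Qed.

Lemma dot_weyl_inv w w' x y : weyl Phi w -> w' *m w = 1%:M -> dot x (y *m w) = dot (x *m w') y.
Proof. by move=> W e; rewrite -[in RHS](weyl_dot _ _ W) -mulmxA e mulmx1. Qed.

Lemma weyl_wl w l : weyl Phi w -> weight_lattice Phi l -> weight_lattice Phi (l *m w).
Proof.
move=> W lP a aP; have [w' W' [e1 e2]] := weyl_inv W.
by rewrite dotC (dot_weyl_inv _ _ W e2) dotC -coroot_weyl//; apply: lP; exact: weyl_root.
Qed.

Lemma weyl_act_pi w x : weyl Phi w -> weyl_act w (torus_pi Phi x) = torus_pi Phi (x *m w).
Proof.
move=> W; rewrite /weyl_act; have [q qP ->] := repr_pi Phi x.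
by rewrite mulmxDl -scalemxAl piD//; exact: weyl_cl.
Qed.

Lemma weyl_act_repr {A : Type} (F : 'rV[R]_n -> A) w (t : T) : weyl Phi w -> cl_periodic Phi F ->
  F (repr (weyl_act w t)) = F (repr t *m w).
Proof. by move=> W pF; rewrite /weyl_act periodic_repr. Qed.

Lemma periodic_weyl {A : Type} (F : 'rV[R]_n -> A) w : weyl Phi w -> cl_periodic Phi F ->
  cl_periodic Phi (fun x => F (x *m w)).
Proof. by move=> W pF x q qP; rewrite mulmxDl -scalemxAl pF//; exact: weyl_cl. Qed.

(** An element of W is determined by its action on the roots, since their coroots span. [f] records
    this action as a self-map of the finite type [Phi], and [g] chooses an element with a prescribed
    action. *)
Lemma weyl_finite : exists ws : seq 'M[R]_n, uniq ws /\ forall w, w \in ws <-> weyl Phi w.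
Proof.
pose f w : {ffun Phi -> Phi} := [ffun a : Phi => insubd a (val a *m w)].
pose g (h : {ffun Phi -> Phi}) : 'M[R]_n := xget 1%:M [set w | weyl Phi w /\ f w = h].
have gW (h : {ffun Phi -> Phi}) : weyl Phi (g h).
  by rewrite /g; case: xgetP => [w _ []//|_]; exact: weyl_one.
exists (undup (map g (enum {ffun Phi -> Phi}))); split; first exact: undup_uniq.
move=> w; rewrite mem_undup; split => [/mapP[h _ ->]//|W].
apply/mapP; exists (f w); first by rewrite mem_enum.
rewrite /g; case: xgetP => [w' _ [W' E]|/(_ w)/=[]//].
apply: mx_eq_mul => x; have [c ->] := root_span Hroot x.
rewrite !mulmx_suml big_seq [RHS]big_seq; apply: eq_bigr => a aP.
rewrite -scalemxAl -[RHS]scalemxAl -(coroot_weyl a W) -(coroot_weyl a W'); congr (_ *: coroot _).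
have := congr1 (fun h : {ffun Phi -> Phi} => val (h [` aP]%fset)) (esym E).
by rewrite !ffunE !val_insubd/= !weyl_root.
Qed.

Lemma root_reindex {A : zmodType} (F : 'rV[R]_n -> A) w : weyl Phi w ->
  \sum_(a <- Phi) F (a *m w) = \sum_(a <- Phi) F a.
Proof.
move=> W; have [w' W' [e1 e2]] := weyl_inv W.
rewrite -(big_map (fun a => a *m w) xpredT F); apply: perm_big; apply: uniq_perm.
- rewrite map_inj_uniq ?fset_uniq// => x y /(congr1 (mulmx^~ w')).
  by rewrite -!mulmxA e1 !mulmx1.
- exact: fset_uniq.
move=> b; apply/mapP/idP => [[a aP ->]|bP]; first exact: weyl_root.
by exists (b *m w'); rewrite ?weyl_root// -mulmxA e2 mulmx1.
Qed.

Section Positive.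
Variable Phip : {fset 'rV[R]_n}.
Hypothesis Hpos : positive_roots Phi Phip.

Lemma pos_root a : a \in Phip -> a \in Phi.
Proof. by case: Hpos => v _ ->; case/andP. Qed.

Lemma pos_rootN a : a \in Phip -> - a \notin Phip.
Proof.
case: Hpos => v _ H; rewrite !H => /andP[_ av].
by rewrite negb_and dotNl oppr_gt0 -leNgt (ltW av) orbT.
Qed.

Lemma pos_or a : a \in Phi -> (a \in Phip) || (- a \in Phip).
Proof.
move=> aP; case: Hpos => v v0 H; rewrite !H aP rootN//= dotNl oppr_gt0.
by rewrite orbC -neq_lt v0.
Qed.

Lemma half_sum {A : zmodType} (F : 'rV[R]_n -> A) : (forall a, a \in Phi -> F (- a) = F a) ->
  \sum_(a <- Phi) F a = (\sum_(a <- Phip) F a) *+ 2.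
Proof.
move=> Fe; have -> : \sum_(a <- Phi) F a = \sum_(a <- Phip ++ map -%R Phip) F a.
  apply: perm_big; apply: uniq_perm; first exact: fset_uniq.
    rewrite cat_uniq (map_inj_uniq oppr_inj) ?fset_uniq ?andbT//=.
    by apply/hasPn => _ /mapP[b bP ->]; exact: pos_rootN.
  move=> a; rewrite mem_cat; apply/idP/orP => [aP|[/pos_root//|/mapP[b bP ->]]].
    case/orP: (pos_or aP); [by left|move=> h; right; apply/mapP; exists (- a) => //].
    by rewrite opprK.
  by apply: rootN; exact: pos_root.
rewrite big_cat/= big_map mulr2n; congr (_ + _).
rewrite big_seq [RHS]big_seq; apply: eq_bigr => a /pos_root; exact: Fe.
Qed.

Lemma pos_reindex {A : Type} (idx : A) (op : Monoid.com_law idx) (F : 'rV[R]_n -> A) w : weyl Phi w ->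
  (forall a, a \in Phi -> F (- a) = F a) ->
  \big[op/idx]_(a <- Phip) F (a *m w) = \big[op/idx]_(a <- Phip) F a.
Proof.
move=> W Fe; have [w' W' [e1 e2]] := weyl_inv W.
(* The positive one of the two roots [a w] and [- a w]; this permutes the positive roots. *)
pose s a := if a *m w \in Phip then a *m w else - (a *m w).
have sP a : a \in Phip -> s a \in Phip.
  rewrite /s => aP; case: ifPn => // n0; have := pos_or (weyl_root W (pos_root aP)).
  by rewrite (negPf n0).
transitivity (\big[op/idx]_(a <- Phip) F (s a)).
  apply: eq_big_seq => a aP; rewrite /s; case: ifP => // _.
  by rewrite Fe// weyl_root// pos_root.
have sI : {in Phip &, injective s}.
  have wI : injective (fun a : 'rV[R]_n => a *m w).
    by move=> x y /(congr1 (mulmx^~ w')); rewrite -!mulmxA e1 !mulmx1.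
  move=> a b aP bP; rewrite /s; case: ifP => _; case: ifP => _.
  - exact: wI.
  - by rewrite -mulNmx => /wI E; move: aP; rewrite E (negPf (pos_rootN bP)).
  - by rewrite -mulNmx => /wI E; move: bP; rewrite -E (negPf (pos_rootN aP)).
  - by move=> /oppr_inj; exact: wI.
rewrite -(big_map s xpredT F); apply: perm_big.
have us : uniq (map s Phip) by rewrite map_inj_in_uniq ?fset_uniq.
apply: uniq_perm => //; first exact: fset_uniq.
have sub : {subset map s Phip <= (Phip : seq _)} by move=> _ /mapP[a aP ->]; exact: sP.
by have [] := uniq_min_size us sub; rewrite ?size_map.
Qed.

(** Reducedness of the root system enters here: the only multiples of [a] among the roots are [a]
    and [- a]. *)
Lemma pos_not_parallel a b (c : R) : a \in Phip -> b \in Phip -> b = c *: a -> b = a.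
Proof.
move=> aP bP E; have [_ _ _ H] := Hroot.
have cP : c *: a \in Phi by rewrite -E pos_root.
case: (H a (pos_root aP) c cP) => c1; first by rewrite E c1 scale1r.
by move: bP; rewrite E c1 scaleN1r (negPf (pos_rootN aP)).
Qed.

End Positive.

End Weyl.

(** * The cotangent identity *)

Section Expi.
Context {R : realType}.
Local Open Scope complex_scope.
Implicit Types x y : R.

Lemma expiD x y : expi (x + y) = expi x * expi y.
Proof. by rewrite /expi cosD sinD; apply/eqP; rewrite eq_complex /= eqxx/= addrC eqxx. Qed.

Lemma expi0 : expi (0 : R) = 1.
Proof. by rewrite /expi cos0 sin0. Qed.

Lemma expi_neq0 x : expi x != 0.
Proof.
apply/eqP => E; have : expi x * expi (- x) = 1 by rewrite -expiD subrr expi0.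
by rewrite E mul0r => /eqP; rewrite eq_sym oner_eq0.
Qed.

Lemma expiN x : expi (- x) = (expi x)^-1.
Proof. by apply: (mulfI (expi_neq0 x)); rewrite -expiD subrr expi0 divff// expi_neq0. Qed.

Lemma expiMn x (m : nat) : expi (x *+ m) = expi x ^+ m.
Proof. by elim: m => [|m IH]; rewrite ?mulr0n ?expi0 ?expr0// mulrS exprS expiD IH. Qed.

Lemma expi_eq1 x : expi x = 1 -> cos x = 1.
Proof. by move=> /eqP; rewrite eq_complex => /andP[/eqP]. Qed.

Lemma expiMz x (m : int) : expi (x * m%:~R) = expi x ^ m.
Proof.
case: m => m; first by rewrite -pmulrn mulr_natr expiMn.
by rewrite NegzE mulrNz mulrN expiN -pmulrn mulr_natr expiMn -exprnN.
Qed.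

Definition cot x : R := cos x / sin x.

Lemma cotN x : cot (- x) = - cot x.
Proof. by rewrite /cot cosN sinN invrN mulrN. Qed.

Lemma cos_half x : cos x = 1 - 2 * sin (x / 2) ^+ 2.
Proof.
rewrite [in LHS](_ : x = x / 2 + x / 2); last by rewrite -splitr.
rewrite cosD -!expr2; have := cos2Dsin2 (x / 2).
by move=> h; rewrite -[X in X - _ ^+ 2](addrK (sin (x / 2) ^+ 2)) h; ring.
Qed.

Lemma sin_half x : sin x = 2 * sin (x / 2) * cos (x / 2).
Proof.
rewrite [in LHS](_ : x = x / 2 + x / 2); last by rewrite -splitr.
by rewrite sinD; ring.
Qed.

Lemma cos_neq1 x : (cos x != 1) = (sin (x / 2) != 0).
Proof.
rewrite cos_half -[X in _ != X]subr0 (inj_eq (addrI _)) eqr_opp mulf_eq0 pnatr_eq0/=.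
by rewrite sqrf_eq0.
Qed.

(** The formula [cot(x/2) = i (e^(ix) + 1) / (e^(ix) - 1)] cleared of its denominator; it turns sums
    of products of cotangents into rational functions. *)
Lemma cot_expi x : sin (x / 2) != 0 ->
  (cot (x / 2))%:C * (expi x - 1) = 'i * (expi x + 1).
Proof.
move=> s0; rewrite /cot /expi (cos_half x) (sin_half x).
set s := sin _; set c := cos _; rewrite -/s in s0.
have cs : c ^+ 2 = 1 - s ^+ 2 by have := cos2Dsin2 (x / 2); rewrite -/s -/c; lra.
apply/eqP; rewrite eq_complex /=; apply/andP; split; apply/eqP.
  by field.
by rewrite (_ : _ + _ = 2 * c ^+ 2 + (c / s) * 0); [rewrite cs; ring|field].
Qed.

End Expi.

(** * Polynomials with simple roots *)

Section RationalIdentity.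
Variable (C : numClosedFieldType).

(* A polynomial of degree at most deg D vanishing at the simple roots of D, whose
   constant term is c D(0), is c D. *)
Lemma poly_eq_scale (D N : {poly C}) :
  separable_poly D -> D.[0] != 0 -> (size N <= size D)%N ->
  (forall z, root D z -> root N z) -> N = (N.[0] / D.[0]) *: D.
Proof.
move=> sD D0 sN H; apply/eqP; rewrite -subr_eq0; apply/negPn/negP => nz.
have [rs Drs] := closed_field_poly_normal D.
have Dnz : D != 0 by apply: contraNneq D0 => ->; rewrite horner0.
have lD : lead_coef D != 0 by rewrite lead_coef_eq0.
have u : uniq rs.
  by move: sD; rewrite Drs (eqp_separable (eqp_scale _ lD)) separable_prod_XsubC.
have Droot z : (z \in rs) = root D z.
  by rewrite Drs rootZ// root_prod_XsubC.
have sDs : size D = (size rs).+1 by rewrite {1}Drs size_scale// size_prod_XsubC.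
have := max_poly_roots (rs := 0 :: rs) nz.
rewrite /= u andbT Droot /root D0 => /(_ _ isT).
rewrite hornerD hornerN hornerZ divfK// subrr eqxx/=.
move=> /(_ _) L.
have : leq (size (N - (N.[0] / D.[0]) *: D)) (size D).
  rewrite (leq_trans (size_polyD _ _))// geq_max sN size_polyN.
  exact: size_scale_leq.
rewrite leqNgt sDs L//.
apply/allP => z; rewrite Droot => rz.
rewrite /root hornerD hornerN hornerZ.
by rewrite (eqP (H z rz)) (eqP rz) mulr0 subrr.
Qed.

Lemma separable_prod (I : eqType) (s : seq I) (p : I -> {poly C}) :
  uniq s -> (forall i, i \in s -> separable_poly (p i)) ->
  (forall i j, i \in s -> j \in s -> i != j -> coprimep (p i) (p j)) ->
  separable_poly (\prod_(i <- s) p i).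
Proof.
elim: s => [_ _ _|i s IH /= /andP[ins us] H1 H2].
  by rewrite big_nil unlock coprime1p.
rewrite big_cons separable_mul H1 ?mem_head//= IH//=; last 2 first.
- by move=> j js; apply: H1; rewrite in_cons js orbT.
- by move=> j l js ls; apply: H2; rewrite in_cons ?js ?ls orbT.
rewrite big_seq; elim/big_rec: _ => [|j r js IHr]; first by rewrite coprimep1.
rewrite coprimepMr IHr andbT; apply: H2; rewrite ?mem_head ?in_cons ?js ?orbT//.
by apply: contraNneq ins => ->.
Qed.

Lemma separable_binomial (u : C) (m : nat) : u != 0 -> (0 < m)%N ->
  separable_poly (u *: 'X^m - 1).
Proof.
move=> u0 m0; rewrite unlock.
apply/Pdiv.ClosedField.coprimepP => z.
rewrite /root !hornerE => /eqP E.
rewrite derivB derivZ derivXn derivC !hornerE.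
have z0 : z != 0.
  by apply: contraTneq m0 => z0; apply/negP => m0; move: E; rewrite z0 expr0n (gtn_eqF m0) mulr0 sub0r => /eqP; rewrite oppr_eq0 oner_eq0.
rewrite subr0 hornerMn !hornerE mulf_eq0 negb_or u0/= -mulr_natr mulf_neq0//.
  exact: expf_neq0.
by rewrite pnatr_eq0 -lt0n.
Qed.

End RationalIdentity.

(** * Constancy of the cotangent sum *)

Section CotIdentity.
Context {R : realType} {n : nat} (Phi Phip : {fset 'rV[R]_n}) (k : 'rV[R]_n -> R).
Hypothesis Hroot : root_system Phi.
Hypothesis Hk : forall w a, weyl Phi w -> a \in Phi -> k (a *m w) = k a.
Implicit Types (a b x v : 'rV[R]_n).
Local Open Scope complex_scope.
Local Notation C := (R[i]).

Lemma kN a : a \in Phi -> k (- a) = k a.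
Proof.
move=> aP; rewrite -(Hk (weyl_refl1 aP) aP) mul_reflection_mx reflection_self//.
exact: (root_neq0 Hroot).
Qed.

(** The reflection permutes the summands, preserves [k] and [g], and changes the sign of [dot a b];
    so the sum is its own opposite. This is the cancellation of residues on the wall of [a]. *)
Lemma reflection_sum0 (g : 'rV[R]_n -> C) a : a \in Phi ->
  (forall b, b \in Phi -> g (reflection a b) = g b) ->
  \sum_(b <- Phi | (b != a) && (b != - a)) (k b * dot a b)%:C * g b = 0.
Proof.
move=> aP gr; have a0 := root_neq0 Hroot aP.
pose F b := if (b != a) && (b != - a) then (k b * dot a b)%:C * g b else 0.
have E : \sum_(b <- Phi) F (b *m reflection_mx a) = \sum_(b <- Phi) F b.
  by apply: (root_reindex Hroot); exact: weyl_refl1.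
have ra : a *m reflection_mx a = - a by rewrite mul_reflection_mx reflection_self.
have inv b c : (b *m reflection_mx a == c) = (b == c *m reflection_mx a).
  by apply/eqP/eqP => [<-|->]; rewrite -mulmxA reflection_mx2// mulmx1.
have FN b : b \in Phi -> F (b *m reflection_mx a) = - F b.
  move=> bP; rewrite /F !inv mulNmx ra opprK andbC.
  case: ifP => _; last by rewrite oppr0.
  rewrite mul_reflection_mx gr// -mul_reflection_mx (Hk (weyl_refl1 aP) bP).
  rewrite -mulNr; congr (_ * _); rewrite -rmorphN; congr (_%:C); rewrite -mulrN; congr (_ * _).
  have := dot_reflection (- a) b a0; rewrite mulNmx ra opprK => ->.
  by rewrite dotNl.
move: E; rewrite big_seq (eq_bigr (fun b => - F b) FN).
rewrite -big_seq sumrN => /eqP; rewrite eq_sym -addr_eq0 -mulr2n mulrn_eq0/= => /eqP F0.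
by rewrite big_mkcond; exact: F0.
Qed.

Section Line.
Variables (v x : 'rV[R]_n) (Phiv : {fset 'rV[R]_n}).
Hypothesis Hv : forall a, a \in Phi -> dot a v \is a Num.int.
Hypothesis Hv0 : {in Phi, forall a, dot a v != 0}.
Hypothesis HPhiv : forall a, (a \in Phiv) = (a \in Phi) && (0 < dot a v).
Let m a : int := Num.floor (dot a v).
Hypothesis Hx1 : forall a, a \in Phiv -> cos (dot a x) != 1.
Hypothesis Hx2 : forall a b, a \in Phiv -> b \in Phiv -> a != b ->
  cos (dot (a *~ m b - b *~ m a) x) != 1.

(** On the line [x + s v], with [z = e^(is)], the exponential of [a] is [u a z^(m a)]; [p a] and
    [q a] are this quantity minus and plus 1, so that [cot(a/2) = i q_a / p_a] and the double sum
    becomes [- N / D]. The positive system [Phiv] is the one defined by [v], so all exponents are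
    positive. [Hx1] puts the point [z = 1] off the poles, and [Hx2] keeps the poles of different
    roots apart. *)
Let u a : C := expi (dot a x).
Let p a : {poly C} := u a *: 'X^`|m a| - 1.
Let q a : {poly C} := u a *: 'X^`|m a| + 1.
Let kk a b : R := k a * k b * dot a b.
Let rest a b : {poly C} := \prod_(c <- Phiv | (c != a) && (c != b)) p c.
Let N : {poly C} :=
  \sum_(a <- Phiv) \sum_(b <- Phiv | b != a) (kk a b)%:C *: (q a * q b * rest a b).
Let D : {poly C} := \prod_(a <- Phiv) p a.

Let mE a : a \in Phi -> (m a)%:~R = dot a v.
Proof. by move=> aP; rewrite /m floorK// Hv. Qed.

Let PhivP a : a \in Phiv -> a \in Phi.
Proof. by rewrite HPhiv => /andP[]. Qed.

Let m_gt0 a : a \in Phiv -> 0 < m a.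
Proof. by move=> aP; rewrite -(ltr_int R) mE ?PhivP//; move: aP; rewrite HPhiv => /andP[]. Qed.

Let mabs a : a \in Phiv -> m a = `|m a|%N :> int.
Proof. by move=> aP; rewrite gez0_abs// ltW// m_gt0. Qed.

Let mabs_gt0 a : a \in Phiv -> (0 < `|m a|)%N.
Proof. by move=> aP; rewrite absz_gt0 gt_eqF// m_gt0. Qed.

Let posv : positive_roots Phi Phiv.
Proof. by exists v => //; exact: HPhiv. Qed.

Let u0 a : u a != 0. Proof. exact: expi_neq0. Qed.

Let size_pm (e : C) a : a \in Phiv -> size (u a *: 'X^`|m a| + e%:P) = `|m a|.+1.
Proof.
move=> aP; rewrite size_polyDl size_scale ?size_polyXn//.
by rewrite (leq_ltn_trans (size_polyC_leq1 e))// ltnS mabs_gt0.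
Qed.

Let size_p a : a \in Phiv -> size (p a) = `|m a|.+1.
Proof. by move=> aP; rewrite -(size_pm (-1) aP) /p polyCN. Qed.

Let size_q a : a \in Phiv -> size (q a) = `|m a|.+1.
Proof. by move=> aP; rewrite -(size_pm 1 aP). Qed.

Let p_neq0 a : a \in Phiv -> p a != 0.
Proof. by move=> aP; rewrite -size_poly_gt0 size_p. Qed.

Let q_neq0 a : a \in Phiv -> q a != 0.
Proof. by move=> aP; rewrite -size_poly_gt0 size_q. Qed.

Let p0 a : a \in Phiv -> (p a).[0] = -1.
Proof. by move=> aP; rewrite /p !hornerE expr0n gtn_eqF ?mabs_gt0//= mulr0 sub0r. Qed.

Let q0 a : a \in Phiv -> (q a).[0] = 1.
Proof. by move=> aP; rewrite /q !hornerE expr0n gtn_eqF ?mabs_gt0//= mulr0 add0r. Qed.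

Let DE a b : a \in Phiv -> b \in Phiv -> b != a -> D = p a * p b * rest a b.
Proof.
move=> aP bP ba; rewrite /D (bigD1_seq a)//= ?fset_uniq//.
rewrite -big_filter (bigD1_seq b)/= ?filter_uniq ?fset_uniq ?mem_filter ?ba//.
by rewrite big_filter_cond mulrA.
Qed.

Let kkC a b : kk a b = kk b a.
Proof. by rewrite /kk dotC [k a * _]mulrC. Qed.

Let restC a b : rest a b = rest b a.
Proof. by apply: eq_bigl => c; rewrite andbC. Qed.

Let D0 : D.[0] != 0.
Proof.
rewrite /D horner_prod prodf_seq_neq0; apply/allP => a aP /=.
by rewrite p0// oppr_eq0 oner_eq0.
Qed.

(** At [z = 0] every [p a] is -1 and every [q a] is 1, so each product [q a * q b * rest a b] has
    the same value as [D = p a * p b * rest a b]. *)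
Let N0 : N.[0] = (\sum_(a <- Phiv) \sum_(b <- Phiv | b != a) kk a b)%:C * D.[0].
Proof.
rewrite /N horner_sum rmorph_sum mulr_suml big_seq [RHS]big_seq; apply: eq_bigr => a aP.
rewrite horner_sum rmorph_sum mulr_suml big_seq_cond [RHS]big_seq_cond.
apply: eq_bigr => b /andP[bP ba]; rewrite hornerZ (DE aP bP ba) !hornerM p0// p0// q0// q0//.
by rewrite mulrNN.
Qed.

Let size_N : (size N <= size D)%N.
Proof.
rewrite /N (leq_trans (size_sum _ _ _))//; apply/bigmax_leqP_seq => a aP _.
rewrite (leq_trans (size_sum _ _ _))//; apply/bigmax_leqP_seq => b bP ba.
rewrite (leq_trans (size_scale_leq _ _))// (DE aP bP ba).
have r0 : rest a b != 0.
  by apply: contraNneq D0 => r0; rewrite (DE aP bP ba) r0 mulr0 horner0.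
rewrite !size_mul ?mulf_neq0 ?p_neq0 ?q_neq0//.
by rewrite !size_p ?size_q.
Qed.

Let chi (z : C) b : C := expi (dot b x) * z ^ (m b).

Let pE z b : b \in Phiv -> (p b).[z] = chi z b - 1.
Proof. by move=> bP; rewrite /p /chi !hornerE {2}mabs. Qed.

Let qE z b : b \in Phiv -> (q b).[z] = chi z b + 1.
Proof. by move=> bP; rewrite /q /chi !hornerE {2}mabs. Qed.

(** [chi z] is multiplicative in the root, and [reflection a b] differs from [b] by an integer
    multiple of [a], on which [chi z] is 1. *)
Let chi_reflection z a b : z != 0 -> chi z a = 1 -> a \in Phi -> b \in Phi ->
  chi z (reflection a b) = chi z b.
Proof.
move=> z0 ca aP bP; have [_ Hr Hc _] := Hroot.
have rP := Hr a b aP bP.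
have /int_intr [N1 NE] := Hc a b aP bP.
have mr : m (reflection a b) = m b - m a * N1.
  apply: (@intr_inj R); rewrite mE// intrB intrM !mE// -NE reflectionE dotBl dotZl.
  by rewrite [_ * dot a v]mulrC.
have eN : expi (N1%:~R * dot a x) = expi (dot a x) ^ N1 by rewrite mulrC expiMz.
have ca' : expi (dot a x) * z ^ m a = 1 := ca.
rewrite /chi mr reflectionE NE dotBl dotZl expiD expiN eN expfzDr// -invr_expz -exprz_exp.
by rewrite mulrACA -invfM -expfzMl ca' exp1rz invr1 mulr1.
Qed.

Let chiN z b : z != 0 -> b \in Phi -> chi z (- b) = (chi z b)^-1.
Proof.
move=> z0 bP; rewrite /chi dotNl expiN invfM; congr (_ * _).
have -> : m (- b) = - m b.
  by apply: (@intr_inj R); rewrite mE ?(rootN Hroot)// intrN mE// dotNl.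
by rewrite invr_expz.
Qed.

(** Raising [u a z^(m a) = 1] to the power [m b] and [u b z^(m b) = 1] to the power [m a] eliminates
    [z]; the quotient contradicts [Hx2]. *)
Let no_common a b z : a \in Phiv -> b \in Phiv -> a != b ->
  root (p a) z -> ~~ root (p b) z.
Proof.
move=> aP bP ab ra; apply/negP => rb.
have z0 : z != 0.
  by apply: contraTneq ra => ->; rewrite /root p0// oppr_eq0 oner_eq0.
have ca : chi z a = 1 by apply/eqP; rewrite -subr_eq0 -pE.
have cb : chi z b = 1 by apply/eqP; rewrite -subr_eq0 -pE.
have /eqP := Hx2 aP bP ab; apply; apply: expi_eq1.
have dz c (M : int) : dot (c *~ M) x = dot c x * M%:~R by rewrite -scaler_int dotZl mulrC.
rewrite dotBl !dz expiD expiN !expiMz.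
have E c d : chi z c = 1 -> expi (dot c x) ^ m d = (z ^ (m c * m d))^-1.
  move=> cc; apply: (mulIf (x := z ^ (m c * m d))); first by rewrite expfz_neq0.
  rewrite mulVf ?expfz_neq0// -exprz_exp -expfzMl.
  by rewrite -/(chi z c) cc exp1rz.
by rewrite (E a b ca) (E b a cb) [m b * _]mulrC divff// invr_neq0 ?expfz_neq0.
Qed.

(** At a zero of [p a], a term without the index [a] contains the factor [p a] and vanishes. The
    terms [(a, b)] and [(b, a)] are equal, and their sum over [b] vanishes by [reflection_sum0]. *)
Let root_N z : root D z -> root N z.
Proof.
rewrite /D /root horner_prod prodf_seq_eq0 => /hasP[a aP /= pa].
have z0 : z != 0.
  by apply: contraTneq pa => ->; rewrite p0// oppr_eq0 oner_eq0.
have ca : chi z a = 1 by apply/eqP; rewrite -subr_eq0 -pE.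
have pb b : b \in Phiv -> b != a -> (p b).[z] != 0.
  by move=> bP ba; apply: (no_common aP bP) => //; rewrite eq_sym.
pose t b c := ((kk b c)%:C *: (q b * q c * rest b c)).[z].
have tC b c : t b c = t c b by rewrite /t kkC restC [q b * _]mulrC.
have t0 b c : b != a -> c != a -> t b c = 0.
  move=> ba ca'; rewrite /t hornerZ !hornerM /rest horner_prod.
  rewrite [\prod_(_ <- _ | _) _](_ : _ = 0) ?mulr0//.
  by apply/eqP; rewrite prodf_seq_eq0; apply/hasP; exists a => //=; rewrite ![a == _]eq_sym ba ca' pa.
have S0 : \sum_(b <- Phiv | b != a) t a b = 0.
  pose P := \prod_(c <- Phiv | c != a) (p c).[z].
  (* Up to the factor i, the cotangent of [b / 2] continued to [z]; it is invariant under the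
     reflection of [a] because [chi z a = 1]. *)
  pose g b := (chi z b + 1) / (chi z b - 1).
  have tE b : b \in Phiv -> b != a ->
      t a b = (k a)%:C * (q a).[z] * P * ((k b * dot a b)%:C * g b).
    move=> bP ba; rewrite /t hornerZ !hornerM /rest horner_prod /P.
    rewrite -[\prod_(c <- Phiv | c != a) _]big_filter.
    rewrite (bigD1_seq b)/= ?filter_uniq ?fset_uniq ?mem_filter ?ba// big_filter_cond.
    rewrite /g -pE// -qE//.
    have := pb b bP ba; set A := \prod_(_ <- _ | _) _.
    rewrite /kk !rmorphM/= => h; field; exact: h.
  rewrite big_seq_cond (eq_bigr (fun b => (k a)%:C * (q a).[z] * P * ((k b * dot a b)%:C * g b))); last first.
    by move=> b /andP[]; exact: tE.
  rewrite -big_seq_cond -mulr_sumr (_ : \sum_(b <- Phiv | _) _ = 0) ?mulr0//.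
  have := reflection_sum0 (g := g) (PhivP aP).
  move=> /(_ _) H.
  have {}H := H (fun b bP => congr1 (fun w => (w + 1) / (w - 1)) (chi_reflection z0 ca (PhivP aP) bP)).
  (* [dot a b] and [g b] both change sign with [b], so [F] is even and its sum over all roots is
     twice the one over [Phiv]. *)
  pose F b := if (b != a) && (b != - a) then (k b * dot a b)%:C * g b else 0.
  have FE b : b \in Phi -> F (- b) = F b.
    move=> bP; rewrite /F eqr_oppLR eqr_opp andbC; case: ifP => // _.
    rewrite kN// dotNr mulrN rmorphN mulNr -mulrN; congr (_ * _).
    rewrite /g chiN//; have cb0 : chi z b != 0 by rewrite mulf_neq0 ?expi_neq0 ?expfz_neq0.
    have [->|cb1] := eqVneq (chi z b) 1; first by rewrite invr1 subrr invr0 !mulr0 oppr0.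
    have cb2 : chi z b - 1 != 0 by rewrite subr_eq0.
    have cb3 : 1 - chi z b != 0 by rewrite subr_eq0 eq_sym.
    move: (chi z b) cb0 cb2 cb3 => c c0 c1 c2.
    have -> : c^-1 + 1 = c^-1 * (c + 1) by rewrite mulrDr mulVf// mulr1 addrC.
    have -> : c^-1 - 1 = c^-1 * (1 - c) by rewrite mulrBr mulVf// mulr1.
    by rewrite -mulf_div divff ?invr_neq0// mul1r -opprB invrN mulrN opprK.
  have Fs : \sum_(b <- Phiv) F b = 0.
    have := half_sum Hroot posv FE; rewrite /F -[X in X = _]big_mkcond H => /esym/eqP.
    by rewrite mulrn_eq0/= => /eqP.
  transitivity (\sum_(b <- Phiv) F b); last exact: Fs.
  rewrite big_mkcond; apply: eq_big_seq => b bP; rewrite /F.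
  rewrite (_ : b != - a) ?andbT//.
  by apply: contraTneq bP => ->; exact: (pos_rootN posv aP).
have -> : N.[z] = \sum_(a' <- Phiv) \sum_(b <- Phiv | b != a') t a' b.
  by rewrite /N horner_sum; apply: eq_bigr => b _; rewrite horner_sum.
rewrite (bigD1_seq a)//= ?fset_uniq// S0 add0r; apply/eqP.
transitivity (\sum_(b <- Phiv | b != a) t a b); last exact: S0.
apply: eq_bigr => b ba; rewrite -big_filter (bigD1_seq a)/= ?filter_uniq ?fset_uniq//; last first.
  by rewrite mem_filter eq_sym ba.
rewrite tC big_filter_cond big1 ?addr0// => c /andP[_ ca'].
exact: t0.
Qed.

(** [N] and [D] satisfy [poly_eq_scale], so [N = K D] with [K] read off at [z = 0]. Evaluation at
    [z = 1], which is the point [x] itself, gives the sum; the sign is [i^2]. *)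
Lemma cot_sum_line :
  \sum_(a <- Phiv) \sum_(b <- Phiv | b != a)
    k a * k b * dot a b * (cot (dot a x / 2) * cot (dot b x / 2)) =
  - \sum_(a <- Phiv) \sum_(b <- Phiv | b != a) k a * k b * dot a b.
Proof.
have sepD : separable_poly D.
  apply: separable_prod; first exact: fset_uniq.
    by move=> a aP; apply: separable_binomial => //; exact: mabs_gt0.
  move=> a b aP bP ab; apply/Pdiv.ClosedField.coprimepP => z ra.
  exact: (no_common aP bP ab ra).
have := poly_eq_scale sepD D0 size_N root_N.
rewrite N0 mulfK//; set K := \sum_(a <- _) _ => NE.
have D1 : D.[1] != 0.
  rewrite /D horner_prod prodf_seq_neq0; apply/allP => a aP /=.
  rewrite /p !hornerE expr1n mulr1 subr_eq0; apply/eqP => /expi_eq1 E.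
  by have := Hx1 aP; rewrite E eqxx.
apply: (@complexI R); apply: (mulIf D1).
have KE : K%:C * D.[1] = N.[1] by rewrite NE hornerZ.
rewrite rmorphN mulNr KE {NE} /N horner_sum -sumrN rmorph_sum mulr_suml.
rewrite big_seq [RHS]big_seq; apply: eq_bigr => a aP.
rewrite horner_sum -sumrN rmorph_sum mulr_suml.
rewrite big_seq_cond [RHS]big_seq_cond; apply: eq_bigr => b /andP[bP ba].
have cE c : c \in Phiv -> (cot (dot c x / 2))%:C * (p c).[1] = 'i * (q c).[1].
  move=> cP; rewrite /p /q !hornerE expr1n mulr1.
  by apply: cot_expi; rewrite -cos_neq1 Hx1.
rewrite (DE aP bP ba) hornerZ !hornerM -/(kk a b).
transitivity ((kk a b)%:C * ((cot (dot a x / 2))%:C * (p a).[1]) *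
   ((cot (dot b x / 2))%:C * (p b).[1]) * (rest a b).[1]).
  by rewrite !rmorphM/=; ring.
rewrite !cE//.
transitivity ('i ^+ 2 * ((kk a b)%:C * ((q a).[1] * (q b).[1] * (rest a b).[1])) : C).
  by ring.
by rewrite sqr_i mulN1r.
Qed.

End Line.

(** The factor 4 counts the signs of [a] and [b]. As the right side does not mention [Q], the double
    sum is the same for any two positive systems, here [Phip] and the one attached to the line. *)
Lemma pos_pair_sum (Q : {fset 'rV[R]_n}) (f : 'rV[R]_n -> 'rV[R]_n -> R) :
  positive_roots Phi Q ->
  {in Phi &, forall a b, f (- a) b = f a b} -> {in Phi &, forall a b, f a (- b) = f a b} ->
  (\sum_(a <- Q) \sum_(b <- Q | b != a) f a b) *+ 4 =
  \sum_(a <- Phi) \sum_(b <- Phi | (b != a) && (b != - a)) f a b.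
Proof.
move=> HQ f1 f2.
rewrite (half_sum Hroot HQ); last first.
  move=> a aP; rewrite big_seq_cond [RHS]big_seq_cond.
  apply: eq_big => [b|b /andP[bP _]]; last exact: f1.
  by rewrite opprK [_ && (b != a)]andbC.
rewrite -[4%N]/(2 * 2)%N mulrnA; congr (_ *+ 2).
rewrite -sumrMnl; apply: eq_big_seq => a aQ.
have aP := pos_root HQ aQ.
rewrite [RHS]big_mkcond (half_sum Hroot HQ); last first.
  move=> b bP; rewrite eqr_oppLR eqr_opp andbC f2//.
congr (_ *+ 2); rewrite big_mkcond; apply: eq_big_seq => b bQ.
rewrite [b != - a](_ : _ = true) ?andbT//.
by apply: contraTneq bQ => ->; exact: (pos_rootN HQ aQ).
Qed.

(* On a generic line in a direction of the coroot lattice, the sum is a rational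
   function of e^{it}.  Its simple poles cancel, the roots b and s_a b having
   opposite residues on the wall of a, so it is constant on the line. *)
Lemma cot_sum_const (mu : probability (torus Phi) R) : normalized_haar mu ->
  positive_roots Phi Phip ->
  exists c : R, \forall t \ae mu,
    \sum_(a <- Phip) \sum_(b <- Phip | b != a)
      k a * k b * dot a b * (cot (dot a (repr t) / 2) * cot (dot b (repr t) / 2)) = c.
Proof.
move=> Hhaar Hpos.
(* The direction [v] lies in the coroot lattice, so that all exponents [<a, v>] are integers, and is
   orthogonal to no root. *)
have [||b bP|v vL v0] := @regular_vector R n Phi (coroot_lattice Phi).
- exact: cl0.
- by move=> y z N yL zL; apply: clD => //; have := clZ N%:Z zL; rewrite pmulrn.
- exists (coroot b); first exact: cl_coroot.
  by rewrite dot_coroot ?pnatr_eq0//; exact: (root_neq0 Hroot).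
pose Q := [fset a in Phi | 0 < dot a v]%fset.
have QE a : (a \in Q) = (a \in Phi) && (0 < dot a v) by rewrite !inE.
have HQ : positive_roots Phi Q by exists v.
have vint a : a \in Phi -> dot a v \is a Num.int.
  by move=> aP; have [N ->] := wl_cl (root_wl Hroot aP) vL; exact: intr_int.
pose m a := Num.floor (dot a v).
pose K := \sum_(a <- Q) \sum_(b <- Q | b != a) k a * k b * dot a b.
exists (- K).
have W1 : \forall t \ae mu, forall a, a \in (Q : seq _) -> cos (dot a (repr t)) != 1.
  apply: near_seq => a aQ; have aP := pos_root HQ aQ.
  by apply: (wall_null Hhaar (root_wl Hroot aP)); exact: (root_neq0 Hroot).
(* Distinct positive roots are not parallel, so [m_b a - m_a b] is a nonzero weight and the points
   where its exponential is 1 form a null set. *)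
have W2 : \forall t \ae mu, forall a, a \in (Q : seq _) -> forall b, b \in (Q : seq _) -> a != b ->
    cos (dot (a *~ m b - b *~ m a) (repr t)) != 1.
  apply: near_seq => a aQ; apply: near_seq => b bQ.
  have aP := pos_root HQ aQ; have bP := pos_root HQ bQ.
  have [<-|ab] := eqVneq a b; first by apply: nearW.
  have : a *~ m b - b *~ m a != 0.
    apply: contra ab; rewrite subr_eq0 => /eqP E; apply/eqP/esym.
    apply: (pos_not_parallel Hroot HQ aQ bQ (c := (m b)%:~R / (m a)%:~R)).
    have ma : (m a)%:~R != 0 :> R by rewrite floorK ?vint// v0.
    by apply: (scalerI ma); rewrite scalerA mulrCA divff// mulr1 !scaler_int E.
  move=> /(wall_null Hhaar _) H.
  have : \forall t \ae mu, cos (dot (a *~ m b - b *~ m a) (repr t)) != 1.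
    by apply: H; apply: wlD; [|apply: wlN]; apply: wlZ; exact: (root_wl Hroot).
  by apply: filterS.
move: W1 W2; apply: filterS2 => t w1 w2.
rewrite -(@cot_sum_line v (repr t) Q)//; last by move=> a b aQ bQ ab; exact: w2.
pose f a b := k a * k b * dot a b * (cot (dot a (repr t) / 2) * cot (dot b (repr t) / 2)).
have f1 : {in Phi &, forall a b, f (- a) b = f a b}.
  by move=> a b aP bP; rewrite /f kN// !dotNl mulNr cotN; ring.
have f2 : {in Phi &, forall a b, f a (- b) = f a b}.
  by move=> a b aP bP; rewrite /f kN// !dotNl dotNr mulNr cotN; ring.
apply: (@mulIf R 4); first by rewrite pnatr_eq0.
by rewrite !mulr_natr (pos_pair_sum Hpos f1 f2) (pos_pair_sum HQ f1 f2).
Qed.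

End CotIdentity.

(** * Trigonometric polynomials *)

Section Rules.
Context {R : realType} {V : normedModType R}.
Implicit Types (f g : V -> R) (x v : V) (a b : R).

Lemma der_eq f g x v a b : is_derive x v f a -> f =1 g -> a = b -> is_derive x v g b.
Proof. by move=> df /funext <- <-. Qed.
Lemma derD f g x v a b : is_derive x v f a -> is_derive x v g b ->
  is_derive x v (fun y => f y + g y) (a + b).
Proof. by move=> df dg; exact: is_deriveD. Qed.
Lemma derB f g x v a b : is_derive x v f a -> is_derive x v g b ->
  is_derive x v (fun y => f y - g y) (a - b).
Proof. by move=> df dg; exact: is_deriveB. Qed.
Lemma derM f g x v a b : is_derive x v f a -> is_derive x v g b ->
  is_derive x v (fun y => f y * g y) (f x * b + g x * a).
Proof. by move=> df dg; exact: is_deriveM. Qed.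
Lemma derZ c f x v a : is_derive x v f a -> is_derive x v (fun y => c * f y) (c * a).
Proof. by move=> df; exact: (is_deriveZ c df). Qed.
End Rules.

Lemma derV {R : realType} (f : R -> R) (x v a : R) : f x != 0 -> is_derive x v f a ->
  is_derive x v (fun y => (f y)^-1) (- (f x ^- 2) * a).
Proof. by move=> f0 df; exact: (is_deriveV f0 df). Qed.

(** * Directional derivatives from partial derivatives *)

Section Partial.
Context {R : realType} {n : nat}.
Implicit Types (x v : 'rV[R]_n) (F : 'rV[R]_n -> R).
Local Notation e i := (delta_mx 0 i : 'rV[R]_n).

Lemma MVT_signed {V : normedModType R} (F G : V -> R) (x v : V) (r : R) :
  (forall y, is_derive y v F (G y)) ->
  exists2 s, `|s| <= `|r| & F (x + r *: v) - F x = r * G (x + s *: v).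
Proof.
move=> dF; have [r0|r0|->] := ltgtP r 0; last first.
- by exists 0; rewrite ?scale0r ?addr0 ?subrr ?mul0r.
- have [s /andP[s0 sr] E] := @MVT_line R V F G x v r r0 dF.
  by exists s => //; rewrite !gtr0_norm// ltW.
have r1 : 0 < - r by rewrite oppr_gt0.
have [s /andP[s0 sr] E] := @MVT_line R V F G (x + r *: v) v (- r) r1 dF.
exists (r + s).
  by rewrite ltr0_norm ?(ltr0_norm r0); lra.
by rewrite scaleNr addrK in E; rewrite scalerDl addrA -opprB E mulNr opprK.
Qed.

Lemma row_sum_delta v : v = \sum_i v 0 i *: e i.
Proof. by rewrite {1}[v]row_sum_delta. Qed.

(** The increment from [x] to [x + h v] is split along coordinate directions ([w h i] keeps the
    first [i] coordinates of [h v]); each piece is a partial derivative at a nearby point, and the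
    partial derivatives are continuous. *)
Lemma C1_directional F (G : 'I_n -> 'rV[R]_n -> R) x v :
  (forall i, continuous (G i)) -> (forall i y, is_derive y (e i) F (G i y)) ->
  is_derive x v F (\sum_i v 0 i * G i x).
Proof.
move=> cG dF.
pose w (h : R) (i : nat) := \sum_(j < n | (j < i)%N) (h * v 0 j) *: e j.
have wS (h : R) (i : 'I_n) : w h i.+1 = w h i + (h * v 0 i) *: e i.
  rewrite /w (bigD1 i)//= addrC; congr (_ + _); apply: eq_bigl => j.
  by rewrite ltnS leq_eqVlt -val_eqE/=; case: ltngtP.
have w0 h : w h 0 = 0 by rewrite /w big_pred0.
have wn h : w h n = h *: v.
  rewrite [v in RHS]row_sum_delta scaler_sumr /w; apply: eq_big => j; first by rewrite ltn_ord.
  by rewrite scalerA.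
pose M := \sum_j `|v 0 j| * `|e j|.
have wM h i : `|w h i| <= `|h| * M.
  rewrite (le_trans (ler_norm_sum _ _ _))// /M mulr_sumr big_mkcond; apply: ler_sum => j _.
  case: ifP => _; last by rewrite !mulr_ge0.
  by rewrite normrZ normrM mulrA.
have M0 : 0 <= M by apply: sumr_ge0 => j _; rewrite mulr_ge0.
have tele h : F (x + h *: v) - F x = \sum_(i < n) (F (x + w h i.+1) - F (x + w h i)).
  rewrite -wn -[in F x](addr0 x) -(w0 h).
  by rewrite -(big_mkord xpredT (fun i => F (x + w h i.+1) - F (x + w h i))) telescope_sumr.
have step h (i : 'I_n) : exists2 y, `|y - x| <= `|h| * (M + M) &
    F (x + w h i.+1) - F (x + w h i) = h * (v 0 i * G i y).
  have [s s1 E] := MVT_signed (x + w h i) (h * v 0 i) (dF i).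
  exists (x + w h i + s *: e i); last by rewrite wS addrA E mulrA.
  rewrite addrAC [x + w h i]addrC addrK (le_trans (ler_normD _ _))// mulrDr lerD//.
  rewrite normrZ (le_trans (ler_wpM2r _ s1))// normrM -mulrA ler_wpM2l//.
  by rewrite /M (bigD1 i)//= lerDl sumr_ge0// => j _; rewrite mulr_ge0.
have cv : h^-1 *: ((F \o shift x) (h *: v) - F x) @[h --> 0^'] --> \sum_i v 0 i * G i x.
  apply/cvgrPdist_le => eps eps0.
  pose S : R := \sum_i `|v 0 i| + 1.
  have S0 : 0 < S by rewrite ltr_pwDr// sumr_ge0.
  have nG : \forall y \near x, forall i, i \in index_enum 'I_n -> `|G i x - G i y| <= eps / S.
    apply: (@near_seq _ (nbhs x) _ _ _ (fun i y => `|G i x - G i y| <= eps / S)) => i _.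
    have /cvgrPdist_le := cG i x; apply; exact: divr_gt0.
  have [d /= d0 Hd] := (nbhs_ballP _ _).1 nG.
  exists (d / (M + M + 1)) => /=.
    by rewrite divr_gt0// ltr_wpDl// addr_ge0.
  move=> h /=; rewrite sub0r normrN => hd h0.
  have hMd : `|h| * (M + M) < d.
    rewrite ltr_pdivlMr in hd; last by rewrite ltr_wpDl// addr_ge0.
    by rewrite (le_lt_trans _ hd)// ler_wpM2l// lerDl.
  rewrite [h *: v + x]addrC tele scaler_sumr -sumrB (le_trans (ler_norm_sum _ _ _))//.
  apply: (@le_trans _ _ (\sum_i `|v 0 i| * (eps / S))).
    apply: ler_sum => i _.
    have [y yx ->] := step h i.
    have -> : h^-1 *: (h * (v 0 i * G i y)) = v 0 i * G i y.
      by rewrite [LHS]mulrA mulVf// mul1r.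
    rewrite -mulrBr normrM ler_wpM2l//.
    apply: Hd; last exact: mem_index_enum.
    by rewrite -ball_normE /ball_/= distrC (le_lt_trans yx).
  rewrite -mulr_suml mulrC -mulrA ger_pMr// ler_pdivrMl// mulr1 /S lerDl//.
by split; [apply/cvg_ex; eexists; exact: cv|rewrite /derive (cvg_lim _ cv)].
Qed.

End Partial.

(** * Frequencies, derivatives and divisibility by sin(a/2) *)

Section Trig.
Context {R : realType} {n : nat} (Phi : {fset 'rV[R]_n}).
Hypothesis Hroot : root_system Phi.
Implicit Types (a b l x v : 'rV[R]_n) (N : R).

(* The bound N on the square norms of the frequencies makes the space
   finite-dimensional. *)
Definition rtp N (f : 'rV[R]_n -> R) := exists s : seq ('rV[R]_n * (R * R)),
  (forall z, z \in s -> weight_lattice Phi z.1 /\ dot z.1 z.1 <= N) /\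
  forall x, f x = \sum_(z <- s) z.2.1 * cos (dot z.1 x + z.2.2).

Lemma rtp_eq N f g : f =1 g -> rtp N f -> rtp N g.
Proof. by move=> /funext ->. Qed.

Lemma rtp_cos l (c th : R) N : weight_lattice Phi l -> dot l l <= N ->
  rtp N (fun x => c * cos (dot l x + th)).
Proof.
move=> lP lN; exists [:: (l, (c, th))]; split=> [z|x]; last by rewrite big_seq1.
by rewrite inE => /eqP ->.
Qed.

Lemma rtp0 N : rtp N (fun=> 0).
Proof. by exists [::]; split => // x; rewrite big_nil. Qed.

Lemma rtpD N f g : rtp N f -> rtp N g -> rtp N (fun x => f x + g x).
Proof.
move=> [s [sP fE]] [t [tP gE]]; exists (s ++ t); split=> [z|x].
  by rewrite mem_cat => /orP[/sP|/tP].
by rewrite big_cat /= fE gE.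
Qed.

Lemma rtpZ N (c : R) f : rtp N f -> rtp N (fun x => c * f x).
Proof.
move=> [s [sP fE]]; exists [seq (z.1, (c * z.2.1, z.2.2)) | z <- s]; split=> [z|x].
  by move=> /mapP[y /sP yP ->].
by rewrite fE mulr_sumr big_map; apply: eq_bigr => z _; rewrite mulrA.
Qed.

Lemma rtp_sum N (I : eqType) (r : seq I) (P : pred I) (F : I -> 'rV[R]_n -> R) :
  (forall i, i \in r -> P i -> rtp N (F i)) -> rtp N (fun x => \sum_(i <- r | P i) F i x).
Proof.
elim: r => [_|i r IH H].
  by apply: rtp_eq (rtp0 N) => x; rewrite big_nil.
have IH' : rtp N (fun x => \sum_(j <- r | P j) F j x).
  by apply: IH => j jr; apply: H; rewrite in_cons jr orbT.
case Pi : (P i); last by apply: rtp_eq IH' => x; rewrite big_cons Pi.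
apply: rtp_eq (rtpD (H i (mem_head _ _) Pi) IH') => x.
by rewrite big_cons Pi.
Qed.

Lemma rtp_le N M f : N <= M -> rtp N f -> rtp M f.
Proof.
move=> NM [s [sP fE]]; exists s; split => // z /sP[zP zN]; split => //.
exact: le_trans NM.
Qed.

Lemma rtp_periodic N f : rtp N f -> cl_periodic Phi f.
Proof.
move=> [s [sP fE]] x q qP; rewrite !fE; apply: eq_big_seq => z /sP[zP _].
by rewrite (cos_dot_periodic _ zP _ qP).
Qed.

Lemma rtp_cont N f : rtp N f -> continuous f.
Proof.
move=> [s [sP /funext ->]]; apply: cont_sum => z _; apply: contZ; exact: cont_cos_dot.
Qed.

Lemma is_derive_dot l x v : is_derive x v (dot l) (dot l v).
Proof.
have cv : h^-1 *: ((dot l \o shift x) (h *: v) - dot l x) @[h --> (0:R)^'] --> dot l v.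
  apply: cvg_near_cst; near=> h => /=.
  have h0 : h != 0 by near: h; exact: nbhs_dnbhs_neq.
  by rewrite dotDr addrK dotZr [_ *: _]mulrA mulVf// mul1r.
by split; [apply/cvg_ex; eexists; exact: cv|rewrite /derive (cvg_lim _ cv)].
Unshelve. all: by end_near. Qed.

Lemma is_derive_ldot (g : R -> R) d l x v th : is_derive (dot l x + th) (1 : R) g d ->
  is_derive x v (fun y => g (dot l y + th)) (d * dot l v).
Proof.
move=> dg; apply: (@is_derive_chain R _ g (fun y => dot l y + th)) => //.
have := is_deriveD (is_derive_dot l x v) (is_derive_cst th x v).
by rewrite addr0; apply.
Qed.

Lemma is_derive_sum (I : Type) (r : seq I) (F : I -> 'rV[R]_n -> R) (d : I -> R) x v :
  (forall i, is_derive x v (F i) (d i)) ->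
  is_derive x v (fun y => \sum_(i <- r) F i y) (\sum_(i <- r) d i).
Proof.
move=> dF; elim: r => [|i r IH].
  by under eq_fun do rewrite big_nil; rewrite big_nil; exact: is_derive_cst.
by under eq_fun do rewrite big_cons; rewrite big_cons; exact: is_deriveD.
Qed.

Lemma is_derive_uniq f x v (d1 d2 : R) : is_derive x v f d1 -> is_derive x v f d2 -> d1 = d2.
Proof. by case=> _ <- [_ <-]. Qed.

Lemma is_derive_scale (c : R) f x v d : is_derive x v f d ->
  is_derive x v (fun y => c * f y) (c * d).
Proof. by move=> df; apply: (is_deriveZ c). Qed.

(** Differentiation shifts each phase by [pi / 2] and rescales the amplitude; the frequencies, hence
    the bound [N], are unchanged. *)
Lemma rtp_derive N f v : rtp N f ->
  exists2 g, rtp N g & forall x, is_derive x v f (g x).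
Proof.
move=> [s [sP fE]].
exists (fun x => \sum_(z <- s) (z.2.1 * dot z.1 v) * cos (dot z.1 x + (z.2.2 + pi / 2))).
  by apply: rtp_sum => z /sP[zP zN] _; exact: rtp_cos.
move=> x; rewrite (_ : f = fun x => \sum_(z <- s) z.2.1 * cos (dot z.1 x + z.2.2)); last exact/funext.
apply: is_derive_sum => z.
rewrite addrA cosDpihalf (_ : _ * _ = z.2.1 * (- sin (dot z.1 x + z.2.2) * dot z.1 v)); last by ring.
by apply: is_derive_scale; exact: is_derive_ldot.
Qed.

Lemma rtp_weyl N f w : weyl Phi w -> rtp N f -> rtp N (fun x => f (x *m w)).
Proof.
move=> W [s [sP fE]]; have [w' W' [e1 e2]] := weyl_inv Hroot W.
exists [seq (z.1 *m w', z.2) | z <- s]; split=> [z /mapP[y /sP[yP yN] ->]|x] /=.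
  by split; [exact: weyl_wl|rewrite (weyl_dot Hroot)].
rewrite fE big_map; apply: eq_bigr => z _ /=.
by rewrite (dot_weyl_inv Hroot _ _ W e2).
Qed.

Lemma dot_reflection_root a l : a != 0 -> dot (reflection a l) a = - dot l a.
Proof.
by rewrite -dot_eq0 => aa; rewrite reflectionE dotBl dotZl /coroot dotZr; field.
Qed.

(** Sum over [j < m] of the case [m = 1], which is the half angle formula [H1]. It exhibits the
    factor [sin(y/2)] explicitly. *)
Lemma sin_telescope (x y : R) m :
  (sin x - sin (x - m%:R * y)) * cos (y / 2) =
  sin (y / 2) * \sum_(j < m) (cos (x - j%:R * y) + cos (x - j.+1%:R * y)).
Proof.
have H1 z : (sin z - sin (z - y)) * cos (y / 2) = sin (y / 2) * (cos z + cos (z - y)).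
  rewrite sinB cosB (cos_half y) (sin_half y).
  have := cos2Dsin2 (y / 2); set c := cos (y / 2); set s := sin (y / 2) => E.
  have Ec : c * c = 1 - s * s by move: E; rewrite !expr2 => <-; rewrite addrK.
  transitivity (sin z * 2 * s ^+ 2 * c + cos z * 2 * s * (c * c)); first by ring.
  by rewrite Ec; ring.
elim: m => [|m IH].
  by rewrite mul0r subr0 subrr mul0r big_ord0 mulr0.
rewrite big_ord_recr/= mulrDr -IH.
have -> : x - m.+1%:R * y = (x - m%:R * y) - y by rewrite -natr1; ring.
by rewrite -H1; ring.
Qed.

(** If [<l, coroot a>] is a natural number [m], then [reflection a l = l - m a], and telescoping
    produces the frequencies [l - j a] with [0 <= j <= m], which lie on the segment from [l] to its
    reflection and so are no longer than [l]. *)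
Lemma reflection_term a l (th : R) : a \in Phi -> weight_lattice Phi l ->
  exists2 g, rtp (dot l l) g & forall x,
    sin (dot a x / 2) * g x = cos (dot a x / 2) * (dot l a *
      (sin (dot l x + th) - sin (dot (reflection a l) x + th))).
Proof.
move=> aP; have a0 := root_neq0 Hroot aP.
(* A negative pairing is reduced to a positive one by exchanging [l] with its reflection: both sign
   changes compensate and the length is the same. *)
suff H l' (m : nat) : weight_lattice Phi l' -> dot l' (coroot a) = m%:R ->
    exists2 g, rtp (dot l' l') g & forall x,
    sin (dot a x / 2) * g x = cos (dot a x / 2) * (dot l' a *
      (sin (dot l' x + th) - sin (dot (reflection a l') x + th))).
  move=> lP; have /int_intr[[m|m] mE] := lP a aP; first exact: (H l m).
  pose l' := reflection a l.
  have l'E : l' = l *m reflection_mx a by rewrite mul_reflection_mx.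
  have W := weyl_refl1 aP.
  have ra : a *m reflection_mx a = - a by rewrite mul_reflection_mx reflection_self.
  have l'l : reflection a l' = l by rewrite -mul_reflection_mx l'E -mulmxA reflection_mx2// mulmx1.
  have l'a : dot l' a = - dot l a.
    exact: dot_reflection_root.
  have [||g gN gE] := H l' m.+1.
  - by rewrite l'E; exact: weyl_wl.
  - by rewrite /coroot dotZr l'a mulrN -dotZr mE NegzE mulrNz opprK.
  exists g; first by move: gN; rewrite l'E (weyl_dot Hroot _ _ W).
  by move=> x; rewrite gE l'l l'a; ring.
move=> lP mE.
have aa : dot a a != 0 by rewrite dot_eq0.
have la : dot l' a = m%:R * dot a a / 2.
  by rewrite -mE /coroot dotZr; field.
have rE x : dot (reflection a l') x = dot l' x - m%:R * dot a x.
  by rewrite reflectionE mE dotBl dotZl.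
have wl j : weight_lattice Phi (l' - j%:R *: a).
  by apply: wlD => //; apply: wlN; rewrite scaler_nat pmulrn; apply: wlZ; exact: root_wl.
(* The difference of square lengths is [|a|^2 j (m - j)]. *)
have nl j : (j <= m)%N -> dot (l' - j%:R *: a) (l' - j%:R *: a) <= dot l' l'.
  move=> jm; rewrite !(dotBl, dotBr, dotZl, dotZr) [dot a l']dotC la -subr_ge0.
  rewrite (_ : _ - _ = dot a a * (j%:R * (m%:R - j%:R))); last by field.
  by rewrite mulr_ge0 ?dot_ge0// mulr_ge0// subr_ge0 ler_nat.
exists (fun x => \sum_(j < m) (dot l' a * cos (dot (l' - j%:R *: a) x + th) +
    dot l' a * cos (dot (l' - j.+1%:R *: a) x + th))).
  apply: rtp_sum => j _ _; apply: rtpD; apply: rtp_cos => //; apply: nl => //.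
  exact: ltnW.
move=> x; rewrite rE.
have := sin_telescope (dot l' x + th) (dot a x) m.
rewrite (_ : dot l' x + th - m%:R * dot a x = dot l' x - m%:R * dot a x + th); last by ring.
move=> E; rewrite mulrCA [cos _ * _]mulrC E mulrCA; congr (_ * _).
rewrite mulr_sumr; apply: eq_bigr => j _.
rewrite mulrDr !dotBl !dotZl; congr (_ * cos _ + _ * cos _); ring.
Qed.

(* For an s_a-invariant f, the derivative along a is divisible by sin(a/2). *)
Lemma rtp_cot_derive N f fa a : a \in Phi -> rtp N f -> (forall x, f (reflection a x) = f x) ->
  (forall x, is_derive x a f (fa x)) ->
  exists2 g, rtp N g & forall x,
    sin (dot a x / 2) * g x = cos (dot a x / 2) * fa x.
Proof.
move=> aP [s [sP fE]] fr dfa.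
have a0 := root_neq0 Hroot aP.
have W := weyl_refl1 aP.
have H z : z \in s -> exists2 g, rtp N g & forall x,
    sin (dot a x / 2) * g x = cos (dot a x / 2) * (dot z.1 a *
      (sin (dot z.1 x + z.2.2) - sin (dot (reflection a z.1) x + z.2.2))).
  move=> /sP[zP zN]; have [g gN gE] := reflection_term z.2.2 aP zP.
  by exists g => //; exact: rtp_le gN.
(* Writing [f] as the mean of [f] and its reflection pairs each frequency with its reflected one,
   the shape handled by [reflection_term]. *)
have faE x : fa x = - (2^-1) * \sum_(z <- s) z.2.1 * (dot z.1 a *
      (sin (dot z.1 x + z.2.2) - sin (dot (reflection a z.1) x + z.2.2))).
  apply: (is_derive_uniq (dfa x)).
  have -> : f = fun y => \sum_(z <- s) (z.2.1 / 2) *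
      (cos (dot z.1 y + z.2.2) + cos (dot (reflection a z.1) y + z.2.2)).
    apply/funext => y; have -> : f y = 2^-1 * f y + 2^-1 * f (reflection a y).
      by rewrite fr -mulrDl [_ + _](_ : _ = 1) ?mul1r//; lra.
    rewrite !fE !mulr_sumr -big_split/=; apply: eq_bigr => z _.
    rewrite -!mul_reflection_mx (dot_weyl_inv Hroot _ _ W (reflection_mx2 a0)).
    by ring.
  rewrite mulr_sumr; apply: is_derive_sum => z.
  rewrite [X in is_derive _ _ _ X](_ : _ = z.2.1 / 2 * (- sin (dot z.1 x + z.2.2) * dot z.1 a
     + - sin (dot (reflection a z.1) x + z.2.2) * dot (reflection a z.1) a)).
    by apply: is_derive_scale; apply: is_deriveD; exact: is_derive_ldot.
  by rewrite dot_reflection_root//; field.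
have [G GN GE] : exists2 G, rtp N G & forall x, sin (dot a x / 2) * G x =
    cos (dot a x / 2) * \sum_(z <- s) z.2.1 * (dot z.1 a *
      (sin (dot z.1 x + z.2.2) - sin (dot (reflection a z.1) x + z.2.2))).
  elim: s H {sP fE faE} => [_|z s IH H].
    by exists (fun=> 0); [exact: rtp0|move=> x; rewrite big_nil !mulr0].
  have [|G GN GE] := IH; first by move=> y ys; apply: H; rewrite in_cons ys orbT.
  have [g gN gE] := H z (mem_head _ _).
  exists (fun x => z.2.1 * g x + G x); first by apply: rtpD => //; exact: rtpZ.
  by move=> x; rewrite big_cons mulrDr GE mulrCA gE; ring.
exists (fun x => - 2^-1 * G x); first exact: rtpZ.
by move=> x; rewrite faE mulrCA GE mulrCA.
Qed.

End Trig.

(** * Regularized ground state and symmetry *)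

Section SinSquare.
Context {R : realType}.
Implicit Types y : R.

(* sin^2 (y/2), written so that its periodicity and derivative are immediate *)
Definition sg y : R := (1 - cos y) / 2.

Lemma sgE y : sg y = sin (y / 2) ^+ 2.
Proof. by rewrite /sg cos_half; field. Qed.

Lemma sg_ge0 y : 0 <= sg y. Proof. by rewrite sgE sqr_ge0. Qed.

Lemma sg_le1 y : sg y <= 1.
Proof. by rewrite sgE -[leRHS](cos2Dsin2 (y / 2)) lerDr sqr_ge0. Qed.

Lemma sin_sqr_sg y : (sin y / 2) ^+ 2 = sg y * (1 - sg y).
Proof.
have E := cos2Dsin2 y; have -> : (sin y / 2) ^+ 2 = (sin y ^+ 2) / 4 by field.
have -> : sin y ^+ 2 = 1 - cos y ^+ 2 by rewrite -E addrC addKr.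
by rewrite /sg; field.
Qed.

Lemma sg_periodic_eq y z : cos y = cos z -> sg y = sg z.
Proof. by rewrite /sg => ->. Qed.

Lemma is_derive_sg y : is_derive y (1 : R) sg (sin y / 2).
Proof.
apply: (der_eq (derZ 2^-1 (derB (is_derive_cst (1 : R) y 1) (is_derive_cos y)))).
  by move=> z; rewrite /sg mulrC.
by rewrite sub0r opprK mulrC.
Qed.

Section Eps.
Variable e : R.
Hypothesis e0 : 0 < e.

Lemma sge_gt0 y : 0 < sg y + e. Proof. by rewrite ltr_wpDl// sg_ge0. Qed.
Let ne y : sg y + e != 0. Proof. by rewrite gt_eqF// sge_gt0. Qed.

Lemma is_derive_sge y : is_derive y (1 : R) (fun z => sg z + e) (sin y / 2).
Proof. by have := is_deriveD (is_derive_sg y) (is_derive_cst e y 1); rewrite addr0. Qed.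

(** A smooth substitute for [2 ln |sin(y/2)|]. As [e] tends to 0, [lns1] and [lns2], its
    derivatives, tend to [cot(y/2)] and [- 1 / (2 sin^2(y/2))] off the zeros of [sg]. *)
Definition lns y := ln (sg y + e).
Definition lns1 y := (sin y / 2) / (sg y + e).
Definition lns2 y := ((cos y / 2) * (sg y + e) - (sin y / 2) ^+ 2) / (sg y + e) ^+ 2.

Lemma is_derive_lns y : is_derive y (1 : R) lns (lns1 y).
Proof.
rewrite /lns1 mulrC; apply: (@is_derive_chain R _ (@ln R) (fun z => sg z + e)).
  exact: is_derive_sge.
exact: is_derive1_ln (sge_gt0 y).
Qed.

Lemma is_derive_lns1 y : is_derive y (1 : R) lns1 (lns2 y).
Proof.
have D := derM (derZ 2^-1 (is_derive_sin y)) (@derV R (fun z => sg z + e) y 1 _ (ne y) (is_derive_sge y)).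
apply: (@der_eq R R _ lns1 y 1 _ (lns2 y) D).
  by move=> z; rewrite /lns1 [2^-1 * _]mulrC.
by rewrite /lns2; field; exact: ne.
Qed.

Lemma cont_sg : continuous sg.
Proof.
rewrite /sg => y; apply: (@contM R R (fun y => 1 - cos y) (fun=> 2^-1)); last exact: cont_cst.
by apply: contB; [exact: cont_cst|exact: continuous_cos].
Qed.

Lemma cont_sge : continuous (fun y => sg y + e).
Proof. by apply: contD; [exact: cont_sg|exact: cont_cst]. Qed.

Lemma cont_lns : continuous lns.
Proof.
move=> y; apply: (@continuous_comp R R R (fun z => sg z + e)); first exact: cont_sge.
by apply: continuous_ln; exact: sge_gt0.
Qed.

Let cont_s2 : continuous (fun y : R => sin y / 2).
Proof. by apply: contM; [exact: continuous_sin|exact: cont_cst]. Qed.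

Lemma cont_lns1 : continuous lns1.
Proof. by apply: contM => //; apply: contV => //; exact: cont_sge. Qed.

Lemma cont_lns2 : continuous lns2.
Proof.
apply: contM; last first.
  apply: contV; first by move=> y; rewrite expf_eq0/= (negPf (ne y)).
  by apply: contX; exact: cont_sge.
apply: contB; last by apply: contX.
apply: contM; last exact: cont_sge.
by apply: contM; [exact: continuous_cos|exact: cont_cst].
Qed.

Lemma lns1_sqr y : lns1 y ^+ 2 <= sg y / (sg y + e) ^+ 2.
Proof.
rewrite /lns1 expr_div_n sin_sqr_sg ler_wpM2r// ?invr_ge0 ?sqr_ge0//.
by rewrite ler_piMr ?sg_ge0// gerBl sg_ge0.
Qed.

Lemma sg_lns1_sqr y : sg y * lns1 y ^+ 2 <= 1.
Proof.
apply: (le_trans (ler_wpM2l (sg_ge0 y) (lns1_sqr y))).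
rewrite mulrA -expr2 -expr_div_n expr_le1// ?divr_ge0 ?sg_ge0 ?(ltW (sge_gt0 _))//.
by rewrite ler_pdivrMr ?sge_gt0// mul1r lerDl ltW.
Qed.

Lemma sg_lns2 y : sg y * `|lns2 y| <= 2.
Proof.
rewrite /lns2 normrM normfV [X in _ / X]ger0_norm ?sqr_ge0//.
have s0 := sg_ge0 y; have s1 := sg_le1 y; have w0 := sge_gt0 y.
have : `|cos y / 2 * (sg y + e) - (sin y / 2) ^+ 2| <= 2 * (sg y + e).
  have -> : 2 * (sg y + e) = (sg y + e) + (sg y + e) by ring.
  rewrite (le_trans (ler_normB _ _))// lerD//.
    rewrite normrM (gtr0_norm w0) ler_piMl ?(ltW w0)// normrM.
    have c1 : `|cos y| <= 1 by exact: cos_max.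
    by rewrite mulr_ile1// ger0_norm ?invr_ge0// invf_le1// ler1n.
  rewrite ger0_norm ?sqr_ge0// sin_sqr_sg (le_trans (y := sg y))//; last by rewrite lerDl ltW.
  by rewrite ler_piMr// gerBl.
move=> H; rewrite mulrA ler_pdivrMr ?exprn_gt0//.
apply: (le_trans (ler_wpM2l s0 H)).
by rewrite expr2 mulrCA ler_wpM2l// ler_wpM2r// ?(ltW w0)// lerDl (ltW e0).
Qed.

End Eps.

Lemma sg_eq0 y : (sg y == 0) = (cos y == 1).
Proof. by rewrite /sg mulf_eq0 invr_eq0 pnatr_eq0 orbF subr_eq0 eq_sym. Qed.

End SinSquare.

(** * Second order data and Green's formula *)

Section Jets.
Context {R : realType} {n : nat} (Phi : {fset 'rV[R]_n}) (mu : probability (torus Phi) R).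
Hypothesis Hroot : root_system Phi.
Hypothesis Hhaar : normalized_haar mu.
Implicit Types (a b l x v : 'rV[R]_n) (F : 'rV[R]_n -> R).
Local Notation e i := (delta_mx 0 i : 'rV[R]_n).
Local Notation T := (torus Phi).
Local Notation Int f := (\int[mu]_(t in setT) f t)%R.
Local Notation IT F := (\int[mu]_(t in setT) F (repr t))%R.

(** Only the pure second derivatives are recorded, being all that the Laplacian needs; explicit
    derivatives make products and compositions computable. *)
Definition jet F (G H : 'I_n -> 'rV[R]_n -> R) :=
  [/\ continuous F, forall i, continuous (G i), forall i, continuous (H i) &
   forall i x, is_derive x (e i) F (G i x) /\ is_derive x (e i) (G i) (H i x)].

Lemma jetM F G H F' G' H' : jet F G H -> jet F' G' H' ->
  jet (fun x => F x * F' x) (fun i x => F x * G' i x + F' x * G i x)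
      (fun i x => F x * H' i x + F' x * H i x + 2 * G i x * G' i x).
Proof.
move=> [cF cG cH dF] [cF' cG' cH' dF']; split.
- exact: contM.
- by move=> i; apply: contD; apply: contM.
- by move=> i; apply: contD; [apply: contD; apply: contM|apply: contM => //; apply: contM => //; exact: cont_cst].
move=> i x; have [d1 d2] := dF i x; have [d1' d2'] := dF' i x.
split; first exact: (is_deriveM d1 d1').
by apply: (der_eq (derD (derM d1 d2') (derM d1' d2))) => //; ring.
Qed.

Lemma jet_comp (g g1 g2 : R -> R) F G H : jet F G H ->
  continuous g -> continuous g1 -> continuous g2 ->
  (forall y, is_derive y (1:R) g (g1 y)) -> (forall y, is_derive y (1:R) g1 (g2 y)) ->
  jet (fun x => g (F x)) (fun i x => g1 (F x) * G i x)
    (fun i x => g1 (F x) * H i x + G i x * (g2 (F x) * G i x)).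
Proof.
move=> [cF cG cH dF] cg cg1 cg2 dg dg1; split.
- exact: cont_comp.
- by move=> i; apply: contM => //; exact: cont_comp.
- by move=> i; apply: contD; apply: contM => //; [exact: cont_comp|apply: contM => //; exact: cont_comp].
move=> i x; have [d1 d2] := dF i x; split; first exact: is_derive_chain.
exact: is_deriveM (is_derive_chain d1 (dg1 (F x))) d2.
Qed.

Lemma jet_dot a : jet (dot a) (fun i _ => a 0 i) (fun _ _ => 0).
Proof.
split; [exact: continuous_dot|by move=> i; exact: cont_cst|by move=> i; exact: cont_cst|].
move=> i x; split; last exact: is_derive_cst.
by have := is_derive_dot a x (e i); rewrite dot_delta.
Qed.

Lemma jet_sum (I : Type) (r : seq I) (F : I -> 'rV[R]_n -> R) G H :
  (forall j, jet (F j) (G j) (H j)) ->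
  jet (fun x => \sum_(j <- r) F j x) (fun i x => \sum_(j <- r) G j i x)
      (fun i x => \sum_(j <- r) H j i x).
Proof.
move=> J; split.
- by apply: cont_sum => j _; case: (J j).
- by move=> i; apply: cont_sum => j _; case: (J j).
- by move=> i; apply: cont_sum => j _; case: (J j).
by move=> i x; split; apply: is_derive_sum => j; have [_ _ _ /(_ i x) []] := J j.
Qed.

Lemma jetZ (c : R) F G H : jet F G H ->
  jet (fun x => c * F x) (fun i x => c * G i x) (fun i x => c * H i x).
Proof.
move=> [cF cG cH dF]; split.
- exact: contZ.
- by move=> i; exact: contZ.
- by move=> i; exact: contZ.
by move=> i x; have [d1 d2] := dF i x; split; exact: is_derive_scale.
Qed.

Lemma jet_eq F F' G G' H H' : F =1 F' -> (forall i, G i =1 G' i) -> (forall i, H i =1 H' i) ->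
  jet F G H -> jet F' G' H'.
Proof.
move=> /funext <- EG EH; have -> : G' = G by apply/funext => i; apply/funext => x; rewrite EG.
by have -> : H' = H by apply/funext => i; apply/funext => x; rewrite EH.
Qed.

Lemma rtp_jet N (f : 'rV[R]_n -> R) : rtp Phi N f -> exists G H, [/\ jet f G H,
  forall i, rtp Phi N (G i) & forall i, rtp Phi N (H i)].
Proof.
move=> fN.
have /choice[G HG] : forall i, exists g, rtp Phi N g /\ forall x, is_derive x (e i) f (g x).
  by move=> i; have [g gN gd] := rtp_derive (e i) fN; exists g.
have /choice[H HH] : forall i, exists g, rtp Phi N g /\ forall x, is_derive x (e i) (G i) (g x).
  by move=> i; have [g gN gd] := rtp_derive (e i) (HG i).1; exists g.
exists G, H; split; [|by move=> i; case: (HG i)|by move=> i; case: (HH i)].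
split; first exact: rtp_cont fN.
- by move=> i; exact: rtp_cont (HG i).1.
- by move=> i; exact: rtp_cont (HH i).1.
by move=> i x; split; [exact: (HG i).2|exact: (HH i).2].
Qed.

Lemma Int_sum (I : Type) (r : seq I) (F : I -> T -> R) : (forall i, bm (F i)) ->
  Int (fun t => \sum_(i <- r) F i t) = \sum_(i <- r) Int (F i).
Proof.
move=> bF; elim: r => [|i r IH].
  by rewrite big_nil; under eq_Rintegral do rewrite big_nil; rewrite Int_cst.
rewrite big_cons -IH -IntD; [|exact: bm_intg|by apply: bm_intg; exact: bm_sum].
by apply: eq_Rintegral => t _; rewrite big_cons.
Qed.

(** The integrand is the divergence of [F grad F' - F' grad F], and each component of the divergence
    has integral 0 by [IT_derive]. *)
Lemma green F G H F' G' H' : cl_periodic Phi F -> cl_periodic Phi F' ->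
  jet F G H -> jet F' G' H' ->
  bm (fun t : T => F (repr t) * (\sum_i H' i (repr t)) - F' (repr t) * (\sum_i H i (repr t))) /\
  IT (fun x => F x * (\sum_i H' i x) - F' x * (\sum_i H i x)) = 0.
Proof.
move=> pF pF' [cF cG cH dF] [cF' cG' cH' dF'].
have pG i : cl_periodic Phi (G i) by have [] := IT_derive Hroot Hhaar pF cF (cG i) (fun x => (dF i x).1).
have pG' i : cl_periodic Phi (G' i) by have [] := IT_derive Hroot Hhaar pF' cF' (cG' i) (fun x => (dF' i x).1).
have X i : cl_periodic Phi (fun x => F x * H' i x - F' x * H i x) /\
    IT (fun x => F x * H' i x - F' x * H i x) = 0.
  apply: (IT_derive Hroot Hhaar (F := fun x => F x * G' i x - F' x * G i x) (v := e i)).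
  - by move=> x q qP; rewrite pF// pF'// pG// pG'.
  - by apply: contB; apply: contM.
  - by apply: contB; apply: contM.
  move=> x; have [d1 d2] := dF i x; have [d1' d2'] := dF' i x.
  by apply: (der_eq (derB (derM d1 d2') (derM d1' d2))) => //; ring.
have bX i : bm (fun t : T => F (repr t) * H' i (repr t) - F' (repr t) * H i (repr t)).
  by apply: (periodic_bm Hroot) (X i).1; apply: contB; apply: contM.
rewrite (_ : (fun t : T => _) =
    (fun t : T => \sum_i (F (repr t) * H' i (repr t) - F' (repr t) * H i (repr t)))).
  split; first by apply: bm_sum.
  rewrite Int_sum// big1// => i _; exact: (X i).2.
by apply/funext => t; rewrite !mulr_sumr -sumrB.
Qed.

End Jets.

Section UniformlyBounded.
Context {R : realType} {V : Type}.
Implicit Types F G : nat -> V -> R.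

(** The index is that of the regularization parameter [1 / (m + 1)]; bounded convergence requires a
    bound independent of it. *)
Definition ubd F := exists M : R, forall m x, `|F m x| <= M.

Lemma ubdD F G : ubd F -> ubd G -> ubd (fun m x => F m x + G m x).
Proof.
move=> [M FM] [N GN]; exists (M + N) => m x.
by rewrite (le_trans (ler_normD _ _))// lerD.
Qed.
Lemma ubdM F G : ubd F -> ubd G -> ubd (fun m x => F m x * G m x).
Proof. by move=> [M FM] [N GN]; exists (M * N) => m x; rewrite normrM ler_pM. Qed.
Lemma ubd_bounded (f : V -> R) : (exists M : R, forall x, `|f x| <= M) -> ubd (fun _ x => f x).
Proof. by move=> [M fM]; exists M. Qed.
Lemma ubd_cst (c : R) : ubd (fun _ _ => c).
Proof. by exists `|c|. Qed.
Lemma ubd_sum (I : eqType) (r : seq I) (F : I -> nat -> V -> R) :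
  (forall i, i \in r -> ubd (F i)) -> ubd (fun m x => \sum_(i <- r) F i m x).
Proof.
elim: r => [_|i r IH H].
  by exists 0 => m x; rewrite big_nil normr0.
have [M FM] := H i (mem_head _ _).
have [|N GN] := IH; first by move=> j jr; apply: H; rewrite in_cons jr orbT.
exists (M + N) => m x; rewrite big_cons.
by rewrite (le_trans (ler_normD _ _))// lerD.
Qed.
Lemma ubdN F : ubd F -> ubd (fun m x => - F m x).
Proof. by move=> [M FM]; exists M => m x; rewrite normrN. Qed.
Lemma ubdB F G : ubd F -> ubd G -> ubd (fun m x => F m x - G m x).
Proof. by move=> bF bG; apply: ubdD => //; exact: ubdN. Qed.
End UniformlyBounded.

Lemma cvg_bigsum {R : realType} {V : Type} {F : set_system V} {FF : Filter F} (I : eqType)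
  (r : seq I) (u : I -> V -> R) (l : I -> R) :
  (forall i, i \in r -> u i m @[m --> F] --> l i) ->
  \sum_(i <- r) u i m @[m --> F] --> \sum_(i <- r) l i.
Proof.
elim: r => [_|i r IH H].
  by rewrite big_nil; under eq_fun do rewrite big_nil; exact: cvg_cst.
under eq_fun do rewrite big_cons; rewrite big_cons.
apply: cvgD; first by apply: H; exact: mem_head.
by apply: IH => j jr; apply: H; rewrite in_cons jr orbT.
Qed.

Section LnsLimit.
Context {R : realType}.
Local Notation ep m := (m.+1%:R^-1 : R).

Lemma ep_gt0 m : 0 < ep m. Proof. by rewrite invr_gt0. Qed.

Lemma ep_le1 m : ep m <= 1. Proof. by rewrite invf_le1// ler1n. Qed.

Let cvg_sge (y : R) : sg y + ep m @[m --> \oo] --> sg y.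
Proof. by rewrite -[X in _ --> X]addr0; apply: cvgD; [exact: cvg_cst|exact: cvg_harmonic]. Qed.

Lemma cvg_lns (y : R) : sg y != 0 -> lns (ep m) y @[m --> \oo] --> ln (sg y).
Proof.
move=> s0; apply: (@cvg_comp _ _ _ (fun m => sg y + ep m) (@ln R)); first exact: cvg_sge.
by apply: continuous_ln; rewrite lt_def s0 sg_ge0.
Qed.

Lemma cvg_lns1 (y : R) : sg y != 0 -> lns1 (ep m) y @[m --> \oo] --> cot (y / 2).
Proof.
move=> s0; rewrite (_ : cot (y / 2) = (sin y / 2) / sg y); last first.
  move: s0; rewrite sgE sqrf_eq0 => s0; rewrite /cot (sin_half y).
  by field.
by apply: cvgM; [exact: cvg_cst|apply: cvgV => //; exact: cvg_sge].
Qed.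

Lemma cvg_lns2 (y : R) : sg y != 0 -> lns2 (ep m) y @[m --> \oo] --> - (2 * sg y)^-1.
Proof.
move=> s0; rewrite (_ : - _ = ((cos y / 2) * sg y - (sin y / 2) ^+ 2) / (sg y) ^+ 2); last first.
  rewrite sin_sqr_sg (_ : cos y = 1 - 2 * sg y); last by rewrite /sg; field.
  by field.
apply: cvgM; first apply: cvgB.
- by apply: cvgM; [exact: cvg_cst|exact: cvg_sge].
- exact: cvg_cst.
by apply: cvgV; [rewrite expf_neq0|rewrite expr2; under eq_fun do rewrite expr2; apply: cvgM; exact: cvg_sge].
Qed.

End LnsLimit.

(** * The regularized ground state *)

Section Regularized.
Context {R : realType} {n : nat} (Phi Phip : {fset 'rV[R]_n}) (mu : probability (torus Phi) R)
  (k : 'rV[R]_n -> R).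
Hypothesis Hroot : root_system Phi.
Hypothesis Hhaar : normalized_haar mu.
Hypothesis Hpos : positive_roots Phi Phip.
Hypothesis Hk : forall w a, weyl Phi w -> a \in Phi -> k (a *m w) = k a.
Hypothesis Hk0 : forall a, a \in Phi -> 0 <= k a.
Implicit Types (a b l x v : 'rV[R]_n) (F f : 'rV[R]_n -> R).
Local Notation e i := (delta_mx 0 i : 'rV[R]_n).
Local Notation T := (torus Phi).
Local Notation Int f := (\int[mu]_(t in setT) f t)%R.
Local Notation IT F := (\int[mu]_(t in setT) F (repr t))%R.
Local Notation ep m := (m.+1%:R^-1 : R).
Local Notation intg f := (mu.-integrable setT (EFin \o f)).

(** [De m] is the product of the [(sin^2(a/2) + 1/(m+1))^(k_a/2)] and [S m] its logarithm; the
    gradient of [S m] is the sum of the [E m a] times [a], and its Laplacian the sum of the [E2 m a]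
    times [|a|^2]. *)
Let E m a x := k a / 2 * lns1 (ep m) (dot a x).
Let E2 m a x := k a / 2 * lns2 (ep m) (dot a x).
Let S m x := \sum_(a <- Phip) k a / 2 * lns (ep m) (dot a x).
Let De m x := expR (S m x).

Definition grad (G : 'I_n -> 'rV[R]_n -> R) a x := \sum_i a 0 i * G i x.
Definition lap (H : 'I_n -> 'rV[R]_n -> R) x := \sum_i H i x.

Lemma jet_S m : jet (S m) (fun i x => \sum_(a <- Phip) E m a x * a 0 i)
  (fun i x => \sum_(a <- Phip) E2 m a x * (a 0 i * a 0 i)).
Proof.
have J a : jet (fun x => k a / 2 * lns (ep m) (dot a x)) (fun i x => E m a x * a 0 i)
    (fun i x => E2 m a x * (a 0 i * a 0 i)).
  have := jetZ (k a / 2) (jet_comp (jet_dot a) (cont_lns (ep_gt0 m)) (cont_lns1 (ep_gt0 m))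
    (cont_lns2 (ep_gt0 m)) (is_derive_lns (ep_gt0 m)) (is_derive_lns1 (ep_gt0 m))).
  by apply: jet_eq => [x//|i x|i x]; rewrite /E /E2; ring.
exact: (jet_sum Phip J).
Qed.

Lemma jet_De m : jet (De m) (fun i x => De m x * \sum_(a <- Phip) E m a x * a 0 i)
  (fun i x => De m x * \sum_(a <- Phip) E2 m a x * (a 0 i * a 0 i) +
     (\sum_(a <- Phip) E m a x * a 0 i) * (De m x * \sum_(a <- Phip) E m a x * a 0 i)).
Proof.
exact: (jet_comp (jet_S m) (@continuous_expR R) (@continuous_expR R) (@continuous_expR R)
   (@is_derive_expR R) (@is_derive_expR R)).
Qed.

(** With [De = exp S], this is [L(f De) = De (L f + 2 grad S . grad f + f (|grad S|^2 + L S))]. *)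
Lemma jet_fDe f G H m : jet f G H -> exists G' H', jet (fun x => f x * De m x) G' H' /\
  forall x, lap H' x = De m x * (lap H x + 2 * \sum_(a <- Phip) E m a x * grad G a x
    + f x * (\sum_(a <- Phip) \sum_(b <- Phip) E m a x * E m b x * dot a b
             + \sum_(a <- Phip) E2 m a x * dot a a)).
Proof.
move=> J; have := jetM J (jet_De m); set G' := (G' in jet _ G' _); set H' := (H' in jet _ _ H').
move=> J'; exists G', H'; split => // x; rewrite /lap /H'.
have S1 : \sum_i G i x * (\sum_(a <- Phip) E m a x * a 0 i) = \sum_(a <- Phip) E m a x * grad G a x.
  under eq_bigr do rewrite mulr_sumr.
  rewrite exchange_big; apply: eq_bigr => a _; rewrite /grad mulr_sumr.
  by apply: eq_bigr => i _; ring.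
have S2 : \sum_i (\sum_(a <- Phip) E m a x * a 0 i) * (\sum_(a <- Phip) E m a x * a 0 i) =
    \sum_(a <- Phip) \sum_(b <- Phip) E m a x * E m b x * dot a b.
  under eq_bigr do rewrite mulr_suml.
  rewrite exchange_big; apply: eq_bigr => a _.
  under eq_bigr do rewrite mulr_sumr.
  rewrite exchange_big; apply: eq_bigr => b _; rewrite /dot mulr_sumr.
  by apply: eq_bigr => i _; ring.
have S3 : \sum_i (\sum_(a <- Phip) E2 m a x * (a 0 i * a 0 i)) = \sum_(a <- Phip) E2 m a x * dot a a.
  rewrite exchange_big; apply: eq_bigr => a _; rewrite /dot mulr_sumr.
  by [].
rewrite -S1 -S2 -S3 -/(lap H x) /lap.
rewrite !mulr_sumr -!big_split !mulr_sumr -big_split/= mulr_sumr; apply: eq_bigr => i _.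
by ring.
Qed.

Lemma periodic_sg a : weight_lattice Phi a -> cl_periodic Phi (fun x => sg (dot a x)).
Proof.
move=> aP x q qP; apply: sg_periodic_eq.
by have := cos_dot_periodic 0 aP x qP; rewrite !addr0.
Qed.

Lemma periodic_De m : cl_periodic Phi (De m).
Proof.
move=> x q qP; rewrite /De /S; congr expR; apply: eq_big_seq => a aP.
rewrite /lns; congr (_ * ln (_ + _)).
by apply: periodic_sg => //; apply: (root_wl Hroot); exact: (pos_root Hpos).
Qed.

(** The nonnegativity of [k] is essential: each factor has a base at most 2, since [sg] and the
    parameter are at most 1, and a nonnegative exponent. *)
Lemma ubd_De : ubd De.
Proof.
exists (expR (\sum_(a <- Phip) k a / 2 * ln 2)) => m x.
rewrite ger0_norm ?expR_ge0// ler_expR /S big_seq [leRHS]big_seq; apply: ler_sum => a aP.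
rewrite ler_wpM2l ?divr_ge0 ?Hk0 ?(pos_root Hpos)//.
rewrite ler_ln ?posrE// ?sge_gt0 ?ep_gt0//.
by rewrite (_ : 2 = 1 + 1) ?lerD ?sg_le1 ?ep_le1//; ring.
Qed.

(* Delta, as a function on h_R *)
Definition wDelta x := \prod_(a <- Phip) `|sin (dot a x / 2)| `^ k a.

Lemma cvg_De x : (forall a, a \in (Phip : seq _) -> sg (dot a x) != 0) ->
  De m x @[m --> \oo] --> wDelta x.
Proof.
move=> s0.
have -> : wDelta x = expR (\sum_(a <- Phip) k a / 2 * ln (sg (dot a x))).
  rewrite expR_sum; apply: eq_big_seq => a aP.
  have sp : 0 < sg (dot a x) by rewrite lt_def s0// sg_ge0.
  have n0 : 0 < `|sin (dot a x / 2)|.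
    by rewrite normr_gt0; move: (s0 a aP); rewrite sgE sqrf_eq0.
  rewrite /powR gt_eqF//; congr expR.
  by rewrite sgE -real_normK ?num_real// lnXn// -mulr_natr; field.
apply: (@cvg_comp _ _ _ (fun m => S m x) expR); last exact: continuous_expR.
by apply: cvg_bigsum => a aP; apply: cvgM; [exact: cvg_cst|apply: cvg_lns; exact: s0].
Qed.

Lemma norm_sin_half (y : R) : `|sin (y / 2)| = Num.sqrt (sg y).
Proof. by rewrite sgE sqrtr_sqr. Qed.

Lemma cont_sg_dot a : continuous (fun x => sg (dot a x)).
Proof. by apply: cont_comp; [exact: cont_sg|exact: continuous_dot]. Qed.

Lemma bm_wDelta : bm (fun t : T => wDelta (repr t)).
Proof.
rewrite (_ : (fun _ => _) = fun t : T => \prod_(a <- Phip | a \in Phip) `|sin (dot a (repr t) / 2)| `^ k a); last first.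
  by apply/funext => t; rewrite /wDelta big_seq.
apply: bm_prod => a aP; have aPhi := pos_root Hpos aP; split.
  under eq_fun do rewrite norm_sin_half.
  apply: (measurableT_comp (measurable_powR (k a))).
  apply: (@continuous_measurable_repr R n Phi (fun x => Num.sqrt (sg (dot a x)))).
    by apply: cont_comp; [exact: sqrt_continuous|exact: cont_sg_dot].
  by move=> x q qP; rewrite (periodic_sg (root_wl Hroot aPhi)).
exists 1 => t; rewrite ger0_norm ?powR_ge0//.
have s1 : `|sin (dot a (repr t) / 2)| <= 1.
  by rewrite norm_sin_half -sqrtr1 ler_wsqrtr// sg_le1.
have := @ge0_ler_powR R (k a) (Hk0 aPhi) _ _ (normr_ge0 (sin (dot a (repr t) / 2))) ler01 s1.
by rewrite powR1; apply.
Qed.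

Lemma walls_null : \forall t \ae mu, forall a, a \in (Phip : seq _) -> sg (dot a (repr t)) != 0.
Proof.
apply: near_seq => a aP; have aPhi := pos_root Hpos aP.
have := wall_null Hhaar (root_wl Hroot aPhi) (root_neq0 Hroot aPhi).
by apply: filterS => t; rewrite sg_eq0.
Qed.

(** The function [wp] at [p = 0]. On the wall of [a], where the inverse is 0 by convention, its
    value is [- 1/12]. *)
Definition trigV a x := (4 * sg (dot a x))^-1 - 12^-1.
Definition V0 x := \sum_(a <- Phip) k a * (k a - 1) * dot a a * trigV a x.

Lemma meas_trigV a : a \in Phip -> measurable_fun setT (fun t : T => trigV a (repr t)).
Proof.
move=> aP; apply: measurable_funB; last exact: measurable_cst.
have powE y : (4 * sg y)^-1 = (4 * sg y) `^ (-1) :> R.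
  by rewrite powR_inv1// mulr_ge0// sg_ge0.
under eq_fun do rewrite powE.
apply: (measurableT_comp (measurable_powR (-1))).
apply: measurable_funM; first exact: measurable_cst.
apply: (@continuous_measurable_repr R n Phi (fun x => sg (dot a x))).
  by apply: cont_comp; [exact: cont_sg|exact: continuous_dot].
by apply: periodic_sg; apply: (root_wl Hroot); exact: (pos_root Hpos).
Qed.

Lemma meas_V0 : measurable_fun setT (fun t : T => V0 (repr t)).
Proof.
rewrite (_ : (fun _ => _) = (fun t : T => \sum_(a <- Phip)
    if a \in Phip then k a * (k a - 1) * dot a a * trigV a (repr t) else 0)); last first.
  by apply/funext => t; apply: eq_big_seq => a ->.
apply: measurable_sum => a; have [aP|_] := boolP (a \in Phip); last exact: measurable_cst.
by apply: measurable_funM; [exact: measurable_cst|exact: meas_trigV].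
Qed.

(* [g a] is the trigonometric polynomial cot(a/2) d_a f. *)
Definition wdata f (G H : 'I_n -> 'rV[R]_n -> R) (g : 'rV[R]_n -> 'rV[R]_n -> R) :=
  [/\ jet f G H, cl_periodic Phi f & forall a, a \in Phip ->
   [/\ continuous (g a), cl_periodic Phi (g a) &
    forall x, sin (dot a x / 2) * g a x = cos (dot a x / 2) * grad G a x]].

(* Delta^-1 (-L + V_0)(f Delta); see [g] in [wdata]. *)
Definition gauge cQ f (H : 'I_n -> 'rV[R]_n -> R) (g : 'rV[R]_n -> 'rV[R]_n -> R) x :=
  - lap H x - \sum_(a <- Phip) k a * g a x
  + (\sum_(a <- Phip) dot a a * (k a ^+ 2 / 4 - k a * (k a - 1) / 12) - cQ / 4) * f x.

Lemma mul_lns1_le (p C s l : R) : 0 <= C -> `|p| <= C * s -> 0 <= s -> s <= 1 -> s * l ^+ 2 <= 1 ->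
  `|p * l| <= C.
Proof.
move=> C0 pC s0 s1 sl; rewrite -(@ler_pXn2r _ 2)// ?nnegrE// normrM exprMn.
apply: (@le_trans _ _ ((C * s) ^+ 2 * `|l| ^+ 2)).
  by rewrite ler_wpM2r ?sqr_ge0// lerXn2r ?nnegrE// mulr_ge0.
rewrite real_normK ?num_real// exprMn -mulrA ler_piMr ?sqr_ge0// expr2 -mulrA.
by rewrite mulr_ile1// mulr_ge0// sqr_ge0.
Qed.

(** Here [p] stands for a value of phi, and [s], [s'] for [sg] at two walls. Squaring uses
    [|p|^2 <= (C s) (C s')], so a single factor phi controls the poles of both walls. *)
Lemma mul_lns11_le (p C s l s' l' : R) : 0 <= C -> `|p| <= C * s -> `|p| <= C * s' ->
  0 <= s -> 0 <= s' -> s * l ^+ 2 <= 1 -> s' * l' ^+ 2 <= 1 -> `|p * l * l'| <= C.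
Proof.
move=> C0 pC pC' s0 s0' sl sl'; rewrite -(@ler_pXn2r _ 2)// ?nnegrE// !normrM !exprMn.
apply: (@le_trans _ _ ((C * s) * (C * s') * `|l| ^+ 2 * `|l'| ^+ 2)).
  by rewrite !ler_wpM2r ?sqr_ge0// expr2 ler_pM.
rewrite !real_normK ?num_real//.
rewrite (_ : _ * _ = C ^+ 2 * ((s * l ^+ 2) * (s' * l' ^+ 2))); last by ring.
by rewrite ler_piMr ?sqr_ge0// mulr_ile1// mulr_ge0// sqr_ge0.
Qed.

Lemma kp_ge0 a : a \in Phip -> 0 <= k a.
Proof. by move=> aP; apply: Hk0; exact: (pos_root Hpos). Qed.

Lemma jet_lap_cont F G H : jet F G H -> continuous (lap H).
Proof. by case=> _ _ cH _; apply: cont_sum => i _. Qed.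

Lemma jet_lap_periodic F G H : cl_periodic Phi F -> jet F G H -> cl_periodic Phi (lap H).
Proof.
move=> pF [cF cG cH d] x q qP; apply: eq_bigr => i _.
have [pG _] := IT_derive Hroot Hhaar pF cF (cG i) (fun x => (d i x).1).
by have [-> ] := IT_derive Hroot Hhaar pG (cG i) (cH i) (fun x => (d i x).2).
Qed.

Lemma jet_grad_cont F G H a : jet F G H -> continuous (grad G a).
Proof. by case=> _ cG _ _; apply: cont_sum => i _; exact: contZ. Qed.

Lemma jet_grad_periodic F G H a : cl_periodic Phi F -> jet F G H -> cl_periodic Phi (grad G a).
Proof.
move=> pF [cF cG cH d] x q qP; apply: eq_bigr => i _.
by have [->] := IT_derive Hroot Hhaar pF cF (cG i) (fun x => (d i x).1).
Qed.

Lemma bm_repr F : continuous F -> cl_periodic Phi F -> bm (fun t : T => F (repr t)).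
Proof. exact: (periodic_bm Hroot). Qed.

Lemma cont_gauge cQ f G H g : wdata f G H g -> continuous (gauge cQ f H g).
Proof.
move=> [J pf Dg]; have [cf _ _ _] := J.
apply: contD; last exact: contZ.
apply: contB; first by apply: contN; exact: (jet_lap_cont J).
rewrite (_ : (fun _ => _) = (fun x => \sum_(a <- Phip | a \in Phip) k a * g a x)); last first.
  by apply/funext => x; rewrite big_seq.
by apply: cont_sum => a aP; apply: contZ; have [] := Dg a aP.
Qed.

Lemma periodic_gauge cQ f G H g : wdata f G H g -> cl_periodic Phi (gauge cQ f H g).
Proof.
move=> [J pf Dg] x q qP; rewrite /gauge pf// (jet_lap_periodic pf J)//.
congr (_ - _ + _); apply: eq_big_seq => a aP; have [_ pg _] := Dg a aP; by rewrite pg.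
Qed.

Lemma bm_gauge cQ f G H g : wdata f G H g -> bm (fun t : T => gauge cQ f H g (repr t)).
Proof. by move=> D; apply: bm_repr; [exact: (cont_gauge D)|exact: periodic_gauge D]. Qed.

(** * Pairing with functions vanishing on the walls *)

Section Adjoint.
Variables (f : 'rV[R]_n -> R) (Gf Hf : 'I_n -> 'rV[R]_n -> R) (g : 'rV[R]_n -> 'rV[R]_n -> R).
Hypothesis Df : wdata f Gf Hf g.
Variables (phi : 'rV[R]_n -> R) (Gp Hp : 'I_n -> 'rV[R]_n -> R) (C : R).
Hypothesis Jp : jet phi Gp Hp.
Hypothesis pphi : cl_periodic Phi phi.
Hypothesis C0 : 0 <= C.
Hypothesis phiC : forall a, a \in Phip -> k a != 0 -> forall x, `|phi x| <= C * sg (dot a x).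

(** The integrand of Green's formula for [f De] and [phi], with [phi] moved inside the sums so that
    each singular factor can be bounded together with it. *)
Let B m x := De m x * (f x * lap Hp x - phi x * lap Hf x -
  (2 * (\sum_(a <- Phip) (phi x * E m a x) * grad Gf a x) +
   f x * (\sum_(a <- Phip) \sum_(b <- Phip) (phi x * E m a x * E m b x) * dot a b +
          \sum_(a <- Phip) (phi x * E2 m a x) * dot a a))).

Lemma green_B m : bm (fun t : T => B m (repr t)) /\ IT (B m) = 0.
Proof.
have [J pf _] := Df.
have [G' [H' [J' E']]] := jet_fDe m J.
have pF : cl_periodic Phi (fun x => f x * De m x).
  by move=> x q qP; rewrite pf// periodic_De.
have [b1 i1] := green Hroot Hhaar pF pphi J' Jp.
have BE x : f x * De m x * (\sum_i Hp i x) - phi x * (\sum_i H' i x) = B m x.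
  rewrite -/(lap H' x) -/(lap Hp x) E' /B.
  have -> : \sum_(a <- Phip) phi x * E m a x * grad Gf a x =
      phi x * \sum_(a <- Phip) E m a x * grad Gf a x.
    by rewrite mulr_sumr; apply: eq_bigr => a _; rewrite mulrA.
  have -> : \sum_(a <- Phip) phi x * E2 m a x * dot a a =
      phi x * \sum_(a <- Phip) E2 m a x * dot a a.
    by rewrite mulr_sumr; apply: eq_bigr => a _; rewrite mulrA.
  have -> : \sum_(a <- Phip) \sum_(b <- Phip) phi x * E m a x * E m b x * dot a b =
      phi x * \sum_(a <- Phip) \sum_(b <- Phip) E m a x * E m b x * dot a b.
    rewrite mulr_sumr; apply: eq_bigr => a _; rewrite mulr_sumr; apply: eq_bigr => b _.
    by rewrite !mulrA.
  by ring.
split.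
  by move: b1; congr bm; apply/funext => t; exact: BE.
by rewrite -i1; apply: eq_Rintegral => t _; rewrite BE.
Qed.

Let bounded_of F : continuous F -> cl_periodic Phi F -> ubd (fun (_ : nat) x => F x).
Proof. by move=> cF pF; apply: ubd_bounded; exact: (periodic_bounded Hroot). Qed.

(** A wall with [k a = 0] contributes nothing; on the others [|phi| <= C sg] beats the first
    derivatives of the logarithm, their products in pairs, and its second derivatives. *)
Lemma ubd_B : ubd B.
Proof.
have [J pf _] := Df; have [cf _ _ _] := J; have [cp _ _ _] := Jp.
have k2 a : a \in Phip -> `|k a / 2| = k a / 2.
  by move=> aP; rewrite ger0_norm// divr_ge0// kp_ge0.
apply: ubdM; first exact: ubd_De.
apply: ubdB.
  apply: ubdB; apply: ubdM.
  - exact: (bounded_of cf pf).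
  - exact: (bounded_of (jet_lap_cont Jp) (jet_lap_periodic pphi Jp)).
  - exact: (bounded_of cp pphi).
  - exact: (bounded_of (jet_lap_cont J) (jet_lap_periodic pf J)).
apply: ubdD.
  apply: ubdM; first exact: ubd_cst.
  apply: ubd_sum => a aP; apply: ubdM.
    exists (k a / 2 * C) => m x; rewrite /E mulrCA normrM k2//.
    have [->|ka] := eqVneq (k a) 0; first by rewrite !mul0r.
    rewrite ler_wpM2l ?divr_ge0 ?kp_ge0//.
    apply: (mul_lns1_le C0 (phiC aP ka x)); rewrite ?sg_ge0 ?sg_le1//.
    exact: (sg_lns1_sqr (ep_gt0 m)).
  by apply: bounded_of; [exact: (jet_grad_cont J)|exact: jet_grad_periodic pf J].
apply: ubdM; first exact: bounded_of.
apply: ubdD.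
  apply: ubd_sum => a aP; apply: ubd_sum => b bP; apply: ubdM; last exact: ubd_cst.
  exists (k a / 2 * (k b / 2) * C) => m x; rewrite /E.
  rewrite (_ : _ * _ = (k a / 2) * (k b / 2) * (phi x * lns1 (ep m) (dot a x) * lns1 (ep m) (dot b x))); last by ring.
  rewrite normrM normrM !k2//.
  have [->|ka] := eqVneq (k a) 0; first by rewrite !mul0r.
  have [->|kb] := eqVneq (k b) 0; first by rewrite !mul0r mulr0 !mul0r.
  rewrite ler_wpM2l ?mulr_ge0 ?invr_ge0 ?kp_ge0//.
  apply: (mul_lns11_le C0 (phiC aP ka x) (phiC bP kb x)); rewrite ?sg_ge0//.
    exact: (sg_lns1_sqr (ep_gt0 m)).
  exact: (sg_lns1_sqr (ep_gt0 m)).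
apply: ubd_sum => a aP; apply: ubdM; last exact: ubd_cst.
exists (k a / 2 * (C * 2)) => m x; rewrite /E2 mulrCA normrM k2//.
have [->|ka] := eqVneq (k a) 0; first by rewrite !mul0r.
rewrite ler_wpM2l ?divr_ge0 ?kp_ge0// normrM.
apply: (le_trans (ler_wpM2r _ (phiC aP ka x))) => //.
by rewrite -mulrA ler_wpM2l//; exact: (sg_lns2 (ep_gt0 m)).
Qed.

Variable cQ : R.
Hypothesis HcQ : \forall t \ae mu, \sum_(a <- Phip) \sum_(b <- Phip | b != a)
  k a * k b * dot a b * (cot (dot a (repr t) / 2) * cot (dot b (repr t) / 2)) = cQ.

(** Limit of [green_B] as the regularization is removed; the integrand is the limit of [- B m]. *)
Lemma adjoint_identity : let u (t : T) := wDelta (repr t) * (f (repr t) * (- lap Hp (repr t) + V0 (repr t) * phi (repr t))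
    - phi (repr t) * gauge cQ f Hf g (repr t)) in
  intg u /\ Int u = 0.
Proof.
move=> u; have [J pf Dg] := Df; have [cf _ _ _] := J; have [cp _ _ _] := Jp.
have mr F : continuous F -> cl_periodic Phi F -> measurable_fun setT (fun t : T => F (repr t)).
  exact: continuous_measurable_repr.
have mu_ : measurable_fun setT u.
  apply: measurable_funM; first by have [] := bm_wDelta.
  apply: measurable_funB; apply: measurable_funM.
  - exact: mr.
  - apply: measurable_funD.
      by apply: measurable_funN; apply: mr; [exact: (jet_lap_cont Jp)|exact: (jet_lap_periodic pphi Jp)].
    by apply: measurable_funM; [exact: meas_V0|exact: mr].
  - exact: mr.
  - exact: (bm_gauge _ Df).1.
have [M BM] := ubd_B.
have := @Int_bct _ T R mu (fun m t => - B m (repr t)) u M.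
case.
- by move=> m; apply: measurableT_comp => //; have [[]] := green_B m.
- exact: mu_.
- by apply: nearW => t m; rewrite normrN.
- move: walls_null HcQ; apply: filterS2 => t st cqt.
  set x := repr t in st cqt *.
  have cE a : a \in Phip -> E m a x @[m --> \oo] --> k a / 2 * cot (dot a x / 2).
    by move=> aP; apply: cvgM; [exact: cvg_cst|apply: cvg_lns1; exact: st].
  have cE2 a : a \in Phip -> E2 m a x @[m --> \oo] --> k a / 2 * - (2 * sg (dot a x))^-1.
    by move=> aP; apply: cvgM; [exact: cvg_cst|apply: cvg_lns2; exact: st].
  have L : - B m x @[m --> \oo] --> - (wDelta x * (f x * lap Hp x - phi x * lap Hf x -
  (2 * (\sum_(a <- Phip) (phi x * (k a / 2 * cot (dot a x / 2))) * grad Gf a x) +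
   f x * (\sum_(a <- Phip) \sum_(b <- Phip) (phi x * (k a / 2 * cot (dot a x / 2)) * (k b / 2 * cot (dot b x / 2))) * dot a b +
          \sum_(a <- Phip) (phi x * (k a / 2 * - (2 * sg (dot a x))^-1)) * dot a a)))).
    apply: cvgN; apply: cvgM; first exact: cvg_De.
    apply: cvgB; first exact: cvg_cst.
    apply: cvgD; last apply: cvgM; [|exact: cvg_cst|].
      apply: cvgM; first exact: cvg_cst.
      apply: cvg_bigsum => a aP; apply: cvgM; last exact: cvg_cst.
      by apply: cvgM; [exact: cvg_cst|exact: cE].
    apply: cvgD; apply: cvg_bigsum => a aP; last first.
      by apply: cvgM; [apply: cvgM; [exact: cvg_cst|exact: cE2]|exact: cvg_cst].
    apply: cvg_bigsum => b bP; apply: cvgM; last exact: cvg_cst.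
    by apply: cvgM; [apply: cvgM; [exact: cvg_cst|exact: cE]|exact: cE].
  rewrite (_ : u t = - (wDelta x * (f x * lap Hp x - phi x * lap Hf x -
  (2 * (\sum_(a <- Phip) (phi x * (k a / 2 * cot (dot a x / 2))) * grad Gf a x) +
   f x * (\sum_(a <- Phip) \sum_(b <- Phip) (phi x * (k a / 2 * cot (dot a x / 2)) * (k b / 2 * cot (dot b x / 2))) * dot a b +
          \sum_(a <- Phip) (phi x * (k a / 2 * - (2 * sg (dot a x))^-1)) * dot a a)))))//.
  rewrite -mulrN /u -/x; congr (wDelta x * _).
  have -> : \sum_(a <- Phip) (phi x * (k a / 2 * cot (dot a x / 2))) * grad Gf a x =
      phi x / 2 * \sum_(a <- Phip) k a * g a x.
    rewrite mulr_sumr; apply: eq_big_seq => a aP; have [_ _ /(_ x) gE] := Dg a aP.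
    have sn : sin (dot a x / 2) != 0 by move: (st a aP); rewrite sgE sqrf_eq0.
    rewrite (_ : g a x = cos (dot a x / 2) * grad Gf a x / sin (dot a x / 2)); last by rewrite -gE mulrC mulKf.
    by rewrite /cot; field.
  (* The off-diagonal part is the constant [cQ], up to the factor 1/4; on the diagonal,
     [cot^2 = 1 / sin^2 - 1]. *)
  have -> : \sum_(a <- Phip) \sum_(b <- Phip) (phi x * (k a / 2 * cot (dot a x / 2)) * (k b / 2 * cot (dot b x / 2))) * dot a b
    = phi x * (cQ / 4 + \sum_(a <- Phip) k a ^+ 2 / 4 * dot a a * ((sg (dot a x))^-1 - 1)).
    rewrite -cqt mulr_suml -big_split mulr_sumr; apply: eq_big_seq => a aP.
    have sn : sin (dot a x / 2) != 0 by move: (st a aP); rewrite sgE sqrf_eq0.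
    rewrite (bigD1_seq a)//= addrC mulrDr; congr (_ + _).
      rewrite [(\sum_(b <- _ | _) _) / 4]mulr_suml [_ * (\sum_(b <- _ | _) _)]mulr_sumr.
      by apply: eq_bigr => b _; field.
    rewrite sgE /cot; have : cos (dot a x / 2) ^+ 2 = 1 - sin (dot a x / 2) ^+ 2.
      by rewrite -[X in X - _](cos2Dsin2 (dot a x / 2)) addrK.
    set c := cos _; set s := sin _ => c2.
    rewrite (_ : _ * dot a a = phi x * k a ^+ 2 / 4 * (c ^+ 2) / s ^+ 2 * dot a a); last by field.
    by rewrite c2; field.
  have -> : \sum_(a <- Phip) (phi x * (k a / 2 * - (2 * sg (dot a x))^-1)) * dot a a =
      phi x * \sum_(a <- Phip) (- (k a / 4) * dot a a / sg (dot a x)).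
    rewrite mulr_sumr; apply: eq_big_seq => a aP; have := st a aP => s0; by field.
  (* The poles match: the squared gradient contributes [k^2 / 4] and the Laplacian of the logarithm
     [- k / 4], whose sum is the coefficient [k (k - 1) / 4] of the potential. What remains is the
     constant of [gauge]. *)
  have -> : V0 x = \sum_(a <- Phip) (k a ^+ 2 / 4 * dot a a * ((sg (dot a x))^-1 - 1))
     + \sum_(a <- Phip) (- (k a / 4) * dot a a / sg (dot a x)) + \sum_(a <- Phip) dot a a * (k a ^+ 2 / 4 - k a * (k a - 1) / 12).
    rewrite -!big_split; apply: eq_big_seq => a aP; have := st a aP => s0.
    by rewrite /trigV /=; field.
  rewrite /gauge.
  set X := \sum_(a <- Phip) dot a a * _; set Y := \sum_(a <- Phip) _; set Z := \sum_(a <- Phip) _.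
  by set G := \sum_(a <- Phip) _; field.
move=> iu; rewrite (_ : (fun m => _) = fun=> 0) => [cu|].
  by split => //; rewrite -(cvg_lim _ cu)// lim_cst.
apply/funext => m; have [bB iB] := green_B m.
rewrite (_ : (fun t => _) = (fun t : T => -1 * B m (repr t))); last by apply/funext => t; rewrite mulN1r.
by rewrite IntZ ?iB ?mulr0//; exact: bm_intg.
Qed.

End Adjoint.

(** * Symmetry of the gauged operator *)

Section Symmetric.
Variables (f : 'rV[R]_n -> R) (Gf Hf : 'I_n -> 'rV[R]_n -> R) (g : 'rV[R]_n -> 'rV[R]_n -> R).
Variables (f' : 'rV[R]_n -> R) (Gf' Hf' : 'I_n -> 'rV[R]_n -> R) (g' : 'rV[R]_n -> 'rV[R]_n -> R).
Hypothesis Df : wdata f Gf Hf g.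
Hypothesis Df' : wdata f' Gf' Hf' g'.

(** Green's formula for [f De] and [f' De]: the zero order terms of [jet_fDe] cancel by
    antisymmetry, and only the gradient terms keep a singular coefficient. *)
Let B m x := De m x ^+ 2 * (f x * (lap Hf' x + 2 * \sum_(a <- Phip) E m a x * grad Gf' a x)
  - f' x * (lap Hf x + 2 * \sum_(a <- Phip) E m a x * grad Gf a x)).

Let green_sym m : bm (fun t : T => B m (repr t)) /\ IT (B m) = 0.
Proof.
have [J pf _] := Df; have [J' pf' _] := Df'.
have [G1 [H1 [J1 E1]]] := jet_fDe m J.
have [G1' [H1' [J1' E1']]] := jet_fDe m J'.
have pF : cl_periodic Phi (fun x => f x * De m x).
  by move=> x q qP; rewrite pf// periodic_De.
have pF' : cl_periodic Phi (fun x => f' x * De m x).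
  by move=> x q qP; rewrite pf'// periodic_De.
have [b1 i1] := green Hroot Hhaar pF pF' J1 J1'.
have BE x : f x * De m x * (\sum_i H1' i x) - f' x * De m x * (\sum_i H1 i x) = B m x.
  by rewrite -/(lap H1 x) -/(lap H1' x) E1 E1' /B; ring.
split.
  by move: b1; congr bm; apply/funext => t; exact: BE.
by rewrite -i1; apply: eq_Rintegral => t _; rewrite BE.
Qed.

(** The divisibility recorded in [wdata] replaces the singular gradient term by the bounded [h a],
    times the factor [sg / (sg + 1/(m+1))], which lies in [[0, 1]]. *)
Let E_grad F G H h (D : wdata F G H h) a m x : a \in Phip ->
  E m a x * grad G a x = k a / 2 * (sg (dot a x) / (sg (dot a x) + ep m)) * h a x.
Proof.
move=> aP; have [_ _ /(_ a aP)[_ _ /(_ x) hE]] := D.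
have sp := sge_gt0 (ep_gt0 m) (dot a x).
rewrite /E /lns1 (sin_half (dot a x)); set w := sg (dot a x) + ep m in sp *.
rewrite (_ : _ * grad G a x = k a / 2 / w * (sin (dot a x / 2) * (cos (dot a x / 2) * grad G a x))); last first.
  by field; rewrite gt_eqF.
by rewrite -hE sgE; field; rewrite gt_eqF.
Qed.

Let ubd_E_grad F G H h (D : wdata F G H h) a : a \in Phip ->
  ubd (fun m x => E m a x * grad G a x).
Proof.
move=> aP; have [_ _ /(_ a aP)[ch ph _]] := D.
have [M hM] := periodic_bounded Hroot ch ph.
exists (k a / 2 * 1 * M) => m x; rewrite (E_grad D)//.
have sp := sge_gt0 (ep_gt0 m) (dot a x).
rewrite normrM ler_pM// normrM ler_pM//.
  by rewrite ger0_norm// divr_ge0// kp_ge0.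
have q0 : 0 <= sg (dot a x) / (sg (dot a x) + ep m) by rewrite divr_ge0 ?sg_ge0// (ltW sp).
by rewrite ger0_norm// ler_pdivrMr// mul1r lerDl ltW// ep_gt0.
Qed.

Let bounded_of F : continuous F -> cl_periodic Phi F -> ubd (fun (_ : nat) x => F x).
Proof. by move=> cF pF; apply: ubd_bounded; exact: (periodic_bounded Hroot). Qed.

Let ubd_sym : ubd B.
Proof.
have [J pf _] := Df; have [J' pf' _] := Df'.
have [cf _ _ _] := J; have [cf' _ _ _] := J'.
apply: ubdM; first by under eq_fun do under eq_fun do rewrite expr2; apply: ubdM; exact: ubd_De.
apply: ubdB; (apply: ubdM; first exact: bounded_of); (apply: ubdD; last
  (apply: ubdM; [exact: ubd_cst|apply: ubd_sum => a aP])).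
- exact: (bounded_of (jet_lap_cont J') (jet_lap_periodic pf' J')).
- exact: (ubd_E_grad Df').
- exact: (bounded_of (jet_lap_cont J) (jet_lap_periodic pf J)).
- exact: (ubd_E_grad Df).
Qed.

Lemma gauge_symmetric cQ : let u (t : T) := wDelta (repr t) ^+ 2 * (f (repr t) * gauge cQ f' Hf' g' (repr t)
    - f' (repr t) * gauge cQ f Hf g (repr t)) in
  bm u /\ Int u = 0.
Proof.
move=> u; have [J pf Dg] := Df; have [J' pf' Dg'] := Df'.
have [cf _ _ _] := J; have [cf' _ _ _] := J'.
have bu : bm u.
  apply: bmM.
    by under eq_fun do rewrite expr2; apply: bmM; exact: bm_wDelta.
  by apply: bmB; apply: bmM; [exact: bm_repr|exact: (bm_gauge _ Df')|exact: bm_repr|exact: (bm_gauge _ Df)].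
split => //; have [M BM] := ubd_sym.
have := @Int_bct _ T R mu (fun m t => - B m (repr t)) u M.
case.
- by move=> m; apply: measurableT_comp => //; have [[]] := green_sym m.
- by case: bu.
- by apply: nearW => t m; rewrite normrN.
- move: walls_null; apply: filterS => t st; set x := repr t in st *.
  have cE F G H h : wdata F G H h -> forall a, a \in Phip ->
      E m a x * grad G a x @[m --> \oo] --> k a / 2 * h a x.
    move=> D a aP; have s0 := st a aP; rewrite (_ : k a / 2 * h a x = k a / 2 * cot (dot a x / 2) * grad G a x).
      by apply: cvgM; [apply: cvgM; [exact: cvg_cst|exact: cvg_lns1]|exact: cvg_cst].
    have [_ _ /(_ a aP)[_ _ /(_ x) hE]] := D.
    have sn : sin (dot a x / 2) != 0 by move: s0; rewrite sgE sqrf_eq0.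
    rewrite (_ : h a x = cos (dot a x / 2) * grad G a x / sin (dot a x / 2)); last by rewrite -hE mulrC mulKf.
    by rewrite /cot; field.
  have L : - B m x @[m --> \oo] --> - (wDelta x ^+ 2 * (f x * (lap Hf' x + 2 * \sum_(a <- Phip) k a / 2 * g' a x)
     - f' x * (lap Hf x + 2 * \sum_(a <- Phip) k a / 2 * g a x))).
    apply: cvgN; apply: cvgM.
      by rewrite expr2; under eq_fun do rewrite expr2; apply: cvgM; exact: cvg_De.
    apply: cvgB; (apply: cvgM; first exact: cvg_cst); (apply: cvgD; first exact: cvg_cst);
      (apply: cvgM; first exact: cvg_cst); apply: cvg_bigsum => a aP.
      exact: (cE _ _ _ _ Df').
    exact: (cE _ _ _ _ Df).
  rewrite (_ : u t = - (wDelta x ^+ 2 * (f x * (lap Hf' x + 2 * \sum_(a <- Phip) k a / 2 * g' a x)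
     - f' x * (lap Hf x + 2 * \sum_(a <- Phip) k a / 2 * g a x))))//.
  rewrite -mulrN /u -/x; congr (wDelta x ^+ 2 * _).
  have Z h : 2 * \sum_(a <- Phip) k a / 2 * h a x = \sum_(a <- Phip) k a * h a x.
    by rewrite mulr_sumr; apply: eq_bigr => a _; field.
  by rewrite !Z /gauge; ring.
move=> iu; rewrite (_ : (fun m => _) = fun=> 0) => [cu|].
  by rewrite -(cvg_lim _ cu)// lim_cst.
apply/funext => m; have [bB iB] := green_sym m.
rewrite (_ : (fun t => _) = (fun t : T => -1 * B m (repr t))); last by apply/funext => t; rewrite mulN1r.
by rewrite IntZ ?iB ?mulr0//; exact: bm_intg.
Qed.

End Symmetric.

End Regularized.

(** * The Weierstrass function *)

Section WeierstrassCorrection.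
Context {R : realType} (p : R).
Hypothesis p1 : -1 < p.
Hypothesis p2 : p < 1.

Let term (x : R) m := m%:R * p ^+ m / (1 - p ^+ m) * (cos (m%:R * x) - 1).

(* the part of the Weierstrass function which is bounded near the poles *)
Definition wp_reg (x : R) := - 2 * limn (fun N => \sum_(1 <= m < N) term x m).

Lemma wp_split x : wp p x = (4 * sg x)^-1 - 12^-1 + wp_reg x.
Proof. by rewrite /wp /wp_reg sgE mulNr. Qed.

Let r : R := `|p|.
Let r0 : 0 <= r. Proof. exact: normr_ge0. Qed.
Let r1 : r < 1. Proof. by rewrite /r ltr_norml p1 p2. Qed.

(** Closed form of the partial sums of the series of [m r^m]; the subtracted term is nonnegative,
    whence the bound [r / (1 - r)^2]. *)
Let geo N : (\sum_(0 <= m < N) m%:R * r ^+ m) * (1 - r) ^+ 2 =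
  r - r ^+ N * (N%:R * (1 - r) + r).
Proof.
elim: N => [|N IH]; first by rewrite big_geq// !mul0r expr0; ring.
by rewrite big_nat_recr//= mulrDl IH -natr1 (exprS r N); set y := r ^+ N; ring.
Qed.

Let geo_le N : \sum_(0 <= m < N) m%:R * r ^+ m <= r / (1 - r) ^+ 2.
Proof.
have q0 : 0 < (1 - r) ^+ 2 by rewrite exprn_gt0// subr_gt0.
rewrite ler_pdivlMr// geo gerBl mulr_ge0 ?exprn_ge0// addr_ge0// mulr_ge0//.
by rewrite subr_ge0 ltW.
Qed.

(** For [m >= 1] the denominator is at least [1 - |p|], and the cosine factor is at most 2 in
    absolute value; the term with [m = 0] is 0. *)
Let term_le x m : `|term x m| <= 2 / (1 - r) * (m%:R * r ^+ m).
Proof.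
have q0 : 0 < 1 - r by rewrite subr_gt0.
have [->|m0] := eqVneq m 0; first by rewrite /term !mul0r normr0 mulr0.
rewrite /term !normrM normfV normr_nat normrX -/r.
rewrite (_ : 2 / (1 - r) * _ = m%:R * r ^+ m / (1 - r) * 2); last by ring.
rewrite ler_pM ?mulr_ge0 ?invr_ge0 ?exprn_ge0 ?normr_ge0//.
  have pm : 1 - r <= `|1 - p ^+ m|.
    rewrite (le_trans _ (lerB_dist _ _))// normr1 lerB// normrX -/r.
    by rewrite -[leRHS]expr1 ler_wiXn2l ?lt0n// ltW.
  rewrite ler_wpM2l ?mulr_ge0 ?exprn_ge0// lef_pV2// posrE.
  exact: lt_le_trans pm.
rewrite ler_norml; have := cos_le1 (m%:R * x); have := cos_geN1 (m%:R * x).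
by move=> ? ?; apply/andP; split; lra.
Qed.

Let S (x : R) N := \sum_(1 <= m < N) term x m.

Let S_series x : S x = series (term x).
Proof.
apply/funext => -[|N]; rewrite /S /series /=; first by rewrite !big_geq.
by rewrite [RHS]big_ltn// /term !mul0r add0r.
Qed.

Let cvg_S x : cvgn (S x).
Proof.
rewrite S_series; apply: (@normed_cvg R R^o).
have m0 m : 0 <= m%:R * r ^+ m by rewrite mulr_ge0// exprn_ge0.
have q0 : 0 <= 2 / (1 - r) by rewrite divr_ge0// subr_ge0 ltW.
apply: (@series_le_cvg _ _ (fun m => 2 / (1 - r) * (m%:R * r ^+ m))) => [m|m|m|].
- exact: normr_ge0.
- by rewrite mulr_ge0.
- exact: term_le.
apply: nondecreasing_is_cvgn.
  by apply: nondecreasing_series => m _ _; rewrite mulr_ge0.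
exists (2 / (1 - r) * (r / (1 - r) ^+ 2)) => _ [N _ <-].
by rewrite /series/= -mulr_sumr ler_wpM2l// geo_le.
Qed.

Lemma wp_reg_bounded : exists M : R, forall x, `|wp_reg x| <= M.
Proof.
pose K : R := 2 / (1 - r) * (r / (1 - r) ^+ 2).
exists (2 * K) => x; rewrite /wp_reg -/(S x) normrM normrN normr_nat ler_wpM2l//.
have SK N : `|S x N| <= K.
  rewrite S_series /series/= (le_trans (ler_norm_sum _ _ _))//.
  rewrite (le_trans (ler_sum _ (fun m _ => term_le x m)))// -mulr_sumr.
  by rewrite ler_wpM2l ?geo_le// divr_ge0// subr_ge0 ltW.
rewrite ler_norml; apply/andP; split.
  apply: limr_ge; first exact: cvg_S.
  by apply: nearW => N; have := SK N; rewrite ler_norml => /andP[].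
apply: limr_le; first exact: cvg_S.
by apply: nearW => N; have := SK N; rewrite ler_norml => /andP[].
Qed.

Lemma wp_regN x : wp_reg (- x) = wp_reg x.
Proof.
rewrite /wp_reg (_ : (fun N => \sum_(1 <= m < N) term (- x) m) = S x)//.
by apply/funext => N; apply: eq_bigr => m _; rewrite /term mulrN cosN.
Qed.

Section Torus.
Context {n : nat} (Phi Phip : {fset 'rV[R]_n}) (k : 'rV[R]_n -> R).
Hypothesis Hroot : root_system Phi.
Hypothesis Hpos : positive_roots Phi Phip.
Hypothesis Hk : forall w a, weyl Phi w -> a \in Phi -> k (a *m w) = k a.
Local Notation T := (torus Phi).
Implicit Types a l : 'rV[R]_n.

Let term_periodic l m : weight_lattice Phi l -> cl_periodic Phi (fun x => term (dot l x) m).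
Proof.
move=> lP x q qP; rewrite /term -!dotZl.
have lmP : weight_lattice Phi (m%:R *: l).
  by rewrite scaler_nat pmulrn; exact: wlZ.
by have := cos_dot_periodic 0 lmP x qP; rewrite !addr0 => ->.
Qed.

Lemma wp_reg_periodic l : weight_lattice Phi l -> cl_periodic Phi (fun x => wp_reg (dot l x)).
Proof.
move=> lP x q qP; rewrite /wp_reg -/(S (dot l x)) -/(S (dot l (x + (2 * pi) *: q))).
rewrite (_ : S (dot l (x + _)) = S (dot l x))//; apply/funext => N.
by apply: eq_bigr => m _; exact: (term_periodic m lP).
Qed.

Lemma bm_wp_reg l : weight_lattice Phi l -> bm (fun t : T => wp_reg (dot l (repr t))).
Proof.
move=> lP; have [M HM] := wp_reg_bounded; split; last by exists M.
apply: measurable_funM; first exact: measurable_cst.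
apply: (@measurable_fun_cvg _ _ _ _ (fun N (t : T) => S (dot l (repr t)) N)); last first.
  by move=> t _; exact: cvg_S.
move=> N; apply: measurable_sum => m.
apply: (@continuous_measurable_repr R n Phi (fun x => term (dot l x) m)); last exact: term_periodic.
apply: contZ; apply: contB; last exact: cont_cst.
rewrite (_ : (fun _ => _) = fun x => cos (dot (m%:R *: l) x + 0)); last first.
  by apply/funext => x; rewrite dotZl addr0.
exact: cont_cos_dot.
Qed.

Definition V_reg (t : T) := \sum_(a <- Phip) k a * (k a - 1) * dot a a * wp_reg (dot a (repr t)).

Lemma potential_split (t : T) : potential Phip k p t = V0 Phip k (repr t) + V_reg t.
Proof.
rewrite /potential /V0 /V_reg -big_split; apply: eq_bigr => a _.
by rewrite wp_split /trigV mulrDr.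
Qed.

Lemma bm_V_reg : bm V_reg.
Proof.
rewrite /V_reg (_ : (fun _ => _) = fun t : T => \sum_(a <- Phip | a \in Phip)
    k a * (k a - 1) * dot a a * wp_reg (dot a (repr t))).
  apply: bm_sum => a aP; apply: bmZ; apply: bm_wp_reg.
  by apply: (root_wl Hroot); exact: (pos_root Hpos).
by apply/funext => t; rewrite [LHS]big_seq.
Qed.

Lemma pos_sum_weyl (h : R -> R) (c : 'rV[R]_n -> R) w (t : T) : weyl Phi w ->
  (forall y, h (- y) = h y) ->
  (forall l, weight_lattice Phi l -> cl_periodic Phi (fun x => h (dot l x))) ->
  (forall w a, weyl Phi w -> a \in Phi -> c (a *m w) = c a) ->
  \sum_(a <- Phip) c a * h (dot a (repr (weyl_act w t))) =
  \sum_(a <- Phip) c a * h (dot a (repr t)).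
Proof.
move=> W hN hp cw; have [w' W' [e1 e2]] := weyl_inv Hroot W.
transitivity (\sum_(a <- Phip) (fun a => c a * h (dot a (repr t))) (a *m w')); last first.
  apply: (pos_reindex Hroot Hpos) => // a aP.
  rewrite dotNl hN -(cw _ a (weyl_refl1 aP) aP) mul_reflection_mx reflection_self//.
  exact: (root_neq0 Hroot).
apply: eq_big_seq => a aP; have aPhi := pos_root Hpos aP.
rewrite cw//; congr (_ * _).
rewrite (weyl_act_repr (F := fun x => h (dot a x)) t W); last first.
  by apply: hp; exact: (root_wl Hroot).
by rewrite (dot_weyl_inv Hroot _ _ W e2).
Qed.

Lemma wDelta_weyl w (t : T) : weyl Phi w ->
  wDelta Phip k (repr (weyl_act w t)) = wDelta Phip k (repr t).
Proof.
move=> W; have [w' W' [e1 e2]] := weyl_inv Hroot W.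
pose F x a := Num.sqrt (sg (dot a x)) `^ k a.
transitivity (\prod_(a <- Phip) F (repr t) (a *m w')).
  apply: eq_big_seq => a aP; have aPhi := pos_root Hpos aP.
  rewrite /F norm_sin_half Hk// -(dot_weyl_inv Hroot _ _ W e2); congr (Num.sqrt _ `^ _).
  apply: (weyl_act_repr (F := fun x => sg (dot a x)) t W).
  by apply: periodic_sg; exact: (root_wl Hroot).
transitivity (\prod_(a <- Phip) F (repr t) a); last first.
  by apply: eq_bigr => a _; rewrite norm_sin_half.
apply: (pos_reindex Hroot Hpos) => // a aP; rewrite /F dotNl /sg cosN -/(sg _); congr (_ `^ _).
by rewrite -(Hk (weyl_refl1 aP) aP) mul_reflection_mx reflection_self// (root_neq0 Hroot).
Qed.

Lemma V_reg_weyl w (t : T) : weyl Phi w -> V_reg (weyl_act w t) = V_reg t.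
Proof.
move=> W; apply: (pos_sum_weyl (h := wp_reg)) => //.
- exact: wp_regN.
- exact: wp_reg_periodic.
by move=> v a V aP; rewrite Hk// (weyl_dot Hroot).
Qed.

End Torus.
End WeierstrassCorrection.

Lemma absz_shift (j : int) (J : nat) : (`|j| <= J)%N -> (absz (j + J%:Z)%R < 2 * J + 1)%N /\ 0 <= j + J%:Z.
Proof. by move=> jJ; split; lia. Qed.

(** * Vanishing on the walls *)

Section Near.
Context {R : realType} {V : topologicalType}.
Implicit Types (f : V -> R) (x : V).
Lemma near_lt f x (M : R) : {for x, continuous f} -> f x < M -> \forall y \near x, f y < M.
Proof. by move=> cf; apply: (@cvgr_lt _ _ (nbhs x) _ f (f x)). Qed.
Lemma near_gt f x (M : R) : {for x, continuous f} -> M < f x -> \forall y \near x, M < f y.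
Proof. by move=> cf; apply: (@cvgr_gt _ _ (nbhs x) _ f (f x)). Qed.
Lemma cont_norm f x : {for x, continuous f} -> {for x, continuous (fun y => `|f y|)}.
Proof. by move=> cf; apply: (@cvg_norm _ _ _ (nbhs x) _ f (f x)). Qed.
Lemma near_all (P : V -> Prop) x : (forall y, P y) -> \forall y \near x, P y.
Proof. exact: nearW. Qed.
End Near.

Section SineBounds.
Context {R : realType}.
Implicit Types y z : R.

Lemma sg_le_sqr z : sg z <= z ^+ 2.
Proof.
have [s _ E] := @MVT_signed R R (@sin R) (@cos R) 0 1 (z / 2) (fun y => is_derive_sin y).
move: E; rewrite sin0 add0r subr0 add0r /GRing.scale/= !mulr1 => E.
have c1 : cos s ^+ 2 <= 1 by rewrite -real_normK ?num_real// expr_le1// cos_max.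
rewrite sgE E exprMn (le_trans (ler_piMr (sqr_ge0 _) c1))//.
rewrite expr_div_n ler_pdivrMr ?exprn_gt0// ler_peMr ?sqr_ge0//.
by rewrite -natrX ler1n.
Qed.

Let sin_lb1 y : 0 <= y -> y <= 1 -> cos 1 * y <= sin y.
Proof.
move=> y0 y1; have [s sy E] := @MVT_signed R R (@sin R) (@cos R) 0 1 y (fun y => is_derive_sin y).
move: E; rewrite sin0 add0r subr0 add0r /GRing.scale/= !mulr1 => ->.
rewrite mulrC ler_wpM2l// -(cos_norm s).
have p2 := pi_ge2 R.
have s1 : `|s| <= 1 by rewrite (le_trans sy)// ger0_norm.
have [->//|ns] := eqVneq `|s| 1.
by rewrite ltW// ltr_cos ?in_itv/= ?normr_ge0 ?ler01 ?lt_neqAle ?ns//; lra.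
Qed.

(** With [y = |z| / 2], it suffices that [sin y >= (cos 1 / 2) y]. For [y <= 1] this follows from
    the mean value theorem; for [1 < y <= pi/2] from [sin y >= sin 1 >= cos 1] and [y <= 2]. *)
Lemma sg_ge_sqr z : `|z| <= pi -> cos 1 ^+ 2 / 16 * z ^+ 2 <= sg z.
Proof.
move=> zp; have c0 := @cos1_gt0 R; have c1 := cos_le1 (1 : R); have p2 := pi_ge2 R.
have zE : sg z = sin (`|z| / 2) ^+ 2 by rewrite -sgE /sg cos_norm.
have z2 : z ^+ 2 = `|z| ^+ 2 by rewrite real_normK ?num_real.
rewrite zE z2; move: (normr_ge0 z) zp; move: `|z| => y y0 yp.
rewrite (_ : cos 1 ^+ 2 / 16 * y ^+ 2 = (cos 1 / 2 * (y / 2)) ^+ 2); last by field.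
rewrite ler_sqr ?nnegrE ?mulr_ge0 ?invr_ge0 ?(ltW c0)//; last by apply: sin_ge0_pi; apply/andP; split; lra.
have [y1|y1] := leP (y / 2) 1.
  apply: le_trans (sin_lb1 _ y1); last by rewrite divr_ge0.
  by rewrite ler_wpM2r ?divr_ge0//; lra.
apply: (@le_trans _ _ (sin 1)).
  apply: le_trans (sin_lb1 ler01 (lexx 1)).
  have ph : pi / 2 <= 2 :> R by have /andP[_] := (@pihalf_02_cos_pihalf R).1.
  rewrite mulr1 -mulrA ler_piMr ?(ltW c0)//; lra.
by rewrite ltW// ltr_sin// in_itv/=; apply/andP; split; lra.
Qed.

Lemma sg_neq0 z : 0 < `|z| -> `|z| <= pi -> sg z != 0.
Proof.
move=> z0 zp; rewrite gt_eqF// (lt_le_trans _ (sg_ge_sqr zp))//.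
have z2 : 0 < z ^+ 2 by rewrite -real_normK ?num_real// exprn_gt0.
by rewrite mulr_gt0 ?divr_gt0// exprn_gt0// cos1_gt0.
Qed.

Lemma sgD_eq y z : sg z = 0 -> sg (y + z) = sg y.
Proof.
move=> /eqP; rewrite sg_eq0 => /eqP c1; rewrite /sg cosD c1.
have -> : sin z = 0 by apply/eqP; rewrite -sqrf_eq0 sin2cos2 c1 expr1n subrr.
by rewrite mulr0 subr0 mulr1.
Qed.

End SineBounds.

(** * Lower bounds for integrals near a wall *)

Section Slab.
Context {R : realType} {n : nat} (Phi : {fset 'rV[R]_n}) (mu : probability (torus Phi) R).
Hypothesis Hroot : root_system Phi.
Hypothesis Hhaar : normalized_haar mu.
Implicit Types (a b l h x y : 'rV[R]_n) (U : set 'rV[R]_n).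
Local Notation T := (torus Phi).
Local Notation Int f := (\int[mu]_(t in setT) f t)%R.
Local Notation intg f := (mu.-integrable setT (EFin \o f)).
Local Notation sqint f := (f \in Lfun mu 2%:E).

(** The saturation of an open set is the union of its translates by the lattice. *)
Lemma open_pi U : open U -> open (torus_pi Phi @` U : set T).
Proof.
move=> oU; rewrite /open/= /quotient_open.
rewrite (_ : _ @^-1` _ = \bigcup_(q in coroot_lattice Phi) ((fun x => x + (2 * pi) *: q) @^-1` U)).
  apply: bigcup_open => q _; apply: (open_comp _ oU) => x _.
  by apply: (@continuousD R 'rV[R]_n 'rV[R]_n id (cst _)) => //; exact: cst_continuous.
apply/seteqP; split=> x /=.
  move=> [y Uy /pi_eq[q qP E]]; exists q => //=.
  by rewrite -E.
move=> [q qP /= Uq]; exists (x + (2 * pi) *: q) => //.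
exact: piD.
Qed.

Lemma row_rat_dense (x : 'rV[R]_n) (r : R) : 0 < r ->
  exists y : 'rV[rat]_n, `|x - map_mx ratr y| < r.
Proof.
move=> r0.
have H i : exists q : rat, `|x 0 i - ratr q| < r.
  have [q] := @rat_in_itvoo R (x 0 i - r) (x 0 i + r) ltac:(lra).
  rewrite in_itv/= => /andP[q1 q2]; exists q; rewrite ltr_norml; apply/andP; split; lra.
exists (\row_i sval (cid (H i))).
rewrite /Num.norm/= mx_normrE bigmax_lt// => -[j i] _ /=.
by rewrite !mxE ord1; case: cid.
Qed.

(** Countably many translates of the ball cover the torus, so a null ball would make the total mass
    0. *)
Lemma ball_pos x (r : R) : 0 < r -> mu (torus_pi Phi @` ball x r) != 0%E.
Proof.
move=> r0; set B := torus_pi Phi @` ball x r; apply/eqP => B0.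
have mB : measurable B by apply: open_measurableT; apply: open_pi; exact: ball_open.
(* An enumeration of rational points [y]; translation by [x - y] brings the points near [y] into the
   ball around [x]. *)
pose h (i : nat) : 'rV[R]_n := if (choice.unpickle i : option 'rV[rat]_n) is Some y then x - map_mx ratr y else 0.
have N : mu.-negligible (\bigcup_i (translate (h i) @^-1` B)).
  apply: negligible_bigcup => i; apply/negligibleP; last by transitivity (mu B); [exact: Hhaar|].
  by rewrite -[X in measurable X]setTI; apply: (continuous_measurableTT (@translate_continuous R n Phi (h i))).
have E : \bigcup_i (translate (h i) @^-1` B) = setT.
  apply/seteqP; split=> // t _.
  have [y yr] := row_rat_dense (repr t) r0.
  exists (choice.pickle y) => //=; exists (h (choice.pickle y) + repr t); last by rewrite -translate_pi pi_repr.
  rewrite /h choice.pickleK -ball_normE /= -addrA opprD addrA subrr add0r opprD opprK addrC.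
  by rewrite addrC -opprB normrN.
move: N; rewrite E => /(negligibleP mu measurableT) m0.
by have := probability_setT mu; rewrite m0 => /eqP; rewrite eq_sym onee_eq0.
Qed.

(** The sum of the [m] translates has integral [m Int f] by invariance, and is at least [K] at every
    point of [B]. *)
Lemma averaging (f : T -> R) (B : set T) m (h : 'I_m -> 'rV[R]_n) (K : R) :
  bm f -> (forall t, 0 <= f t) -> measurable B -> 0 <= K ->
  (forall t, B t -> exists i, K <= f (translate (h i) t)) ->
  K * fine (mu B) <= m%:R * Int f.
Proof.
move=> bf f0 mB K0 H.
have bt i : bm (fun t => f (translate (h i) t)).
  have [mf [M fM]] := bf; split; last by exists M.
  by apply: (measurableT_comp mf); exact: (continuous_measurableTT (@translate_continuous R n Phi (h i))).
have b1 : bm (\1_B : T -> R).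
  split; first exact: measurable_indic.
  by exists 1 => t; rewrite indicE; case: (_ \in _); rewrite ?normr1// normr0.
have -> : K * fine (mu B) = Int (fun t => K * \1_B t).
  rewrite IntZ; last exact: bm_intg.
  by congr (_ * _); rewrite /Rintegral integral_indic// setIT.
have -> : m%:R * Int f = Int (fun t => \sum_(i < m) f (translate (h i) t)).
  rewrite Int_sum//.
  under eq_bigr => i _ do rewrite (Int_translate Hhaar (h i) bf.1 (bm_intg mu bf)).
  by rewrite sumr_const card_ord mulr_natl.
apply: Int_le; [by apply: bm_intg; exact: bmZ|by apply: bm_intg; exact: bm_sum|].
move=> t; rewrite indicE; case: (boolP (_ \in _)) => [|_].
  rewrite inE => /H[i Hi]; rewrite mulr1 (le_trans Hi)// (bigD1 i)//= lerDl.
  by apply: sumr_ge0 => j _; exact: f0.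
by rewrite mulr0; apply: sumr_ge0 => j _; exact: f0.
Qed.

(* Each point of a small ball is brought within O(1/N) of the wall, where
   |g| >= c N^2 / 4, by one of O(N) translations along a; hence the integral of
   g^2 is at least of order N^4 / N. *)
Lemma slab (g : T -> R) a x0 (c : R) : sqint g -> a != 0 -> 0 < c ->
  ~ \forall x \near x0, dot a (x - x0) != 0 -> c <= `|g (torus_pi Phi x)| * dot a (x - x0) ^+ 2.
Proof.
move=> g2 a0 c0 /nbhs_ballP[r r0 Hr].
have [mg Ig] := (sqintP mu g).1 g2.
pose M := Int (fun t => g t ^+ 2).
have M0 : 0 <= M by apply: Int_ge0 => t; exact: sqr_ge0.
have aa : dot a a != 0 by rewrite dot_eq0.
pose v := (dot a a)^-1 *: a.
have av : dot a v = 1 by rewrite /v dotZr mulVf.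
pose A := \sum_i `|a 0 i|.
have A0 : 0 <= A by apply: sumr_ge0.
have dA y : `|dot a y| <= A * `|y|.
  rewrite /dot (le_trans (ler_norm_sum _ _ _))// mulr_suml; apply: ler_sum => i _.
  rewrite normrM ler_wpM2l// /Num.norm/= mx_normrE.
  by apply: (le_bigmax _ (fun i => `|y i.1 i.2|) (0, i)).
(* Chosen so that a point within [r'] of [x0], moved along [v] by up to [A r'], stays within
   [r / 2]; the other half of [r] is for a rounding error of order [1 / N]. *)
pose r' := r / (2 * (1 + A * `|v|)).
have q0 : 0 < 1 + A * `|v| by rewrite ltr_pwDl// mulr_ge0.
have r'0 : 0 < r' by rewrite divr_gt0// mulr_gt0.
have r'E : r' + A * r' * `|v| = r / 2 by rewrite /r'; field; rewrite gt_eqF.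
pose K := Num.bound (A * r').
have KA : A * r' <= K%:R by rewrite ltW// archi_boundP// mulr_ge0// ltW.
pose B := torus_pi Phi @` ball x0 r'.
have mB : measurable B by apply: open_measurableT; apply: open_pi; exact: ball_open.
have B0 : 0 < fine (mu B).
  rewrite fine_gt0// lt0e ball_pos//= measure_ge0/=.
  by rewrite (le_lt_trans (probability_le1 mu mB))// ltry.
suff bound N : (0 < N)%N -> 4 * `|v| / r < N%:R ->
    c ^+ 2 * N%:R ^+ 4 / 16 * fine (mu B) <= (2 * (K * N + 2) + 1)%:R * M.
  (* The number of translations is at most [(2K + 5) N]. For [N] above [D] the estimate [bound]
     gives [N^4 <= D N < N^2], which is absurd. *)
  pose D := (2 * K + 5)%:R * M * 16 / (c ^+ 2 * fine (mu B)).
  have D0 : 0 < c ^+ 2 * fine (mu B) by rewrite mulr_gt0// exprn_gt0.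
  pose N := (Num.bound (4 * `|v| / r) + Num.bound D).+1.
  have N1 : 4 * `|v| / r < N%:R.
    rewrite (lt_le_trans (archi_boundP _))// ?divr_ge0 ?mulr_ge0 ?(ltW r0)//.
    by rewrite ler_nat; exact/leqW/leq_addr.
  have N2 : D < N%:R.
    rewrite (lt_le_trans (archi_boundP _))//; last by rewrite ler_nat; exact/leqW/leq_addl.
    by rewrite divr_ge0 ?(ltW D0)// !mulr_ge0.
  have Np : 1 <= N%:R :> R by rewrite ler1n.
  have b := bound N isT N1.
  have le5 : (2 * (K * N + 2) + 1)%:R <= (2 * K + 5)%:R * N%:R :> R.
    rewrite -natrM ler_nat mulnDl; have : (5 <= 5 * N)%N by rewrite leq_pmulr.
    by rewrite mulnDr mulnA -addnA leq_add2l.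
  have b2 : c ^+ 2 * N%:R ^+ 4 / 16 * fine (mu B) <= (2 * K + 5)%:R * N%:R * M.
    by rewrite (le_trans b)// ler_wpM2r.
  have b3 : c ^+ 2 * fine (mu B) * N%:R ^+ 4 <= (2 * K + 5)%:R * M * 16 * N%:R.
    by move: b2; move: (fine (mu B)) (N%:R : R) ((2 * K + 5)%:R : R) => m y z b2; nra.
  have b4 : N%:R ^+ 4 <= D * N%:R.
    by rewrite /D mulrAC ler_pdivlMr// mulrC.
  have b5 : D * N%:R < N%:R * N%:R by rewrite ltr_pM2r// (lt_le_trans ltr01).
  have := le_lt_trans b4 b5; rewrite -expr2 ltNge => /negP; apply.
  by rewrite ler_weXn2l.
move=> N0 Nr; have Np : 0 < N%:R :> R by rewrite ltr0n.
pose J := (K * N + 2)%N.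
pose K0 := c ^+ 2 * N%:R ^+ 4 / 16.
have K00 : 0 <= K0 by rewrite /K0 divr_ge0// mulr_ge0// exprn_ge0// ltW.
(* Truncation at the expected lower bound makes the function bounded, as [averaging] requires,
   without increasing its integral. *)
pose f t := Num.min K0 (g t ^+ 2).
have f0 t : 0 <= f t by rewrite /f le_min K00 sqr_ge0.
have mf : measurable_fun setT f.
  by apply: measurable_minr; [exact: measurable_cst|exact: (measurableT_comp (exprn_measurable 2))].
have bf : bm f by split => //; exists K0 => t; rewrite ger0_norm// ge_min lexx.
have fM : Int f <= M.
  by apply: Int_le => //; [exact: bm_intg|move=> t; rewrite ge_min lexx orbT].
pose h (i : 'I_(2 * J + 1)) := ((i%:R - J%:R) / N%:R) *: v.
have := @averaging f B _ h K0 bf f0 mB K00.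
move=> av'; apply: (le_trans (av' _)); last by rewrite ler_wpM2l.
move=> _ [x xB <-]; clear av'.
have xr : `|x - x0| < r' by rewrite -normrN opprB; move: xB; rewrite -ball_normE.
set d := dot a (x - x0).
have dr : `|d| <= A * r' by rewrite (le_trans (dA _))// ler_wpM2l// ltW.
(* Moves [<a, . - x0>] to the interval from [1/N] to [2/N], hence close to the wall but never onto
   it. Rounding costs at most 2, which is the 2 in [J]. *)
pose j : int := 1 - Num.floor (d * N%:R).
have /andP[j1 j2] := floor_itv (d * N%:R).
have jE : j%:~R = 1 - (Num.floor (d * N%:R))%:~R :> R by rewrite /j rmorphB.
have dN : `|d * N%:R| <= A * r' * N%:R by rewrite normrM [X in _ * X]ger0_norm// ler_wpM2r.
have jJ : `|j%:~R| <= A * r' * N%:R + 2 :> R.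
  move: dN j1 j2; rewrite jE intrD; generalize ((Num.floor (d * N%:R))%:~R : R) (d * N%:R) (A * r' * N%:R) => y z w.
  by rewrite !ler_norml => /andP[? ?] ? ?; apply/andP; split; lra.
have jJ' : `|j%:~R| <= J%:R :> R.
  rewrite (le_trans jJ)// /J natrD natrM lerD2r ler_wpM2r//.
have jJ2 : (`|j| <= J)%N.
  by rewrite -(ler_nat R) natr_absz intr_norm.
have [iP jJ0] := absz_shift jJ2.
exists (Ordinal iP); rewrite /h /=.
have -> : `|j + J%:Z|%:R - J%:R = j%:~R :> R.
  by rewrite natr_absz ger0_norm// intrD addrK.
rewrite translate_pi; set y := _ + x.
have yx : dot a (y - x0) = (1 + d * N%:R - (Num.floor (d * N%:R))%:~R) / N%:R.
  rewrite /y -addrA dotDr dotZr av mulr1 -/d jE; field; rewrite gt_eqF//.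
have y0 : 0 < dot a (y - x0).
  by rewrite yx divr_gt0//; lra.
have y2 : dot a (y - x0) <= 2 / N%:R.
  by rewrite yx ler_pM2r ?invr_gt0//; move: j2; rewrite intrD; lra.
have yr : ball x0 r y.
  rewrite -ball_normE /= -normrN opprB /y -addrA (le_lt_trans (ler_normD _ _))// normrZ.
  have e1 : `|j%:~R / N%:R| * `|v| <= A * r' * `|v| + 2 * `|v| / N%:R.
    rewrite normrM normfV [X in _ / X]ger0_norm//.
    apply: (@le_trans _ _ ((A * r' * N%:R + 2) / N%:R * `|v|)).
      by rewrite ler_wpM2r// ler_wpM2r// invr_ge0.
    rewrite [leLHS](_ : _ = A * r' * `|v| + 2 * `|v| / N%:R)//.
    by field; rewrite gt_eqF.
  have e2 : 2 * `|v| / N%:R < r / 2.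
    rewrite ltr_pdivrMr//; move: Nr; rewrite ltr_pdivrMr//; lra.
  by move: xr r'E e1 e2; lra.
have := Hr y yr; rewrite gt_eqF// => /(_ isT).
set G := `|g _| => cG.
rewrite /f le_min lexx /= -real_normK ?num_real// -/G /K0.
have z0 : 0 < dot a (y - x0) ^+ 2 by rewrite exprn_gt0.
have Gc : c / (2 / N%:R) ^+ 2 <= G.
  rewrite ler_pdivrMr ?exprn_gt0 ?divr_gt0//; apply: (le_trans cG).
  rewrite ler_wpM2l ?normr_ge0//.
  by rewrite lerXn2r//; rewrite nnegrE ?(ltW y0) ?divr_ge0 ?(ltW Np).
rewrite (_ : c ^+ 2 * N%:R ^+ 4 / 16 = (c / (2 / N%:R) ^+ 2) ^+ 2); last first.
  by field; rewrite gt_eqF.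
by rewrite ler_pXn2r// nnegrE ?normr_ge0// divr_ge0 ?(ltW c0)// exprn_ge0// divr_ge0// ltW.
Qed.

End Slab.

(** * Vanishing of domain functions to second order *)

Section Vanishing.
Context {R : realType} {n : nat} (Phi Phip : {fset 'rV[R]_n}) (mu : probability (torus Phi) R)
  (k : 'rV[R]_n -> R) (p : R).
Hypothesis Hroot : root_system Phi.
Hypothesis Hhaar : normalized_haar mu.
Hypothesis Hpos : positive_roots Phi Phip.
Hypothesis p1 : -1 < p.
Hypothesis p2 : p < 1.
Implicit Types (a b l h x y v : 'rV[R]_n).
Local Notation T := (torus Phi).
Local Notation sqint f := (f \in Lfun mu 2%:E).

(** Near the wall the pole [|kap| / (4 sg)] exceeds twice the bound [M] of the rest, so half of it
    survives. *)
Lemma pole_bound (Q rest : 'rV[R]_n -> R) (kap M : R) a x0 : kap != 0 -> 0 < M ->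
  sg (dot a x0) = 0 ->
  (forall x, Q x = kap * (4 * sg (dot a x))^-1 + rest x) ->
  (\forall x \near x0, `|rest x| <= M) ->
  \forall x \near x0, sg (dot a x) != 0 -> `|kap| / 8 / sg (dot a x) <= `|Q x|.
Proof.
move=> k0 M0 s0 QE rM.
have kp : 0 < `|kap| by rewrite normr_gt0.
have sM : \forall x \near x0, sg (dot a x) < `|kap| / (8 * M).
  apply: near_lt; first exact: cont_sg_dot.
  by rewrite s0 divr_gt0// mulr_gt0.
move: rM sM; apply: filterS2 => x rx sx sn0.
have sp : 0 < sg (dot a x) by rewrite lt_def sn0 sg_ge0.
rewrite QE (le_trans _ (lerB_normD _ _))// normrM normfV [X in _ <= _ / X - _]ger0_norm ?mulr_ge0 ?(ltW sp)//.
rewrite lerBrDr (le_trans (lerD (lexx _) rx))//.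
have : M <= `|kap| / 8 / sg (dot a x).
  rewrite ler_pdivlMr// ler_pdivlMr//; move: sx; rewrite ltr_pdivlMr ?mulr_gt0//.
  by move=> /ltW; rewrite [in X in X -> _]mulrA mulrC mulrA.
have -> : `|kap| / (4 * sg (dot a x)) = `|kap| / 8 / sg (dot a x) + `|kap| / 8 / sg (dot a x).
  by field; rewrite gt_eqF.
by rewrite lerD2l.
Qed.

Section Function.
Variable u : 'rV[R]_n -> R.
Hypothesis cu : continuous u.
Hypothesis pu : cl_periodic Phi u.

(** If [u x0] were nonzero, [|Q u|] would be at least a multiple of [1 / sg] near [x0], hence of the
    inverse square of the distance to the wall; [slab] excludes this for a square integrable
    function. *)
Lemma vanish_generic (Q : 'rV[R]_n -> R) a x0 (c : R) : a \in Phip -> cl_periodic Phi Q ->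
  sqint (fun t : T => Q (repr t) * u (repr t)) -> sg (dot a x0) = 0 -> 0 < c ->
  (\forall x \near x0, sg (dot a x) != 0 -> c / sg (dot a x) <= `|Q x|) -> u x0 = 0.
Proof.
move=> aP pQ Qu s0 c0 HQ; apply/eqP/negPn/negP => u0.
have a0 := root_neq0 Hroot (pos_root Hpos aP).
pose eta := `|u x0| / 2.
have e0 : 0 < eta by rewrite divr_gt0// normr_gt0.
have := @slab R n Phi mu Hhaar _ a x0 (c * eta) Qu a0 (mulr_gt0 c0 e0); apply.
have ue : \forall x \near x0, eta < `|u x|.
  apply: (near_gt (f := fun x => `|u x|)); first by apply: (@cont_norm _ _ u); exact: cu.
  by rewrite /eta; have : 0 < `|u x0| by [rewrite normr_gt0]; lra.
have dp : \forall x \near x0, `|dot a (x - x0)| < pi.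
  have cd : continuous (fun x => `|dot a x - dot a x0|).
    have cd : continuous (fun x => dot a x - dot a x0).
      by apply: contB; [exact: continuous_dot|exact: cont_cst].
    by move=> x; apply: (@cont_norm _ _ (fun y => dot a y - dot a x0)); exact: cd.
  have : \forall x \near x0, `|dot a x - dot a x0| < pi.
    apply: near_lt; first exact: cd.
    by rewrite subrr normr0 pi_gt0.
  by apply: filterS => x; rewrite dotBr.
move: HQ ue dp; apply: filterS3 => x Hx ux dx d0.
have sE : sg (dot a x) = sg (dot a (x - x0)).
  by rewrite -(sgD_eq (dot a (x - x0)) s0) -dotDr subrK.
have sn : sg (dot a x) != 0 by rewrite sE sg_neq0 ?normr_gt0// ltW.
have sp : 0 < sg (dot a x) by rewrite lt_def sn sg_ge0.
rewrite (periodic_repr (F := fun x => Q x * u x)); last by move=> y q qP; rewrite pQ// pu.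
have s2 : sg (dot a x) <= dot a (x - x0) ^+ 2 by rewrite sE sg_le_sqr.
apply: (@le_trans _ _ (c / sg (dot a x) * eta * sg (dot a x))).
  by rewrite mulrAC mulfVK.
apply: le_trans (ler_wpM2l (normr_ge0 _) s2); apply: (ler_wpM2r (ltW sp)).
rewrite normrM; apply: ler_pM; [by apply: divr_ge0; apply: ltW|exact: ltW|exact: Hx|exact: ltW].
Qed.

(** Points of the wall of [a] lying on no other wall are dense in it: one moves from [x0] along a
    vector orthogonal to [a] but to no other positive root. Continuity of [u] then concludes. *)
Lemma wall_generic a x0 : a \in Phip -> sg (dot a x0) = 0 ->
  (forall x, sg (dot a x) = 0 -> (forall b, b \in (Phip : seq _) -> b != a -> sg (dot b x) != 0) -> u x = 0) ->
  u x0 = 0.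
Proof.
move=> aP s0 H; have a0 := root_neq0 Hroot (pos_root Hpos aP).
have aa : dot a a != 0 by rewrite dot_eq0.
have [v av bv] : exists2 v, dot a v = 0 & {in rem a Phip, forall b, dot b v != 0}.
  apply: (@regular_vector R n _ [set v | dot a v = 0]).
  - by rewrite /= dot0r.
  - by move=> x y m /= ax ay; rewrite dotDr -scaler_nat dotZr ax ay mulr0 addr0.
  move=> b; rewrite mem_rem_uniq ?fset_uniq// inE => /andP[ba bP].
  pose c := dot b a / dot a a; exists (b - c *: a) => /=.
    by rewrite dotBr dotZr /c (dotC b a) mulfVK// subrr.
  have y0 : b - c *: a != 0.
    rewrite subr_eq0; apply: contra ba => /eqP bE; apply/eqP.
    exact: (pos_not_parallel Hroot Hpos aP bP bE).
  have -> : dot b (b - c *: a) = dot (b - c *: a) (b - c *: a).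
    rewrite [RHS]dotBl dotZl (_ : dot a (b - c *: a) = 0) ?mulr0 ?subr0//.
    by rewrite dotBr dotZr /c (dotC b a) mulfVK// subrr.
  by rewrite dot_eq0.
apply/eqP/negPn/negP => u0.
pose y (m : nat) := x0 + m.+1%:R^-1 *: v.
have cy : y m @[m --> \oo] --> x0.
  rewrite -[X in _ --> X]addr0 -(scale0r v); apply: cvgD; first exact: cvg_cst.
  by apply: cvgZl; exact: cvg_harmonic.
have un : \forall m \near \oo, u (y m) != 0.
  have : \forall m \near \oo, 0 < `|u (y m)|.
    apply: (@cvgr_gt _ _ _ _ (fun m => `|u (y m)|) `|u x0|); last by rewrite normr_gt0.
    by apply: cvg_norm; apply: (@cvg_comp _ _ _ y u _ (nbhs x0)) => //; exact: cu.
  by apply: filterS => m; rewrite normr_gt0.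
have bn : \forall m \near \oo, forall b, b \in (rem a Phip : seq _) -> sg (dot b (y m)) != 0.
  apply: near_seq => b bR; have [sb|sb] := eqVneq (sg (dot b x0)) 0; last first.
    have : \forall m \near \oo, 0 < sg (dot b (y m)).
      apply: (@cvgr_gt _ _ _ _ (fun m => sg (dot b (y m))) (sg (dot b x0))); last by rewrite lt_def sb sg_ge0.
      by apply: (@cvg_comp _ _ _ y (fun x => sg (dot b x)) _ (nbhs x0)) => //; exact: cont_sg_dot.
    by apply: filterS => m; apply: lt0r_neq0.
  have : \forall m \near \oo, `|m.+1%:R^-1 * dot b v| < pi.
    apply: (@cvgr_lt _ _ _ _ (fun m : nat => `|m.+1%:R^-1 * dot b v|) `|0 * dot b v|); last by rewrite mul0r normr0 pi_gt0.
    by apply: cvg_norm; apply: cvgM; [exact: cvg_harmonic|exact: cvg_cst].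
  apply: filterS => m mp; rewrite /y dotDr dotZr addrC sgD_eq// sg_neq0 ?(ltW mp)//.
  by rewrite normr_gt0 mulf_neq0// bv.
suff : \forall m \near \oo, False by case/filter_ex.
move: un bn; apply: filterS2 => m um bm; move/negP: um; apply; apply/eqP/H.
  by rewrite /y dotDr dotZr av mulr0 addr0.
by move=> b bP ba; apply: bm; rewrite mem_rem_uniq ?fset_uniq// inE ba.
Qed.

Lemma V0_periodic : cl_periodic Phi (V0 Phip k).
Proof.
move=> x q qP; apply: eq_big_seq => a aP; rewrite /trigV.
by rewrite (periodic_sg (root_wl Hroot (pos_root Hpos aP)) x qP).
Qed.

(** Away from the other walls only the term of [a] has a pole. If [k a = 1] the potential has no
    pole on this wall, and the extra clause of the domain about [wp] takes its place. *)
Lemma vanish_wall a x0 : a \in Phip -> k a != 0 -> sg (dot a x0) = 0 ->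
  sqint (fun t : T => potential Phip k p t * u (repr t)) ->
  (k a = 1 -> sqint (fun t : T => wp p (dot a (repr t)) * u (repr t))) ->
  u x0 = 0.
Proof.
move=> aP ka s0 Vu wu; have aPhi := pos_root Hpos aP; have aw := root_wl Hroot aPhi.
have aa : dot a a != 0 by rewrite dot_eq0 (root_neq0 Hroot).
apply: (wall_generic aP s0) => x sx bx; have [k1|k1] := eqVneq (k a) 1.
  have [M HM] := wp_reg_bounded p1 p2.
  have M0 : 0 <= M by exact: le_trans (HM 0).
  apply: (@vanish_generic (fun x => wp p (dot a x)) a x (`|1| / 8) aP) => //.
  - by move=> y q qP; rewrite !wp_split (periodic_sg aw)// (wp_reg_periodic _ aw).
  - exact: wu.
  - by rewrite normr1 divr_gt0.
  apply: (@pole_bound _ (fun x => - 12^-1 + wp_reg p (dot a x)) 1 (1 + M)) => //.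
  - by rewrite ltr_pwDl.
  - by move=> y; rewrite wp_split mul1r addrA.
  apply: near_all => y; rewrite (le_trans (ler_normD _ _))// lerD// normrN ger0_norm//.
  by rewrite invf_le1// ler1n.
have [_ [M HM]] := bm_V_reg p1 p2 k Hroot Hpos.
pose kap := k a * (k a - 1) * dot a a.
have kap0 : kap != 0 by rewrite !mulf_neq0// subr_eq0.
pose Vt y := \sum_(b <- Phip | b != a) k b * (k b - 1) * dot b b * trigV b y.
have VtE y : V0 Phip k y = kap * (4 * sg (dot a y))^-1 - kap / 12 + Vt y.
  by rewrite /V0 (bigD1_seq a)//= ?fset_uniq// /trigV -/(Vt y) mulrBr.
have cVt : {for x, continuous Vt}.
  rewrite /Vt /prop_for /continuous_at -big_filter.
  under eq_fun do rewrite -big_filter.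
  apply: (@cvg_bigsum _ _ _ (nbhs_filter x)) => b; rewrite mem_filter => /andP[ba bP].
  apply: cvgM; first exact: cvg_cst.
  apply: cvgB; last exact: cvg_cst.
  apply: cvgV; first by rewrite mulf_neq0// bx.
  by apply: cvgM; [exact: cvg_cst|exact: cont_sg_dot].
have VtM : \forall y \near x, `|Vt y| < `|Vt x| + 1.
  apply: (near_lt (f := fun y => `|Vt y|)); first exact: cont_norm.
  by rewrite ltrDl.
have M0 : 0 <= M by exact: le_trans (HM (torus_pi Phi x)).
pose Q y := potential Phip k p (torus_pi Phi y).
apply: (@vanish_generic Q a x (`|kap| / 8) aP) => //.
- by move=> y q qP; rewrite /Q piD.
- rewrite (_ : (fun _ => _) = fun t : T => potential Phip k p t * u (repr t))//.
  by apply/funext => t; rewrite /Q pi_repr.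
- by rewrite divr_gt0// normr_gt0.
apply: (@pole_bound _ (fun y => - (kap / 12) + Vt y + V_reg p Phip k (torus_pi Phi y)) kap (`|kap / 12| + (`|Vt x| + 1) + M)) => //.
- by rewrite ltr_pwDl// ltr_wpDl// ltr_wpDl.
- by move=> y; rewrite /Q potential_split (periodic_repr _ V0_periodic) VtE !addrA.
move: VtM; apply: filterS => y /ltW yM.
by rewrite (le_trans (ler_normD _ _))// lerD// (le_trans (ler_normD _ _))// lerD// normrN.
Qed.

(* Along a line orthogonal to a wall, an invariant function is even about the
   wall; since it vanishes there, it is bounded by the square of the distance. *)
Lemma wall_quadratic (D K : 'rV[R]_n -> R) a (M : R) : a \in Phip ->
  (forall x, u (reflection a x) = u x) ->
  (forall x, is_derive x a u (D x)) -> (forall x, is_derive x a D (K x)) ->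
  (forall x, `|K x| <= M) ->
  (forall x, sg (dot a x) = 0 -> u x = 0) ->
  exists2 C, 0 <= C & forall x, `|u x| <= C * sg (dot a x).
Proof.
move=> aP ur dD dK KM u0; have a0 := root_neq0 Hroot (pos_root Hpos aP).
have aa : dot a a != 0 by rewrite dot_eq0.
have aa0 : 0 < dot a a by rewrite dot_gt0.
have M0 : 0 <= M by exact: le_trans (KM 0).
have cp : 0 < cos 1 ^+ 2 / 16 :> R by rewrite divr_gt0// exprn_gt0// cos1_gt0.
exists (M / dot a a ^+ 2 / (cos 1 ^+ 2 / 16)).
  by rewrite divr_ge0 ?(ltW cp)// divr_ge0// sqr_ge0.
(* [2 pi m] is the multiple of [2 pi] nearest to [<a, x>], and [x'] is the orthogonal projection of
   [x] on the corresponding affine wall. *)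
move=> x; pose y := dot a x; pose m : int := Num.floor (y / (2 * pi) + 2^-1).
have pi0 := pi_gt0 R.
pose z := y - 2 * pi * m%:~R.
have zpi : `|z| <= pi.
  have /andP[] := floor_itv (y / (2 * pi) + 2^-1); rewrite -/m intrD => m1 m2.
  have yE : y = y / (2 * pi) * (2 * pi) by rewrite mulfVK// gt_eqF// mulr_gt0.
  move: m1 m2; rewrite /z {3}yE; move: (y / (2 * pi)) (m%:~R : R) => w m' m1 m2.
  by rewrite ler_norml; apply/andP; split; nra.
pose s := z / dot a a; pose x' := x - s *: a.
have ax' : dot a x' = 2 * pi * m%:~R.
  by rewrite dotBr dotZr /s mulfVK// -/y /z; ring.
have sgm (w : R) : sg (w + 2 * pi * m%:~R) = sg w.
  rewrite /sg; congr ((1 - _) / 2).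
  have cosN' (N : nat) (c : R) : cos (c + 2 * pi * N%:R) = cos c :> R.
    by rewrite mulr_natr [2 * pi]mulr_natl; apply: (periodicn (@cosD2pi R)).
  case: (m) => N; first exact: cosN'.
  by rewrite NegzE mulrNz mulrN -[LHS](cosN' N.+1) subrK.
have ux' : u x' = 0 by apply: u0; rewrite ax' -(add0r (_ * _)) sgm /sg cos0 subrr mul0r.
(* The reflection about the affine wall through [x'] is the linear one followed by a translation in
   [2 pi Q^vee], and [u] is invariant under both. *)
have even r : u (x' - r *: a) = u (x' + r *: a).
  rewrite -[RHS]ur reflectionE dotDl dotZl dot_coroot// /coroot dotZr (dotC x' a) ax'.
  have -> : x' + r *: a - (2 / dot a a * (2 * pi * m%:~R) + r * 2) *: a =
      x' - r *: a + (2 * pi) *: (coroot a *~ (- m)).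
    rewrite -[coroot a *~ _]scaler_int /coroot !scalerA -!addrA; congr (_ + _).
    rewrite -!scaleNr -!scalerDl; congr (_ *: _); rewrite mulrNz; field.
    by [].
  by rewrite pu//; apply: clZ; exact: (cl_coroot (pos_root Hpos aP)).
have xE : x = x' + s *: a by rewrite subrK.
(* As [u] vanishes at [x'] and is even about it, expanding [u x] in both directions and adding gives
   [s] times a difference of two first derivatives, hence a second derivative. *)
have [s1 s1s E1] := MVT_signed x' s dD.
have [s2 s2s E2] := MVT_signed x' (- s) dD.
rewrite ux' subr0 in E1 E2; rewrite -xE in E1.
rewrite scaleNr even -xE in E2.
have [s3 _ E3] := MVT_signed (x' + s2 *: a) (s1 - s2) dK.
have xx : x' + s2 *: a + (s1 - s2) *: a = x' + s1 *: a.
  by rewrite -addrA -scalerDl [s2 + _]addrC subrK.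
rewrite xx in E3.
have uE : 2 * u x = s * ((s1 - s2) * K (x' + s2 *: a + s3 *: a)).
  by rewrite -E3 mulrBr -E1 -mulNr -E2; ring.
have ub : `|u x| <= M * s ^+ 2.
  rewrite -(@ler_pM2l _ 2)// -[X in X * _ <= _]normr_nat -normrM uE normrM [X in _ * X <= _]normrM.
  have s12 : `|s1 - s2| <= 2 * `|s|.
    by rewrite (le_trans (ler_normB _ _))// mulr_natl mulr2n lerD// -[leRHS]normrN.
  apply: (@le_trans _ _ (`|s| * (2 * `|s| * M))).
    by rewrite ler_wpM2l// ler_pM.
  rewrite -[s ^+ 2]real_normK ?num_real// le_eqVlt; apply/orP; left; apply/eqP.
  by move: `|s| => r; ring.
have zs : z ^+ 2 <= sg (dot a x) / (cos 1 ^+ 2 / 16).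
  rewrite ler_pdivlMr// mulrC.
  have -> : sg (dot a x) = sg z by rewrite -(sgm z) /z subrK.
  exact: sg_ge_sqr.
apply: (le_trans ub); rewrite -(mulrAC _ (sg _)) -mulrA.
rewrite (_ : M * s ^+ 2 = M / dot a a ^+ 2 * z ^+ 2); last by rewrite /s; field.
by apply: ler_wpM2l => //; rewrite divr_ge0// sqr_ge0.
Qed.

End Function.
End Vanishing.

Lemma cont_eps {R : realType} {V : normedModType R} (f : V -> R) x :
  (forall eps, 0 < eps -> exists2 r, 0 < r & forall y, `|x - y| < r -> `|f x - f y| < eps) ->
  {for x, continuous f}.
Proof.
move=> H; apply/(@cvgrPdist_lt _ _ _ (nbhs x)) => eps /H[r r0 Hr].
by apply/nbhs_ballP; exists r => // y; rewrite -ball_normE /=; exact: Hr.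
Qed.

(** * Continuously differentiable functions *)

Section Smooth.
Context {R : realType} {n : nat}.
Implicit Types (x v : 'rV[R]_n) (u : 'rV[R]_n -> R).
Local Notation e i := (delta_mx 0 i : 'rV[R]_n).

Lemma C1_is_derive u i x : C1 u -> is_derive x (e i) u (part i u x).
Proof. by move=> /(_ i)[du _]; exact: derivableP. Qed.

Lemma C1_grad u x v : C1 u -> is_derive x v u (grad (fun i => part i u) v x).
Proof.
move=> cu; apply: (@C1_directional R n u (fun i => part i u)) => [i|i y]; first by have [] := cu i.
exact: C1_is_derive.
Qed.

Lemma C1_continuous u : C1 u -> continuous u.
Proof.
move=> cu x; pose G y := \sum_i `|part i u y|.
have cG : {for x, continuous G}.
  rewrite /G; apply: (@cont_sum _ _ _ _ xpredT (fun i y => `|part i u y|)) => i _ y.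
  by apply: (@cont_norm _ _ (part i u)); have [_] := cu i; apply.
have : \forall y \near x, G y < G x + 1 by apply: near_lt => //; rewrite ltrDl.
move=> /nbhs_ballP[r r0 Hr].
have G0 y : 0 <= G y by apply: sumr_ge0.
apply: cont_eps => eps eps0; exists (Num.min r (eps / (G x + 2))).
  by rewrite /= lt_min r0 divr_gt0// ltr_wpDl.
move=> y; rewrite lt_min => /andP[yr ye].
pose h := y - x.
have hn : `|h| = `|x - y| by rewrite /h -normrN opprB.
have [s s1 E] := MVT_signed x 1 (fun z => C1_grad z h cu).
rewrite scale1r mul1r (_ : x + h = y) in E; last by rewrite /h addrC subrK.
rewrite -normrN opprB E /grad (le_lt_trans (ler_norm_sum _ _ _))//.
have sr : ball x r (x + s *: h).
  rewrite -ball_normE /= opprD addrA subrr add0r normrN normrZ hn.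
  rewrite (le_lt_trans _ yr)// ler_piMl//; by rewrite normr1 in s1.
have := Hr _ sr => Gs.
apply: (@le_lt_trans _ _ (`|h| * G (x + s *: h))).
  rewrite mulr_sumr; apply: ler_sum => i _; rewrite normrM ler_wpM2r//.
  rewrite /Num.norm/= mx_normrE.
  by apply: (le_bigmax _ (fun i => `|h i.1 i.2|) (0, i)).
rewrite hn; move: ye; rewrite ltr_pdivlMr; last by rewrite ltr_wpDl.
apply: le_lt_trans; rewrite ler_wpM2l// (le_trans (ltW Gs))// lerD2l.
by rewrite ler1n.
Qed.

Lemma C2_jet u : C2 u -> jet u (fun i => part i u) (fun i => part i (part i u)).
Proof.
move=> [c1 c2]; split.
- exact: C1_continuous.
- by move=> i; have [] := c1 i.
- by move=> i; have [] := c2 i i.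
by move=> i x; split; exact: C1_is_derive.
Qed.

Lemma lap_laplacian u x : lap (fun i => part i (part i u)) x = laplacian u x.
Proof. by []. Qed.

End Smooth.

Section DomainBound.
Context {R : realType} {n : nat} (Phi Phip : {fset 'rV[R]_n}) (mu : probability (torus Phi) R)
  (k : 'rV[R]_n -> R) (p : R).
Hypothesis Hroot : root_system Phi.
Hypothesis Hhaar : normalized_haar mu.
Hypothesis Hpos : positive_roots Phi Phip.
Hypothesis p1 : -1 < p.
Hypothesis p2 : p < 1.
Local Notation T := (torus Phi).
Local Notation sqint f := (f \in Lfun mu 2%:E).

Lemma domain_bound (u : 'rV[R]_n -> R) : C2 u -> cl_periodic Phi u ->
  (forall w, weyl Phi w -> forall x, u (x *m w) = u x) ->
  sqint (fun t : T => potential Phip k p t * u (repr t)) ->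
  (forall a, a \in Phip -> k a = 1 -> sqint (fun t : T => wp p (dot a (repr t)) * u (repr t))) ->
  exists2 C, 0 <= C & forall a, a \in Phip -> k a != 0 -> forall x, `|u x| <= C * sg (dot a x).
Proof.
move=> [c1 c2] pu uW Vu wu; have cu := C1_continuous c1.
have per F v (cF : C1 F) : cl_periodic Phi F -> cl_periodic Phi (grad (fun i => part i F) v).
  move=> pF; have cG : continuous (grad (fun i => part i F) v).
    by apply: cont_sum => i _; apply: contZ; have [] := cF i.
  by have [] := IT_derive Hroot Hhaar pF (C1_continuous cF) cG (fun x => C1_grad x v cF).
have perp F i (cF : C1 F) : cl_periodic Phi F -> cl_periodic Phi (part i F).
  move=> pF; have cG : continuous (part i F) by have [] := cF i.
  by have [] := IT_derive Hroot Hhaar pF (C1_continuous cF) cG (fun x => C1_is_derive i x cF).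
have one a : a \in Phip -> k a != 0 -> exists2 C, 0 <= C & forall x, `|u x| <= C * sg (dot a x).
  move=> aP ka.
  pose K x := \sum_i a 0 i * grad (fun j => part j (part i u)) a x.
  have cK : continuous K.
    by apply: cont_sum => i _; apply: contZ; apply: cont_sum => j _; apply: contZ; have [] := c2 i j.
  have pK : cl_periodic Phi K.
    by move=> x q qP; apply: eq_bigr => i _; rewrite (per _ _ (c2 i) (perp _ i c1 pu)).
  have [M KM] := periodic_bounded Hroot cK pK.
  apply: (@wall_quadratic _ _ _ _ Hroot Hpos u pu (grad (fun i => part i u) a) K a M) => //.
  - by move=> x; rewrite -mul_reflection_mx uW//; exact: (weyl_refl1 (pos_root Hpos aP)).
  - by move=> x; exact: C1_grad.
  - move=> x; apply: is_derive_sum => i; apply: is_derive_scale; exact: C1_grad.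
  move=> x sx; apply: (@vanish_wall _ _ _ _ mu k p Hroot Hhaar Hpos p1 p2 u cu pu a x aP ka sx Vu).
  by move=> k1; exact: wu.
have /choice[C CP] : forall a, exists c : R, a \in Phip -> k a != 0 ->
    0 <= c /\ forall x, `|u x| <= c * sg (dot a x).
  move=> a; have [aP|] := boolP (a \in Phip); last by exists 0.
  have [ka|ka] := boolP (k a != 0); last by exists 0.
  by have [c c0 uc] := one a aP ka; exists c.
exists (\sum_(a <- Phip) `|C a|); first exact: sumr_ge0.
move=> a aP ka x; have [C0 Cx] := CP a aP ka.
rewrite (le_trans (Cx x))// ler_wpM2r ?sg_ge0// (le_trans (ler_norm _))//.
by rewrite (big_rem a)//= lerDl; apply: sumr_ge0.
Qed.

End DomainBound.

(** * Approximation by trigonometric polynomials *)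

Section LatticeBasis.
Context {R : realType} {n : nat} (Phi : {fset 'rV[R]_n}).
Hypothesis Hroot : root_system Phi.
Implicit Types (a b l x q : 'rV[R]_n).

Lemma independent_roots : exists2 A : 'M[R]_n, A \in unitmx & forall i, row i A \in Phi.
Proof.
pose X : 'M[R]_(size Phi, n) := \matrix_(i < size Phi) Phi`_i.
have fX : row_full X.
  rewrite -sub1mx; apply/row_subP => i; have [c ->] := root_span Hroot (row i 1%:M).
  rewrite big_seq; apply: summx_sub => a aP.
  rewrite scalerA; apply: scalemx_sub.
  have ia : (index a Phi < size Phi)%N by rewrite index_mem.
  have -> : a = row (Ordinal ia) X by rewrite rowK nth_index.
  exact: row_sub.
exists (rowsub (fullrankfun fX) X); first exact: fullrowsub_unit.
by move=> i; rewrite row_rowsub rowK mem_nth.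
Qed.

(** Expansion along the replaced row. It gives the factor by which a determinant changes when one
    basis vector is replaced by a combination of the basis. *)
Lemma det_row_replace (v : 'rV[R]_n) (j : 'I_n) :
  \det (\matrix_(i < n) (if i == j then v else row i (1%:M : 'M[R]_n))) = v 0 j.
Proof.
set M := \matrix_(i < n) _; rewrite (expand_det_row _ j).
have E i : cofactor M j i = \adj (1%:M : 'M[R]_n) i j.
  rewrite [RHS]mxE; rewrite /cofactor; congr (_ * \det _); apply/matrixP => r c.
  by rewrite !mxE eq_sym (negPf (neq_lift _ _)) !mxE.
have A1 : \adj (1%:M : 'M[R]_n) = 1%:M by rewrite -[LHS]mulmx1 mul_adj_mx det1.
under eq_bigr do rewrite E A1.
rewrite (bigD1 j)//= big1 ?addr0 => [|i ij]; first by rewrite !mxE eqxx mulr1.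
by rewrite !mxE (negPf ij) mulr0.
Qed.

(* Among the n-tuples of independent vectors of the lattice, one with |det| minimal
   is a basis. *)
Lemma lattice_basis : exists2 B : 'M[R]_n, B \in unitmx &
  (forall i, coroot_lattice Phi (row i B)) /\
  (forall q, coroot_lattice Phi q -> forall j, (q *m invmx B) 0 j \is a Num.int).
Proof.
have [A uA AP] := independent_roots.
(* Pairings of roots with lattice vectors are integers. Multiplied by the fixed number [det A],
   determinants of lattice vectors become integers, so a minimal nonzero absolute value exists. *)
have detZ (B : 'M[R]_n) : (forall i, coroot_lattice Phi (row i B)) ->
    exists m : int, \det B * \det A = m%:~R.
  move=> BP; have H i j : (B *m A^T) i j \is a Num.int.
    have -> : (B *m A^T) i j = dot (row j A) (row i B).
      by rewrite mxE /dot; apply: eq_bigr => l _; rewrite !mxE mulrC.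
    have [m ->] := wl_cl (root_wl Hroot (AP j)) (BP i); exact: intr_int.
  have [M ME] : exists M : 'M[int]_n, B *m A^T = map_mx intr M.
    exists (\matrix_(i, j) Num.floor ((B *m A^T) i j)); apply/matrixP => i j.
    by rewrite [RHS]mxE [X in _ = X%:~R]mxE floorK.
  by exists (\det M); rewrite -(det_tr A) -det_mulmx ME det_map_mx.
pose P (N : nat) := `[< exists2 B : 'M[R]_n, (forall i, coroot_lattice Phi (row i B)) &
   (0 < N)%N /\ `|\det B * \det A| = N%:R >].
have PE : exists N, P N.
  pose B := \matrix_(i < n) coroot (row i A).
  have BP i : coroot_lattice Phi (row i B) by rewrite rowK; exact: cl_coroot.
  have [m mE] := detZ B BP; exists `|m|%N; apply/asboolP; exists B => //.
  split; last by rewrite mE natr_absz intr_norm.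
  have dA : \det A != 0 by rewrite -unitfE -unitmxE.
  have dB : \det B != 0.
    have -> : B = diag_mx (\row_i (2 / dot (row i A) (row i A))) *m A.
      by apply/matrixP => i j; rewrite mul_diag_mx /coroot !mxE.
    rewrite det_mulmx mulf_neq0// det_diag; apply/prodf_neq0 => i _.
    by rewrite mxE mulf_neq0// invr_neq0// dot_eq0 (root_neq0 Hroot).
  by rewrite absz_gt0 -(intr_eq0 R) -mE mulf_neq0.
case: (ex_minnP PE) => N /asboolP[B BP [N0 BN]] Nmin.
have uB : B \in unitmx.
  rewrite unitmxE unitfE; apply: contraTneq N0 => B0.
  by move: BN; rewrite B0 mul0r normr0 => /esym/eqP; rewrite pnatr_eq0 => /eqP ->.
exists B => //; split => // q qP j.
set c := q *m invmx B; apply/negPn/negP => cj.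
pose v : 'rV[R]_n := \row_i (c 0 i - (Num.floor (c 0 i))%:~R).
have v01 i : 0 <= v 0 i < 1.
  rewrite mxE; have /andP[m1 m2] := floor_itv (c 0 i).
  by rewrite subr_ge0 m1 ltrBlDr addrC -[X in _ + X]/(1%:~R) -intrD.
have vj : 0 < v 0 j.
  rewrite lt_def (andP (v01 j)).1 andbT mxE subr_eq0; apply: contra cj => /eqP ->.
  exact: intr_int.
have vP : coroot_lattice Phi (v *m B).
  have -> : v *m B = q - \sum_i row i B *~ Num.floor (c 0 i).
    have -> : v = c - \row_i (Num.floor (c 0 i))%:~R by apply/rowP => i; rewrite !mxE.
    rewrite mulmxBl /c mulmxKV//; congr (_ - _).
    rewrite mulmx_sum_row; apply: eq_bigr => i _.
    by rewrite mxE scaler_int.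
  apply: clD => //; apply: clN.
  suff H (s : seq 'I_n) : coroot_lattice Phi (\sum_(i <- s) row i B *~ Num.floor (c 0 i)) by exact: H.
  elim: s => [|i s IH]; first by rewrite big_nil; exact: cl0.
  by rewrite big_cons; apply: clD => //; exact: clZ.
(* Replacing the row [j] of [B] by the lattice vector with the fractional coordinates [v] multiplies
   the determinant by [v 0 j], strictly between 0 and 1, against minimality. *)
pose M : 'M[R]_n := \matrix_(i < n) (if i == j then v else row i 1%:M).
have MB i : coroot_lattice Phi (row i (M *m B)).
  by rewrite row_mul rowK; case: eqP => // _; rewrite -row_mul mul1mx.
have [m mE] := detZ _ MB.
have lt : `|\det (M *m B) * \det A| < N%:R.
  rewrite det_mulmx det_row_replace -mulrA normrM BN ger0_norm ?(ltW vj)//.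
  by rewrite gtr_pMl ?ltr0n// (andP (v01 j)).2.
have m0 : (0 < `|m|)%N.
  rewrite absz_gt0 -(intr_eq0 R) -mE det_mulmx det_row_replace -mulrA.
  have BA : \det B * \det A != 0 by rewrite -normr_eq0 BN pnatr_eq0 -lt0n.
  by apply: mulf_neq0 => //; rewrite gt_eqF.
have : P `|m|%N.
  by apply/asboolP; exists (M *m B) => //; split => //; rewrite mE natr_absz intr_norm.
move=> /Nmin; rewrite leqNgt => /negP; apply.
by rewrite -(ltr_nat R) natr_absz intr_norm -mE.
Qed.

Lemma dual_basis : exists b lam : 'I_n -> 'rV[R]_n,
  [/\ forall i, coroot_lattice Phi (b i), forall i, weight_lattice Phi (lam i) &
      forall x, x = \sum_i dot (lam i) x *: b i].
Proof.
have [B uB [BP qB]] := lattice_basis.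
have dE j x : dot (row j (invmx B)^T) x = (x *m invmx B) 0 j.
  by rewrite /dot mxE; apply: eq_bigr => i _; rewrite !mxE mulrC.
exists (fun i => row i B), (fun j => row j (invmx B)^T); split => //.
  by move=> j a aP; rewrite dE; apply: qB; exact: cl_coroot.
move=> x; rewrite -[LHS](mulmxKV uB) mulmx_sum_row.
by apply: eq_bigr => i _; rewrite dE.
Qed.

End LatticeBasis.

Lemma mod_2pi {R : realType} (y : R) : exists (m : int) (z : R),
  [/\ y = z + 2 * pi * m%:~R, `|z| <= pi & sg y = sg z].
Proof.
pose m : int := Num.floor (y / (2 * pi) + 2^-1); have pi0 := pi_gt0 R.
exists m, (y - 2 * pi * m%:~R); split; first by rewrite subrK.
  have /andP[] := floor_itv (y / (2 * pi) + 2^-1); rewrite -/m intrD => m1 m2.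
  have yE : y = y / (2 * pi) * (2 * pi) by rewrite mulfVK// gt_eqF// mulr_gt0.
  move: m1 m2; rewrite {3}yE; move: (y / (2 * pi)) (m%:~R : R) => w m' m1 m2.
  by rewrite ler_norml; apply/andP; split; nra.
have cosN' (N : nat) (c : R) : cos (c + 2 * pi * N%:R) = cos c :> R.
  by rewrite mulr_natr [2 * pi]mulr_natl; apply: (periodicn (@cosD2pi R)).
have E (c : R) : sg (c + 2 * pi * m%:~R) = sg c.
  rewrite /sg; congr ((1 - _) / 2); case: (m) => N; first exact: cosN'.
  by rewrite NegzE mulrNz mulrN -[LHS](cosN' N.+1) subrK.
by rewrite -(E (y - _)) subrK.
Qed.

(** * Approximation by convolution *)

Section Fejer.
Context {R : realType} {n : nat} (Phi : {fset 'rV[R]_n}) (mu : probability (torus Phi) R).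
Hypothesis Hroot : root_system Phi.
Hypothesis Hhaar : normalized_haar mu.
Implicit Types (a b l x y s : 'rV[R]_n) (F : 'rV[R]_n -> R).
Local Notation T := (torus Phi).
Local Notation Int f := (\int[mu]_(t in setT) f t)%R.
Local Notation IT F := (\int[mu]_(t in setT) F (repr t))%R.

Definition trigp F := exists N, rtp Phi N F.

Lemma trigpD F G : trigp F -> trigp G -> trigp (fun x => F x + G x).
Proof.
move=> [N hF] [M hG]; exists (Num.max N M).
by apply: rtpD; [apply: rtp_le hF|apply: rtp_le hG]; rewrite le_max lexx ?orbT.
Qed.

Lemma trigpZ c F : trigp F -> trigp (fun x => c * F x).
Proof. by move=> [N hF]; exists N; exact: rtpZ. Qed.

Lemma trigp_eq F G : F =1 G -> trigp F -> trigp G.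
Proof. by move=> /funext ->. Qed.

Lemma trigp_cos l c th : weight_lattice Phi l -> trigp (fun x => c * cos (dot l x + th)).
Proof. by move=> lP; exists (dot l l); exact: rtp_cos. Qed.

Lemma trigp_cst c : trigp (fun=> c).
Proof.
apply: (trigp_eq _ (trigp_cos c 0 (wl0 (Phi := Phi)))) => x.
by rewrite dot0l addr0 cos0 mulr1.
Qed.

Lemma trigp_sum (I : Type) (r : seq I) (F : I -> 'rV[R]_n -> R) :
  (forall i, trigp (F i)) -> trigp (fun x => \sum_(i <- r) F i x).
Proof.
move=> H; elim: r => [|i r IH].
  by apply: trigp_eq (trigp_cst 0) => x; rewrite big_nil.
by apply: trigp_eq (trigpD (H i) IH) => x; rewrite big_cons.
Qed.

Lemma trigpM F G : trigp F -> trigp G -> trigp (fun x => F x * G x).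
Proof.
move=> [N [s [sP FE]]] [M [t [tP GE]]].
have E x : F x * G x = \sum_(z <- s) \sum_(w <- t)
    (z.2.1 * w.2.1) * (cos (dot z.1 x + z.2.2) * cos (dot w.1 x + w.2.2)).
  rewrite FE GE mulr_suml; apply: eq_bigr => z _; rewrite mulr_sumr.
  by apply: eq_bigr => w _; ring.
apply: trigp_eq (fun x => esym (E x)) _.
have {}E x : \sum_(z <- s) \sum_(w <- t)
    (z.2.1 * w.2.1) * (cos (dot z.1 x + z.2.2) * cos (dot w.1 x + w.2.2)) =
  \sum_(z <- s) \sum_(w <- t) if (z \in s) && (w \in t) then
    (z.2.1 * w.2.1) * (cos (dot z.1 x + z.2.2) * cos (dot w.1 x + w.2.2)) else 0.
  apply: eq_big_seq => z zs; apply: eq_big_seq => w wt.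
  by rewrite zs wt.
apply: trigp_eq (fun x => esym (E x)) _.
apply: trigp_sum => z; apply: trigp_sum => w.
have [/andP[zs wt]|_] := boolP (_ && _); last exact: trigp_cst.
have [zP _] := sP z zs; have [wP _] := tP w wt.
apply: trigp_eq (trigpD (trigp_cos (z.2.1 * w.2.1 / 2) (z.2.2 + w.2.2) (wlD zP wP))
  (trigp_cos (z.2.1 * w.2.1 / 2) (z.2.2 - w.2.2) (wlD zP (wlN wP)))) => x.
rewrite dotDl dotDl dotNl.
have -> : dot z.1 x + dot w.1 x + (z.2.2 + w.2.2) = (dot z.1 x + z.2.2) + (dot w.1 x + w.2.2) by ring.
have -> : dot z.1 x - dot w.1 x + (z.2.2 - w.2.2) = (dot z.1 x + z.2.2) - (dot w.1 x + w.2.2) by ring.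
by rewrite cosD cosB; field.
Qed.

Lemma trigpX N F : trigp F -> trigp (fun x => F x ^+ N).
Proof.
move=> hF; elim: N => [|N IH]; first exact: trigp_cst.
by apply: trigp_eq (trigpM hF IH) => x; rewrite exprS.
Qed.

Lemma trigp_prod (I : Type) (r : seq I) (F : I -> 'rV[R]_n -> R) :
  (forall i, trigp (F i)) -> trigp (fun x => \prod_(i <- r) F i x).
Proof.
move=> H; elim: r => [|i r IH].
  by apply: trigp_eq (trigp_cst 1) => x; rewrite big_nil.
by apply: trigp_eq (trigpM (H i) IH) => x; rewrite big_cons.
Qed.

Lemma trigp_cont F : trigp F -> continuous F.
Proof. by move=> [N]; exact: rtp_cont. Qed.

Lemma trigp_periodic F : trigp F -> cl_periodic Phi F.
Proof. by move=> [N]; exact: rtp_periodic. Qed.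

Lemma trigp_bm F : trigp F -> bm (fun t : T => F (repr t)).
Proof. by move=> hF; apply: (periodic_bm Hroot); [exact: trigp_cont|exact: trigp_periodic]. Qed.

Lemma trigp_sg l : weight_lattice Phi l -> trigp (fun x => sg (dot l x)).
Proof.
move=> lP; apply: trigp_eq (trigpD (trigp_cst 2^-1) (trigp_cos (- 2^-1) 0 lP)) => x.
by rewrite addr0 /sg; field.
Qed.

(** The addition formula separates [x] from the integration variable, so the convolution has only
    the frequencies of [K]; the phase [- pi / 2] supplies the sine. *)
Lemma trigp_convolution (f : T -> R) K : bm f -> trigp K ->
  trigp (fun x => Int (fun t => f t * K (x - repr t))).
Proof.
move=> bf [N [s [sP KE]]].
have bt z c : z \in s -> bm (fun t : T => f t * cos (- dot z.1 (repr t) + c)).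
  move=> zs; have [zP _] := sP z zs; apply: bmM => //.
  apply: (trigp_bm (F := fun y => cos (- dot z.1 y + c))).
  apply: trigp_eq (trigp_cos 1 c (wlN zP)) => x.
  by rewrite dotNl mul1r.
pose A (z : 'rV[R]_n * (R * R)) c := Int (fun t => f t * cos (- dot z.1 (repr t) + c)).
have E x : Int (fun t => f t * K (x - repr t)) = \sum_(z <- s)
    (z.2.1 * A z z.2.2 * cos (dot z.1 x + 0) + z.2.1 * A z (z.2.2 - pi / 2) * cos (dot z.1 x + pi / 2)).
  have bs z : z \in s -> bm (fun t : T => z.2.1 * cos (dot z.1 x + 0) * (f t * cos (- dot z.1 (repr t) + z.2.2)) +
     z.2.1 * cos (dot z.1 x + pi / 2) * (f t * cos (- dot z.1 (repr t) + (z.2.2 - pi / 2)))).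
    by move=> zs; apply: bmD; apply: bmZ; exact: bt.
  transitivity (Int (fun t => \sum_(z <- s) if z \in s then (z.2.1 * cos (dot z.1 x + 0) * (f t * cos (- dot z.1 (repr t) + z.2.2)) +
     z.2.1 * cos (dot z.1 x + pi / 2) * (f t * cos (- dot z.1 (repr t) + (z.2.2 - pi / 2)))) else 0)).
    apply: eq_Rintegral => t _; rewrite KE mulr_sumr; apply: eq_big_seq => z ->.
    rewrite dotDr dotNr addr0 cosDpihalf addrA cosBpihalf -addrA cosD.
    by ring.
  rewrite Int_sum; last by move=> z; case: (boolP (z \in s)) => zs; [exact: bs|exact: bm_cst].
  apply: eq_big_seq => z zs; rewrite zs IntD; try by apply: bm_intg; apply: bmZ; exact: bt.
  by rewrite !IntZ /A; [ring| |]; apply: bm_intg; exact: bt.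
apply: trigp_eq (fun x => esym (E x)) _.
have {}E x : \sum_(z <- s)
    (z.2.1 * A z z.2.2 * cos (dot z.1 x + 0) + z.2.1 * A z (z.2.2 - pi / 2) * cos (dot z.1 x + pi / 2)) =
  \sum_(z <- s) if z \in s then
    (z.2.1 * A z z.2.2 * cos (dot z.1 x + 0) + z.2.1 * A z (z.2.2 - pi / 2) * cos (dot z.1 x + pi / 2)) else 0.
  by apply: eq_big_seq => z ->.
apply: trigp_eq (fun x => esym (E x)) _; apply: trigp_sum => z.
case: (boolP (z \in s)) => zs; last exact: trigp_cst.
by have [zP _] := sP z zs; apply: trigpD; exact: trigp_cos.
Qed.

(* The kernel is a power of prod_i (1 + cos <lam_i, x>) / 2, which is 1 only on the lattice. *)
Lemma fejer F : continuous F -> cl_periodic Phi F -> exists f : nat -> 'rV[R]_n -> R,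
  [/\ forall N, trigp (f N), exists M : R, forall N x, `|f N x| <= M &
      forall x, f N x @[N --> \oo] --> F x].
Proof.
move=> cF pF; have [b [lam [bP lP xE]]] := dual_basis Hroot.
pose kap x := \prod_(i < n) (1 - sg (dot (lam i) x)).
have k01 i x : 0 <= 1 - sg (dot (lam i) x) <= 1.
  by rewrite subr_ge0 sg_le1 gerBl sg_ge0.
have kap0 x : 0 <= kap x by apply: prodr_ge0 => i _; have /andP[] := k01 i x.
have kap1 x : kap x <= 1.
  by rewrite -[leRHS](@big1_eq R 1 *%R 'I_n (index_enum _) xpredT); apply: ler_prod => i _; exact: k01.
have kapN x : kap (- x) = kap x.
  by apply: eq_bigr => i _; rewrite dotNr /sg cosN.
have tk : trigp kap.
  apply: trigp_prod => i; apply: trigp_eq (trigpD (trigp_cst 1) (trigpZ (-1) (trigp_sg (lP i)))) => x.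
  by rewrite mulN1r.
have ck := trigp_cont tk; have pk := trigp_periodic tk.
pose K N x := kap x ^+ N.
have tK N : trigp (K N) by exact: trigpX.
have K0 N x : 0 <= K N x by rewrite exprn_ge0.
pose c N := IT (K N).
have kapE0 : kap 0 = 1.
  by apply: big1 => i _; rewrite dot0r /sg cos0 subrr mul0r subr0.
have [M HM] := periodic_bounded Hroot cF pF.
have M0 : 0 <= M by exact: le_trans (HM 0).
(* The normalizing integral [c N] decays no faster than [(1 - eta)^N] for any [eta]: near 0 the
   kernel exceeds [1 - eta], and balls have positive measure. *)
have mass eta : 0 < eta -> eta < 1 -> exists2 m : R, 0 < m & forall N, (1 - eta) ^+ N * m <= c N.
  move=> e0 e1; pose A := [set t : T | 1 - eta < kap (repr t)].
  have mA : measurable A.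
    rewrite (_ : A = setT `&` (fun t : T => kap (repr t)) @^-1` `]1 - eta, +oo[%classic).
      by apply: (continuous_measurable_repr ck pk) => //; exact: measurable_itv.
    by rewrite setTI; apply/seteqP; split=> t /=; rewrite /A /= in_itv/= andbT.
  have /nbhs_ballP[r r0 Hr] : \forall x \near (0 : 'rV[R]_n), 1 - eta < kap x.
    by apply: near_gt; [exact: ck|rewrite kapE0 ltrBlDr ltrDl].
  have Am : (0 < mu A)%E.
    rewrite lt0e measure_ge0 andbT; apply/eqP => A0.
    have := ball_pos Hhaar 0 r0; rewrite -measure_le0 -A0 => /negP; apply.
    apply: le_measure; rewrite ?inE//; first by apply: open_measurableT; apply: open_pi; exact: ball_open.
    by move=> _ [x xr <-]; rewrite /A /= (periodic_repr _ pk); exact: Hr.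
  have fA : 0 < fine (mu A).
    by rewrite fine_gt0// Am (le_lt_trans (probability_le1 mu mA))// ltry.
  exists (fine (mu A)) => // N.
  have b1 : bm (\1_A : T -> R).
    split; first exact: measurable_indic.
    by exists 1 => t; rewrite indicE; case: (_ \in _); rewrite ?normr1// normr0.
  have -> : (1 - eta) ^+ N * fine (mu A) = Int (fun t => (1 - eta) ^+ N * \1_A t).
    rewrite IntZ; last exact: bm_intg.
    by congr (_ * _); rewrite /Rintegral integral_indic// setIT.
  apply: Int_le; [by apply: bm_intg; exact: bmZ|by apply: bm_intg; exact: trigp_bm|].
  move=> t; rewrite indicE; case: (boolP (t \in A)) => [|_]; last by rewrite mulr0.
  rewrite inE /A /= => At; rewrite mulr1 /K lerXn2r ?nnegrE// ?subr_ge0 ltW//.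
have c0 N : 0 < c N.
  have [m m0 Hm] := mass 2^-1 ltac:(lra) ltac:(lra).
  by apply: lt_le_trans (Hm N); rewrite mulr_gt0// exprn_gt0//; lra.
have bFx x : bm (fun t : T => F (x + repr t)).
  apply: (periodic_bm Hroot (F := fun y => F (x + y))).
    by move=> y; apply: (@continuous_comp _ _ _ (fun y => x + y) F); [|exact: cF];
      apply: (@continuousD R 'rV[R]_n 'rV[R]_n (cst x) id) => //; exact: cst_continuous.
  by move=> y q qP; rewrite addrA pF.
pose f N x := (c N)^-1 * Int (fun t => F (repr t) * K N (x - repr t)).
(* The definition shows that [f N] is a trigonometric polynomial; this translated form shows it as a
   mean of values of [F] around [x]. *)
have fE N x : f N x = (c N)^-1 * IT (fun y => F (x + y) * K N y).
  rewrite /f; congr (_ * _).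
  have pH : cl_periodic Phi (fun y => F y * K N (x - y)).
    move=> y q qP; rewrite pF//; congr (_ * _).
    by rewrite -[in RHS](trigp_periodic (tK N) (x - y) (clN qP)) scalerN opprD addrA.
  rewrite -(IT_translate Hhaar x pH); last first.
    apply: bm_intg; apply: bmM; first exact: (periodic_bm Hroot).
    apply: (periodic_bm Hroot (F := fun y => K N (x - y))).
      move=> y; apply: (@continuous_comp _ _ _ (fun y => x - y) (K N)); last exact: (trigp_cont (tK N)).
      by apply: (@continuousB R 'rV[R]_n 'rV[R]_n (cst x) id) => //; exact: cst_continuous.
    move=> y q qP; rewrite -[in RHS](trigp_periodic (tK N) (x - y) (clN qP)).
    by rewrite scalerN opprD addrA.
  apply: eq_Rintegral => t _; congr (_ * _).
  by rewrite /K opprD addrA subrr add0r kapN.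
have diff N x : f N x - F x = (c N)^-1 * IT (fun y => (F (x + y) - F x) * K N y).
  rewrite fE; have -> : IT (fun y => (F (x + y) - F x) * K N y) =
      IT (fun y => F (x + y) * K N y) - F x * c N.
    rewrite -IntZ; last by apply: bm_intg; exact: trigp_bm.
    rewrite -IntB.
    - by apply: eq_Rintegral => t _; rewrite mulrBl.
    - by apply: bm_intg; apply: bmM => //; exact: trigp_bm.
    by apply: bm_intg; apply: bmZ; exact: trigp_bm.
  by rewrite mulrBr mulrCA mulVf ?mulr1// gt_eqF.
have bnd N x (e : R) (eta : R) : 0 <= e -> 0 < eta -> eta < 1 ->
    (forall s, 1 - eta < kap s -> `|F (x + s) - F x| <= e) ->
    `|f N x - F x| <= e + 2 * M * (1 - eta) ^+ N / c N.
  move=> e0 et0 et1 He; rewrite diff normrM normfV [X in X^-1 * _]gtr0_norm//.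
  have -> : e + 2 * M * (1 - eta) ^+ N / c N = (c N)^-1 * (e * c N + 2 * M * (1 - eta) ^+ N).
    by rewrite mulrDr mulrCA mulVf ?mulr1 ?gt_eqF// [(c N)^-1 * _]mulrC.
  rewrite ler_wpM2l ?invr_ge0 ?(ltW (c0 N))//.
  have bI : bm (fun t : T => (F (x + repr t) - F x) * K N (repr t)).
    apply: bmM; last exact: trigp_bm.
    by apply: bmB => //; exact: bm_cst.
  rewrite (le_trans (Int_norm (bm_intg mu bI)))//.
  have -> : e * c N + 2 * M * (1 - eta) ^+ N = Int (fun t => e * K N (repr t) + 2 * M * (1 - eta) ^+ N).
    rewrite IntD; [|by apply: bm_intg; apply: bmZ; exact: trigp_bm|exact: intg_cst].
    by rewrite IntZ ?Int_cst//; apply: bm_intg; exact: trigp_bm.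
  apply: Int_le.
  - by apply: intg_norm; exact: bm_intg.
  - apply: bm_intg; apply: bmD; [by apply: bmZ; exact: trigp_bm|exact: bm_cst].
  move=> t; rewrite normrM [X in _ * X <= _]ger0_norm//.
  have q0 : 0 <= (1 - eta) ^+ N by rewrite exprn_ge0// subr_ge0 ltW.
  have [kt|kt] := ltP (1 - eta) (kap (repr t)).
    rewrite (le_trans (ler_wpM2r (K0 N _) (He _ kt)))// lerDl mulr_ge0// mulr_ge0//.
  have : `|F (x + repr t) - F x| <= 2 * M.
    by rewrite (le_trans (ler_normB _ _))// mulr_natl mulr2n lerD.
  move=> F2; rewrite -[leLHS]add0r lerD ?mulr_ge0// ler_pM// /K lerXn2r ?nnegrE// subr_ge0 ltW//.
exists f; split.
- by move=> N; apply: trigpZ; apply: trigp_convolution => //; exact: (periodic_bm Hroot).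
- exists M => N x; rewrite fE normrM normfV [X in X^-1 * _]gtr0_norm// ler_pdivrMl// mulrC.
  have bI : bm (fun t : T => F (x + repr t) * K N (repr t)) by apply: bmM => //; exact: trigp_bm.
  rewrite (le_trans (Int_norm (bm_intg mu bI)))// /c.
  rewrite -IntZ; last by apply: bm_intg; exact: trigp_bm.
  apply: Int_le; [by apply: intg_norm; exact: bm_intg|by apply: bm_intg; apply: bmZ; exact: trigp_bm|].
  by move=> t; rewrite normrM [X in _ * X <= _]ger0_norm// ler_wpM2r.
move=> x; apply/cvgrPdist_le => e e0.
have [eta [et0 et1 He]] : exists eta, [/\ 0 < eta, eta < 1 &
    forall s, 1 - eta < kap s -> `|F (x + s) - F x| <= e / 2].
  have e2 : 0 < e / 2 by rewrite divr_gt0.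
  have /nbhs_ballP[r r0 Hr] : \forall y \near x, `|F y - F x| < e / 2.
    apply: (near_lt (f := fun y => `|F y - F x|)); last by rewrite subrr normr0.
    apply: (@cont_norm _ _ (fun y => F y - F x)).
    have cB : continuous (fun y => F y - F x) by apply: contB => //; exact: cont_cst.
    exact: cB.
  pose Bs := \sum_i `|b i|; have B0 : 0 <= Bs by apply: sumr_ge0.
  pose d := r / (Bs + 1); have d0 : 0 < d by rewrite divr_gt0// ltr_wpDl.
  pose c1 : R := cos 1 ^+ 2 / 16; have c10 : 0 < c1 by rewrite divr_gt0// exprn_gt0// cos1_gt0.
  (* If [kap s > 1 - eta], each [sg <lam_i, s>] is below [c1 d^2], so by [sg_ge_sqr] each
     [<lam_i, s>] is within [d] of a multiple of [2 pi]; then [s] is within [r] of the period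
     lattice. *)
  exists (Num.min 2^-1 (c1 * d ^+ 2)); split.
  - by rewrite lt_min invr_gt0 ltr0n mulr_gt0// exprn_gt0.
  - by rewrite gt_min invf_lt1// ltr1n.
  move=> s ks; have sgi i : sg (dot (lam i) s) < c1 * d ^+ 2.
    have : kap s <= 1 - sg (dot (lam i) s).
      rewrite /kap (bigD1 i)//= -[leRHS]mulr1 ler_wpM2l ?(andP (k01 i s)).1//.
      rewrite -[leRHS](@big1_eq R 1 *%R 'I_n (index_enum _) (fun j => j != i)); apply: ler_prod => j _; exact: k01.
    move=> k1; have := lt_le_trans ks k1; rewrite ltrD2l ltrN2 lt_min => /andP[//].
  have H i : exists mz : int * R, [/\ dot (lam i) s = mz.2 + 2 * pi * mz.1%:~R, `|mz.2| <= pi &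
      sg (dot (lam i) s) = sg mz.2].
    by have [m [z ?]] := mod_2pi (dot (lam i) s); exists (m, z).
  have [mz Hmz] := choice H.
  pose h := \sum_i (mz i).2 *: b i; pose q := \sum_i b i *~ (mz i).1.
  have sE : s = h + (2 * pi) *: q.
    rewrite {1}(xE s) /h /q scaler_sumr -big_split; apply: eq_bigr => i _ /=.
    have [-> _ _] := Hmz i; rewrite scalerDl; congr (_ + _).
    by rewrite -[b i *~ _]scaler_int scalerA.
  have qP : coroot_lattice Phi q.
    rewrite /q; elim: (index_enum _) => [|i l IH]; first by rewrite big_nil; exact: cl0.
    by rewrite big_cons; apply: clD => //; exact: clZ.
  rewrite sE addrA pF// ltW//; apply: Hr.
  rewrite -ball_normE /= opprD addrA subrr add0r normrN /h.
  have zd i : `|(mz i).2| <= d.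
    have [_ zpi sgE'] := Hmz i; rewrite -(@ler_pXn2r _ 2)// ?nnegrE ?(ltW d0)//.
    rewrite real_normK ?num_real// -(@ler_pM2l _ c1)//.
    by rewrite (le_trans (sg_ge_sqr zpi))// -sgE' ltW.
  rewrite (le_lt_trans (ler_norm_sum _ _ _))//.
  apply: (@le_lt_trans _ _ (d * Bs)).
    by rewrite mulr_sumr; apply: ler_sum => i _; rewrite normrZ ler_wpM2r.
  rewrite /d mulrAC ltr_pdivrMr; last by rewrite ltr_wpDl.
  by rewrite ltr_pM2l// ltrDl.
have et2 : 0 < eta / 2 by rewrite divr_gt0.
have et3 : eta / 2 < 1 by lra.
(* Taking [eta / 2] in the lower bound leaves the geometric factor [q = (1 - eta) / (1 - eta/2) < 1]
   in the error term. *)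
have [m m0 Hm] := mass (eta / 2) et2 et3.
pose q := (1 - eta) / (1 - eta / 2).
have q0 : 0 <= q by rewrite divr_ge0//; lra.
have q1 : q < 1 by rewrite ltr_pdivrMr; lra.
have : \forall N \near \oo, 2 * M / m * q ^+ N < e / 2.
  apply: (@cvgr_lt _ _ _ _ (fun N => 2 * M / m * q ^+ N) (2 * M / m * 0)); last by rewrite mulr0 divr_gt0.
  by apply: cvgM; [exact: cvg_cst|apply: cvg_expr; rewrite ger0_norm].
apply: filterS => N HN; rewrite -normrN opprB.
have e20 : 0 <= e / 2 by rewrite divr_ge0// ltW.
rewrite (le_trans (bnd N x (e / 2) eta e20 et0 et1 He))//.
rewrite [leRHS](_ : e = e / 2 + e / 2); last by field.
rewrite lerD2l (le_trans _ (ltW HN))// ler_pdivrMr//.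
have q20 : 0 <= 2 * M / m * q ^+ N by rewrite mulr_ge0 ?exprn_ge0// divr_ge0 ?mulr_ge0// ltW.
apply: le_trans (ler_wpM2l q20 (Hm N)).
have n0 : (1 - eta / 2) ^+ N != 0 by rewrite expf_neq0// gt_eqF//; lra.
rewrite le_eqVlt; apply/orP; left; apply/eqP; rewrite /q expr_div_n.
by field; rewrite n0 gt_eqF.
Qed.

End Fejer.

Lemma cont_lip {R : realType} {V W : normedModType R} (f : V -> W) (K : R) :
  (forall x y, `|f x - f y| <= K * `|x - y|) -> continuous f.
Proof.
move=> H x; apply/(@cvgrPdist_lt _ _ _ (nbhs x)) => e e0.
apply/nbhs_ballP; exists (e / (`|K| + 1)).
  by rewrite /= divr_gt0// ltr_wpDl.
move=> y; rewrite -ball_normE /= ltr_pdivlMr ?ltr_wpDl// => xy.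
rewrite (le_lt_trans (H x y))// (le_lt_trans _ xy)// mulrC ler_wpM2l//.
by rewrite (le_trans (ler_norm K))// lerDl.
Qed.

Lemma cvg_uniq_eq {R : realType} (u v : nat -> R) (a b : R) : u =1 v ->
  u N @[N --> \oo] --> a -> v N @[N --> \oo] --> b -> a = b.
Proof. by move=> /funext -> ua vb; exact: (cvg_unique _ ua vb). Qed.

(** * Distance to a set *)

Section Distance.
Context {R : realType} {V : normedModType R} (C : set V).
Hypothesis C0 : C !=set0.

Definition set_dist x : R := inf [set `|x - y| | y in C].

Let dist_inf x : has_inf [set `|x - y| | y in C].
Proof.
have [y Cy] := C0; split; first by exists `|x - y|; exists y.
by exists 0 => _ [z _ <-].
Qed.

Lemma set_dist_ge0 x : 0 <= set_dist x.
Proof.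
apply: lb_le_inf; first by have [] := dist_inf x.
by move=> _ [z _ <-].
Qed.

Lemma set_dist_le x y : C y -> set_dist x <= `|x - y|.
Proof. by move=> Cy; apply: ge_inf; [have [] := dist_inf x|exists y]. Qed.

Lemma set_dist_lipschitz x y : set_dist x <= set_dist y + `|x - y|.
Proof.
rewrite -lerBlDr; apply: lb_le_inf; first by have [] := dist_inf y.
move=> _ [z Cz <-]; rewrite lerBlDr (le_trans (set_dist_le x Cz))//.
rewrite (_ : x - z = (y - z) + (x - y)) ?ler_normD//.
by rewrite [RHS]addrC subrKA.
Qed.

Lemma set_dist_continuous : continuous set_dist.
Proof.
move=> x; apply: cont_eps => e e0; exists e => // y xy.
rewrite (le_lt_trans _ xy)// ler_norml; apply/andP; split.
  by rewrite lerNl opprB lerBlDl distrC set_dist_lipschitz.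
by rewrite lerBlDl set_dist_lipschitz.
Qed.

Lemma set_dist_gt0 x : (exists2 r : R, 0 < r & forall y, `|x - y| < r -> ~ C y) -> 0 < set_dist x.
Proof.
move=> [r r0 H]; apply: lt_le_trans r0 _; apply: lb_le_inf; first by have [] := dist_inf x.
by move=> _ [z Cz <-]; rewrite leNgt; apply/negP => /H.
Qed.

Lemma set_dist_eq0 x : C x -> set_dist x = 0.
Proof.
move=> Cx; apply/eqP; rewrite eq_le set_dist_ge0 andbT.
by rewrite (le_trans (set_dist_le x Cx))// subrr normr0.
Qed.

End Distance.

(** * Weyl invariance of the Haar measure *)

Section WeylMeasure.
Context {R : realType} {n : nat} (Phi : {fset 'rV[R]_n}) (mu : probability (torus Phi) R).
Hypothesis Hroot : root_system Phi.
Hypothesis Hhaar : normalized_haar mu.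
Implicit Types (a b l x y s : 'rV[R]_n) (F : 'rV[R]_n -> R).
Local Notation T := (torus Phi).
Local Notation Int f := (\int[mu]_(t in setT) f t)%R.
Local Notation IT F := (\int[mu]_(t in setT) F (repr t))%R.
Local Notation intg f := (mu.-integrable setT (EFin \o f)).

(** The functions are [min(1, N d)], where [d] is the distance to the complement of the preimage of
    [A]; this complement is periodic, hence so is [d]. *)
Lemma open_approx (A : set T) : open A -> exists f : nat -> 'rV[R]_n -> R,
  [/\ forall N, continuous (f N) /\ cl_periodic Phi (f N), forall N x, 0 <= f N x <= 1 &
      forall t, f N (repr t) @[N --> \oo] --> (\1_A t : R)].
Proof.
(* The whole torus is treated apart, as the distance is meaningful only for a nonempty
   complement. *)
move=> oA; have [AT|/setTPn[t0 At0]] := eqVneq A setT.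
  exists (fun _ _ => 1); split.
  - by move=> N; split; [exact: cont_cst|].
  - by move=> _ _; rewrite ler01 lexx.
  by move=> t; rewrite AT indicT; exact: cvg_cst.
pose C := ~` (torus_pi Phi @^-1` A).
have C0 : C !=set0 by exists (repr t0); rewrite /C /= pi_repr.
have pC x q : coroot_lattice Phi q -> C (x + (2 * pi) *: q) = C x.
  by move=> qP; rewrite /C /= piD.
pose d := set_dist C.
have pd : cl_periodic Phi d.
  suff H x q : coroot_lattice Phi q -> d (x + (2 * pi) *: q) <= d x.
    move=> x q qP; apply/le_anti/andP; split; first exact: H.
    have := H (x + (2 * pi) *: q) (- q) (clN qP).
    by rewrite -addrA -scalerDr subrr scaler0 addr0.
  move=> qP; apply: lb_le_inf; first by have [y Cy] := C0; exists `|x - y|; exists y.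
  move=> _ [z Cz <-]; rewrite (_ : x - z = x + (2 * pi) *: q - (z + (2 * pi) *: q)).
    by apply: set_dist_le => //; rewrite pC.
  by rewrite opprD addrACA subrr addr0.
have cd : continuous d by exact: set_dist_continuous.
exists (fun N x => Num.min 1 (N%:R * d x)); split.
- move=> N; split; last by move=> x q qP; rewrite pd.
  move=> x; apply: (@continuous_min _ _ (fun=> 1) (fun x => N%:R * d x)); first exact: cont_cst.
  by apply: contZ; exact: cd.
- by move=> N x; rewrite ge_min lexx le_min ler01 mulr_ge0// set_dist_ge0.
move=> t; have [tA|tA] := pselect (A t); last first.
  rewrite indicE memNset//= (_ : (fun N => _) = fun=> 0); first exact: cvg_cst.
  apply/funext => N; rewrite /d set_dist_eq0 ?mulr0 ?min_r//.
  by rewrite /C /= pi_repr.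
rewrite indicE mem_set//=.
have d0 : 0 < d (repr t).
  apply: set_dist_gt0 => //.
  have oU : open (torus_pi Phi @^-1` A).
    by apply: open_comp => // x _; exact: torus_pi_continuous.
  have : nbhs (repr t) (torus_pi Phi @^-1` A) by apply: open_nbhs_nbhs; split => //=; rewrite pi_repr.
  move=> /nbhs_ballP[r r0 Hr]; exists r => // y xy; rewrite /C /= => H; apply: H.
  by apply: Hr; rewrite -ball_normE.
apply: cvg_near_cst; exists (Num.bound (d (repr t))^-1) => // N /= bN.
rewrite min_l// -ler_pdivrMr// div1r (le_trans (ltW (archi_boundP _)))//.
  by rewrite invr_ge0 ltW.
by rewrite ler_nat.
Qed.

(** A translation moving [<l, .>] by [pi] changes the sign of the integrand. *)
Lemma IT_cos l th : weight_lattice Phi l -> l != 0 -> IT (fun x => cos (dot l x + th)) = 0.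
Proof.
move=> lP l0; have ll : dot l l != 0 by rewrite dot_eq0.
pose h := (pi / dot l l) *: l.
have lh : dot l h = pi by rewrite dotZr mulfVK.
have bc : bm (fun t : T => cos (dot l (repr t) + th)).
  by apply: (periodic_bm Hroot (F := fun x => cos (dot l x + th))); [exact: cont_cos_dot|exact: cos_dot_periodic].
have := IT_translate Hhaar h (cos_dot_periodic th lP) (bm_intg mu bc).
rewrite (_ : IT (fun x => cos (dot l (h + x) + th)) = Int (fun t => -1 * cos (dot l (repr t) + th))).
  by rewrite IntZ; [lra|exact: bm_intg].
apply: eq_Rintegral => t _; rewrite dotDr lh mulN1r -addrA addrC.
exact: cosDpi.
Qed.

Lemma trigp_weyl F w : weyl Phi w -> trigp Phi F -> trigp Phi (fun x => F (x *m w)).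
Proof. by move=> W [N hF]; exists N; exact: rtp_weyl. Qed.

Lemma IT_trigp_weyl F w : weyl Phi w -> trigp Phi F -> IT (fun x => F (x *m w)) = IT F.
Proof.
move=> W [N [s [sP FE]]]; have [w' W' [e1 e2]] := weyl_inv Hroot W.
have bc l th (lP : weight_lattice Phi l) : bm (fun t : T => cos (dot l (repr t) + th)).
  by apply: (periodic_bm Hroot (F := fun x => cos (dot l x + th))); [exact: cont_cos_dot|exact: cos_dot_periodic].
have S (f : 'rV[R]_n -> 'rV[R]_n) (fP : forall l, weight_lattice Phi l -> weight_lattice Phi (f l)) :
    IT (fun x => \sum_(z <- s) z.2.1 * cos (dot (f z.1) x + z.2.2)) =
    \sum_(z <- s) z.2.1 * IT (fun x => cos (dot (f z.1) x + z.2.2)).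
  transitivity (Int (fun t => \sum_(z <- s) if z \in s then z.2.1 * cos (dot (f z.1) (repr t) + z.2.2) else 0)).
    by apply: eq_Rintegral => t _; apply: eq_big_seq => z ->.
  rewrite Int_sum; last first.
    move=> z; case: (boolP (z \in s)) => [zs|_]; last exact: bm_cst.
    by apply: bmZ; apply: bc; apply: fP; have [] := sP z zs.
  apply: eq_big_seq => z zs; rewrite zs IntZ//; apply: bm_intg; apply: bc.
  by apply: fP; have [] := sP z zs.
transitivity (IT (fun x => \sum_(z <- s) z.2.1 * cos (dot (z.1 *m w') x + z.2.2))).
  apply: eq_Rintegral => t _; rewrite FE; apply: eq_bigr => z _.
  by rewrite (dot_weyl_inv Hroot _ _ W e2).
rewrite (S (fun l => l *m w')); last by move=> l; exact: weyl_wl.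
transitivity (IT (fun x => \sum_(z <- s) z.2.1 * cos (dot z.1 x + z.2.2))); last first.
  by apply: eq_Rintegral => t _; rewrite FE.
rewrite (S id)//; apply: eq_big_seq => z zs; congr (_ * _).
have [zP _] := sP z zs; have [->|z0] := eqVneq z.1 0; first by rewrite mul0mx.
rewrite !IT_cos//; first exact: weyl_wl.
apply: contra z0 => /eqP /(congr1 (mulmx^~ w)).
by rewrite -mulmxA e2 mulmx1 mul0mx => ->.
Qed.

Lemma weyl_continuous (w : 'M[R]_n) : continuous (fun x : 'rV[R]_n => x *m w).
Proof.
pose K : R := \sum_i \sum_j `|w i j|.
apply: (@cont_lip R _ _ _ K) => x y; rewrite -mulmxBl; move: (x - y) => z.
rewrite [leLHS]/Num.norm/= mx_normrE; apply: bigmax_le => [|[i j] _ /=].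
  by rewrite mulr_ge0//; apply: sumr_ge0 => i _; exact: sumr_ge0.
rewrite mxE (le_trans (ler_norm_sum _ _ _))// /K mulr_suml; apply: ler_sum => l _.
rewrite normrM mulrC ler_pM//.
  by rewrite (bigD1 j)//= lerDl sumr_ge0.
rewrite ord1 /Num.norm/= mx_normrE.
by apply: (le_bigmax _ (fun i => `|z i.1 i.2|) (0, l)).
Qed.

Lemma IT_weyl_cont F w : weyl Phi w -> continuous F -> cl_periodic Phi F ->
  IT (fun x => F (x *m w)) = IT F.
Proof.
move=> W cF pF; have [f [tf [M fM] fc]] := fejer Hroot Hhaar cF pF.
have pw := periodic_weyl Hroot W pF.
have cw : continuous (fun x => F (x *m w)).
  by move=> x; apply: (@continuous_comp _ _ _ (fun x => x *m w) F); [exact: weyl_continuous|exact: cF].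
have [_ c1] := @Int_bct _ T R mu (fun N t => f N (repr t)) (fun t => F (repr t)) M
  (fun N => (trigp_bm Hroot (tf N)).1) (continuous_measurable_repr cF pF)
  ltac:(by apply: nearW => t N; exact: fM) ltac:(by apply: nearW => t; exact: fc).
have [_ c2] := @Int_bct _ T R mu (fun N t => f N (repr t *m w)) (fun t => F (repr t *m w)) M
  (fun N => (trigp_bm Hroot (trigp_weyl W (tf N))).1) (continuous_measurable_repr cw pw)
  ltac:(by apply: nearW => t N; exact: fM) ltac:(by apply: nearW => t; exact: fc).
by apply: (cvg_uniq_eq _ c2 c1) => N; exact: (IT_trigp_weyl W (tf N)).
Qed.

Lemma weyl_act_continuous w : weyl Phi w -> continuous (weyl_act w : T -> T).
Proof.
move=> W; apply: continuous_piP => x.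
rewrite (_ : _ \o _ = (torus_pi Phi) \o (fun y => y *m w)).
  by apply: continuous_comp; [exact: weyl_continuous|exact: torus_pi_continuous].
by apply/funext => y /=; exact: weyl_act_pi.
Qed.

Lemma weyl_act_measurable w : weyl Phi w -> measurable_fun setT (weyl_act w : T -> T).
Proof. by move=> W; apply: continuous_measurableTT; exact: weyl_act_continuous. Qed.

(* Trigonometric polynomials have the same integral as their Weyl transforms, since
   only the zero frequency contributes. *)
Lemma haar_weyl w (A : set T) : weyl Phi w -> measurable A -> mu (weyl_act w @^-1` A) = mu A.
Proof.
move=> W mA; have mw := weyl_act_measurable W.
have mp (B : set T) : measurable B -> measurable (weyl_act w @^-1` B).
  by move=> mB; rewrite -[X in measurable X]setTI; exact: mw.
move: A mA; apply: (@dynkin_induction _ T (@open T)) => //.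
- by move=> U V oU oV; exact: openI.
- move=> U oU; have [f [fcp f01 fU]] := open_approx oU.
  have mU := open_measurableT oU.
  have [_ c1] := @Int_bct _ T R mu (fun N t => f N (repr t)) \1_U 1
    (fun N => continuous_measurable_repr (fcp N).1 (fcp N).2) (measurable_indic mU) ltac:(apply: nearW => t N; have /andP[f0 f1] := f01 N (repr t); by rewrite ger0_norm) ltac:(by apply: nearW => t; exact: fU).
  have [_ c2] := @Int_bct _ T R mu (fun N t => f N (repr (weyl_act w t))) (\1_U \o weyl_act w) 1
    (fun N => measurableT_comp (continuous_measurable_repr (fcp N).1 (fcp N).2) mw) (measurableT_comp (measurable_indic mU) mw)
     ltac:(apply: nearW => t N; have /andP[f0 f1] := f01 N (repr (weyl_act w t)); by rewrite ger0_norm) ltac:(by apply: nearW => t; exact: fU).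
  have E : Int (\1_U \o weyl_act w : T -> R) = Int (\1_U : T -> R).
    apply: (cvg_uniq_eq _ c2 c1) => N; rewrite -(IT_weyl_cont W (fcp N).1 (fcp N).2).
    by apply: eq_Rintegral => t _; rewrite (weyl_act_repr _ W (fcp N).2).
  have fin (B : set T) : measurable B -> (mu B = (Int (\1_B : T -> R))%:E).
    move=> mB; rewrite /Rintegral integral_indic// setIT fineK//.
    by rewrite ge0_fin_numE// (le_lt_trans (probability_le1 mu mB))// ltry.
  by rewrite !fin//; [congr (_%:E)|exact: mp].
- move=> B mB IH; rewrite preimage_setC !probability_setC//; last exact: mp.
  by congr (_ - _)%E.
move=> B mB tB IH; rewrite preimage_bigcup !measure_semi_bigcup//.
- by apply: eq_eseriesr => i _; exact: IH.
- exact: bigcup_measurable.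
- by move=> i; exact: mp.
- move: tB => /trivIsetP tB; apply/trivIsetP => i j _ _ ij.
  by rewrite -preimage_setI tB// preimage_set0.
by apply: bigcup_measurable => i _; exact: mp.
Qed.

Lemma Int_weyl (f : T -> R) w : weyl Phi w -> intg f -> intg (fun t => f (weyl_act w t)) /\
  Int (fun t => f (weyl_act w t)) = Int f.
Proof.
move=> W If; have mf := intg_meas If; have mt := weyl_act_measurable W.
have ip : (pushforward mu (weyl_act w : T -> T)).-integrable setT (EFin \o f).
  have /integrableP[mEf Ifi] := If.
  apply/integrableP; split => //.
  rewrite (eq_measure_integral mu) => [//|A mA _].
  exact: haar_weyl.
have iw : intg (fun t => f (weyl_act w t)).
  have /integrableP[_ H] := ip; apply/integrableP; split.
    by apply/measurable_EFinP; exact: (measurableT_comp mf mt).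
  move: H; rewrite ge0_integral_pushforward ?preimage_setT//.
  by apply: measurableT_comp => //; exact/measurable_EFinP.
split => //; rewrite /Rintegral; congr fine; symmetry.
rewrite (eq_measure_integral (pushforward mu (weyl_act w : T -> T))) => [|A mA _]; last first.
  by apply: esym; exact: haar_weyl.
rewrite integral_pushforward ?preimage_setT//; exact/measurable_EFinP.
Qed.

End WeylMeasure.

Section SquareDistance.
Context {d} {T : measurableType d} {R : realType} (mu : probability T R).
Implicit Types f g h : T -> R.
Local Notation Int f := (\int[mu]_(t in setT) f t)%R.
Local Notation sqint f := (f \in Lfun mu 2%:E).

Definition sqdist f g : R := Int (fun t => (f t - g t) ^+ 2).

Lemma sqint_sqr f g : sqint f -> sqint g -> mu.-integrable setT (EFin \o (fun t => (f t - g t) ^+ 2)).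
Proof. by move=> f2 g2; have [] := (sqintP mu (f \- g)).1 (sqintB f2 g2). Qed.

Local Notation sqd := sqdist.

Lemma sqd_ge0 f g : 0 <= sqd f g. Proof. by apply: Int_ge0 => t; exact: sqr_ge0. Qed.

(** From [(x - z)^2 <= 2 (x - y)^2 + 2 (y - z)^2]. Working with squared distances avoids square
    roots, at the price of tolerances divided by 4 or 8. *)
Lemma sqd_triangle f g h : sqint f -> sqint g -> sqint h -> sqd f h <= 2 * sqd f g + 2 * sqd g h.
Proof.
move=> f2 g2 h2; rewrite /sqdist -!IntZ; try exact: sqint_sqr.
rewrite -IntD; try by apply: intgZ; exact: sqint_sqr.
apply: Int_le; first exact: sqint_sqr.
  by apply: intgD; apply: intgZ; exact: sqint_sqr.
move=> t /=; move: (f t) (g t) (h t) => x y z.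
by rewrite -subr_ge0 (_ : _ - _ = ((x - y) - (y - z)) ^+ 2) ?sqr_ge0//; ring.
Qed.

Lemma sqd_bct (f_ : nat -> T -> R) f (M : R) : (forall N, measurable_fun setT (f_ N)) -> measurable_fun setT f ->
  (forall t, `|f t| <= M) -> (forall N t, `|f_ N t| <= M) ->
  (forall t, f_ N t @[N --> \oo] --> f t) ->
  sqd f (f_ N) @[N --> \oo] --> (0 : R).
Proof.
move=> mf_ mf fM f_M fc.
have [_] := @Int_bct _ T R mu (fun N t => (f t - f_ N t) ^+ 2) (fun=> 0) ((2 * M) ^+ 2)
  (fun N => measurableT_comp (exprn_measurable 2) (measurable_funB mf (mf_ N))) (measurable_cst _ )
  ltac:(apply: nearW => t N; rewrite ger0_norm ?sqr_ge0// -real_normK ?num_real//;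
     rewrite lerXn2r ?nnegrE// ?mulr_ge0// ?(le_trans (normr_ge0 _) (fM t))//;
     rewrite (le_trans (ler_normB _ _))// mulr_natl mulr2n lerD//)
  ltac:(apply: nearW => t; rewrite (_ : 0 = (f t - f t) * (f t - f t)); [|by rewrite subrr mul0r];
     under eq_fun do rewrite expr2; apply: cvgM; apply: cvgB; [exact: cvg_cst|exact: fc|exact: cvg_cst|exact: fc]).
by rewrite Int_cst.
Qed.

End SquareDistance.

(** * Mean square density of trigonometric polynomials *)

Section Density.
Context {R : realType} {n : nat} (Phi : {fset 'rV[R]_n}) (mu : probability (torus Phi) R).
Hypothesis Hroot : root_system Phi.
Hypothesis Hhaar : normalized_haar mu.
Local Notation T := (torus Phi).
Implicit Types (f g h : T -> R) (F : 'rV[R]_n -> R).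
Local Notation Int f := (\int[mu]_(t in setT) f t)%R.
Local Notation sqint f := (f \in Lfun mu 2%:E).
Local Notation sqd := (sqdist mu).

Definition approx h := forall e : R, 0 < e -> exists2 F, trigp Phi F & sqd h (fun t => F (repr t)) < e.

Let tb F : trigp Phi F -> sqint (fun t : T => F (repr t)).
Proof. by move=> tF; apply: bm_sqint; exact: trigp_bm. Qed.

Lemma approx_lim h (g : nat -> T -> R) : bm h -> (forall N, bm (g N)) -> (forall N, approx (g N)) ->
  sqd h (g N) @[N --> \oo] --> (0 : R) -> approx h.
Proof.
move=> bh bg ag hg e e0.
have e4 : 0 < e / 4 by rewrite divr_gt0.
have [N HN] : exists N, sqd h (g N) < e / 4.
  have H : \forall N \near \oo, sqd h (g N) < e / 4 by exact: (@cvgr_lt _ _ _ _ _ 0).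
  by have [N] := filter_ex H; exists N.
have [F tF HF] := ag N _ e4; exists F => //.
have := sqd_triangle (bm_sqint mu bh) (bm_sqint mu (bg N)) (tb tF).
by move: HN HF; lra.
Qed.

Lemma approxD h g : bm h -> bm g -> approx h -> approx g -> approx (fun t => h t + g t).
Proof.
move=> bh bg ah ag e e0; have e4 : 0 < e / 4 by rewrite divr_gt0.
have [F tF HF] := ah _ e4; have [G tG HG] := ag _ e4.
exists (fun x => F x + G x); first exact: trigpD.
have sh := bm_sqint mu bh; have sg := bm_sqint mu bg.
have : sqd (fun t => h t + g t) (fun t => F (repr t) + G (repr t)) <=
    2 * sqd h (fun t => F (repr t)) + 2 * sqd g (fun t => G (repr t)).
  rewrite /sqdist -!IntZ; try (by apply: sqint_sqr => //; exact: tb).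
  rewrite -IntD; try (by apply: intgZ; apply: sqint_sqr => //; exact: tb).
  apply: Int_le.
  - by apply: sqint_sqr; apply: sqintD => //; exact: tb.
  - by apply: intgD; apply: intgZ; apply: sqint_sqr => //; exact: tb.
  move=> t /=; move: (h t) (g t) (F _) (G _) => x y z w.
  by rewrite -subr_ge0 (_ : _ - _ = ((x - z) - (y - w)) ^+ 2) ?sqr_ge0//; ring.
by move: HF HG; lra.
Qed.

Lemma approxZ c h : bm h -> approx h -> approx (fun t => c * h t).
Proof.
move=> bh ah e e0; have c0 : 0 < c ^+ 2 + 1 by rewrite ltr_wpDl ?sqr_ge0.
have [F tF HF] := ah (e / (c ^+ 2 + 1)) (divr_gt0 e0 c0).
exists (fun x => c * F x); first exact: trigpZ.
have -> : sqd (fun t => c * h t) (fun t => c * F (repr t)) = c ^+ 2 * sqd h (fun t => F (repr t)).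
  rewrite /sqdist -IntZ; last by apply: sqint_sqr; [exact: bm_sqint|exact: tb].
  by apply: eq_Rintegral => t _; ring.
move: HF; rewrite ltr_pdivlMr// mulrC => HF; apply: le_lt_trans HF.
by rewrite ler_wpM2r ?sqd_ge0// lerDl.
Qed.

Lemma approx_cst c : approx (fun=> c).
Proof.
move=> e e0; exists (fun=> c); first exact: trigp_cst.
rewrite /sqdist; under eq_Rintegral do rewrite subrr expr0n.
by rewrite Int_cst.
Qed.

Let bm_ind (A : set T) : measurable A -> bm (\1_A : T -> R).
Proof.
move=> mA; split; first exact: measurable_indic.
by exists 1 => t; rewrite indicE; case: (_ \in _); rewrite ?normr1// normr0.
Qed.

Lemma approx_sum (I : Type) (r : seq I) (h : I -> T -> R) : (forall i, bm (h i)) -> (forall i, approx (h i)) ->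
  approx (fun t => \sum_(i <- r) h i t).
Proof.
move=> bh ah; elim: r => [|i r IH].
  by have := approx_cst 0; congr approx; apply/funext => t; rewrite big_nil.
have := approxD (bh i) (@bm_sum _ T R _ r xpredT h (fun i _ => bh i)) (ah i) IH.
by congr approx; apply/funext => t; rewrite big_cons.
Qed.

Lemma approx_cont F : continuous F -> cl_periodic Phi F -> approx (fun t => F (repr t)).
Proof.
move=> cF pF; have [f [tf [M fM] fc]] := fejer Hroot Hhaar cF pF.
have [M' FM] := periodic_bounded Hroot cF pF.
apply: (@approx_lim _ (fun N t => f N (repr t))).
- exact: (periodic_bm Hroot).
- by move=> N; exact: trigp_bm.
- move=> N e e0; exists (f N) => //; rewrite /sqdist.
  by under eq_Rintegral do rewrite subrr expr0n; rewrite Int_cst.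
apply: (@sqd_bct _ _ _ mu _ _ (Num.max M M')).
- by move=> N; have [] := trigp_bm Hroot (tf N).
- exact: continuous_measurable_repr.
- by move=> t; rewrite le_max FM orbT.
- by move=> N t; rewrite le_max fM.
by move=> t; exact: fc.
Qed.

(** The sets with this property form a Dynkin class containing the open sets, which are stable under
    intersection and generate the Borel sets. *)
Lemma approx_indic (A : set T) : measurable A -> approx (\1_A : T -> R).
Proof.
move: A; apply: (@dynkin_induction _ T (@open T)) => //.
- by move=> U V oU oV; exact: openI.
- by have := approx_cst 1; congr approx; apply/funext => t; rewrite indicT.
- move=> U oU; have [f [fcp f01 fU]] := open_approx oU; have mU := open_measurableT oU.
  have bf N : bm (fun t : T => f N (repr t)) by apply: (periodic_bm Hroot); have [] := fcp N.
  apply: (@approx_lim _ (fun N t => f N (repr t))) => //.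
  - exact: bm_ind.
  - by move=> N; apply: approx_cont; have [] := fcp N.
  apply: (@sqd_bct _ _ _ mu _ _ 1) => //.
  - by move=> N; have [] := bf N.
  - by move=> t; rewrite indicE; case: (_ \in _); rewrite ?normr1// normr0.
  by move=> N t; have /andP[f0 f1] := f01 N (repr t); rewrite ger0_norm.
- move=> B mB aB.
  have := approxD (@bm_cst _ T R 1) (bmZ (-1) (bm_ind mB)) (approx_cst 1) (approxZ (-1) (bm_ind mB) aB).
  congr approx; apply/funext => t; rewrite !indicE in_setC.
  by case: (_ \in _); rewrite ?mulr1 ?mulr0 ?subrr ?addr0.
move=> B mB tB aB; have mU := bigcup_measurable (fun i (_ : True) => mB i).
have bs N : bm (fun t : T => \sum_(0 <= i < N) \1_(B i) t : R).
  by apply: (@bm_sum _ T R _ _ xpredT (fun i => \1_(B i))) => i _; exact: bm_ind.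
have sE t N : (\sum_(0 <= i < N) \1_(B i) t : R) = (`[< exists2 i, (i < N)%N & B i t >])%:R.
  have [[i iN Bi]|H] := asboolP; last first.
    rewrite big_nat big1// => i /andP[_ iN]; rewrite indicE memNset// => Bi; apply: H.
    by exists i.
  rewrite big_mkord (bigD1 (Ordinal iN))//= indicE mem_set// big1 ?addr0// => j /eqP ji.
  rewrite indicE memNset// => Bj; apply: ji; apply/val_inj.
  by apply: tB => //; exists t.
apply: (@approx_lim _ (fun N t => \sum_(0 <= i < N) \1_(B i) t)) => //.
- exact: bm_ind.
- by move=> N; apply: approx_sum => // i; exact: bm_ind.
apply: (@sqd_bct _ _ _ mu _ _ 1) => //.
- by move=> N; have [] := bs N.
- by move=> t; rewrite indicE; case: (_ \in _); rewrite ?normr1// normr0.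
- by move=> N t; rewrite sE; case: asboolP; rewrite ?normr1// normr0.
move=> t; have [[i _ Bi]|H] := pselect ((\bigcup_k B k) t); rewrite indicE.
  rewrite mem_set; last by exists i.
  apply: cvg_near_cst; exists i.+1 => // N /= iN.
  by rewrite sE asboolT//; exists i.
rewrite memNset// (_ : (fun N => _) = fun=> 0); first exact: cvg_cst.
by apply/funext => N; rewrite sE asboolF// => -[i _ Bi]; apply: H; exists i.
Qed.

Lemma approx_bm h : bm h -> approx h.
Proof.
move=> bh; have [mh [M hM]] := bh.
have M0 : 0 <= M by exact: le_trans (hM point).
(* [h + M] is rounded down to a multiple of [1 / (N + 1)]. The number of steps below a value is a
   sum of indicators of the superlevel sets [A N j], of which at most [J N] are needed. *)
pose J N := Num.truncn (2 * M * N.+1%:R).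
pose A N j := [set t | j.+1%:R <= (h t + M) * N.+1%:R].
have mA N j : measurable (A N j).
  rewrite (_ : A N j = setT `&` (fun t => (h t + M) * N.+1%:R) @^-1` `[j.+1%:R, +oo[%classic).
    apply: measurable_funM; [|exact: measurable_cst|exact: measurableT|exact: measurable_itv].
    by apply: measurable_funD => //; exact: measurable_cst.
  by rewrite setTI; apply/seteqP; split=> t /=; rewrite /A /= in_itv/= andbT.
pose g N t : R := \sum_(j < J N) N.+1%:R^-1 * \1_(A N j) t + - M.
have gE N t : `|h t - g N t| <= N.+1%:R^-1.
  have h0 : 0 <= h t + M by rewrite -lerBlDr sub0r; have := hM t; rewrite ler_norml => /andP[].
  have hJ : h t + M <= 2 * M by rewrite mulr_natl mulr2n lerD2r (le_trans (ler_norm _)).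
  pose y := (h t + M) * N.+1%:R; have y0 : 0 <= y by rewrite mulr_ge0.
  rewrite /g (_ : \sum_(j < J N) N.+1%:R^-1 * \1_(A N j) t = N.+1%:R^-1 * (Num.truncn y)%:R); last first.
    rewrite -mulr_sumr; congr (_ * _).
    have yJ : (Num.truncn y <= J N)%N.
      by rewrite /J truncn_ge_nat ?mulr_ge0// (@le_trans _ _ y) ?truncn_le// ler_wpM2r.
    transitivity (\sum_(j < J N) (j < Num.truncn y)%:R : R).
      apply: eq_bigr => j _; rewrite indicE; congr (_%:R).
      rewrite truncn_ge_nat//; case: (boolP (t \in A N j)).
        by rewrite inE /A /= => ->.
      by rewrite notin_setE /A /= => /negP/negbTE ->.
    rewrite -(big_mkord xpredT (fun j => (j < Num.truncn y)%:R)).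
    rewrite (big_cat_nat _ yJ)//= [X in X + _ = _]big_nat [X in _ + X = _]big_nat.
    rewrite (eq_bigr (fun=> 1)) => [|j /andP[_ ->]//].
    rewrite [X in _ + X = _]big1 => [|j /andP[jy _]]; last by rewrite ltnNge jy.
    by rewrite addr0 -big_nat sumr_const_nat subn0.
  have /andP[y1 y2] := truncn_itv y0.
  rewrite (_ : h t - _ = N.+1%:R^-1 * (y - (Num.truncn y)%:R)); last first.
    have yE : N.+1%:R^-1 * y = h t + M by rewrite /y mulrC mulfK ?pnatr_eq0.
    by rewrite mulrBr yE opprB addrA.
  rewrite normrM ger0_norm// -[leRHS]mulr1 ler_wpM2l// ger0_norm ?subr_ge0//.
  by rewrite lerBlDl natr1 ltW.
have bg N : bm (g N).
  apply: bmD; last exact: bm_cst.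
  by apply: (@bm_sum _ T R _ _ xpredT (fun (j : 'I_(J N)) t => N.+1%:R^-1 * \1_(A N j) t)) => j _; apply: bmZ; exact: bm_ind.
apply: (@approx_lim _ g) => //.
- move=> N; apply: approxD; [|exact: bm_cst| |exact: approx_cst].
    by apply: (@bm_sum _ T R _ _ xpredT (fun (j : 'I_(J N)) t => N.+1%:R^-1 * \1_(A N j) t)) => j _; apply: bmZ; exact: bm_ind.
  by apply: approx_sum => j; [apply: bmZ; exact: bm_ind|apply: approxZ; [exact: bm_ind|exact: approx_indic]].
apply: (@sqd_bct _ _ _ mu _ _ (M + 1)) => //.
- by move=> N; have [] := bg N.
- by move=> t; rewrite (le_trans (hM t))// lerDl.
- move=> N t; rewrite -[g N t](subrK (h t)) (le_trans (ler_normD _ _))// addrC lerD//.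
  by rewrite distrC (le_trans (gE N t))// invf_le1// ler1n.
move=> t; apply/cvgrPdist_le => e e0.
have : \forall N \near \oo, (N.+1%:R^-1 : R) < e.
  by apply: (@cvgr_lt _ _ _ _ _ 0) => //; exact: cvg_harmonic.
by apply: filterS => N Ne; rewrite (le_trans (gE N t))// ltW.
Qed.

End Density.

Lemma sum_const_seq {R : realType} (I : Type) (r : seq I) (c : R) : \sum_(i <- r) c = (size r)%:R * c.
Proof. by rewrite big_const_seq count_predT iter_addr_0 mulr_natl. Qed.

Lemma Int_big_sum {d} {T : measurableType d} {R : realType} (mu : probability T R) (I : eqType)
  (r : seq I) (F : I -> T -> R) :
  (forall i, i \in r -> mu.-integrable setT (EFin \o F i)) ->
  mu.-integrable setT (EFin \o (fun t => \sum_(i <- r) F i t)) /\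
  (\int[mu]_t (\sum_(i <- r) F i t) = \sum_(i <- r) \int[mu]_t F i t)%R.
Proof.
elim: r => [_|i r IH H].
  rewrite big_nil; under eq_Rintegral do rewrite big_nil; rewrite Int_cst; split => //.
  rewrite (_ : (fun _ => _) = fun=> 0); first exact: intg_cst.
  by apply/funext => t; rewrite big_nil.
have [|Is IE] := IH; first by move=> v vs; apply: H; rewrite in_cons vs orbT.
have I1 := H i (mem_head _ _).
rewrite big_cons -IE -IntD//; split; last by apply: eq_Rintegral => t _; rewrite big_cons.
rewrite (_ : (fun _ => _) = F i \+ (fun t => \sum_(i <- r) F i t)); first exact: intgD.
by apply/funext => t; rewrite big_cons.
Qed.

(** Nonnegativity of the variance. *)
Lemma sqr_mean {R : realType} (I : Type) (r : seq I) (G : I -> R) : 0 < (size r)%:R :> R ->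
  ((size r)%:R^-1 * \sum_(w <- r) G w) ^+ 2 <= (size r)%:R^-1 * \sum_(w <- r) G w ^+ 2.
Proof.
set m := (size r)%:R => m0; set A := m^-1 * _.
have S : \sum_(w <- r) G w = m * A by rewrite /A mulrA mulfV ?mul1r// gt_eqF.
have : 0 <= \sum_(w <- r) (G w - A) ^+ 2 by apply: sumr_ge0 => w _; exact: sqr_ge0.
have -> : \sum_(w <- r) (G w - A) ^+ 2 = \sum_(w <- r) G w ^+ 2 - m * A ^+ 2.
  have -> : m * A ^+ 2 = 2 * A * \sum_(w <- r) G w - \sum_(w <- r) A ^+ 2.
    by rewrite S sum_const_seq -/m; ring.
  rewrite mulr_sumr -sumrB -sumrB; apply: eq_bigr => w _; ring.
rewrite subr_ge0 => H; rewrite -(ler_pM2l m0) [leRHS]mulrA mulfV ?gt_eqF//.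
by rewrite mul1r.
Qed.

Lemma cvg_truncation {R : realType} (x y : R) : y != 0 ->
  x - x * (N.+1%:R / (N.+1%:R + `|x|) * (y ^+ 2 / (y ^+ 2 + N.+1%:R^-1))) @[N --> \oo] --> (0 : R).
Proof.
move=> y0; rewrite (_ : (0 : R) = x - x * ((1 + `|x| * 0)^-1 * (y ^+ 2 / (y ^+ 2 + 0)))); last first.
  by rewrite mulr0 !addr0 invr1 mul1r divff ?expf_neq0// mulr1 subrr.
have y2 : y ^+ 2 != 0 by rewrite expf_neq0.
have n0 (N : nat) : N.+1%:R != 0 :> R by rewrite pnatr_eq0.
apply: cvgB; first exact: cvg_cst.
apply: cvgM; first exact: cvg_cst.
apply: cvgM; last first.
  apply: cvgM; first exact: cvg_cst.
  by apply: cvgV; [rewrite addr0|apply: cvgD; [exact: cvg_cst|exact: cvg_harmonic]].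
rewrite (_ : (fun N => _) = fun N : nat => (1 + `|x| * N.+1%:R^-1)^-1).
  apply: cvgV; first by rewrite mulr0 addr0 oner_neq0.
  by apply: cvgD; [exact: cvg_cst|apply: cvgM; [exact: cvg_cst|exact: cvg_harmonic]].
have E (m z : R) : m != 0 -> m / (m + z) = (1 + z / m)^-1.
  by move=> m0; rewrite -[in RHS](mulfV m0) -mulrDl invfM invrK mulrC.
by apply/funext => N; exact: E.
Qed.

(** * Averaging over the Weyl group *)

Section Average.
Context {R : realType} {n : nat} (Phi : {fset 'rV[R]_n}) (mu : probability (torus Phi) R).
Hypothesis Hroot : root_system Phi.
Hypothesis Hhaar : normalized_haar mu.
Local Notation T := (torus Phi).
Implicit Types (f g h : T -> R) (F : 'rV[R]_n -> R).
Local Notation Int f := (\int[mu]_(t in setT) f t)%R.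
Local Notation intg f := (mu.-integrable setT (EFin \o f)).
Local Notation sqint f := (f \in Lfun mu 2%:E).

Definition weyl_seq : seq 'M[R]_n := sval (cid (weyl_finite Hroot)).

Lemma weyl_seq_uniq : uniq weyl_seq.
Proof. by rewrite /weyl_seq; case: cid => ws []. Qed.

Lemma weyl_seqP w : w \in weyl_seq <-> weyl Phi w.
Proof. by rewrite /weyl_seq; case: cid => ws []. Qed.

Definition weyl_avg F x : R := (size weyl_seq)%:R^-1 * \sum_(w <- weyl_seq) F (x *m w).

Lemma weyl_size_gt0 : 0 < (size weyl_seq)%:R :> R.
Proof.
rewrite ltr0n; have /weyl_seqP := weyl_one Phi.
by case: weyl_seq.
Qed.

Lemma weyl_avg_inv F w x : weyl Phi w -> weyl_avg F (x *m w) = weyl_avg F x.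
Proof.
move=> W; have [w' W' [e1 e2]] := weyl_inv Hroot W.
congr (_ * _); under eq_bigr do rewrite -mulmxA.
rewrite -(big_map (mulmx w) xpredT (fun v => F (x *m v))); apply: perm_big.
have us : uniq (map (mulmx w) weyl_seq).
  rewrite map_inj_uniq ?weyl_seq_uniq// => a b /(congr1 (mulmx w')).
  by rewrite !mulmxA e2 !mul1mx.
apply: uniq_perm => //; first exact: weyl_seq_uniq.
have sub : {subset map (mulmx w) weyl_seq <= weyl_seq}.
  by move=> _ /mapP[a /weyl_seqP aP ->]; apply/weyl_seqP; exact: weyl_mul.
by have [] := uniq_min_size us sub; rewrite ?size_map.
Qed.

Lemma weyl_avg_id F x : (forall w, weyl Phi w -> F (x *m w) = F x) -> weyl_avg F x = F x.
Proof.
move=> H; rewrite /weyl_avg (eq_big_seq (fun=> F x)) => [|w /weyl_seqP]; last exact: H.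
by rewrite sum_const_seq mulrA mulVf ?mul1r// gt_eqF// weyl_size_gt0.
Qed.

Lemma rtp_weyl_avg N F : rtp Phi N F -> rtp Phi N (weyl_avg F).
Proof.
move=> hF; apply: rtpZ; apply: rtp_sum => w /weyl_seqP W _.
exact: (rtp_weyl Hroot W hF).
Qed.

Lemma trigp_weyl_avg F : trigp Phi F -> trigp Phi (weyl_avg F).
Proof. by move=> [N hF]; exists N; exact: rtp_weyl_avg. Qed.

(** The change of variables by [w] preserves the measure and [phi], so every term of the mean has
    the same integral. *)
Lemma Int_weyl_avg (phi : T -> R) F : sqint phi ->
  (forall w, weyl Phi w -> \forall t \ae mu, phi (weyl_act w t) = phi t) ->
  continuous F -> cl_periodic Phi F ->
  Int (fun t => phi t * weyl_avg F (repr t)) = Int (fun t => phi t * F (repr t)).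
Proof.
move=> phi2 phiW cF pF; have bF := periodic_bm Hroot cF pF.
have cw (w : 'M[R]_n) : continuous (F \o (mulmx^~ w : 'rV[R]_n -> 'rV[R]_n)).
  by move=> x; apply: continuous_comp; [exact: weyl_continuous|exact: cF].
have iw w : weyl Phi w -> intg (fun t : T => phi t * F (repr t *m w)).
  move=> W; apply: sqint_mul => //; apply: bm_sqint.
  by apply: (periodic_bm Hroot (F := fun x => F (x *m w))); [exact: cw|exact: periodic_weyl].
have Iw w : weyl Phi w -> Int (fun t : T => phi t * F (repr t *m w)) = Int (fun t => phi t * F (repr t)).
  move=> W; have I1 : intg (fun t => phi t * F (repr t)) by apply: sqint_mul => //; exact: bm_sqint.
  have [I2 <-] := Int_weyl Hroot Hhaar W I1.
  apply: Int_ae; [exact: intg_meas (iw w W)|exact: intg_meas I2|].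
  move: (phiW w W); apply: filterS => t ->.
  by rewrite (weyl_act_repr _ W pF).
have E : Int (fun t => phi t * weyl_avg F (repr t)) = (size weyl_seq)%:R^-1 *
    \sum_(w <- weyl_seq) Int (fun t => phi t * F (repr t *m w)).
  have [Is <-] := @Int_big_sum _ T R mu _ weyl_seq (fun w t => phi t * F (repr t *m w))
    (fun w ws => iw w ((weyl_seqP w).1 ws)).
  rewrite -IntZ//; apply: eq_Rintegral => t _; rewrite /weyl_avg mulrCA; congr (_ * _).
  by rewrite mulr_sumr.
rewrite E (eq_big_seq (fun=> Int (fun t => phi t * F (repr t)))) => [|w /weyl_seqP]; last exact: Iw.
by rewrite sum_const_seq mulrA mulVf ?mul1r// gt_eqF// weyl_size_gt0.
Qed.

(** The quotient [g / D] may fail to be square integrable. It is replaced by the bounded [h N], in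
    which large values of [g] and small values of [D] are damped; [h N * D] converges to [g] with
    error dominated by [|g|]. A polynomial close to [h N] is then averaged over W. *)
Lemma density (D g : T -> R) : bm D -> (forall w, weyl Phi w -> forall t, D (weyl_act w t) = D t) ->
  (\forall t \ae mu, D t != 0) -> sqint g ->
  (forall w, weyl Phi w -> \forall t \ae mu, g (weyl_act w t) = g t) ->
  forall e : R, 0 < e -> exists F, [/\ trigp Phi F, forall w, weyl Phi w -> forall x, F (x *m w) = F x &
    sqdist mu g (fun t => F (repr t) * D t) < e].
Proof.
move=> bD DW D0 g2 gW e e0.
have [mD [M DM]] := bD; have [mg Ig] := (sqintP mu g).1 g2.
have M0 : 0 <= M by exact: le_trans (DM point).
pose q N (x y : R) := N.+1%:R / (N.+1%:R + `|x|) * (y ^+ 2 / (y ^+ 2 + N.+1%:R^-1)).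
pose h N t := g t * (N.+1%:R / (N.+1%:R + `|g t|)) * (D t / (D t ^+ 2 + N.+1%:R^-1)).
have N0 N : 0 < N.+1%:R :> R by [].
have Ni0 N : 0 < N.+1%:R^-1 :> R by rewrite invr_gt0.
have d1 N (x : R) : 0 < N.+1%:R + `|x| :> R by rewrite ltr_pwDl.
have d2 N (y : R) : 0 < y ^+ 2 + N.+1%:R^-1 by rewrite ltr_wpDl ?sqr_ge0.
have hD N t : h N t * D t = g t * q N (g t) (D t) by rewrite /h /q expr2; ring.
have q01 N x y : 0 <= q N x y <= 1.
  have a1 : 0 <= (N.+1%:R / (N.+1%:R + `|x|) : R) <= 1.
    by rewrite divr_ge0 ?(ltW (d1 _ _))//= ler_pdivrMr// mul1r lerDl.
  have a2 : 0 <= y ^+ 2 / (y ^+ 2 + N.+1%:R^-1) <= 1.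
    by rewrite divr_ge0 ?sqr_ge0 ?(ltW (d2 _ _))//= ler_pdivrMr// mul1r lerDl ltW.
  have /andP[? ?] := a1; have /andP[? ?] := a2.
  by rewrite /q mulr_ge0//= mulr_ile1.
have bh N : bm (h N).
  split.
    have c1 : continuous (fun x : R => x * (N.+1%:R / (N.+1%:R + `|x|))).
      apply: contM; first by move=> x; exact: cvg_id.
      apply: contM; first exact: cont_cst.
      apply: contV; first by move=> x; rewrite gt_eqF.
      apply: contD; first exact: cont_cst.
      exact: norm_continuous.
    have c2 : continuous (fun y : R => y / (y ^+ 2 + N.+1%:R^-1)).
      apply: contM; first by move=> x; exact: cvg_id.
      apply: contV; first by move=> x; rewrite gt_eqF.
      apply: contD; last exact: cont_cst.
      by apply: contX => x; exact: cvg_id.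
    apply: measurable_funM.
      exact: (measurableT_comp (continuous_measurable_fun c1) mg).
    exact: (measurableT_comp (continuous_measurable_fun c2) mD).
  exists (N.+1%:R * (M / N.+1%:R^-1)) => t; rewrite /h normrM ler_pM//.
    rewrite normrM [X in _ * X <= _]ger0_norm ?divr_ge0 ?(ltW (d1 _ _))//.
    by rewrite mulrA ler_pdivrMr// mulrC ler_wpM2l// lerDr.
  rewrite normrM normfV [X in _ / X]gtr0_norm// ler_pM ?invr_ge0 ?(ltW (d2 _ _))//.
  by rewrite lef_pV2 ?posrE// lerDr sqr_ge0.
have cvh : sqdist mu g (fun t => h N t * D t) @[N --> \oo] --> (0 : R).
  have mhD N : measurable_fun setT (fun t => (g t - h N t * D t) ^+ 2).
    apply: (measurableT_comp (exprn_measurable 2)); apply: measurable_funB => //.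
    by apply: measurable_funM => //; have [] := bh N.
  have hle N t : `|(g t - h N t * D t) ^+ 2| <= g t ^+ 2.
    rewrite ger0_norm ?sqr_ge0// hD (_ : g t - _ = g t * (1 - q N (g t) (D t))); last by ring.
    have /andP[? ?] := q01 N (g t) (D t).
    by rewrite exprMn ler_piMr ?sqr_ge0// expr_le1// ?subr_ge0// gerBl.
  have hcv : \forall t \ae mu, (g t - h N t * D t) ^+ 2 @[N --> \oo] --> (0 : R).
    move: D0; apply: filterS => t Dt; rewrite (_ : (0 : R) = 0 * 0); last by rewrite mulr0.
    by under eq_fun do rewrite hD expr2; apply: cvgM; exact: cvg_truncation.
  have [_] := @Int_dct _ T R mu (fun N t => (g t - h N t * D t) ^+ 2) (fun=> 0) (fun t => g t ^+ 2)
    mhD (measurable_cst _) Ig hle hcv.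
  by rewrite Int_cst.
have e8 : 0 < e / 8 by rewrite divr_gt0.
have [N HN] : exists N, sqdist mu g (fun t => h N t * D t) < e / 8.
  have H : \forall N \near \oo, sqdist mu g (fun t => h N t * D t) < e / 8 by exact: (@cvgr_lt _ _ _ _ _ 0).
  by have [N] := filter_ex H; exists N.
have M21 : 0 < M ^+ 2 + 1 by rewrite ltr_wpDl ?sqr_ge0.
have [F tF HF] := approx_bm Hroot Hhaar (bh N) (divr_gt0 e8 M21).
have bF := trigp_bm Hroot tF.
have bhN := bh N.
have sF : sqint (fun t : T => F (repr t)) by exact: bm_sqint.
have sFD : sqint (fun t : T => F (repr t) * D t) by apply: bm_sqint; exact: bmM.
have shD : sqint (fun t : T => h N t * D t) by apply: bm_sqint; exact: bmM.
have H2 : sqdist mu (fun t => h N t * D t) (fun t => F (repr t) * D t) < e / 8.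
  move: HF; rewrite ltr_pdivlMr// mulrC; apply: le_lt_trans.
  apply: (@le_trans _ _ (M ^+ 2 * sqdist mu (h N) (fun t => F (repr t)))); last first.
    by rewrite ler_wpM2r ?sqd_ge0// lerDl.
  have i2 : intg (fun t => (h N t - F (repr t)) ^+ 2) by apply: sqint_sqr => //; exact: bm_sqint.
  rewrite -IntZ//; apply: Int_le; [exact: sqint_sqr|exact: intgZ|].
  move=> t; rewrite -mulrBl exprMn mulrC ler_wpM2r ?sqr_ge0//.
  by rewrite -real_normK ?num_real// lerXn2r ?nnegrE.
have H3 : sqdist mu g (fun t => F (repr t) * D t) < e.
  by have := sqd_triangle g2 shD sFD; move: HN H2; lra.
exists (weyl_avg F); split.
- exact: trigp_weyl_avg.
- by move=> w W x; exact: weyl_avg_inv.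
(* Averaging does not increase the distance: [g] and [D] are invariant, so the new error is the mean
   of the transforms of the old one, and [sqr_mean] applies. *)
apply: le_lt_trans H3.
pose r t := g t - F (repr t) * D t.
have r2 : sqint r by exact: sqintB.
have [mr Ir] := (sqintP mu r).1 r2.
have bA := trigp_bm Hroot (trigp_weyl_avg tF).
have Iw w : w \in weyl_seq -> intg (fun t => r (weyl_act w t) ^+ 2) /\
    Int (fun t => r (weyl_act w t) ^+ 2) = Int (fun t => r t ^+ 2).
  by move=> /weyl_seqP W; exact: (Int_weyl Hroot Hhaar W Ir).
have [Is IE] := @Int_big_sum _ T R mu _ weyl_seq (fun w t => r (weyl_act w t) ^+ 2)
  (fun w ws => (Iw w ws).1).
have m0 := weyl_size_gt0.
have -> : sqdist mu g (fun t => F (repr t) * D t) =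
    Int (fun t => (size weyl_seq)%:R^-1 * \sum_(w <- weyl_seq) r (weyl_act w t) ^+ 2).
  rewrite IntZ// IE (eq_big_seq (fun=> Int (fun t => r t ^+ 2))); last by move=> w /Iw[].
  by rewrite sum_const_seq mulrA mulVf ?mul1r// gt_eqF.
have mrw w : weyl Phi w -> measurable_fun setT (fun t => r (weyl_act w t)).
  by move=> W; exact: (measurableT_comp mr (weyl_act_measurable Hroot W)).
have mavg : measurable_fun setT (fun t => ((size weyl_seq)%:R^-1 * \sum_(w <- weyl_seq) r (weyl_act w t)) ^+ 2).
  apply: (measurableT_comp (exprn_measurable 2)); apply: measurable_funM; first exact: measurable_cst.
  rewrite (_ : (fun _ => _) = fun t => \sum_(w <- weyl_seq) if w \in weyl_seq then r (weyl_act w t) else 0).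
    apply: measurable_sum => w; have [/weyl_seqP W|_] := boolP (w \in weyl_seq); [exact: mrw|exact: measurable_cst].
  by apply/funext => t; apply: eq_big_seq => w ->.
have -> : sqdist mu g (fun t => weyl_avg F (repr t) * D t) =
    Int (fun t => ((size weyl_seq)%:R^-1 * \sum_(w <- weyl_seq) r (weyl_act w t)) ^+ 2).
  apply: Int_ae.
  - apply: (measurableT_comp (exprn_measurable 2)); apply: measurable_funB => //.
    by apply: measurable_funM => //; have [] := bA.
  - exact: mavg.
  have : \forall t \ae mu, forall w, w \in weyl_seq -> g (weyl_act w t) = g t.
    by apply: near_seq => w /weyl_seqP; exact: gW.
  apply: filterS => t gt; congr (_ ^+ 2).
  transitivity ((size weyl_seq)%:R^-1 * \sum_(w <- weyl_seq) (g t - F (repr t *m w) * D t)).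
    rewrite sumrB sum_const_seq mulrBr mulrA mulVf ?gt_eqF// mul1r; congr (_ - _).
    by rewrite /weyl_avg -mulrA mulr_suml.
  congr (_ * _); apply: eq_big_seq => w ws; have W := (weyl_seqP w).1 ws.
  by rewrite /r gt// DW// (weyl_act_repr _ W (trigp_periodic tF)).
have igm : intg (fun t => (size weyl_seq)%:R^-1 * \sum_(w <- weyl_seq) r (weyl_act w t) ^+ 2) by exact: intgZ.
apply: Int_le => //; last by move=> t; exact: sqr_mean.
apply: (intg_dom mavg igm) => t; rewrite ger0_norm ?sqr_ge0//; exact: sqr_mean.
Qed.

End Average.

Lemma quarter_bound {R : realFieldType} (a b c e : R) :
  b <= e / 4 -> a < c -> c <= e / 4 -> 2 * a + 2 * b < e.
Proof. lra. Qed.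

(** * The adjoint pairing on real functions *)

Section RealInner.
Context {d} {T : measurableType d} {R : realType} (mu : probability T R).
Implicit Types f g h x y z u v w : T -> R.
Local Notation Int f := (\int[mu]_(t in setT) f t)%R.
Local Notation sqint f := (f \in Lfun mu 2%:E).

Definition rip f g : R := Int (fun t => f t * g t).

Lemma ripC f g : rip f g = rip g f.
Proof. by apply: eq_Rintegral => t _; rewrite mulrC. Qed.

Lemma ripDZ c f g h : sqint f -> sqint g -> sqint h ->
  rip (fun t => f t + c * g t) h = rip f h + c * rip g h.
Proof.
move=> f2 g2 h2; rewrite /rip -IntZ; last exact: sqint_mul.
rewrite -IntD; [|exact: sqint_mul|by apply: intgZ; exact: sqint_mul].
by apply: eq_Rintegral => t _ /=; ring.
Qed.

Lemma ripB f g h : sqint f -> sqint g -> sqint h ->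
  rip (fun t => f t - g t) h = rip f h - rip g h.
Proof.
move=> f2 g2 h2; rewrite -mulN1r -ripDZ//.
by congr (rip _ _); apply/funext => t; rewrite mulN1r.
Qed.

(* The last clause says that y lies in the span of es, in a form stable under null sets. *)
Lemma projection (S : (T -> R) -> Prop) : (forall f, S f -> sqint f) -> S (fun=> 0) ->
  (forall c f g, S f -> S g -> S (fun t => f t + c * g t)) ->
  forall es : seq (T -> R), (forall i, (i < size es)%N -> S (nth (fun=> 0) es i)) ->
  forall x, sqint x -> exists y, [/\ S y,
    forall i, (i < size es)%N -> rip (fun t => x t - y t) (nth (fun=> 0) es i) = 0 &
    forall z, sqint z -> (forall i, (i < size es)%N -> rip z (nth (fun=> 0) es i) = 0) -> rip z y = 0].
Proof.
move=> S2 S0 SD; elim=> [|e es IH] He x x2.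
  exists (fun=> 0); split => // z z2 _; rewrite /rip.
  by under eq_Rintegral do rewrite mulr0; rewrite Int_cst.
have He' i : (i < size es)%N -> S (nth (fun=> 0) es i) by move=> ie; exact: (He i.+1).
have Se : S e by exact: (He 0%N).
have [y0 [Sy0 xy0 py0]] := IH He' x x2.
have [e0 [Se0 ee0 pe0]] := IH He' e (S2 _ Se).
pose e' t := e t - e0 t.
have Se' : S e'.
  have := SD (-1) _ _ Se Se0; rewrite (_ : (fun t => _) = e')//.
  by apply/funext => t; rewrite mulN1r.
have y02 := S2 _ Sy0; have e2 := S2 _ Se; have e02 := S2 _ Se0; have e'2 := S2 _ Se'.
have dec z : sqint z -> rip z e = rip z e' + rip z e0.
  by move=> z2; rewrite ripC [X in X + _]ripC [X in _ + X]ripC ripB// subrK.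
(* Gram-Schmidt: [e'] is [e] minus its projection on the previous vectors. If its norm is 0 it
   vanishes almost everywhere and adds no direction. *)
have [q0|q0] := eqVneq (rip e' e') 0.
  exists y0; split => //.
    case=> [_|i ie]; last exact: xy0.
    have z2 : sqint (fun t => x t - y0 t) by exact: sqintB.
    rewrite /= dec// (pe0 _ z2 xy0) addr0.
    rewrite /rip (@Int_ae _ _ _ mu _ (fun=> 0)) ?Int_cst//; first by apply: measurable_funM; [exact: (sqint_meas z2)|exact: (sqint_meas e'2)].
    have := Int_sqr_eq0 (sqint_meas e'2) ((sqintP mu e').1 e'2).2.
    move=> H; have /H : Int (fun t => e' t ^+ 2) = 0.
      by rewrite -[RHS]q0; apply: eq_Rintegral => t _; rewrite expr2.
    by apply: filterS => t ->; rewrite mulr0.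
  by move=> z z2 H; apply: py0 => // i ie; exact: (H i.+1).
pose c := rip (fun t => x t - y0 t) e' / rip e' e'.
exists (fun t => y0 t + c * e' t).
have xE : (fun t => x t - (y0 t + c * e' t)) = (fun t => (x t - y0 t) + - c * e' t).
  by apply/funext => t; ring.
have xy2 : sqint (fun t => x t - y0 t) by exact: sqintB.
have Sy := SD c _ _ Sy0 Se'.
have perp_es i : (i < size es)%N -> rip (fun t => x t - (y0 t + c * e' t)) (nth (fun=> 0) es i) = 0.
  move=> ie; rewrite xE ripDZ//; last exact: S2 (He' i ie).
  by rewrite xy0// ee0// mulr0 addr0.
have xyy2 : sqint (fun t => x t - (y0 t + c * e' t)) by apply: sqintB => //; exact: S2.
split => //.
- case=> [_|i ie]; last exact: perp_es.
  rewrite /= dec// (pe0 _ xyy2 perp_es) addr0 xE ripDZ// /c mulNr mulfVK// subrr.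
  by [].
move=> z z2 H; have Hes i : (i < size es)%N -> rip z (nth (fun=> 0) es i) = 0 by move=> ie; exact: (H i.+1).
have := dec z z2; rewrite (H 0%N)// (pe0 _ z2 Hes) addr0 => ze'.
by rewrite ripC ripDZ// ripC (py0 _ z2 Hes) ripC -ze' mulr0 addr0.
Qed.

(** Pythagoras: the projection is the best approximation. *)
Lemma sqd_perp x y f : sqint x -> sqint y -> sqint f ->
  rip (fun t => x t - y t) (fun t => y t - f t) = 0 -> sqdist mu x y <= sqdist mu x f.
Proof.
move=> x2 y2 f2 H.
have xy2 : sqint (fun t => x t - y t) by exact: sqintB.
have yf2 : sqint (fun t => y t - f t) by exact: sqintB.
have E : sqdist mu x f = sqdist mu x y + sqdist mu y f.
  have -> : sqdist mu x f = Int (fun t => ((x t - y t) ^+ 2 + (y t - f t) ^+ 2) + 2 * ((x t - y t) * (y t - f t))).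
    by apply: eq_Rintegral => t _; ring.
  have i1 := sqint_sqr x2 y2; have i2 := sqint_sqr y2 f2; have i3 := sqint_mul xy2 yf2.
  rewrite IntD; [|exact: intgD|exact: intgZ].
  by rewrite IntZ// -/(rip _ _) H mulr0 addr0 IntD.
by rewrite E lerDl sqd_ge0.
Qed.

(** In the application [H] is the invariant square integrable functions, [S N] the invariant
    trigonometric polynomials of square frequency at most [N] times Delta, [A] the trigonometric
    operator on them, and [B] the bounded difference of the potentials. *)
Variables (H : (T -> R) -> Prop) (S : R -> (T -> R) -> Prop) (A : (T -> R) -> (T -> R) -> Prop)
  (B : T -> R).
Hypothesis H2 : forall f, H f -> sqint f.
Hypothesis SH : forall N f, S N f -> H f.
Hypothesis HB : forall f g, H f -> H g -> H (fun t => f t - B t * g t).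
Hypothesis bB : bm B.
Hypothesis S0 : forall N, S N (fun=> 0).
Hypothesis SD : forall N c f g, S N f -> S N g -> S N (fun t => f t + c * g t).
Hypothesis Sle : forall N M f, N <= M -> S N f -> S M f.
Hypothesis Sfin : forall N, exists es : seq (T -> R),
  (forall i, (i < size es)%N -> S N (nth (fun=> 0) es i)) /\
  forall y, S N y -> forall z, sqint z -> (forall i, (i < size es)%N -> rip z (nth (fun=> 0) es i) = 0) ->
    rip z y = 0.
Hypothesis Sdense : forall g, H g -> forall e : R, 0 < e -> exists N f, S N f /\ sqdist mu g f < e.
Hypothesis SA : forall N f, S N f -> exists2 f', S N f' & A f f'.
Hypothesis Asym : forall f f' g g', A f f' -> A g g' -> rip f' g = rip f g'.

(* Project on the finite-dimensional invariant subspaces: if [y] is the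
   projection of [u], then [A y] is the projection of [w - B u]. *)
Lemma core_approx u w : H u -> H w ->
  (forall N f f', S N f -> S N f' -> A f f' -> rip u (fun t => f' t + B t * f t) = rip w f) ->
  forall e : R, 0 < e -> exists N f f', [/\ S N f, S N f', A f f', sqdist mu u f < e &
    sqdist mu w (fun t => f' t + B t * f t) < e].
Proof.
move=> Hu Hw uw e e0; have [mB [M BM]] := bB.
pose v t := w t - B t * u t.
have Hv : H v by exact: HB.
have u2 := H2 Hu; have w2 := H2 Hw; have v2 := H2 Hv.
(* Returning from [v] to [w] adds the error [B (u - y)], whose square norm is up to [M^2] times that
   of [u - y]. *)
pose e' := e / (4 * (M ^+ 2 + 1)).
have M1 : 0 < M ^+ 2 + 1 by rewrite ltr_wpDl ?sqr_ge0.
have e'0 : 0 < e' by rewrite divr_gt0// mulr_gt0.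
have [N1 [f1 [Sf1 uf1]]] := Sdense Hu e'0.
have [N2 [f2 [Sf2 vf2]]] := Sdense Hv e'0.
pose N := Num.max N1 N2.
have {}Sf1 : S N f1 by apply: Sle Sf1; rewrite le_max lexx.
have {}Sf2 : S N f2 by apply: Sle Sf2; rewrite le_max lexx orbT.
have S2 f : S N f -> sqint f by move=> /SH; exact: H2.
have [es [esS esP]] := Sfin N.
have [y [Sy uy _]] := projection S2 (S0 N) (@SD N) esS u2.
have y2 := S2 _ Sy.
have [y' Sy' Ay] := SA Sy; have y'2 := S2 _ Sy'.
exists N, y, y'.
have pu f : S N f -> rip (fun t => u t - y t) f = 0.
  by move=> Sf; apply: (esP f Sf) => //; exact: sqintB.
have SB f g : S N f -> S N g -> S N (fun t => f t - g t).
  move=> Sf Sg; have := SD (-1) Sf Sg; rewrite (_ : (fun t => _) = (fun t => f t - g t))//.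
  by apply/funext => t; rewrite mulN1r.
have sB f : sqint f -> sqint (fun t => B t * f t) by exact: sqint_bm.
(* By symmetry [<y', f> = <y, f'>], which equals [<u, f'>] because [f'] lies again in the subspace;
   the hypothesis on [u] and [w] turns this into [<v, f>]. *)
have pv f : S N f -> rip (fun t => v t - y' t) f = 0.
  move=> Sf; have [f' Sf' Af] := SA Sf; have f2' := S2 _ Sf; have f'2 := S2 _ Sf'.
  rewrite ripB// (Asym Ay Af).
  have := pu _ Sf'; rewrite ripB// => /eqP; rewrite subr_eq0 => /eqP <-.
  have := uw _ _ _ Sf Sf' Af.
  have -> : rip u (fun t => f' t + B t * f t) = rip u f' + rip u (fun t => B t * f t).
    rewrite ripC [X in X + _]ripC [X in _ + X]ripC -[X in _ + X]mul1r -ripDZ//; last exact: sB.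
    by congr rip; apply/funext => t; rewrite mul1r.
  have -> : rip v f = rip w f - rip u (fun t => B t * f t).
    rewrite /v ripB//; last exact: sB.
    by congr (_ - _); apply: eq_Rintegral => t _; ring.
  by move=> <-; ring.
have uy_lt : sqdist mu u y < e'.
  by apply: le_lt_trans uf1; apply: sqd_perp => //; [exact: S2|apply: pu; exact: SB].
have vy_lt : sqdist mu v y' < e'.
  by apply: le_lt_trans vf2; apply: sqd_perp => //; [exact: S2|apply: pv; exact: SB].
have e'e : e' <= e / 4.
  rewrite /e' ler_pM2l// lef_pV2 ?posrE ?mulr_gt0// ler_peMr// lerDr sqr_ge0//.
split => //; first by apply: (lt_le_trans uy_lt); lra.
have i1 := sqint_sqr v2 y'2; have i2 := sqint_sqr u2 y2.
have le1 : sqdist mu w (fun t => y' t + B t * y t) <= 2 * sqdist mu v y' + 2 * (M ^+ 2 * sqdist mu u y).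
  rewrite /sqdist -(IntZ (M ^+ 2))// -!IntZ//; last by apply: intgZ.
  rewrite -IntD; [|exact: intgZ|by apply: intgZ; apply: intgZ].
  apply: Int_le; first by apply: sqint_sqr => //; apply: sqintD => //; exact: sB.
    by apply: intgD; apply: intgZ => //; apply: intgZ.
  move=> t /=.
  have -> : w t - (y' t + B t * y t) = (v t - y' t) + B t * (u t - y t) by rewrite /v; ring.
  have : (B t * (u t - y t)) ^+ 2 <= M ^+ 2 * (u t - y t) ^+ 2.
    rewrite exprMn ler_wpM2r ?sqr_ge0// -real_normK ?num_real//.
    by rewrite lerXn2r ?nnegrE// (le_trans _ (BM t)).
  move: (v t - y' t) (B t * _) (M ^+ 2 * _) => a b c bc.
  by have := sqr_ge0 (a - b); nra.
have le2 : M ^+ 2 * sqdist mu u y <= e / 4.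
  apply: (@le_trans _ _ ((M ^+ 2 + 1) * e')).
    by apply: ler_pM; rewrite ?sqr_ge0 ?sqd_ge0 ?lerDl ?ltW.
  by rewrite /e' invfM mulrC -!mulrA mulVf ?mulr1 ?gt_eqF.
apply: (le_lt_trans le1); move: le2 vy_lt e'e.
exact: quarter_bound.
Qed.

End RealInner.

(** * Invariant trigonometric polynomials times Delta *)

Section Core.
Context {R : realType} {n : nat} (Phi Phip : {fset 'rV[R]_n}) (mu : probability (torus Phi) R)
  (k : 'rV[R]_n -> R).
Hypothesis Hroot : root_system Phi.
Hypothesis Hhaar : normalized_haar mu.
Hypothesis Hpos : positive_roots Phi Phip.
Hypothesis Hk : forall w a, weyl Phi w -> a \in Phi -> k (a *m w) = k a.
Hypothesis Hk0 : forall a, a \in Phi -> 0 <= k a.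
Implicit Types (a b l x : 'rV[R]_n) (F : 'rV[R]_n -> R).
Local Notation T := (torus Phi).
Local Notation Int f := (\int[mu]_(t in setT) f t)%R.
Local Notation sqint f := (f \in Lfun mu 2%:E).
Local Notation D t := (wDelta Phip k (repr t)).
Local Notation avg := (weyl_avg Hroot).

Definition sqintW (f : T -> R) := sqint f /\ forall w, weyl Phi w -> \forall t \ae mu, f (weyl_act w t) = f t.

Definition winv F := forall w, weyl Phi w -> forall x, F (x *m w) = F x.

Definition trigD N (f : T -> R) := exists F, [/\ rtp Phi N F, winv F & f = fun t => F (repr t) * D t].

(** The coordinates of [l] in the dual basis are the integers [<l, b_i>], bounded since
    [2 |<l, b_i>| <= |l|^2 + |b_i|^2]. They are shifted by [K] to be listed as naturals. *)
Lemma weights_finite N : exists s : seq 'rV[R]_n,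
  forall l, weight_lattice Phi l -> dot l l <= N -> l \in s.
Proof.
have [b [lam [bP lamP xE]]] := dual_basis Hroot.
have lE l : l = \sum_i dot l (b i) *: lam i.
  apply/eqP; rewrite -subr_eq0 -dot_eq0; set d := l - _.
  have dx x : dot l x = dot (\sum_i dot l (b i) *: lam i) x.
    rewrite {1}(xE x) dot_sumr dotC dot_sumr; apply: eq_bigr => i _.
    by rewrite !dotZr mulrC [dot (lam i) x]dotC.
  by rewrite {1}/d dotBl dx subrr.
have [K HK] : exists K : nat, forall i, (N + dot (b i) (b i)) / 2 <= K%:R.
  exists (Num.trunc (\sum_i `|(N + dot (b i) (b i)) / 2|)).+1 => i.
  rewrite (le_trans (ler_norm _))//; apply: (@le_trans _ _ (\sum_i `|(N + dot (b i) (b i)) / 2|)).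
    by rewrite (bigD1 i)//= lerDl sumr_ge0.
  by apply: ltW; apply: truncnS_gt.
exists [seq \sum_i ((f i : nat)%:R - K%:R) *: lam i | f : {ffun 'I_n -> 'I_(K + K).+1} <- enum {: {ffun 'I_n -> 'I_(K + K).+1}}].
move=> l lP lN; apply/mapP.
have /choice[m mE] : forall i, exists m : 'I_(K + K).+1, dot l (b i) = (m : nat)%:R - K%:R.
  move=> i; have [z zE] := wl_cl lP (bP i).
  have : `|dot l (b i)| <= K%:R.
    apply: le_trans (HK i); have := dot_ge0 (l - b i); have := dot_ge0 (l + b i).
    rewrite dotBl !dotBr dotDl !dotDr (dotC (b i) l) => h1 h2.
    by rewrite ler_norml; apply/andP; split; lra.
  rewrite zE -intr_norm -[K%:R]/(K%:Z%:~R) ler_int => zK.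
  have H : (`|(z + K%:Z)%R|%N < (K + K).+1)%N by move: zK; clear; lia.
  exists (Ordinal H) => /=.
  have -> : (`|(z + K%:Z)%R|%N)%:R = (z + K%:Z)%:~R :> R.
    by rewrite -[LHS]/((Posz _)%:~R); congr (_%:~R); move: zK; clear; lia.
  by rewrite intrD addrK.
exists (finfun m); first by rewrite mem_enum.
rewrite {1}(lE l); apply: eq_bigr => i _.
by rewrite mE ffunE.
Qed.

Lemma wDelta_neq0 : \forall t \ae mu, D t != 0.
Proof.
move: (walls_null Hroot Hhaar Hpos); apply: filterS => t H.
rewrite /wDelta prodf_seq_neq0; apply/allP => a aP /=.
by rewrite powR_eq0 norm_sin_half negb_and sqrtr_eq0 -ltNge lt0r H// sg_ge0.
Qed.

Lemma bm_trigD F : continuous F -> cl_periodic Phi F -> bm (fun t : T => F (repr t) * D t).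
Proof.
move=> cF pF; apply: bmM; first exact: (periodic_bm Hroot).
exact: (bm_wDelta Hroot Hpos Hk0).
Qed.

Lemma trigD_sqintW F : continuous F -> cl_periodic Phi F -> winv F ->
  sqintW (fun t => F (repr t) * D t).
Proof.
move=> cF pF iF; split; first by apply: bm_sqint; exact: bm_trigD.
move=> w W; apply: nearW => t.
by rewrite (weyl_act_repr (F := F) t W pF) iF// (wDelta_weyl Hroot Hpos Hk).
Qed.

(** The W-averages of the cosines of phases 0 and [pi / 2], over the finitely many admissible
    weights, span: by the addition formula these two phases give every other. *)
Lemma trigD_fin N : exists es : seq (T -> R),
  (forall i, (i < size es)%N -> trigD N (nth (fun=> 0) es i)) /\
  forall y, trigD N y -> forall z, sqint z ->
    (forall i, (i < size es)%N -> rip mu z (nth (fun=> 0) es i) = 0) -> rip mu z y = 0.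
Proof.
have [s sP] := weights_finite N.
pose q (lc : 'rV[R]_n * R) : 'rV[R]_n -> R := avg (fun x => 1 * cos (dot lc.1 x + lc.2)).
pose e lc (t : T) := q lc (repr t) * D t.
pose ls := [seq l <- s | `[< weight_lattice Phi l /\ dot l l <= N >]].
pose qs := [seq (l, c) | l <- ls, c <- [:: (0 : R); pi / 2]].
have qsP l c : (l, c) \in qs -> weight_lattice Phi l /\ dot l l <= N.
  by case/allpairsP => -[l' c'] /= [+ _ [-> _]]; rewrite mem_filter => /andP[/asboolP].
have qr l c : weight_lattice Phi l -> dot l l <= N -> rtp Phi N (q (l, c)).
  by move=> lP lN; apply: rtp_weyl_avg; exact: rtp_cos.
have eS l c : weight_lattice Phi l -> dot l l <= N -> trigD N (e (l, c)).
  move=> lP lN; exists (q (l, c)); split => //; first exact: qr.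
  by move=> w W x; exact: weyl_avg_inv.
exists [seq e lc | lc <- qs]; split.
  move=> i; rewrite size_map => iq; rewrite (nth_map (0, 0))//.
  have := mem_nth (0, 0) iq; case: (nth _ _ _) => l c /qsP[]; exact: eS.
move=> y [F [[r [rP FE]] iF ->]] z z2 H.
have ez l c : weight_lattice Phi l -> dot l l <= N -> c \in [:: 0; pi / 2] -> rip mu z (e (l, c)) = 0.
  move=> lP lN cP; have lcq : (l, c) \in qs.
    by apply/allpairsP; exists (l, c); split => //=; rewrite mem_filter sP// andbT; apply/asboolP.
  have := H (index (l, c) qs); rewrite size_map index_mem (nth_map (0, 0)) ?index_mem// nth_index//.
  exact.
have e2 l c : weight_lattice Phi l -> dot l l <= N -> sqint (e (l, c)).
  move=> lP lN; apply: bm_sqint; have hq := qr l c lP lN.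
  by apply: bm_trigD; [exact: rtp_cont hq|exact: rtp_periodic hq].
have yE t : F (repr t) * D t = \sum_(i <- r)
    (i.2.1 * cos i.2.2 * e (i.1, 0) t + i.2.1 * sin i.2.2 * e (i.1, pi / 2) t).
  rewrite -(weyl_avg_id Hroot (x := repr t) (fun w W => iF w W _)) /weyl_avg.
  under eq_bigr do rewrite FE.
  rewrite exchange_big /= mulr_sumr mulr_suml; apply: eq_bigr => i _.
  rewrite /e /q /weyl_avg /= !mulr_sumr !mulr_suml !mulr_sumr -big_split /=.
  apply: eq_bigr => w _; rewrite addr0 cosD cosDpihalf; ring.
rewrite /rip; under eq_Rintegral do rewrite yE mulr_sumr.
have I c l : weight_lattice Phi l -> dot l l <= N -> mu.-integrable setT (EFin \o (fun t => z t * e (l, c) t)).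
  by move=> lP lN; apply: sqint_mul => //; exact: e2.
pose G (i : 'rV[R]_n * (R * R)) := (fun t => i.2.1 * cos i.2.2 * (z t * e (i.1, 0) t)) \+
  (fun t => i.2.1 * sin i.2.2 * (z t * e (i.1, pi / 2) t)).
have [_ E] := @Int_big_sum _ T R mu _ r G (fun i ir => intgD
  (intgZ (i.2.1 * cos i.2.2) (I 0 i.1 (rP i ir).1 (rP i ir).2))
  (intgZ (i.2.1 * sin i.2.2) (I (pi / 2) i.1 (rP i ir).1 (rP i ir).2))).
transitivity (Int (fun t => \sum_(i <- r) G i t)).
  by apply: eq_Rintegral => t _; apply: eq_bigr => i _; rewrite /G /=; ring.
rewrite E big_seq big1// => i ir; have [iP iN] := rP i ir.
rewrite /G IntD; [|exact: intgZ (I _ _ iP iN)|exact: intgZ (I _ _ iP iN)].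
rewrite !IntZ; [|exact: (I _ _ iP iN)|exact: (I _ _ iP iN)].
by rewrite -!/(rip mu _ _) !ez ?inE ?eqxx ?orbT// !mulr0 addr0.
Qed.

Variable cQ : R.
Hypothesis HcQ : \forall t \ae mu, \sum_(a <- Phip) \sum_(b <- Phip | b != a)
  k a * k b * dot a b * (cot (dot a (repr t) / 2) * cot (dot b (repr t) / 2)) = cQ.

Local Notation wd := (wdata Phi Phip).
Local Notation gg := (gauge Phip k cQ).

(* Averaging over W, harmless against W-invariant functions, spares proving that
   the gauged operator preserves invariance. *)
Definition trigA (f f' : T -> R) := exists F G H (h : 'rV[R]_n -> 'rV[R]_n -> R), [/\ wd F G H h, winv F,
  f = (fun t => F (repr t) * D t) & f' = fun t => avg (gg F H h) (repr t) * D t].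

Lemma gauge_data N F : rtp Phi N F -> winv F ->
  exists G H (h : 'rV[R]_n -> 'rV[R]_n -> R), wd F G H h /\ rtp Phi N (gg F H h).
Proof.
move=> hF iF; have [G [H [J hG hH]]] := rtp_jet hF; have [_ cG _ dF] := J.
have dFa a x : is_derive x a F (grad G a x).
  by apply: (@C1_directional R n F G) => // i y; have [] := dF i y.
have /choice[g gP] : forall a, exists g, a \in Phip -> rtp Phi N g /\ forall x,
    sin (dot a x / 2) * g x = cos (dot a x / 2) * grad G a x.
  move=> a; have [aP|] := boolP (a \in Phip); last by exists (fun=> 0).
  have aPhi := pos_root Hpos aP.
  have [|g hg gE] := rtp_cot_derive Hroot aPhi hF _ (dFa a); last by exists g.
  by move=> x; rewrite -mul_reflection_mx iF//; exact: weyl_refl1.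
exists G, H, g; split.
  split => //; first exact: rtp_periodic hF.
  move=> a aP; have [hg gE] := gP a aP.
  by split => //; [exact: rtp_cont hg|exact: rtp_periodic hg].
apply: rtpD; last exact: rtpZ.
have E y z : y - z = y + -1 * z by move=> *; rewrite mulN1r.
rewrite (_ : (fun x => _) = fun x => -1 * (\sum_i H i x) + -1 * \sum_(a <- Phip) k a * g a x); last first.
  by apply/funext => x; rewrite !mulN1r.
apply: rtpD; apply: rtpZ; first by apply: rtp_sum => i _ _; exact: hH.
by apply: rtp_sum => a aP _; apply: rtpZ; have [] := gP a aP.
Qed.

Lemma Int_gauge_avg phi F G H h : sqintW phi -> wd F G H h ->
  Int (fun t => phi t * (avg (gg F H h) (repr t) * D t)) =
  Int (fun t => phi t * (gg F H h (repr t) * D t)).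
Proof.
move=> [phi2 phiW] W.
transitivity (Int (fun t => (phi t * D t) * avg (gg F H h) (repr t))).
  by apply: eq_Rintegral => t _; ring.
rewrite (Int_weyl_avg Hroot Hhaar); first by apply: eq_Rintegral => t _; ring.
- rewrite (_ : (fun _ => _) = (fun t => D t) \* phi).
    by apply: sqint_bm => //; exact: (bm_wDelta Hroot Hpos Hk0).
  by apply/funext => t; rewrite /= mulrC.
- move=> w hw; move: (phiW w hw); apply: filterS => t ->.
  by rewrite (wDelta_weyl Hroot Hpos Hk).
- exact: (cont_gauge W).
- exact: (periodic_gauge k Hroot Hhaar cQ W).
Qed.

Lemma trigA_sym f f' g g' : trigA f f' -> trigA g g' -> rip mu f' g = rip mu f g'.
Proof.
move=> [F [G [H [h [W iF -> ->]]]]] [F' [G' [H' [h' [W' iF' -> ->]]]]].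
have [[[cF _ _ _] pF _] [[cF' _ _ _] pF' _]] := (W, W').
rewrite ripC /rip (Int_gauge_avg _ W); last exact: trigD_sqintW.
rewrite (Int_gauge_avg _ W'); last exact: trigD_sqintW.
have [bu] := gauge_symmetric Hroot Hhaar Hpos Hk0 W W' cQ.
have b1 : bm (fun t : T => F (repr t) * D t * (gg F' H' h' (repr t) * D t)).
  apply: bmM; first exact: bm_trigD.
  by apply: bm_trigD; [exact: (cont_gauge W')|exact: (periodic_gauge k Hroot Hhaar cQ W')].
have b2 : bm (fun t : T => F' (repr t) * D t * (gg F H h (repr t) * D t)).
  apply: bmM; first exact: bm_trigD.
  by apply: bm_trigD; [exact: (cont_gauge W)|exact: (periodic_gauge k Hroot Hhaar cQ W)].
move=> E; apply/esym/eqP; rewrite -subr_eq0 -IntB; [|exact: bm_intg|exact: bm_intg].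
rewrite -[X in _ == X]E; apply/eqP; apply: eq_Rintegral => t _ /=; ring.
Qed.

Lemma trigD_apply N f : trigD N f -> exists2 f', trigD N f' & trigA f f'.
Proof.
move=> [F [hF iF ->]]; have [G [H [h [W hh]]]] := gauge_data hF iF.
exists (fun t => avg (gg F H h) (repr t) * D t); last by exists F, G, H, h.
exists (avg (gg F H h)); split => //; first exact: rtp_weyl_avg.
by move=> w Ww x; exact: weyl_avg_inv.
Qed.

Lemma trigD_mem N f : trigD N f -> sqintW f.
Proof.
move=> [F [hF iF ->]].
by apply: trigD_sqintW => //; [exact: rtp_cont hF|exact: rtp_periodic hF].
Qed.

Lemma sqintW_bm (B f g : T -> R) : bm B -> (forall w, weyl Phi w -> forall t, B (weyl_act w t) = B t) ->
  sqintW f -> sqintW g -> sqintW (fun t => f t + B t * g t).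
Proof.
move=> bB BW [f2 fW] [g2 gW]; split; first by apply: sqintD => //; exact: sqint_bm.
move=> w W; have := gW w W; have := fW w W; apply: filterS2 => t -> ->.
by rewrite BW.
Qed.

Lemma trigD_dense g : sqintW g -> forall e : R, 0 < e -> exists N f, trigD N f /\ sqdist mu g f < e.
Proof.
move=> [g2 gW] d d0.
have [|F [[N hF] iF FE]] := density Hroot Hhaar (bm_wDelta Hroot Hpos Hk0)
  (fun w W t => wDelta_weyl Hroot Hpos Hk t W) _ g2 gW d0; first exact: wDelta_neq0.
by exists N, (fun t => F (repr t) * D t); split => //; exists F.
Qed.

Lemma trigD_core (B : T -> R) : bm B -> (forall w, weyl Phi w -> forall t, B (weyl_act w t) = B t) ->
  forall u v : T -> R, sqintW u -> sqintW v ->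
  (forall N f f', trigD N f -> trigD N f' -> trigA f f' -> rip mu u (fun t => f' t + B t * f t) = rip mu v f) ->
  forall e : R, 0 < e -> exists N f f', [/\ trigD N f, trigD N f', trigA f f', sqdist mu u f < e &
    sqdist mu v (fun t => f' t + B t * f t) < e].
Proof.
move=> bB BW u v Hu Hv uv e e0.
apply: (@core_approx _ T R mu sqintW trigD trigA B) => //.
- by move=> f [].
- exact: trigD_mem.
- move=> f g Hf Hg; rewrite (_ : (fun t => _) = fun t => f t + (- B t) * g t).
    apply: sqintW_bm => //; first by have := bmZ (-1) bB; under eq_fun do rewrite mulN1r.
    by move=> w W t; rewrite BW.
  by apply/funext => t; rewrite mulNr.
- move=> N; exists (fun=> 0); split => //; first exact: rtp0.
  by apply/funext => t; rewrite mul0r.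
- move=> N c f g [F [hF iF ->]] [G [hG iG ->]]; exists (fun x => F x + c * G x); split.
  + by apply: rtpD => //; exact: rtpZ.
  + by move=> w W x; rewrite iF// iG.
  by apply/funext => t; ring.
- by move=> N M f NM [F [hF iF ->]]; exists F; split => //; exact: rtp_le hF.
- exact: trigD_fin.
- exact: trigD_dense.
- exact: trigD_apply.
- exact: trigA_sym.
Qed.

End Core.

(** * The domain of the elliptic Hamiltonian *)

Section TestFunctions.
Context {R : realType} {n : nat} (Phi Phip : {fset 'rV[R]_n}) (mu : probability (torus Phi) R)
  (k : 'rV[R]_n -> R) (p : R).
Hypothesis Hroot : root_system Phi.
Hypothesis Hhaar : normalized_haar mu.
Hypothesis Hpos : positive_roots Phi Phip.
Hypothesis Hk : forall w a, weyl Phi w -> a \in Phi -> k (a *m w) = k a.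
Hypothesis Hk0 : forall a, a \in Phi -> 0 <= k a.
Hypothesis p1 : -1 < p.
Hypothesis p2 : p < 1.
Implicit Types (a b l x : 'rV[R]_n) (F u : 'rV[R]_n -> R).
Local Notation T := (torus Phi).
Local Notation Int f := (\int[mu]_(t in setT) f t)%R.
Local Notation sqint f := (f \in Lfun mu 2%:E).
Local Notation D t := (wDelta Phip k (repr t)).
Local Notation avg := (weyl_avg Hroot).
Local Notation pot := (potential Phip k p).
Local Notation Vr := (V_reg p (Phi:=Phi) Phip k).

Lemma rtp_C1 N F : rtp Phi N F -> C1 F /\ forall i, rtp Phi N (part i F).
Proof.
move=> hF; suff H i : (forall x, derivable F x (delta_mx 0 i)) /\ rtp Phi N (part i F).
  by split => [i|i]; [split; [exact: (H i).1|exact: rtp_cont (H i).2]|exact: (H i).2].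
have [g hg dg] := rtp_derive (delta_mx 0 i) hF; split; first by move=> x; have [] := dg x.
by apply: rtp_eq hg => x; rewrite /part; have [_ ->] := dg x.
Qed.

Lemma rtp_C2 N F : rtp Phi N F -> C2 F.
Proof. by move=> /rtp_C1[c1 h]; split => // i; have [] := rtp_C1 (h i). Qed.

(** What membership in the domain of [hamiltonian] says of the real part, or of the imaginary part,
    lifted to the covering space; the potential is real, so the two parts decouple. *)
Definition real_dom u := [/\ C2 u, cl_periodic Phi u, winv Phi u,
  sqint (fun t => pot t * u (repr t)) &
  forall a, a \in Phip -> k a = 1 -> sqint (fun t : T => wp p (dot a (repr t)) * u (repr t))].

Definition real_ham u (t : T) := - laplacian u (repr t) + pot t * u (repr t).

Lemma bm_laplacian u : C2 u -> cl_periodic Phi u -> bm (fun t : T => laplacian u (repr t)).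
Proof.
move=> c2 pu; have J := C2_jet c2.
apply: (periodic_bm Hroot (F := lap (fun i => part i (part i u)))); first exact: jet_lap_cont J.
exact: (jet_lap_periodic Hroot Hhaar pu J).
Qed.

Lemma real_ham_sqint u : real_dom u -> sqint (real_ham u).
Proof.
move=> [c2 pu iu Vu _]; apply: sqintD => //; apply: sqintN; apply: bm_sqint; exact: bm_laplacian.
Qed.

Lemma real_dom_bm u : real_dom u -> bm (fun t : T => u (repr t)).
Proof.
move=> [[c1 c2] pu _ _ _]; apply: (periodic_bm Hroot) => //; exact: C1_continuous.
Qed.

Lemma real_dom_sqintW u : real_dom u -> sqintW mu (fun t : T => u (repr t)).
Proof.
move=> du; have bu := real_dom_bm du; have [c2 pu iu _ _] := du.
split; first exact: bm_sqint.
by move=> w W; apply: nearW => t; rewrite (weyl_act_repr (F := u) t W pu) iu.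
Qed.

Variable cQ : R.
Hypothesis HcQ : \forall t \ae mu, \sum_(a <- Phip) \sum_(b <- Phip | b != a)
  k a * k b * dot a b * (cot (dot a (repr t) / 2) * cot (dot b (repr t) / 2)) = cQ.

(** [domain_bound] supplies the quadratic vanishing required by [adjoint_identity], which treats the
    potential at [p = 0]; the bounded remainder [V_reg] only multiplies. The average in [trigA]
    disappears against the invariant [u]. *)
Lemma real_adjoint_pair u f f' : real_dom u -> trigA Phip k Hroot cQ f f' ->
  rip mu f (real_ham u) = rip mu (fun t => f' t + Vr t * f t) (fun t => u (repr t)).
Proof.
move=> du [F [G [H [h [W iF -> ->]]]]]; have [c2 pu iu Vu wu] := du.
have bu := real_dom_bm du; have [u2 uW] := real_dom_sqintW du.
have [[cF _ _ _] pF _] := W.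
have bFD := bm_trigD Hroot Hpos Hk0 cF pF.
have bV : bm Vr by exact: (bm_V_reg p1 p2 k Hroot Hpos).
have cg := cont_gauge (k := k) (cQ := cQ) W.
have pg := periodic_gauge k Hroot Hhaar cQ W.
have bg := bm_trigD Hroot Hpos Hk0 cg pg.
have [C C0 HC] := domain_bound Hroot Hhaar Hpos p1 p2 c2 pu iu Vu wu.
have [_ E] := adjoint_identity Hroot Hhaar Hpos Hk0 W (C2_jet c2) pu C0 HC HcQ.
have i1 : mu.-integrable setT (EFin \o (fun t => F (repr t) * D t * real_ham u t)).
  by apply: sqint_mul; [exact: bm_sqint|exact: real_ham_sqint].
have i2 : mu.-integrable setT (EFin \o (fun t => u (repr t) * (gauge Phip k cQ F H h (repr t) * D t))).
  by apply: bm_intg; exact: bmM.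
have i3 : mu.-integrable setT (EFin \o (fun t => u (repr t) * (Vr t * (F (repr t) * D t)))).
  by apply: bm_intg; apply: bmM => //; exact: bmM.
have bA : bm (fun t : T => avg (gauge Phip k cQ F H h) (repr t) * D t).
  apply: bmM; last exact: (bm_wDelta Hroot Hpos Hk0).
  have cA : continuous (avg (gauge Phip k cQ F H h)).
    apply: contZ; rewrite (_ : (fun _ => _) = fun x => \sum_(w <- weyl_seq Hroot)
      ((gauge Phip k cQ F H h) \o (mulmx^~ w : 'rV[R]_n -> 'rV[R]_n)) x)//.
    apply: cont_sum => w _ x; apply: continuous_comp; [exact: weyl_continuous|exact: cg].
  apply: (periodic_bm Hroot cA) => x q qP; rewrite /weyl_avg; congr (_ * _).
  apply: eq_big_seq => w /weyl_seqP Ww; exact: (periodic_weyl Hroot Ww pg x qP).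
have i4 : mu.-integrable setT (EFin \o (fun t => u (repr t) * (avg (gauge Phip k cQ F H h) (repr t) * D t))).
  by apply: bm_intg; exact: bmM.
rewrite [RHS]ripC.
have -> : rip mu (fun t => u (repr t)) (fun t => avg (gauge Phip k cQ F H h) (repr t) * D t +
     Vr t * (F (repr t) * D t)) =
   Int (fun t => u (repr t) * (gauge Phip k cQ F H h (repr t) * D t)) +
   Int (fun t => u (repr t) * (Vr t * (F (repr t) * D t))).
  rewrite -(@Int_gauge_avg _ _ _ _ _ _ Hroot Hhaar Hpos Hk Hk0 cQ (fun t => u (repr t)) F G H h)// -IntD//.
  by apply: eq_Rintegral => t _ /=; ring.
apply/eqP; rewrite -subr_eq0 -IntD// -IntB//; last exact: intgD.
rewrite -[X in _ == X]E; apply/eqP; apply: eq_Rintegral => t _ /=.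
by rewrite /real_ham potential_split lap_laplacian; ring.
Qed.

(** Each factor cancels the double pole of one term of the potential, so invariant trigonometric
    polynomials times [walls] belong to the domain. *)
Definition walls x := \prod_(a <- Phip) sg (dot a x).

Lemma trigp_walls : trigp Phi walls.
Proof.
apply: (trigp_eq (F := fun x => \prod_(a <- Phip) (if a \in Phip then sg (dot a x) else 1))).
  by move=> x; apply: eq_big_seq => a ->.
apply: trigp_prod => a; have [aP|_] := boolP (a \in Phip); last exact: trigp_cst.
by apply: trigp_sg; apply: (root_wl Hroot); exact: (pos_root Hpos).
Qed.

Lemma winv_walls : winv Phi walls.
Proof.
move=> w W x; have [w' W' [e1 e2]] := weyl_inv Hroot W.
transitivity (\prod_(a <- Phip) (fun a => sg (dot a x)) (a *m w')).
  by apply: eq_bigr => a _; rewrite (dot_weyl_inv Hroot _ _ W e2).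
by apply: (pos_reindex Hroot Hpos) => // a aP; rewrite dotNl /sg cosN.
Qed.

Lemma walls_neq0 : \forall t \ae mu, walls (repr t) != 0.
Proof.
move: (walls_null Hroot Hhaar Hpos); apply: filterS => t H.
by rewrite /walls prodf_seq_neq0; apply/allP => a aP /=; exact: H.
Qed.

Lemma bm_trigV_walls a : a \in Phip -> bm (fun t : T => trigV a (repr t) * walls (repr t)).
Proof.
move=> aP; have [mw _] := trigp_bm Hroot trigp_walls.
split; first by apply: measurable_funM => //; exact: (meas_trigV Hroot Hpos).
exists 1 => t; rewrite /walls (big_rem a)//= /trigV.
have : 0 <= \prod_(b <- rem a Phip) sg (dot b (repr t)) by apply: prodr_ge0 => b _; exact: sg_ge0.
have : \prod_(b <- rem a Phip) sg (dot b (repr t)) <= 1 by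
  apply: prodr_ile1 => b _; rewrite sg_ge0 sg_le1.
move: (\prod_(b <- _) _) => r r1 r0; have := sg_ge0 (dot a (repr t)); have := sg_le1 (dot a (repr t)).
move: (sg _) => s s1 s0.
have [->|sn] := eqVneq s 0; first by rewrite mul0r mulr0 normr0.
rewrite (_ : _ * _ = (4^-1 - s / 12) * r); last by field.
rewrite normrM -[leRHS]mulr1 ler_pM//; last by rewrite ger0_norm.
by rewrite ler_norml; apply/andP; split; lra.
Qed.

Lemma real_dom_test F : trigp Phi F -> winv Phi F -> real_dom (fun x => F x * walls x).
Proof.
move=> hF iF; have hFw := trigpM hF trigp_walls; have bF := trigp_bm Hroot hF.
have bFw := trigp_bm Hroot hFw.
have bwp a : a \in Phip -> bm (fun t : T => wp p (dot a (repr t)) * (F (repr t) * walls (repr t))).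
  move=> aP; rewrite (_ : (fun _ => _) = (fun t => (trigV a (repr t) * walls (repr t)) * F (repr t)
    + wp_reg p (dot a (repr t)) * (F (repr t) * walls (repr t)))).
    apply: bmD; first by apply: bmM => //; exact: bm_trigV_walls.
    apply: bmM => //; apply: (bm_wp_reg p1 p2); apply: (root_wl Hroot); exact: (pos_root Hpos).
  by apply/funext => t; rewrite wp_split /trigV; ring.
split.
- by case: hFw => N; exact: rtp_C2.
- exact: trigp_periodic hFw.
- by move=> w W x; rewrite iF// winv_walls.
- apply: bm_sqint; rewrite (_ : (fun _ => _) = fun t : T => \sum_(a <- Phip | a \in Phip)
    k a * (k a - 1) * dot a a * (wp p (dot a (repr t)) * (F (repr t) * walls (repr t)))).
    by apply: bm_sum => a aP; apply: bmZ; exact: bwp.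
  apply/funext => t; rewrite -[RHS]big_seq /potential mulr_suml.
  by apply: eq_bigr => a _; rewrite -!mulrA.
by move=> a aP _; apply: bm_sqint; exact: bwp.
Qed.

(** A domain function [f] closer to [d] than the norm of [d] exists by [density]; orthogonality
    would give [|d - f|^2 = |d|^2 + |f|^2]. *)
Lemma real_dom_separating d : sqintW mu d ->
  (forall u, real_dom u -> rip mu d (fun t => u (repr t)) = 0) -> \forall t \ae mu, d t = 0.
Proof.
move=> [d2 dW] Hd; apply: Int_sqr_eq0; [exact: sqint_meas d2|exact: ((sqintP mu d).1 d2).2|].
apply/eqP; rewrite eq_le; apply/andP; split; last by apply: Int_ge0 => t; exact: sqr_ge0.
rewrite leNgt; apply/negP => d0.
have walls_inv w : weyl Phi w -> forall t : T, walls (repr (weyl_act w t)) = walls (repr t).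
  by move=> W t; rewrite (weyl_act_repr (F := walls) t W (trigp_periodic trigp_walls)) winv_walls.
have [F [hF iF]] := density Hroot Hhaar (trigp_bm Hroot trigp_walls) walls_inv walls_neq0 d2 dW d0.
have df := real_dom_test hF iF; have f2 := bm_sqint mu (real_dom_bm df).
have := Hd _ df; set f := (fun t => _) => df0; apply/negP; rewrite -leNgt.
have i1 := ((sqintP mu d).1 d2).2; have i2 := ((sqintP mu f).1 f2).2.
have i3 : mu.-integrable setT (EFin \o (d \* f)) by exact: sqint_mul.
have -> : sqdist mu d f = Int (fun t => d t ^+ 2) + Int (fun t => f t ^+ 2) + -2 * rip mu d f.
  rewrite /rip -(IntZ _ i3) -IntD// -IntD; [|exact: intgD|exact: intgZ].
  by apply: eq_Rintegral => t _ /=; ring.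
by rewrite df0 mulr0 addr0 lerDl; apply: Int_ge0 => t; exact: sqr_ge0.
Qed.

End TestFunctions.

Local Open Scope complex_scope.
Local Open Scope ring_scope.

(** * Self-adjointness *)

Section ComplexParts.
Context {R : realType} {n : nat} (Phi Phip : {fset 'rV[R]_n}) (mu : probability (torus Phi) R)
  (k : 'rV[R]_n -> R) (p : R).
Local Notation T := (torus Phi).
Implicit Types (f g : T -> R[i]) (F u : 'rV[R]_n -> R) (a b l x : 'rV[R]_n).
Local Notation Int f := (\int[mu]_(t in setT) f t)%R.
Local Notation sqint f := (f \in Lfun mu 2%:E).
Local Notation cre f := (fun t => complex.Re (f t)).
Local Notation cim f := (fun t => complex.Im (f t)).
Local Notation pot := (potential Phip k p).

Definition cplx (f1 f2 : T -> R) : T -> R[i] := fun t => f1 t +i* f2 t.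

Lemma innerE f g : L2 mu f -> L2 mu g -> inner mu f g =
  (rip mu (cre f) (cre g) + rip mu (cim f) (cim g)) +i*
  (rip mu (cre f) (cim g) - rip mu (cim f) (cre g)).
Proof.
move=> [f1 f2] [g1 g2]; rewrite /inner /cintegral; congr (_ +i* _).
  rewrite /rip -IntD; [|exact: sqint_mul|exact: sqint_mul].
  apply: eq_Rintegral => t _ /=; case: (f t) (g t) => a b [c d] /=.
  by ring.
rewrite /rip -IntB; [|exact: sqint_mul|exact: sqint_mul].
apply: eq_Rintegral => t _ /=; case: (f t) (g t) => a b [c d] /=.
  by ring.
Qed.

Lemma sqnormE f g : L2 mu f -> L2 mu g ->
  sqnorm (inner mu) (f - g) = sqdist mu (cre f) (cre g) + sqdist mu (cim f) (cim g).
Proof.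
move=> [f1 f2] [g1 g2]; have d1 := sqintB f1 g1; have d2 := sqintB f2 g2.
have ReB (y z : R[i]) : complex.Re (y - z) = complex.Re y - complex.Re z by case: y z => ? ? [].
have ImB (y z : R[i]) : complex.Im (y - z) = complex.Im y - complex.Im z by case: y z => ? ? [].
rewrite /sqnorm innerE /=.
  rewrite /rip /sqdist; congr (_ + _); apply: eq_Rintegral => t _.
    by rewrite ReB expr2.
  by rewrite ImB expr2.
all: split.
- by rewrite (_ : (fun _ => _) = cre f \- cre g)//; apply/funext => t; exact: ReB.
- by rewrite (_ : (fun _ => _) = cim f \- cim g)//; apply/funext => t; exact: ImB.
- by rewrite (_ : (fun _ => _) = cre f \- cre g)//; apply/funext => t; exact: ReB.
- by rewrite (_ : (fun _ => _) = cim f \- cim g)//; apply/funext => t; exact: ImB.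
Qed.

Lemma L2W_parts f : L2W mu f <-> sqintW mu (cre f) /\ sqintW mu (cim f).
Proof.
split=> [[[f1 f2] fW]|[[f1 W1] [f2 W2]]].
  by split; split => // w /fW; apply: filterS => t ->.
split => // w W; have := W2 w W; have := W1 w W; apply: filterS2 => t.
by case: (f t) (f _) => a b [c d] /= -> ->.
Qed.

Lemma L2W_cplx (f1 f2 : T -> R) : sqintW mu f1 -> sqintW mu f2 -> L2W mu (cplx f1 f2).
Proof. by move=> s1 s2; apply/L2W_parts. Qed.

Lemma sqintW0 : sqintW mu (fun=> 0).
Proof. by split; [exact: sqint_cst|move=> w _; exact: nearW]. Qed.

Hypothesis Hroot : root_system Phi.
Hypothesis Hhaar : normalized_haar mu.
Hypothesis Hpos : positive_roots Phi Phip.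

Lemma lift_repr f (t : T) : f t = Re_lift f (repr t) +i* Im_lift f (repr t).
Proof. by rewrite /Re_lift /Im_lift pi_repr; case: (f t). Qed.

Lemma hamiltonian_parts f h : hamiltonian mu Phip k p (f, h) ->
  [/\ real_dom Phip mu k p (Re_lift f), real_dom Phip mu k p (Im_lift f) &
   h = cplx (real_ham Phip k p (Re_lift f)) (real_ham Phip k p (Im_lift f))].
Proof.
move=> [/= [c1 c2] fW [fL [V1 V2] wf] hE].
have ReZ (r : R) (z : R[i]) : complex.Re (r%:C * z) = r * complex.Re z by case: z => ? ? /=; ring.
have ImZ (r : R) (z : R[i]) : complex.Im (r%:C * z) = r * complex.Im z by case: z => ? ? /=; ring.
have RE t : Re_lift f (repr t) = complex.Re (f t) by rewrite /Re_lift pi_repr.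
have IE t : Im_lift f (repr t) = complex.Im (f t) by rewrite /Im_lift pi_repr.
split.
- split => //.
  + by move=> x q qP; rewrite /Re_lift piD.
  + by move=> w W x; rewrite /Re_lift -(weyl_act_pi Hroot)// fW.
  + rewrite (_ : (fun _ => _) = (fun t => complex.Re ((pot t)%:C * f t)))//.
    by apply/funext => t; rewrite ReZ RE.
  + move=> a aP ka; have [w1 _] := wf a aP ka.
    rewrite (_ : (fun _ => _) = (fun t : T => complex.Re ((wp p (dot a (repr t)))%:C * f t)))//.
    by apply/funext => t; rewrite ReZ RE.
- split => //.
  + by move=> x q qP; rewrite /Im_lift piD.
  + by move=> w W x; rewrite /Im_lift -(weyl_act_pi Hroot)// fW.
  + rewrite (_ : (fun _ => _) = (fun t => complex.Im ((pot t)%:C * f t)))//.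
    by apply/funext => t; rewrite ImZ IE.
  + move=> a aP ka; have [_ w1] := wf a aP ka.
    rewrite (_ : (fun _ => _) = (fun t : T => complex.Im ((wp p (dot a (repr t)))%:C * f t)))//.
    by apply/funext => t; rewrite ImZ IE.
apply/funext => t; rewrite hE /cplx /real_ham RE IE /torus_laplacian.
by case: (f t) => a b /=; congr (_ +i* _); ring.
Qed.

Lemma hamiltonian_real u : real_dom Phip mu k p u ->
  hamiltonian mu Phip k p (cplx (fun t => u (repr t)) (fun=> 0), cplx (real_ham Phip k p u) (fun=> 0)).
Proof.
move=> du; have [c2 pu iu Vu wu] := du.
have sW := real_dom_sqintW Hroot du.
have ReE : Re_lift (cplx (fun t : T => u (repr t)) (fun=> 0)) = u.
  by apply/funext => x; rewrite /Re_lift /cplx /= (periodic_repr _ pu).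
have ImE : Im_lift (cplx (fun t : T => u (repr t)) (fun=> 0)) = fun=> 0 by [].
have z2 : C2 (fun _ : 'rV[R]_n => 0 : R).
  by apply: rtp_C2; exact: (rtp0 Phi 0).
have p0 i : part i (fun _ : 'rV[R]_n => 0 : R) = fun=> 0.
  by apply/funext => x; rewrite /part derive_cst.
have L2Z (q : T -> R) : sqint (fun t => q t * u (repr t)) ->
    L2 mu (fun t => (q t)%:C * cplx (fun t : T => u (repr t)) (fun=> 0) t).
  move=> qu; split => /=.
    by rewrite (_ : (fun _ => _) = fun t => q t * u (repr t))//; apply/funext => t; ring.
  rewrite (_ : (fun _ => _) = fun=> 0); first exact: sqint_cst.
  by apply/funext => t; ring.
split => /=.
- by split; rewrite ?ReE ?ImE.
- by move=> w W t; rewrite /cplx (weyl_act_repr (F := u) t W pu) iu.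
- split; first by apply: L2W_cplx => //; exact: sqintW0.
    exact: L2Z.
  by move=> a aP ka; apply: L2Z; exact: wu.
move=> t; rewrite /cplx /torus_laplacian ReE ImE /real_ham.
have -> : laplacian (fun=> 0 : R) (repr t) = 0 :> R.
  by apply: big1 => i _; rewrite !p0.
by congr (_ +i* _) => /=; ring.
Qed.

Lemma trig_poly_rtp f : trig_poly Phi f -> exists N F1 F2, [/\ rtp Phi N F1, rtp Phi N F2 &
  f = cplx (fun t => F1 (repr t)) (fun t => F2 (repr t))].
Proof.
move=> [s [c sP fE]]; pose N : R := \sum_(l <- s) dot l l.
have sN l : l \in s -> dot l l <= N.
  by move=> ls; rewrite /N (big_rem l)//= lerDl; apply: sumr_ge0 => y _; exact: dot_ge0.
pose F1 x := \sum_(l <- s) (complex.Re (c l) * cos (dot l x + 0) + complex.Im (c l) * cos (dot l x + pi / 2)).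
pose F2 x := \sum_(l <- s) (complex.Im (c l) * cos (dot l x + 0) + - complex.Re (c l) * cos (dot l x + pi / 2)).
exists N, F1, F2; split.
- by apply: rtp_sum => l ls _; apply: rtpD; apply: rtp_cos; [exact: sP|exact: sN|exact: sP|exact: sN].
- by apply: rtp_sum => l ls _; apply: rtpD; apply: rtp_cos; [exact: sP|exact: sN|exact: sP|exact: sN].
apply/funext => t; rewrite fE /cplx /F1 /F2.
elim: s {sP fE N sN F1 F2} => [|l s IH]; first by rewrite !big_nil.
rewrite !big_cons IH /torus_exp /expi !addr0 !cosDpihalf; case: (c l) => y z /=.
by congr (_ +i* _) => /=; ring.
Qed.

(** Coefficients are attached to list entries, so sums are concatenations. In [trig_poly] the
    coefficient is a function of the frequency, and repeated frequencies must be merged. *)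
Let trig_pairs f := exists s : seq ('rV[R]_n * R[i]), (forall z, z \in s -> weight_lattice Phi z.1) /\
  forall t, f t = \sum_(z <- s) z.2 * torus_exp z.1 t.

Let trig_pairsD f g : trig_pairs f -> trig_pairs g -> trig_pairs (fun t => f t + g t).
Proof.
move=> [s [sP fE]] [r [rP gE]]; exists (s ++ r); split=> [z|t]; last by rewrite big_cat fE gE.
by rewrite mem_cat => /orP[/sP|/rP].
Qed.

Let trig_pairs_sum (I : eqType) (r : seq I) (F : I -> T -> R[i]) :
  (forall i, i \in r -> trig_pairs (F i)) -> trig_pairs (fun t => \sum_(i <- r) F i t).
Proof.
elim: r => [_|i r IH H].
  by exists [::]; split => // t; rewrite !big_nil.
under [X in trig_pairs X]eq_fun do rewrite big_cons; apply: trig_pairsD; first exact: (H i (mem_head _ _)).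
by apply: IH => j jr; apply: H; rewrite in_cons jr orbT.
Qed.

Let trig_pairs_poly f : trig_pairs f -> trig_poly Phi f.
Proof.
move=> [s [sP fE]]; exists (undup (map fst s)), (fun l => \sum_(z <- s | z.1 == l) z.2).
  by move=> l; rewrite mem_undup => /mapP[z /sP zP ->].
move=> t; rewrite fE.
transitivity (\sum_(l <- undup (map fst s)) \sum_(z <- s | z.1 == l) z.2 * torus_exp z.1 t); last first.
  apply: eq_bigr => l _; rewrite mulr_suml; apply: eq_bigr => z /eqP -> //.
under [RHS]eq_bigr do rewrite big_mkcond.
rewrite exchange_big /= big_seq [RHS]big_seq; apply: eq_bigr => z zs.
rewrite (bigD1_seq z.1) ?undup_uniq ?mem_undup ?map_f//= eqxx big1 ?addr0// => l.
by rewrite eq_sym => /negPf ->.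
Qed.

Let trig_pairs_cos l (c th : R) (y : R[i]) : weight_lattice Phi l ->
  trig_pairs (fun t => y * (c * cos (dot l (repr t) + th))%:C).
Proof.
move=> lP; exists [:: (l, y * ((c / 2 * cos th) +i* (c / 2 * sin th)));
  (- l, y * ((c / 2 * cos th) +i* - (c / 2 * sin th)))]; split.
  by move=> z; rewrite !inE => /orP[] /eqP -> //=; exact: wlN.
move=> t; rewrite big_cons big_seq1 /torus_exp /expi /= dotNl cosN sinN cosD.
by case: y => a b; congr (_ +i* _) => /=; field.
Qed.

Lemma rtp_trig_poly N1 N2 F1 F2 : rtp Phi N1 F1 -> rtp Phi N2 F2 ->
  trig_poly Phi (cplx (fun t => F1 (repr t)) (fun t => F2 (repr t))).
Proof.
move=> [s1 [s1P E1]] [s2 [s2P E2]]; apply: trig_pairs_poly.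
rewrite (_ : cplx _ _ = fun t => (\sum_(z <- s1) 1 * (z.2.1 * cos (dot z.1 (repr t) + z.2.2))%:C) +
   \sum_(z <- s2) 'i * (z.2.1 * cos (dot z.1 (repr t) + z.2.2))%:C).
  by apply: trig_pairsD; apply: trig_pairs_sum => z; [move=> /s1P[+ _]|move=> /s2P[+ _]]; exact: trig_pairs_cos.
apply/funext => t; rewrite /cplx E1 E2 [LHS]complexE /= (rmorph_sum (real_complex R)) (rmorph_sum (real_complex R)) mulr_sumr.
by congr (_ + _); apply: eq_bigr => z _; rewrite mul1r.
Qed.

End ComplexParts.

Lemma half_sum_lt {R : realFieldType} (x y e : R) : x <= e -> y < e -> 2^-1 * x + 2^-1 * y < e.
Proof. lra. Qed.

Lemma halves_lt {R : realFieldType} (x y e : R) : x < e / 2 -> y < e / 2 -> x + y < e.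
Proof. lra. Qed.

Lemma sum_diff_inj {R : realFieldType} (x y x' y' : R) :
  x + y = x' + y' -> x - y = x' - y' -> x = x' /\ y = y'.
Proof. by move=> ? ?; split; lra. Qed.

(** * Continuity of the inner product *)

Section InnerContinuity.
Context {d} {T : measurableType d} {R : realType} (mu : probability T R).
Implicit Types f g h : T -> R.
Local Notation Int f := (\int[mu]_(t in setT) f t)%R.
Local Notation sqint f := (f \in Lfun mu 2%:E).

(** Instead of Cauchy-Schwarz, the inequality [|x y| <= c y^2 / 2 + x^2 / (2 c)] is integrated, with
    [c] small against the norm of [f]. *)
Lemma rip_continuous f : sqint f -> forall e : R, 0 < e -> exists2 r, 0 < r &
  forall g h, sqint g -> sqint h -> sqdist mu g h < r -> `|rip mu f g - rip mu f h| < e.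
Proof.
move=> f2 e e0; have If := ((sqintP mu f).1 f2).2.
pose S := Int (fun t => f t ^+ 2); have S0 : 0 <= S by apply: Int_ge0 => t; exact: sqr_ge0.
have S1 : 0 < S + 1 by rewrite ltr_wpDl.
pose c := e / (S + 1); have c0 : 0 < c by rewrite divr_gt0.
exists (c * e); first exact: mulr_gt0.
move=> g h g2 h2 gh; have gh2 := sqintB g2 h2.
rewrite [rip _ f g]ripC [rip _ f h]ripC -ripB// /rip.
have i1 := sqint_sqr g2 h2.
have i2 := sqint_mul gh2 f2.
apply: (le_lt_trans (Int_norm i2)).
apply: (@le_lt_trans _ _ (2^-1 * c * S + (2 * c)^-1 * sqdist mu g h)); last first.
  have H1 : c * S <= e by rewrite /c mulrAC ler_pdivrMr// ler_wpM2l ?ltW// ltrDl.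
  have H2 : c^-1 * sqdist mu g h < e by rewrite mulrC ltr_pdivrMr// mulrC.
  by rewrite -mulrA [(2 * c)^-1]invfM -[X in _ + X]mulrA; exact: half_sum_lt.
rewrite -!IntZ// -IntD; [|exact: intgZ|exact: intgZ].
apply: Int_le; first exact: intg_norm.
  by apply: intgD; exact: intgZ.
move=> t /=; move: (g t - h t) (f t) => x y; rewrite normrM.
have -> : 2^-1 * c * y ^+ 2 + (2 * c)^-1 * x ^+ 2 =
   `|x| * `|y| + (2 * c)^-1 * (c * `|y| - `|x|) ^+ 2.
  by rewrite sqrrB exprMn !real_normK ?num_real//; field; rewrite gt_eqF.
by rewrite lerDl mulr_ge0 ?sqr_ge0// invr_ge0 mulr_ge0// ltW.
Qed.

Lemma rip_ae0 f g : sqint f -> sqint g -> (\forall t \ae mu, f t = 0) -> rip mu f g = 0.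
Proof.
move=> f2 g2 f0; rewrite /rip (@Int_ae _ _ _ mu _ (fun=> 0)) ?Int_cst//.
  by apply: measurable_funM; [exact: (sqint_meas f2)|exact: (sqint_meas g2)].
by move: f0; apply: filterS => t ->; rewrite mul0r.
Qed.

Lemma sqdistxx f : sqdist mu f f = 0.
Proof.
by rewrite /sqdist; under eq_Rintegral do rewrite subrr expr0n; rewrite Int_cst.
Qed.

End InnerContinuity.

Lemma eq_of_norm_lt {R : realFieldType} (x y : R) :
  (forall e, 0 < e -> `|x - y| < 4 * e) -> x = y.
Proof.
move=> H; apply/eqP; rewrite -subr_eq0 -normr_le0 leNgt; apply/negP => d0.
have : 0 < `|x - y| / 4 by rewrite divr_gt0.
by move=> /H; rewrite mulrC mulfVK// ltxx.
Qed.

Lemma sum_close {R : realFieldType} (a1 a2 b1 b2 a1' a2' b1' b2' e : R) : a1' + a2' = b1' + b2' ->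
  `|a1 - a1'| < e -> `|a2 - a2'| < e -> `|b1 - b1'| < e -> `|b2 - b2'| < e ->
  `|(a1 + a2) - (b1 + b2)| < 4 * e.
Proof. by move=> E; rewrite !ltr_norml => /andP[? ?] /andP[? ?] /andP[? ?] /andP[? ?]; lra. Qed.

Lemma diff_close {R : realFieldType} (a1 a2 b1 b2 a1' a2' b1' b2' e : R) : a1' - a2' = b1' - b2' ->
  `|a1 - a1'| < e -> `|a2 - a2'| < e -> `|b1 - b1'| < e -> `|b2 - b2'| < e ->
  `|(a1 - a2) - (b1 - b2)| < 4 * e.
Proof. by move=> E; rewrite !ltr_norml => /andP[? ?] /andP[? ?] /andP[? ?] /andP[? ?]; lra. Qed.

(** * The restricted adjoint and its closure *)

Section Selfadjoint.
Context {R : realType} {n : nat} (Phi Phip : {fset 'rV[R]_n}) (mu : probability (torus Phi) R)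
  (k : 'rV[R]_n -> R) (p : R).
Hypothesis Hroot : root_system Phi.
Hypothesis Hpos : positive_roots Phi Phip.
Hypothesis Hhaar : normalized_haar mu.
Hypothesis Hk : forall w a, weyl Phi w -> a \in Phi -> k (a *m w) = k a.
Hypothesis Hk0 : forall a, a \in Phi -> 0 <= k a.
Hypothesis p1 : -1 < p.
Hypothesis p2 : p < 1.
Local Notation T := (torus Phi).
Local Notation sqint f := (f \in Lfun mu 2%:E).
Local Notation cre f := (fun t => complex.Re (f t)).
Local Notation cim f := (fun t => complex.Im (f t)).
Local Notation D t := (wDelta Phip k (repr t)).
Local Notation Vr := (V_reg p (Phi:=Phi) Phip k).
Local Notation tD := (trigD (Phi := Phi) Phip k).
Local Notation adj := (hamiltonian_adj mu Phip k p).
Local Notation G := (restriction adj (calP Phi Phip k)).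

Lemma calP_parts u : calP Phi Phip k u <->
  exists N1 N2 f1 f2, [/\ tD N1 f1, tD N2 f2 & u = cplx f1 f2].
Proof.
split=> [[f [tf fW] uE]|[N1 [N2 [_ [_ [[F1 [h1 i1 ->]] [F2 [h2 i2 ->]] ->]]]]]]; last first.
  exists (cplx (fun t => F1 (repr t)) (fun t => F2 (repr t))).
    split; first exact: rtp_trig_poly h1 h2.
    move=> w W t; rewrite /cplx (weyl_act_repr (F := F1) t W (rtp_periodic h1)) i1//.
    by rewrite (weyl_act_repr (F := F2) t W (rtp_periodic h2)) i2.
  move=> t; rewrite (_ : Delta Phi Phip k t = D t)// /cplx.
  by congr (_ +i* _) => /=; ring.
have [N [F1 [F2 [h1 h2 fE]]]] := trig_poly_rtp tf.
have inv F : rtp Phi N F -> (forall w, weyl Phi w -> forall t : T, F (repr (weyl_act w t)) = F (repr t)) ->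
    winv Phi F.
  move=> hF FW w W x; have pF := rtp_periodic hF.
  by rewrite -(periodic_repr _ pF) -(weyl_act_pi Hroot)// FW// (periodic_repr _ pF).
exists N, N, (fun t => F1 (repr t) * D t), (fun t => F2 (repr t) * D t); split.
- exists F1; split => //; apply: inv => // w W t.
  by have := fW w W t; rewrite fE => /(congr1 (@complex.Re R)).
- exists F2; split => //; apply: inv => // w W t.
  by have := fW w W t; rewrite fE => /(congr1 (@complex.Im R)).
apply/funext => t; rewrite uE fE (_ : Delta Phi Phip k t = D t)// /cplx.
by congr (_ +i* _) => /=; ring.
Qed.

(** Pairing with a real test function separates the real and imaginary parts of [u] and [v]. *)
Lemma adj_test u v w : adj (u, v) -> real_dom Phip mu k p w ->
  rip mu (cre u) (real_ham Phip k p w) = rip mu (cre v) (fun t => w (repr t)) /\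
  rip mu (cim u) (real_ham Phip k p w) = rip mu (cim v) (fun t => w (repr t)).
Proof.
move=> [/= uH vH uv] dw; have := uv _ _ (hamiltonian_real Hroot dw).
have hw2 := real_ham_sqint Hroot Hhaar dw.
have [w2 _] := real_dom_sqintW Hroot dw.
have [[uL _] [vL _]] := (uH, vH).
have z (f : T -> R) : rip mu f (fun=> 0) = 0.
  by rewrite /rip; under eq_Rintegral do rewrite mulr0; rewrite Int_cst.
rewrite !innerE//=; last 2 first.
- by split => //=; exact: sqint_cst.
- by split => //=; exact: sqint_cst.
rewrite !z !addr0 !sub0r => -[E1 E2]; split => //.
by apply: oppr_inj.
Qed.

(** The adjoint is a relation between representatives, so [v] and [v'] need not be equal functions;
    density of the domain makes them equal almost everywhere, hence in every pairing. *)
Lemma adj_unique u v v' f : adj (u, v) -> adj (u, v') -> sqint f ->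
  rip mu f (cre v) = rip mu f (cre v') /\ rip mu f (cim v) = rip mu f (cim v').
Proof.
move=> a a' f2.
have [_ /L2W_parts[v1 v2] _] := a; have [_ /L2W_parts[v1' v2'] _] := a'.
have sep (g g' : T -> R) : sqintW mu g -> sqintW mu g' ->
    (forall w, real_dom Phip mu k p w -> rip mu g (fun t => w (repr t)) = rip mu g' (fun t => w (repr t))) ->
    rip mu f g = rip mu f g'.
  move=> [g2 gW] [g2' gW'] E; apply/eqP; rewrite -subr_eq0 ripC [rip _ f g']ripC -ripB//.
  apply/eqP; apply: rip_ae0 => //; first exact: sqintB.
  apply: (real_dom_separating Hroot Hhaar Hpos p1 p2 (k := k)); last first.
    by move=> w dw; rewrite ripB ?E ?subrr//; have [] := real_dom_sqintW Hroot dw.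
  split; first exact: sqintB.
  by move=> w W; have := gW' w W; have := gW w W; apply: filterS2 => t -> ->.
split; apply: sep => // w dw.
  by have [<- _] := adj_test a dw; have [<- _] := adj_test a' dw.
by have [_ <-] := adj_test a dw; have [_ <-] := adj_test a' dw.
Qed.

Variable cQ : R.
Hypothesis HcQ : \forall t \ae mu, \sum_(a <- Phip) \sum_(b <- Phip | b != a)
  k a * k b * dot a b * (cot (dot a (repr t) / 2) * cot (dot b (repr t) / 2)) = cQ.
Local Notation tA := (trigA Phip k Hroot cQ).

Let bV : bm Vr. Proof. exact: (bm_V_reg p1 p2 k Hroot Hpos). Qed.
Let VW w : weyl Phi w -> forall t : T, Vr (weyl_act w t) = Vr t.
Proof. by move=> W t; exact: (V_reg_weyl p Hroot Hpos Hk t W). Qed.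
Let mem N f : tD N f -> sqintW mu f.
Proof. exact: (trigD_mem mu Hroot Hpos Hk Hk0). Qed.
Let memV N N' f f' : tD N f -> tD N' f' -> sqintW mu (fun t => f' t + Vr t * f t).
Proof. by move=> hf hf'; apply: sqintW_bm => //; [exact: mem hf'|exact: mem hf]. Qed.

(** The explicit action of the adjoint on P. [f1'] and [f2'] come from the trigonometric operator
    and [V_reg] adds the bounded part; the identity is checked on real and imaginary parts. *)
Lemma adj_pair N1 N2 M1 M2 f1 f2 f1' f2' : tD N1 f1 -> tD N2 f2 -> tD M1 f1' -> tD M2 f2' ->
  tA f1 f1' -> tA f2 f2' ->
  adj (cplx f1 f2, cplx (fun t => f1' t + Vr t * f1 t) (fun t => f2' t + Vr t * f2 t)).
Proof.
move=> D1 D2 D1' D2' A1 A2.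
have L1 := L2W_cplx (mem D1) (mem D2); have L2 := L2W_cplx (memV D1 D1') (memV D2 D2').
split => //= phi h Hh; have [dr di ->] := hamiltonian_parts Hroot Hh.
have phiE : phi = cplx (fun t => Re_lift phi (repr t)) (fun t => Im_lift phi (repr t)).
  by apply/funext => t; exact: lift_repr.
have [sr _] := real_dom_sqintW Hroot dr; have [si _] := real_dom_sqintW Hroot di.
have hr := real_ham_sqint Hroot Hhaar dr; have hi := real_ham_sqint Hroot Hhaar di.
have E w f f' : real_dom Phip mu k p w -> tA f f' ->
    rip mu f (real_ham Phip k p w) = rip mu (fun t => f' t + Vr t * f t) (fun t => w (repr t)).
  by move=> dw Af; apply: (real_adjoint_pair Hhaar Hpos Hk Hk0 p1 p2 HcQ).
have [[L1' _] [L2' _]] := (L1, L2).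
rewrite [in RHS]phiE !innerE//=.
by rewrite (E _ _ _ dr A1) (E _ _ _ di A2) (E _ _ _ di A1) (E _ _ _ dr A2).
Qed.

Lemma calP_adj u : calP Phi Phip k u -> exists v1 v2 f1 f2 f1' f2', [/\ u = cplx f1 f2,
  v1 = (fun t => f1' t + Vr t * f1 t), v2 = (fun t => f2' t + Vr t * f2 t), tA f1 f1' /\ tA f2 f2' &
  [/\ sqintW mu f1, sqintW mu f2, sqintW mu f1', sqintW mu f2' & adj (u, cplx v1 v2)]].
Proof.
move=> /calP_parts[N1 [N2 [f1 [f2 [D1 D2 ->]]]]].
have [f1' D1' A1] := trigD_apply Hroot Hpos cQ D1.
have [f2' D2' A2] := trigD_apply Hroot Hpos cQ D2.
exists (fun t => f1' t + Vr t * f1 t), (fun t => f2' t + Vr t * f2 t), f1, f2, f1', f2'.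
split => //; split; [exact: mem D1|exact: mem D2|exact: mem D1'|exact: mem D2'|exact: (adj_pair D1 D2 D1' D2' A1 A2)].
Qed.

Lemma trig_symmetric f f' g g' : tA f f' -> tA g g' -> sqintW mu f -> sqintW mu f' -> sqintW mu g -> sqintW mu g' ->
  rip mu f (fun t => g' t + Vr t * g t) = rip mu g (fun t => f' t + Vr t * f t).
Proof.
move=> Af Ag [f2 _] [f2' _] [g2 _] [g2' _].
have sV h : sqint h -> sqint (fun t => Vr t * h t) by exact: sqint_bm.
have E a b c : sqint a -> sqint b -> sqint c ->
    rip mu a (fun t => b t + Vr t * c t) = rip mu a b + rip mu a (fun t => Vr t * c t).
  move=> a2 b2 c2; rewrite ripC [X in X + _]ripC [X in _ + X]ripC -[X in _ + X]mul1r -ripDZ//; last exact: sV.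
  by congr rip; apply/funext => t; rewrite mul1r.
rewrite !E// -(trigA_sym Hhaar Hpos Hk Hk0 Af Ag) [rip _ f' g]ripC; congr (_ + _).
by apply: eq_Rintegral => t _; ring.
Qed.

(** The second components [g] and [g'] are arbitrary representatives; [adj_unique] replaces them by
    the explicit ones, for which [trig_symmetric] applies. *)
Lemma G_symmetric f g f' g' : G (f, g) -> G (f', g') -> inner mu f g' = inner mu g f'.
Proof.
move=> [/= a /calP_adj[v1 [v2 [f1 [f2 [g1 [g2 [fE v1E v2E [A1 A2] [s1 s2 t1 t2 af]]]]]]]]].
move=> [/= a' /calP_adj[v1' [v2' [f1' [f2' [g1' [g2' [fE' v1E' v2E' [A1' A2'] [s1' s2' t1' t2' af']]]]]]]]].
have [[fL _] [gL _] _] := a; have [[fL' _] [gL' _] _] := a'.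
have S := sqintW_bm bV VW.
have [q1 _] := s1; have [q2 _] := s2; have [q1' _] := s1'; have [q2' _] := s2'.
rewrite !innerE// fE fE' /=; rewrite fE in a af; rewrite fE' in a' af'.
have [-> _] := adj_unique a' af' q1; have [_ ->] := adj_unique a' af' q2.
have [_ ->] := adj_unique a' af' q1; have [-> _] := adj_unique a' af' q2.
rewrite ![rip mu (fun t => complex.Re (g t)) _]ripC ![rip mu (fun t => complex.Im (g t)) _]ripC.
have [-> ->] := adj_unique a af q1'; have [-> ->] := adj_unique a af q2'.
rewrite v1E v2E v1E' v2E' /= (trig_symmetric A1 A1')// (trig_symmetric A2 A2')//.
by rewrite (trig_symmetric A1 A2')// (trig_symmetric A2 A1').
Qed.

Local Notation cl := (op_closure (L2W mu) (inner mu) G).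

(** The pairings are continuous, so an identity valid on the graph passes to its closure. The four
    real functions [c] are the parts of [a] and [b]. *)
Lemma closure_extend a b u v : L2 mu a -> L2 mu b ->
  (forall f g, G (f, g) -> inner mu a g = inner mu b f) -> cl (u, v) -> inner mu a v = inner mu b u.
Proof.
move=> aL bL ab [/= [uL _] [vL _] H].
have [[a1 a2] [b1 b2]] := (aL, bL); have [[u1 u2] [v1 v2]] := (uL, vL).
suff X e : 0 < e -> exists f g, [/\ inner mu a g = inner mu b f, L2 mu f, L2 mu g &
  [/\ forall c, c \in [:: cre a; cim a; cre b; cim b] -> `|rip mu c (cre u) - rip mu c (cre f)| < e,
      forall c, c \in [:: cre a; cim a; cre b; cim b] -> `|rip mu c (cim u) - rip mu c (cim f)| < e,
      forall c, c \in [:: cre a; cim a; cre b; cim b] -> `|rip mu c (cre v) - rip mu c (cre g)| < e &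
      forall c, c \in [:: cre a; cim a; cre b; cim b] -> `|rip mu c (cim v) - rip mu c (cim g)| < e]].
  rewrite !innerE//; congr (_ +i* _); apply: eq_of_norm_lt => e e0; have [f [g [E fL gL [H1 H2 H3 H4]]]] := X e e0.
    move: E; rewrite !innerE// => -[E1 E2]; apply: (sum_close E1).
    - by apply: H3; rewrite !inE eqxx.
    - by apply: H4; rewrite !inE eqxx ?orbT.
    - by apply: H1; rewrite !inE eqxx ?orbT.
    - by apply: H2; rewrite !inE eqxx ?orbT.
  move: E; rewrite !innerE// => -[E1 E2]; apply: (diff_close E2).
  - by apply: H4; rewrite !inE eqxx ?orbT.
  - by apply: H3; rewrite !inE eqxx ?orbT.
  - by apply: H2; rewrite !inE eqxx ?orbT.
  - by apply: H1; rewrite !inE eqxx ?orbT.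
move=> e0.
have [r1 r10 R1] := rip_continuous a1 e0; have [r2 r20 R2] := rip_continuous a2 e0.
have [r3 r30 R3] := rip_continuous b1 e0; have [r4 r40 R4] := rip_continuous b2 e0.
pose r := Num.min (Num.min r1 r2) (Num.min r3 r4).
have r0 : 0 < r by rewrite !lt_min r10 r20 r30.
have [[f g] Gfg [uf vg]] := H r r0; exists f, g.
have [[/= [fL _] [gL _] _] _] := Gfg.
move: uf vg; rewrite /= !sqnormE// => uf vg.
have RR g1 g2 : sqint g1 -> sqint g2 -> sqdist mu g1 g2 < r ->
    forall c, c \in [:: cre a; cim a; cre b; cim b] -> `|rip mu c g1 - rip mu c g2| < e.
  move=> s1 s2; rewrite !lt_min => /andP[/andP[q1 q2] /andP[q3 q4]] c.
  by rewrite !inE => /or4P[] /eqP ->; [exact: R1|exact: R2|exact: R3|exact: R4].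
have [[f1 f2] [g1 g2]] := (fL, gL).
split => //; first exact: ab.
split; apply: RR => //.
- by apply: le_lt_trans uf; rewrite lerDl sqd_ge0.
- by apply: le_lt_trans uf; rewrite lerDr sqd_ge0.
- by apply: le_lt_trans vg; rewrite lerDl sqd_ge0.
- by apply: le_lt_trans vg; rewrite lerDr sqd_ge0.
Qed.

Lemma inner_conj f g : L2 mu f -> L2 mu g -> inner mu f g = (inner mu g f)^*.
Proof.
move=> fL gL; rewrite !innerE//.
rewrite [rip _ (cre f) (cre g)]ripC [rip _ (cim f) (cim g)]ripC [rip _ (cre f) (cim g)]ripC.
by rewrite [rip _ (cim f) (cre g)]ripC; congr (_ +i* _); rewrite opprB.
Qed.

(** Symmetry is extended to the closure in one argument at a time, conjugation exchanging the
    two. *)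
Lemma closure_symmetric u v u' v' : cl (u, v) -> cl (u', v') -> inner mu u v' = inner mu v u'.
Proof.
move=> c c'; have [[uL _] [vL _] _] := c.
apply: (closure_extend uL vL) c' => f g Gfg; have [[[fL _] [gL _] _] _] := Gfg.
rewrite inner_conj// [RHS]inner_conj//; congr (_ ^*); apply/esym.
by apply: (closure_extend fL gL _ c) => f' g'; exact: G_symmetric.
Qed.

Lemma G_closure f g : G (f, g) -> cl (f, g).
Proof.
move=> H; have [[/= fH gH _] _] := H; split => //= e e0; exists (f, g) => //=.
have [[fL _] [gL _]] := (fH, gH).
by rewrite !sqnormE// !sqdistxx addr0.
Qed.

Lemma calP_dom : calP Phi Phip k `<=` dom adj.
Proof.
by move=> u /calP_adj[v1 [v2 [? [? [? [? [_ _ _ _ [_ _ _ _ a]]]]]]]]; exists (cplx v1 v2).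
Qed.

Lemma G_dense : densely_defined (L2W mu) (inner mu) G.
Proof.
move=> u uH e e0; have [u1 u2] := (L2W_parts mu u).1 uH.
have e2 : 0 < e / 2 by rewrite divr_gt0.
have [N1 [f1 [D1 F1]]] := trigD_dense Hroot Hhaar Hpos Hk Hk0 u1 e2.
have [N2 [f2 [D2 F2]]] := trigD_dense Hroot Hhaar Hpos Hk Hk0 u2 e2.
have P : calP Phi Phip k (cplx f1 f2) by apply/calP_parts; exists N1, N2, f1, f2.
exists (cplx f1 f2); first by have [v av] := calP_dom P; exists v.
have [uL _] := uH; have [fL _] := L2W_cplx (mem D1) (mem D2).
by rewrite sqnormE//=; exact: halves_lt.
Qed.

Lemma adjoint_closure : adjoint (L2W mu) (inner mu) cl `<=` cl.
Proof.
move=> [u w] [/= uH wH uw]; split => //= e e0.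
have [[u1 u2] [w1 w2]] := ((L2W_parts mu u).1 uH, (L2W_parts mu w).1 wH).
have [[uL _] [wL _]] := (uH, wH).
have test N f f' : tD N f -> tD N f' -> tA f f' ->
    rip mu (cre u) (fun t => f' t + Vr t * f t) = rip mu (cre w) f /\
    rip mu (cim u) (fun t => f' t + Vr t * f t) = rip mu (cim w) f.
  move=> Df Df' Af.
  have [fL _] := L2W_cplx (mem Df) (mem Df); have [gL _] := L2W_cplx (memV Df Df') (memV Df Df').
  (* Pairing with [(1 + i) f] yields the sum and the difference of the equations for the real and
     imaginary parts, so this one element gives both. *)
  have P : calP Phi Phip k (cplx f f) by apply/calP_parts; exists N, N, f, f.
  have := uw _ _ (G_closure (conj (adj_pair Df Df Df' Df' Af Af) P)).
  by rewrite /= !innerE//= => -[]; exact: sum_diff_inj.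
have e2 : 0 < e / 2 by rewrite divr_gt0.
have [N1 [f1 [f1' [D1 D1' A1 B1 C1]]]] := trigD_core Hhaar Hpos Hk Hk0 bV VW u1 w1
  (fun N f f' Df Df' Af => (test N f f' Df Df' Af).1) e2.
have [N2 [f2 [f2' [D2 D2' A2 B2 C2]]]] := trigD_core Hhaar Hpos Hk Hk0 bV VW u2 w2
  (fun N f f' Df Df' Af => (test N f f' Df Df' Af).2) e2.
exists (cplx f1 f2, cplx (fun t => f1' t + Vr t * f1 t) (fun t => f2' t + Vr t * f2 t)).
  split; first exact: (adj_pair D1 D2 D1' D2' A1 A2).
  by apply/calP_parts; exists N1, N2, f1, f2.
have [fL _] := L2W_cplx (mem D1) (mem D2); have [gL _] := L2W_cplx (memV D1 D1') (memV D2 D2').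
by rewrite /= !sqnormE//=; split; exact: halves_lt.
Qed.

End Selfadjoint.

Theorem theorem2p5 (R : realType) (n : nat) (Phi Phip : {fset 'rV[R]_n})
    (mu : probability (torus Phi) R) (k : 'rV[R]_n -> R) (p : R) :
  root_system Phi ->
  positive_roots Phi Phip ->
  normalized_haar mu ->
  (forall w a, weyl Phi w -> a \in Phi -> k (a *m w) = k a) ->
  (forall a, a \in Phi -> 0 <= k a) ->
  -1 < p -> p < 1 ->
  calP Phi Phip k `<=` dom (hamiltonian_adj mu Phip k p) /\
  essentially_self_adjoint (L2W mu) (inner mu)
    (restriction (hamiltonian_adj mu Phip k p) (calP Phi Phip k)).
Proof.
move=> Hroot Hpos Hhaar Hk Hk0 p1 p2.
have [cQ HcQ] := cot_sum_const Hroot Hk Hhaar Hpos.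
have dense := G_dense Hroot Hpos Hhaar Hk Hk0 p1 p2 HcQ.
split; first exact: (calP_dom Hroot Hpos Hhaar Hk Hk0 p1 p2 HcQ).
split => //; split.
  move=> u uH e e0; have [f [g fg] uf] := dense u uH e e0.
  by exists f => //; exists g; exact: G_closure.
apply/seteqP; split; first exact: (adjoint_closure Hroot Hpos Hhaar Hk Hk0 p1 p2 HcQ).
move=> [u v] c; have [uH vH _] := c; split => // f g.
exact: (closure_symmetric Hroot Hpos Hhaar Hk Hk0 p1 p2 HcQ c).
Qed.
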